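(* Let $a>0$, $\sigma>1$, $\nu>0$, and let $u\in\mathcal C(\mathbb R^+,Z^{-1}_{a,\sigma}(\mathbb R^3))$ (with $u\in L^1_{loc}(\mathbb R^+,Z^{1}_{a,\sigma}(\mathbb R^3))$) be a global solution of (NSE). Then $\limsup_{t\to\infty}\|u(t)\|_{Z^{-1}_{a,\sigma}}=0$.
   Context: (NSE) denotes the 3D incompressible Navier–Stokes system $\partial_t u-\nu\Delta u+u\cdot\nabla u=-\nabla p$, $\operatorname{div}u=0$ on $\mathbb R^+\times\mathbb R^3$, $u(0,x)=u^0(x)$, with viscosity $\nu>0$. The Fourier transform is $\hat f(\xi)=\int_{\mathbb R^3}e^{-ix\cdot\xi}f(x)\,dx$. For $a>0$, $\sigma>1$, $\rho\in\mathbb R$, $Z^{\rho}_{a,\sigma}(\mathbb R^3)$ is the set of $f\in\mathcal S'(\mathbb R^3)$ with $\|f\|_{Z^{\rho}_{a,\sigma}}=\int_{\mathbb R^3}|\xi|^{\rho}e^{a|\xi|^{1/\sigma}}|\hat f(\xi)|\,d\xi<\infty$. For vector fields, $|\hat f(\xi)|$ denotes the Euclidean norm of $\hat f(\xi)$. *)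

(* Defs.v *)
From HB Require Import structures.
From mathcomp Require Import all_boot all_order all_algebra.
From mathcomp Require Import all_classical all_reals all_analysis.
From mathcomp Require Import measurable_realfun.
Set Implicit Arguments. Unset Strict Implicit. Unset Printing Implicit Defensive.
Import Order.TTheory GRing.Theory Num.Theory.
Import numFieldNormedType.Exports.
Local Open Scope classical_set_scope.
Local Open Scope ring_scope.

Definition leb3 (R : realType) :=
  ((@lebesgue_measure R \x @lebesgue_measure R) \x @lebesgue_measure R)%E.
Arguments leb3 R : clear implicits.

Definition coord3 (R : realType) (x : R * R * R) (j : 'I_3) : R :=
  match val j with 0 => x.1.1 | 1 => x.1.2 | _ => x.2 end.

Definition sub3 (R : realType) (x y : R * R * R) : R * R * R :=
  (x.1.1 - y.1.1, x.1.2 - y.1.2, x.2 - y.2).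

Definition opp3 (R : realType) (x : R * R * R) : R * R * R :=
  (- x.1.1, - x.1.2, - x.2).

Definition norm3 (R : realType) (x : R * R * R) : R :=
  Num.sqrt (\sum_(j < 3) coord3 x j ^+ 2).

Definition cplx (R : realType) := (R * R)%type.
Definition cadd (R : realType) (z w : cplx R) : cplx R := (z.1 + w.1, z.2 + w.2).
Definition csub (R : realType) (z w : cplx R) : cplx R := (z.1 - w.1, z.2 - w.2).
Definition cmul (R : realType) (z w : cplx R) : cplx R :=
  (z.1 * w.1 - z.2 * w.2, z.1 * w.2 + z.2 * w.1).
Definition cscale (R : realType) (r : R) (z : cplx R) : cplx R := (r * z.1, r * z.2).
Definition cconj (R : realType) (z : cplx R) : cplx R := (z.1, - z.2).
Definition cmulI (R : realType) (z : cplx R) : cplx R := (- z.2, z.1).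

(* A (Fourier transformed) vector field: xi |-> \hat f(xi) in C^3. *)
Definition fvec (R : realType) := (R * R * R -> 'I_3 -> cplx R)%type.

Definition cnorm3 (R : realType) (v : 'I_3 -> cplx R) : R :=
  Num.sqrt (\sum_(j < 3) ((v j).1 ^+ 2 + (v j).2 ^+ 2)).

Definition Znorm (R : realType) (a sigma rho : R) (fh : fvec R) : \bar R :=
  (\int[leb3 R]_x
     (powR (norm3 x) rho * expR (a * powR (norm3 x) sigma^-1)
        * cnorm3 (fh x))%:E)%E.

Definition inZ (R : realType) (a sigma rho : R) (fh : fvec R) : Prop :=
  (forall j : 'I_3, measurable_fun setT (fun x => (fh x j).1) /\
                    measurable_fun setT (fun x => (fh x j).2)) /\
  (Znorm a sigma rho fh < +oo)%E.

Definition conv (R : realType) (f g : R * R * R -> cplx R) (xi : R * R * R)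
  : cplx R :=
  (Rintegral (leb3 R) setT (fun eta => (cmul (f eta) (g (sub3 xi eta))).1),
   Rintegral (leb3 R) setT (fun eta => (cmul (f eta) (g (sub3 xi eta))).2)).

(* Fourier transform of the nonlinear term  P (u . grad u) = P div (u (x) u):
   F(div(u (x) u))_j (xi) = i (2 pi)^{-3} \sum_k xi_k (\hat u_k * \hat u_j)(xi),
   and the Leray projector P(xi) w = w - xi (xi . w) / |xi|^2. *)
Definition divuu (R : realType) (vh : fvec R) (xi : R * R * R) (j : 'I_3)
  : cplx R :=
  cmulI (cscale ((2 * pi) ^- 3)
     (\big[@cadd R/(0, 0)]_(k < 3)
        cscale (coord3 xi k) (conv (fun x => vh x k) (fun x => vh x j) xi))).

Definition NLterm (R : realType) (vh : fvec R) (xi : R * R * R) (j : 'I_3)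
  : cplx R :=
  csub (divuu vh xi j)
    (cscale (coord3 xi j / norm3 xi ^+ 2)
       (\big[@cadd R/(0, 0)]_(k < 3) cscale (coord3 xi k) (divuu vh xi k))).

(* A global solution of (NSE) with viscosity nu, in the class
   C(R^+, Z^{-1}_{a,sigma}) (with L^1_loc(R^+, Z^1_{a,sigma})), given through
   the Fourier transform Uh t = \hat{u(t)} of u(t) (real-valued,
   divergence free), satisfying the Duhamel (mild) formulation of (NSE)
   in Fourier variables, with initial datum u^0 = u(0). *)
Definition NSE_global_solution (R : realType) (a sigma nu : R)
  (Uh : R -> fvec R) : Prop :=
  (forall t, 0 <= t -> inZ a sigma (-1) (Uh t)) /\
  (forall t, 0 <= t -> forall e : R, 0 < e -> exists2 d : R, 0 < d &
     forall s, 0 <= s -> `|s - t| < d ->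
       (Znorm a sigma (-1) (fun x j => csub (Uh s x j) (Uh t x j)) < e%:E)%E) /\
  measurable_fun `[(0:R), +oo[ (fun t => Znorm a sigma 1 (Uh t)) /\
  (forall T : R, 0 < T ->
     (\int[@lebesgue_measure R]_(t in `[0%R, T]) Znorm a sigma 1 (Uh t) < +oo)%E) /\
  (* u(t) is a real vector field: \hat u(t)(-xi) = conj(\hat u(t)(xi)) *)
  (forall t, 0 <= t -> {ae leb3 R, forall xi, forall j : 'I_3,
       Uh t (opp3 xi) j = cconj (Uh t xi j)}) /\
  (* div u(t) = 0 *)
  (forall t, 0 <= t -> {ae leb3 R, forall xi,
       \sum_(k < 3) coord3 xi k * (Uh t xi k).1 = 0 /\
       \sum_(k < 3) coord3 xi k * (Uh t xi k).2 = 0}) /\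
  (forall t, 0 <= t -> {ae leb3 R, forall xi, forall j : 'I_3,
     let h := fun s => cscale (expR (- nu * (t - s) * norm3 xi ^+ 2))
                              (NLterm (Uh s) xi j) in
     (@lebesgue_measure R).-integrable `[(0:R), t] (fun s => ((h s).1)%:E) /\
     (@lebesgue_measure R).-integrable `[(0:R), t] (fun s => ((h s).2)%:E) /\
     Uh t xi j =
       csub (cscale (expR (- nu * t * norm3 xi ^+ 2)) (Uh 0 xi j))
            (Rintegral (@lebesgue_measure R) `[(0:R), t] (fun s => (h s).1),
             Rintegral (@lebesgue_measure R) `[(0:R), t] (fun s => (h s).2))}).

(* Main.v *)
(** Split off from the initial datum its part at high frequencies or of large
    amplitude, which is small for the norm of [X^-1] with the weight
    [(1 + |xi|)^2] and generates by Picard iteration a small global solution [w].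
    Convolution bounds give [v = w - u] in [L^oo_loc(H^1)]. In the energy estimate
    for [v] the transport by [u] cancels, and what remains is absorbed because
    [|\hat w|] is small in [L^2_t L^1_xi]. Hence [v] is bounded in [L^2] with
    square-integrable gradient, the gradient is small at some time, and then so is
    the [X^-1] norm of [v] by Cauchy-Schwarz. So [u(t0)] is small in [X^-1] for
    some [t0], and it stays small afterwards. On the time interval [[t - 1, t]]
    half of the heat kernel pays for the weight [exp(a (s - t + 1) |xi|)], which
    turns smallness in [X^-1] at [t - 1] into smallness in [Z^-1_{a, sigma}] at [t].
    The estimates bear on pointwise majorants of [|\hat u|], for a version of
    [\hat u] that is jointly measurable in time and frequency. *)

Require Import Defs.
From HB Require Import structures.
From mathcomp Require Import all_boot all_order all_algebra.
From mathcomp Require Import all_classical all_reals all_analysis.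
From mathcomp Require Import measurable_realfun.
From mathcomp Require Import ring lra.
Import Order.TTheory GRing.Theory Num.Theory.
Import numFieldNormedType.Exports.
Local Open Scope classical_set_scope.
Local Open Scope ring_scope.
Set Implicit Arguments. Unset Strict Implicit. Unset Printing Implicit Defensive.

(** [u] is only known to be integrable in frequency, whereas [v = w - u] starts from a bounded datum
    of bounded support; this opens the way to energy methods. Its [L^2] norm is not known to be
    finite at positive times, so that bound is first produced by iterating the Duhamel inequality.
    The [H^1] bound makes every trilinear integral absolutely convergent, and only then can the
    antisymmetry of transport be used. In the weight [(1 + |xi|)^2] one factor pays for [|xi|^-1]
    and the other carries the derivative. Energy is balanced frequency by frequency in integrated
    form, without differentiating in time. The condition [4 C e <= nu] closes both the Picard
    iteration and the energy absorption. In the last step the weight is truncated, so that all norms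
    stay finite during the bootstrap, and Fatou's lemma removes the truncation; [exp(a
    |xi|^(1/sigma)) <= exp(a) exp(a |xi|)] lets an analytic weight do the Gevrey work. Finally, the
    hypotheses hold off null sets of frequencies that depend on time, so they are collected at
    rational times and carried to all times by continuity. *)

Section Generic.
Context d (T : measurableType d) (R : realType) (mu : {measure set T -> \bar R}).
Local Open Scope ereal_scope.

Lemma ge0_le_integralT (f g : T -> \bar R) : (forall x, 0 <= f x) ->
  (forall x, f x <= g x) -> \int[mu]_x f x <= \int[mu]_x g x.
Proof.
move=> f0 fg; have g0 x : 0 <= g x by exact: le_trans (f0 x) (fg x).
rewrite !ge0_integralTE//; apply: le_ereal_sup => _ [h /= hf <-].
by exists h => // x; exact: le_trans (hf x) (fg x).
Qed.

Lemma ge0_integralZlT (f : T -> \bar R) (k : \bar R) : measurable_fun setT f ->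
  (forall x, 0 <= f x) -> 0 <= k -> \int[mu]_x (k * f x) = k * \int[mu]_x f x.
Proof. by move=> mf f0 k0; rewrite ge0_integralZl. Qed.

Lemma ge0_integralZrT (f : T -> \bar R) (k : \bar R) : measurable_fun setT f ->
  (forall x, 0 <= f x) -> 0 <= k -> \int[mu]_x (f x * k) = (\int[mu]_x f x) * k.
Proof.
by move=> mf f0 k0; under eq_integral do rewrite muleC; rewrite ge0_integralZl// muleC.
Qed.

(** The square of [c * a - c^-1 * e] is nonnegative, so [(c * a + c^-1 * e)^2 >= 4 * a * e >= (2 *
    b)^2]. An infinite [a] or [e] makes the right-hand side infinite. *)
Lemma mule_amgm (c : R) (a b e : \bar R) : (0 < c)%R -> 0 <= a -> 0 <= b -> 0 <= e ->
  b * b <= a * e -> 2%:E * b <= c%:E * a + c^-1%:E * e.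
Proof.
move=> c0; have ci : (0 < c^-1)%R by rewrite invr_gt0.
case: a => [a| |]//; case: e => [e| |]//; case: b => [b| |]//; rewrite ?lee_fin => a0 b0 e0.
- move=> bae.
  rewrite -ler_sqr ?nnegrE ?addr_ge0 ?mulr_ge0// ?(ltW c0) ?(ltW ci)//.
  have : (0 <= (c * a - c^-1 * e) ^+ 2)%R by exact: sqr_ge0.
  have -> : ((c * a - c^-1 * e) ^+ 2 = (c * a + c^-1 * e) ^+ 2 - 4 * (a * e))%R.
    by field; rewrite gt_eqF.
  nra.
all: by move=> _; rewrite !gt0_muley ?lte_fin// ?addey ?addye ?leey// -EFinM.
Qed.

(** Almost everywhere [a] vanishes, hence so does [b]; the convention [0 * +oo = 0] makes this true
    even where [e] is infinite. *)
Lemma integral_sq_eq0 (a b e : T -> \bar R) : measurable_fun setT a ->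
  (forall x, 0 <= a x) -> measurable_fun setT b -> (forall x, 0 <= b x) ->
  (forall x, b x * b x <= a x * e x) ->
  \int[mu]_x a x = 0 -> \int[mu]_x b x = 0.
Proof.
move=> ma a0 mb b0 bae I0.
have /(ae_eq_integral_abs mu measurableT ma) : \int[mu]_x `|a x| = 0.
  by under eq_integral do rewrite gee0_abs//.
case=> N [mN N0 sN].
rewrite (@ge0_ae_eq_integral _ _ _ mu setT _ (cst 0))//.
- by rewrite integral0.
- exists N; split=> // x /= H; apply: sN => /= /(_ Logic.I) ax.
  apply: H => _; apply/eqP; have := bae x; rewrite ax mul0e => /(conj (mule_ge0 (b0 x) (b0 x))) /andP.
  by rewrite -eq_le eq_sym mule_eq0 orbb.
Qed.

(** Integrating the weighted arithmetic-geometric inequality and optimizing its parameter gives the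
    result for extended values. A vanishing integral on the right is treated apart; an infinite one
    next to a nonzero one leaves nothing to prove. *)
Lemma cauchy_schwarz (a b e : T -> \bar R) : measurable_fun setT a ->
  (forall x, 0 <= a x) -> measurable_fun setT b -> (forall x, 0 <= b x) ->
  measurable_fun setT e -> (forall x, 0 <= e x) ->
  (forall x, b x * b x <= a x * e x) ->
  (\int[mu]_x b x) * (\int[mu]_x b x) <= (\int[mu]_x a x) * (\int[mu]_x e x).
Proof.
move=> ma a0 mb b0 me e0 bae.
have [A0|A0] := eqVneq (\int[mu]_x a x) 0.
  by rewrite (integral_sq_eq0 ma a0 mb b0 bae A0) A0 !mul0e.
have [B0|B0] := eqVneq (\int[mu]_x e x) 0.
  have bea x : b x * b x <= e x * a x by rewrite [leRHS]muleC.
  by rewrite (integral_sq_eq0 me e0 mb b0 bea B0) B0 mul0e mule0.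
have Age : 0 <= \int[mu]_x a x by apply: integral_ge0.
have Bge : 0 <= \int[mu]_x e x by apply: integral_ge0.
have Ige : 0 <= \int[mu]_x b x by apply: integral_ge0.
have key (c : R) : (0 < c)%R -> 2%:E * \int[mu]_x b x <=
    c%:E * \int[mu]_x a x + c^-1%:E * \int[mu]_x e x.
  move=> c0; have ci : (0 <= c^-1)%R by rewrite invr_ge0 ltW.
  rewrite -!ge0_integralZlT//; try (by rewrite lee_fin// ltW).
  rewrite -ge0_integralD//; last 4 first.
  - by move=> x _; rewrite !mule_ge0// lee_fin ltW.
  - by apply: emeasurable_funM.
  - by move=> x _; rewrite !mule_ge0// lee_fin ltW.
  - by apply: emeasurable_funM.
  apply: ge0_le_integralT => x; first by rewrite !mule_ge0.
  exact: mule_amgm.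
move: key Age Bge Ige A0 B0.
case: (\int[mu]_x a x) => [A| |]//; case: (\int[mu]_x e x) => [B| |]//; last first.
- by move=> *; rewrite mulyy leey.
- by move=> _ _ B0 _ _ Bn; rewrite gt0_mulye ?leey// lt0e Bn.
- by move=> _ A0 _ _ An _; rewrite gt0_muley ?leey// lt0e An.
move=> key; rewrite !lee_fin => A0 B0 I0; rewrite !eqe => An Bn.
have {An}Ap : (0 < A)%R by rewrite lt_def An.
have {Bn}Bp : (0 < B)%R by rewrite lt_def Bn.
(* This [c] minimizes [c * A + c^-1 * B]; both terms then equal [sqrt (A * B)]. *)
set c := Num.sqrt (B / A).
have cp : (0 < c)%R by rewrite sqrtr_gt0 divr_gt0.
have c2 : (c ^+ 2 = B / A)%R by rewrite sqr_sqrtr// divr_ge0.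
have {key} := key c cp; rewrite -!EFinM -EFinD.
move: I0; case: (\int[mu]_x b x) => [I| |]//; last by rewrite gt0_muley ?lte_fin// leye_eq.
rewrite -!EFinM !lee_fin => I0.
have cne : (c != 0)%R by rewrite gt_eqF.
have Ane : (A != 0)%R by rewrite gt_eqF.
have -> : (c^-1 * B = c * A)%R.
  have -> : (B = c ^+ 2 * A)%R by rewrite c2 mulfVK ?gt_eqF.
  by field.
have -> : (A * B = (c * A) ^+ 2)%R by rewrite exprMn c2; field.
move=> H; rewrite -expr2 ler_sqr ?nnegrE ?mulr_ge0// ?(ltW cp)//; lra.
Qed.

End Generic.

(** * Sigma-finite product measures and Tonelli's theorem *)

Section ProdSigmaFinite.
Context d1 d2 (T1 : measurableType d1) (T2 : measurableType d2) (R : realType).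
Variables (m1 : {sigma_finite_measure set T1 -> \bar R}).
Variables (m2 : {sigma_finite_measure set T2 -> \bar R}).
Local Open Scope ereal_scope.

(* In the library the canonical sigma-finite structure on [m1 \x m2] is the one
   inferred for probabilities; a separate constant restores the general one. *)
Definition prodm : set (T1 * T2)%type -> \bar R := m1 \x m2.

HB.instance Definition _ := Measure.copy prodm (m1 \x m2).

Lemma prodm_sigma_finite : sigma_finite setT prodm.
Proof.
have /sigma_finiteP[F [TF ndF Foo]] := sigma_finiteT m1.
have /sigma_finiteP[G [TG ndG Goo]] := sigma_finiteT m2.
exists (fun n => F n `*` G n) => [|k].
  apply/seteqP; split=> // -[x y] _.
  have [n _ Fnx] : (\bigcup_i F i) x by rewrite -TF.
  have [k _ Gky] : (\bigcup_i G i) y by rewrite -TG.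
  exists (maxn n k) => //; split => /=.
  - exact: (subsetPset _ _ (ndF _ _ (leq_maxl n k))).
  - exact: (subsetPset _ _ (ndG _ _ (leq_maxr n k))).
have [mF Fk] := Foo k; have [mG Gk] := Goo k.
split; first exact: measurableX.
by rewrite /prodm product_measure1E// lte_mul_pinfty// ge0_fin_numE.
Qed.

HB.instance Definition _ := Measure_isSigmaFinite.Build _ _ _ prodm prodm_sigma_finite.

End ProdSigmaFinite.

Section Tonelli.
Context d1 d2 (T1 : measurableType d1) (T2 : measurableType d2) (R : realType).
Variables (m1 : {sigma_finite_measure set T1 -> \bar R}).
Variables (m2 : {sigma_finite_measure set T2 -> \bar R}).
Local Open Scope ereal_scope.

Lemma tonelli (F : T1 -> T2 -> \bar R) :
  measurable_fun setT (fun p : T1 * T2 => F p.1 p.2) -> (forall x y, 0 <= F x y) ->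
  \int[m1]_x \int[m2]_y F x y = \int[m2]_y \int[m1]_x F x y.
Proof. by move=> mF F0; exact: (fubini_tonelli _ mF). Qed.

Lemma measurable_tonelli (F : T1 -> T2 -> \bar R) :
  measurable_fun setT (fun p : T1 * T2 => F p.1 p.2) -> (forall x y, 0 <= F x y) ->
  measurable_fun setT (fun x => \int[m2]_y F x y).
Proof. by move=> mF F0; exact: (measurable_fun_fubini_tonelli_F _ mF). Qed.

End Tonelli.

(** * Lebesgue measure on R^3 *)

Section Lebesgue.
Context (R : realType).
Definition TT := measurableTypeR R.
Definition X3 := (measurableTypeR R * measurableTypeR R * measurableTypeR R)%type.
Definition lam : {sigma_finite_measure set (measurableTypeR R) -> \bar R} := @lebesgue_measure R.
Definition mu3 : {sigma_finite_measure set X3 -> \bar R} := 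
  SigmaFiniteMeasure.clone _ _ _ (prodm (SigmaFiniteMeasure.clone _ _ _ (prodm lam lam) _) lam) _.

(** The image measure agrees with Lebesgue measure on the intervals []a, b]], whose preimages [[c -
    b, c - a[] have the same length; uniqueness of Lebesgue measure concludes. *)
Lemma lebesgue_integral_reflect (c : R) (f : TT -> \bar R) :
  measurable_fun setT f -> (forall x, 0 <= f x)%E ->
  (\int[lam]_x f (c - x)%R = \int[lam]_x f x)%E.
Proof.
move=> mf f0.
have mphi : measurable_fun setT (fun x : TT => (c - x)%R : TT).
  by apply: measurable_funB.
have := ge0_integral_pushforward mphi lam measurableT mf (fun x _ => f0 x).
rewrite preimage_setT => <-.
apply: eq_measure_integral => A mA _; apply/esym.
apply: (lebesgue_measure_unique _ mA) => _ [[a b] _ <-].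
rewrite /= /pushforward.
rewrite (_ : _ @^-1` _ = `[(c - b)%R, (c - a)%R[%classic); last first.
  by apply/seteqP; split=> x /=; rewrite !in_itv/= => /andP[? ?]; apply/andP; split; lra.
rewrite !lebesgue_measure_itv/= !lte_fin -!EFinB.
have -> : ((c - b < c - a) = (a < b))%R by apply/idP/idP; lra.
by case: ifP => // _; congr (_%:E); ring.
Qed.

Lemma mu3E (f : X3 -> \bar R) : measurable_fun setT f ->
  (forall x, 0 <= f x)%E ->
  (\int[mu3]_x f x = \int[lam]_x \int[lam]_y \int[lam]_z f (x, y, z))%E.
Proof.
move=> mf f0; rewrite /mu3 (fubini_tonelli1 f mf f0).
rewrite fubini_tonelli1; [by []| |].
- exact: measurable_fun_fubini_tonelli_F.
- by move=> x; apply: integral_ge0.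
Qed.

Lemma mu3_reflect (c : X3) (f : X3 -> \bar R) : measurable_fun setT f ->
  (forall x, 0 <= f x)%E ->
  (\int[mu3]_x f (sub3 c x) = \int[mu3]_x f x)%E.
Proof.
move=> mf f0.
have ms : measurable_fun setT (sub3 c : X3 -> X3).
  rewrite /sub3; apply: measurable_fun_pair; first apply: measurable_fun_pair.
  - by apply: measurable_funB; [exact: measurable_cst|exact: measurableT_comp measurable_fst measurable_fst].
  - by apply: measurable_funB; [exact: measurable_cst|exact: measurableT_comp measurable_snd measurable_fst].
  - by apply: measurable_funB; [exact: measurable_cst|exact: measurable_snd].
rewrite (mu3E mf f0).
rewrite (@mu3E (fun x => f (sub3 c x)) (measurableT_comp mf ms) (fun x => f0 _)).
have mG : measurable_fun setT (fun p : TT * TT => \int[lam]_z f (p, z))%E.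
  exact: measurable_fun_fubini_tonelli_F.
have G0 p : (0 <= \int[lam]_z f (p, z))%E by apply: integral_ge0.
transitivity (\int[lam]_x \int[lam]_y \int[lam]_z f ((c.1.1 - x)%R, (c.1.2 - y)%R, z))%E.
  apply: eq_integral => x _; apply: eq_integral => y _.
  apply: (@lebesgue_integral_reflect c.2 (fun z => f ((c.1.1 - x)%R, (c.1.2 - y)%R, z))) => //.
  apply: (measurableT_comp mf); apply: measurable_fun_pair; [exact: measurable_cst|exact: measurable_id].
transitivity (\int[lam]_x \int[lam]_y \int[lam]_z f ((c.1.1 - x)%R, y, z))%E.
  apply: eq_integral => x _.
  apply: (@lebesgue_integral_reflect c.1.2 (fun y => \int[lam]_z f ((c.1.1 - x)%R, y, z))%E) => //.
  by apply: (measurableT_comp mG); apply: measurable_fun_pair; [exact: measurable_cst|exact: measurable_id].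
apply: (@lebesgue_integral_reflect c.1.1 (fun x => \int[lam]_y \int[lam]_z f (x, y, z))%E).
- exact: (measurable_fun_fubini_tonelli_F _ mG G0).
- by move=> x; apply: integral_ge0.
Qed.

(** A translation is a product of two reflections: [x - c = (- c) - (0 - x)]. *)
Lemma mu3_translate (c : X3) (f : X3 -> \bar R) : measurable_fun setT f ->
  (forall x, 0 <= f x)%E ->
  (\int[mu3]_x f (sub3 x c) = \int[mu3]_x f x)%E.
Proof.
move=> mf f0.
have ms : measurable_fun setT (sub3 (opp3 c) : X3 -> X3).
  rewrite /sub3; apply: measurable_fun_pair; first apply: measurable_fun_pair.
  - by apply: measurable_funB; [exact: measurable_cst|exact: measurableT_comp measurable_fst measurable_fst].
  - by apply: measurable_funB; [exact: measurable_cst|exact: measurableT_comp measurable_snd measurable_fst].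
  - by apply: measurable_funB; [exact: measurable_cst|exact: measurable_snd].
rewrite -(mu3_reflect (opp3 c) mf f0).
rewrite -(@mu3_reflect (0, 0, 0) (fun x => f (sub3 (opp3 c) x)) (measurableT_comp mf ms) (fun x => f0 _)).
apply: eq_integral => x _; congr (f _).
by rewrite /sub3 /opp3 /= !sub0r !opprK ![- _ + _]addrC; case: x => -[].
Qed.

(* The factor [1/k] is the total mass of the exponential kernel. *)
Lemma integral_exp_after (k : R) (s : TT) : 0 < k ->
  (\int[lam]_t (if s <= t :> R then expR (- k * (t - s)) else 0)%:E = k^-1%:E)%E.
Proof.
move=> k0.
have -> : (\int[lam]_t (if s <= t :> R then expR (- k * (t - s)) else 0)%:E =
   \int[lam]_(t in `[s, +oo[) (expR (- k * (t - s)))%:E)%E.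
  rewrite [RHS]integral_mkcond; apply: eq_integral => t _.
  rewrite /patch mem_setE in_itv/= andbT.
  by case: ifP.
have cE : continuous (fun t : R => expR (- k * (t - s))).
  move=> t; apply: continuous_comp; last exact: continuous_expR.
  by apply: continuousM; [exact: cst_continuous|apply: cvgB; [exact: cvg_id|exact: cvg_cst]].
have dE (t : R) : is_derive t (1 : R) (fun t : R => - k^-1 * expR (- k * (t - s))) (expR (- k * (t - s))).
  apply: is_derive_eq.
  rewrite /GRing.scale/=; field; lra.
rewrite (@ge0_continuous_FTC2y _ _ (fun t => - k^-1 * expR (- k * (t - s))) _ 0).
- by rewrite subrr mulr0 expR0 mulr1 EFinN oppeK add0e.
- by move=> x _; exact: expR_ge0.
- exact: continuous_subspaceT.
- rewrite -(mulr0 (- k^-1)); apply: cvgMr.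
  rewrite (_ : (fun x => expR _) = (fun z => expR (- z)) \o (fun z => k * (z - s))); last first.
    by apply/funext => x /=; rewrite mulNr.
  apply: (@cvg_comp _ _ _ _ _ _ (pinfty_nbhs R)); last exact: cvgr_expR.
  apply: gt0_cvgMry => //; apply/cvgryPge => A; near=> z.
  rewrite lerBrDr; near: z; exact: nbhs_pinfty_ge.
- by move=> x _; exact: ex_derive.
- by apply: cvg_at_right_filter; apply: cvgM; [exact: cvg_cst|exact: cE].
- by move=> x _; rewrite derive1E; exact: derive_val.
Unshelve. all: by end_near. Qed.

Lemma integral_exp_before (k : R) (t : TT) : 0 < k ->
  (\int[lam]_s (if s <= t :> R then expR (- k * (t - s)) else 0)%:E = k^-1%:E)%E.
Proof.
move=> k0; rewrite -(integral_exp_after (0 : R) k0) -(lebesgue_integral_reflect t).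
- by apply: eq_integral => s _; rewrite subr0 lerBlDr lerDl subKr.
- apply/measurable_EFinP; apply: measurable_fun_ifT => //.
  + by apply: measurable_fun_ler.
  + apply: measurableT_comp => //; apply: measurable_funM => //.
    exact: measurable_funB.
- by move=> s; rewrite lee_fin; case: ifP => // _; exact: expR_ge0.
Qed.

End Lebesgue.

(** * Closure properties of measurable functions and the tactic that chains them *)

Section Measurability.
Context d (T : measurableType d) (R : realType).

Lemma mfst d1 d2 (T1 : measurableType d1) (T2 : measurableType d2) (h : T -> T1 * T2) :
  measurable_fun setT h -> measurable_fun setT (fun x => (h x).1).
Proof. by move=> mh; exact: measurableT_comp measurable_fst mh. Qed.

Lemma msnd d1 d2 (T1 : measurableType d1) (T2 : measurableType d2) (h : T -> T1 * T2) :
  measurable_fun setT h -> measurable_fun setT (fun x => (h x).2).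
Proof. by move=> mh; exact: measurableT_comp measurable_snd mh. Qed.

Lemma mtime (h : T -> TT R) : measurable_fun setT h -> measurable_fun setT (fun x => h x : R).
Proof. by []. Qed.

Lemma mpair d1 d2 (T1 : measurableType d1) (T2 : measurableType d2) (h : T -> T1) (k : T -> T2) :
  measurable_fun setT h -> measurable_fun setT k ->
  measurable_fun setT (fun x => (h x, k x)).
Proof. by move=> mh mk; exact: measurable_fun_pair. Qed.

Lemma mEFin (h : T -> R) : measurable_fun setT h -> measurable_fun setT (fun x => (h x)%:E).
Proof. by move=> mh; exact/measurable_EFinP. Qed.

Lemma mexpR (h : T -> R) : measurable_fun setT h -> measurable_fun setT (fun x => expR (h x)).
Proof. by move=> mh; exact: measurableT_comp. Qed.

(** Real powers are measurable, and [h^-1 = h * (h^2)^(-1)]; with the convention [0^-1 = 0] both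
    sides vanish at a zero of [h]. *)
Lemma minvr (h : T -> R) : measurable_fun setT h -> measurable_fun setT (fun x => (h x)^-1).
Proof.
move=> mh; rewrite (_ : (fun x => _) = (fun x => h x * powR (h x ^+ 2) (-1))); last first.
  apply/funext => x; rewrite powR_inv1 ?sqr_ge0//.
  by have [->|hx] := eqVneq (h x) 0; [rewrite invr0 mul0r|field].
apply: measurable_funM => //; apply: (measurableT_comp (measurable_powR _)).
exact: measurable_funX.
Qed.

Lemma mopp (h : T -> R) : measurable_fun setT h -> measurable_fun setT (fun x => - h x).
Proof. exact: measurable_funN. Qed.

Lemma mpairl d1 (T1 : measurableType d1) (c : T1) : measurable_fun setT (pair c : T -> T1 * T).
Proof. by apply: mpair => //; exact: measurable_cst. Qed.

Lemma mconst d1 (T1 : measurableType d1) (c : T1) : measurable_fun setT (fun _ : T => c).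
Proof. exact: measurable_cst. Qed.

Lemma mid : measurable_fun setT (fun x : T => x).
Proof. exact: measurable_id. Qed.

End Measurability.

Ltac hd t := lazymatch t with ?f _ => hd f | _ => t end.
(** Heads are compared before unifying, so that a hypothesis is tried only on its own function and
    no costly unfolding starts. *)
Ltac sameterm a b := first [constr_eq a b |
  let x := hd a in let y := hd b in constr_eq x y; unify a b].
Ltac ms1 := match goal with
  | |- measurable_fun _ ?h => match goal with
       H : measurable_fun _ ?h' |- _ => sameterm h h'; exact H end
  | |- measurable_fun _ (fun _ => ?c) => first [exact: measurable_cst|exact (mconst c)]
  | |- measurable_fun _ (fun x => x) => first [exact: mid|apply: mtime; exact: mid]
  | |- measurable_fun _ (fun x => (_, _)) => apply: mpair
  | |- measurable_fun _ (fun x => fst _) => first [apply: mfst|apply: mtime; apply: mfst]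
  | |- measurable_fun _ (fun x => snd _) => first [apply: msnd|apply: mtime; apply: msnd]
  | |- measurable_fun _ (fun x => (_)%:E) => apply: mEFin
  | |- measurable_fun _ (fun x => (_ * _)%E) => apply: emeasurable_funM
  | |- measurable_fun _ (fun x => (_ + _)%E) => apply: emeasurable_funD
  | |- measurable_fun _ (fun x => _ * _) => apply: measurable_funM
  | |- measurable_fun _ (fun x => _ - _) => apply: measurable_funB
  | |- measurable_fun _ (fun x => _ + _) => apply: measurable_funD
  | |- measurable_fun _ (fun x => - _) => apply: mopp
  | |- measurable_fun _ (pair _) => exact: mpairl
  | |- measurable_fun _ (fun x => _ ^+ _) => apply: measurable_funX
  | |- measurable_fun _ (fun x => _ ^-1) => apply: minvr
  | |- measurable_fun _ (fun x => expR _) => apply: mexpR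
  | |- measurable_fun _ (fun x => if _ <= _ then _ else _) => apply: measurable_fun_ifT; [apply: measurable_fun_ler| |]
  | |- measurable_fun _ (fun x => ?h _) => match goal with
       H : measurable_fun _ ?h' |- _ => sameterm h h'; apply: (measurableT_comp H) end
  | |- measurable_fun ?D ?h => lazymatch h with
       | (fun _ => _) => fail | _ => change (measurable_fun D (fun x => h x)) end
  end.
Ltac ms := repeat ms1.

(** * Nonnegative measurable functions, and the real inequalities of the Gevrey and bootstrap
    steps *)

Definition nnm d (T : measurableType d) (R : realType) (f : T -> \bar R) :=
  measurable_fun setT f /\ forall p, (0 <= f p)%E.

(** Young's inequality [a * rr <= a^2 / (2 nu) + nu / 2 * rr^2], multiplied by the elapsed time
    [dd]; the constant term is then bounded through [dd <= 1]. *)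
Lemma gevrey_arith (R : realType) (a nu m rr dd : R) : 0 < a -> 0 < nu -> 0 <= m -> m <= rr ->
  0 <= dd -> dd <= 1 -> a * dd * m <= a ^+ 2 / (2 * nu) + nu / 2 * rr ^+ 2 * dd.
Proof.
move=> a0 nu0 m0 mr d0 d1.
have H1 : a * dd * m <= a * dd * rr by apply: ler_wpM2l => //; rewrite mulr_ge0// ltW.
have H2 : a * rr <= a ^+ 2 / (2 * nu) + nu / 2 * rr ^+ 2.
  have : 0 <= (2 * nu)^-1 * (a - nu * rr) ^+ 2.
    by rewrite mulr_ge0 ?sqr_ge0// invr_ge0 mulr_ge0// ltW.
  have -> : (2 * nu)^-1 * (a - nu * rr) ^+ 2 = a ^+ 2 / (2 * nu) + nu / 2 * rr ^+ 2 - a * rr.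
    by field; rewrite gt_eqF.
  by rewrite subr_ge0.
have A10 : 0 <= a ^+ 2 / (2 * nu) by rewrite divr_ge0 ?sqr_ge0// mulr_ge0// ltW.
move: (a ^+ 2 / (2 * nu)) A10 H2 => A1 A10 H2.
have H3 := ler_wpM2r d0 H2.
have H4 : A1 * dd <= A1 by rewrite -[leRHS]mulr1; apply: ler_wpM2l.
lra.
Qed.

Lemma gevrey_arith2 (R : realType) (a nu m rr d t s : R) : 0 < a -> 0 < nu -> 0 <= m -> m <= rr ->
  0 <= d -> d <= 1 -> t = d + s ->
  a * t * m + - (nu * rr ^+ 2) * d <=
  a ^+ 2 / (2 * nu) + (a * s * m + - (nu / 2 * rr ^+ 2) * d).
Proof.
move=> a0 nu0 m0 mr d0 d1 ->; have := gevrey_arith a0 nu0 m0 mr d0 d1.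
by move: (a ^+ 2 / (2 * nu)) => A; lra.
Qed.

(** Here [x] is a supremum in time of the [X^-1] norm and [y] the dissipation. Since [C * y <= 1/2],
    the quadratic term is at most [x / 2], so [x <= 2 * e]. Then [nu * y <= 2 * e], and
    [8 * C * e <= nu] turns this into [C * y <= 1/4]. *)
Lemma bootstrap_arith (R : realType) (C nu e x y : R) : 0 < C -> 0 < nu -> 0 <= e ->
  8 * C * e <= nu -> 0 <= x -> 0 <= y -> y <= (2 * C)^-1 -> x <= e + C * (x * y) ->
  y <= nu^-1 * (e + C * (x * y)) -> x <= 2 * e /\ y <= (4 * C)^-1.
Proof.
move=> C0 nu0 e0 Ce x0 y0 yC hx hy.
have {}yC : C * y <= 2^-1.
  by move: yC; rewrite -div1r ler_pdivlMr ?mulr_gt0// => yC; lra.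
have xy : C * (x * y) <= x * 2^-1.
  by rewrite mulrCA; apply: ler_wpM2l.
have x2e : x <= 2 * e by lra.
split=> //; have hy' : nu * y <= e + C * (x * y).
  by move: hy; rewrite mulrC ler_pdivlMr// mulrC.
have y2 : nu * y <= 2 * e by lra.
rewrite -div1r ler_pdivlMr ?mulr_gt0//.
have : nu * (C * y) <= nu * 4^-1.
  by rewrite mulrCA; have := ler_wpM2l (ltW C0) y2; lra.
by rewrite ler_pM2l// => H; lra.
Qed.

(** * Sequences and series of extended reals *)

Section ExtendedSequences.
Context (R : realType).
Implicit Types u : nat -> \bar R.
Local Open Scope ereal_scope.

Lemma le_limn_einf u (c : \bar R) N : (forall n, (N <= n)%N -> c <= u n) -> c <= limn_einf u.
Proof.
move=> cu; rewrite limn_einf_lim; apply: lime_ge; first exact: is_cvg_einfs.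
exists N => // n /= Nn; apply: le_ereal_inf_tmp => _ [m /= nm <-].
by apply: cu; exact: leq_trans nm.
Qed.

Lemma limn_einf_le u (c : \bar R) : (forall n, u n <= c) -> limn_einf u <= c.
Proof.
move=> uc; rewrite limn_einf_lim; apply: lime_le; first exact: is_cvg_einfs.
apply: nearW => n; apply: le_trans (uc n).
by apply: ereal_inf_lbound; exists n => /=.
Qed.

Lemma nneseries_small u (d : R) : (forall n, 0 <= u n) -> \sum_(0 <= n <oo) u n < +oo ->
  (0 < d)%R -> exists N, forall n, (N <= n)%N -> u n <= d%:E.
Proof.
move=> u0 us d0; have ct := nneseries_tail_cvg us (fun k _ => u0 k).
have := ct [set x | x < d%:E]; case.
  by apply: open_nbhs_nbhs; split; [exact: open_ereal_lt_ereal|rewrite /= lte_fin].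
move=> N _ H; exists N => n Nn; apply: le_trans (ltW (H n Nn)).
rewrite (@nneseries_split _ _ n 1) => [|k _]; last exact: u0.
by rewrite addn1 big_nat1 leeDl// nneseries_ge0.
Qed.

(** If the square root of [L] were below [a], their midpoint would contradict the hypothesis. This
    serves when [a] is known only through strict lower approximations. *)
Lemma sqe_le (a : R) (L : \bar R) : (0 <= a)%R ->
  (forall b : R, (0 <= b)%R -> (b < a)%R -> (b * b)%:E <= L) -> (0 <= L) -> (a * a)%:E <= L.
Proof.
case: L => [l| |] a0 H; [|by move=> _; rewrite leey|by []].
rewrite lee_fin => l0; rewrite lee_fin leNgt; apply/negP => la.
have s0 := sqrtr_ge0 l; have sl : (Num.sqrt l * Num.sqrt l)%R = l by rewrite -expr2 sqr_sqrtr.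
move: (Num.sqrt l) s0 sl => s s0 sl.
have sa : (s < a)%R by rewrite ltNge; apply/negP => ?; nra.
have := H ((s + a) / 2)%R; rewrite lee_fin => H'.
have : ((s + a) / 2 * ((s + a) / 2) <= l)%R by apply: H'; lra.
nra.
Qed.

Lemma sqrDe_le (a b : \bar R) : 0 <= a -> 0 <= b ->
  (a + b) * (a + b) <= 2%:E * (a * a) + 2%:E * (b * b).
Proof.
case: a => [a| |]//; case: b => [b| |]//; rewrite ?lee_fin => a0 b0.
- have := sqr_ge0 (a - b)%R; rewrite expr2; nra.
- by rewrite addey// mulyy gt0_muley ?lte_fin// addey ?leey// -EFinM.
- by rewrite addye// mulyy gt0_muley ?lte_fin// addye ?leey// -EFinM.
- by rewrite addye// mulyy gt0_muley ?lte_fin// addye ?leey//.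
Qed.

Lemma geometric_bound u (a : R) : (forall n, 0 <= u n) -> (forall n, u n <= (a / 2 ^+ n)%:E) ->
  \sum_(0 <= n <oo) u n < +oo.
Proof.
move=> u0 ua; have a0 : (0 <= a)%R.
  by have := le_trans (u0 0%N) (ua 0%N); rewrite expr0 divr1 lee_fin.
apply: (@le_lt_trans _ _ (2 * a)%:E); last by rewrite ltry.
apply: lime_le; first by apply: is_cvg_nneseries => n _ _; exact: u0.
apply: nearW => n; rewrite big_mkord.
apply: (@le_trans _ _ (\sum_(i < n) (a / 2 ^+ i)%:E)).
  by apply: lee_sum => i _; exact: ua.
rewrite sumEFin lee_fin.
have -> : (\sum_(i < n) a / 2 ^+ i = 2 * a - 2 * a / 2 ^+ n)%R.
  elim: n => [|n IH]; first by rewrite big_ord0 expr0; field.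
  rewrite big_ord_recr /= IH exprS; have : (2 ^+ n != 0 :> R)%R by rewrite expf_neq0.
  by move: (2 ^+ n)%R => z z0; field.
by rewrite gerBl divr_ge0 ?mulr_ge0// exprn_ge0.
Qed.

End ExtendedSequences.

Lemma nnm_nneseries d (T : measurableType d) (R : realType) (D : nat -> T -> \bar R) :
  (forall n, nnm (D n)) -> nnm (fun x => (\sum_(0 <= n <oo) D n x)%E).
Proof.
move=> nD; split; last by move=> x; apply: nneseries_ge0 => n _ _; exact: (nD n).2.
apply: (emeasurable_fun_cvg (fun n x => (\sum_(0 <= k < n) D k x)%E)).
- by move=> n; apply: emeasurable_sum => k; exact: (nD k).1.
- move=> x _; apply: is_cvg_nneseries => n _ _; exact: (nD n).2.
Qed.

Lemma measurable_limn_einf d (T : measurableType d) (R : realType) (u : nat -> T -> \bar R) :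
  (forall n, measurable_fun setT (u n)) ->
  measurable_fun setT (fun x => limn_einf (fun n => u n x)).
Proof.
move=> mu; apply: (emeasurable_fun_cvg (fun n x => einfs (u ^~ x) n)).
- by move=> n; exact: measurable_fun_einfs.
- by move=> x _; rewrite limn_einf_lim; exact: is_cvg_einfs.
Qed.

Lemma nnm_finite_ae d (T : measurableType d) (R : realType) (mu : {measure set T -> \bar R})
  (h : T -> \bar R) : nnm h -> (\int[mu]_x h x < +oo)%E ->
  {ae mu, forall x, (h x < +oo)%E}.
Proof.
move=> [mh h0] ih.
have : mu.-integrable setT h.
  by apply/integrableP; split => //; under eq_integral do rewrite gee0_abs//.
move=> /(integrable_ae measurableT) [N [mN N0 sN]]; exists N; split => // x /= hx.
by apply: sN => /= /(_ I); rewrite ge0_fin_numE.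
Qed.
(** * Convolution majorants and the mild formulation *)

Section Majorant.
Context (R : realType) d (X : measurableType d) (mu : {sigma_finite_measure set X -> \bar R}).
(** The frequency space is kept abstract: the estimates see only a difference [sub], a modulus [r]
    and the invariance of [mu]. Coordinates come back when these are instantiated on [R^3]. *)
Variables (sub : X -> X -> X) (r : X -> R).
Hypothesis msub0 : measurable_fun setT (fun p : X * X => sub p.1 p.2).
Hypothesis mr : measurable_fun setT r.
Hypothesis r0 : forall x, 0 <= r x.
Hypothesis subK : forall c x, sub c (sub c x) = x.
Hypothesis reflect : forall c (f : X -> \bar R), measurable_fun setT f ->
  (forall x, 0 <= f x)%E -> (\int[mu]_x f (sub c x) = \int[mu]_x f x)%E.
Hypothesis translate : forall c (f : X -> \bar R), measurable_fun setT f ->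
  (forall x, 0 <= f x)%E -> (\int[mu]_x f (sub x c) = \int[mu]_x f x)%E.
Local Open Scope ereal_scope.
Notation P := (TT R * X)%type.
Notation lam := (lam R).

Lemma msub d' (T : measurableType d') (a b : T -> X) : measurable_fun setT a ->
  measurable_fun setT b -> measurable_fun setT (fun x => sub (a x) (b x)).
Proof. by move=> ma mb; exact: (measurableT_comp msub0 (mpair ma mb)). Qed.

Ltac ms1' := first [ms1 | match goal with
  | |- measurable_fun _ (fun x => sub _ _) => apply: msub end].
Ltac ms ::= repeat ms1'.

(* Scalar majorants [f (s, xi)] of [|\hat u(s, xi)|]: [ker] is the heat kernel,
   extended by 0 to [s > t], and [KK nu f g] bounds the bilinear Duhamel term. *)
Definition mass (f : P -> \bar R) (s : TT R) := \int[mu]_x f (s, x).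
Definition cv (f g : P -> \bar R) (p : P) := \int[mu]_y (f (p.1, y) * g (p.1, sub p.2 y)).
Definition ker (nu : R) (t s : TT R) (x : X) : R :=
  (if s <= t :> R then expR (- (nu * r x ^+ 2) * (t - s)) else 0)%R.
Definition KK (nu : R) (f g : P -> \bar R) (p : P) :=
  \int[lam]_s ((ker nu p.1 s p.2)%:E * ((r p.2)%:E * cv f g (s, p.2))).

Ltac nnhyp x := match x with ?f _ => match goal with
       | H : forall x, is_true (@Order.le _ _ _ (?f' x)) |- _ => sameterm f f'; exact: H
       | H : nnm ?f' |- _ => sameterm f f'; exact: H.2 end end.
Ltac nn1 := lazymatch goal with
  | |- forall _, _ => move=> ?
  | |- is_true (@Order.le _ _ _ ?x) => first [nnhyp x | lazymatch x with
    | (_ * _)%E => apply: mule_ge0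
    | @GRing.add _ _ _ => first [apply: adde_ge0|apply: addr_ge0]
    | (_)%:E => rewrite lee_fin
    | expR _ => exact: expR_ge0
    | (_ * _)%R => apply: mulr_ge0
    | (_ ^-1)%R => rewrite invr_ge0
    | (_ ^+ 2)%R => exact: sqr_ge0
    | (_ ^+ _)%R => apply: exprn_ge0
    | (_%:R)%R => exact: ler0n
    | 1%R => exact: ler01
    | 0%R => exact: lexx
    | Num.norm _ => exact: normr_ge0
    | integral _ _ _ => apply: integral_ge0 => ? _
    end | match goal with H : is_true (@Order.le _ _ _ ?x') |- _ => constr_eq x x'; exact: H 
          | H : is_true (@Order.lt _ _ _ ?x') |- _ => constr_eq x x'; exact: ltW end]
  end.
Ltac nn := repeat nn1.

Lemma ker_ge0 nu t s x : (0 <= ker nu t s x)%R.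
Proof. by rewrite /ker; case: ifP => // _; exact: expR_ge0. Qed.

Ltac nn2 := first [nn1 | match goal with
  | |- is_true (@Order.le _ _ _ (ker _ _ _ _)) => exact: ker_ge0
  | |- is_true (@Order.le _ _ _ (r _)) => exact: r0 end].
Ltac nn ::= repeat nn2.

Lemma ker_le1 nu t s x : (0 <= nu)%R -> (ker nu t s x <= 1)%R.
Proof.
move=> nu0; rewrite /ker; case: ifP => // st; rewrite -expR0 ler_expR.
by rewrite mulNr oppr_le0 mulr_ge0 ?subr_ge0// mulr_ge0// sqr_ge0.
Qed.

Lemma mker nu d' (T : measurableType d') (a b : T -> TT R) (e : T -> X) :
  measurable_fun setT a -> measurable_fun setT b -> measurable_fun setT e ->
  measurable_fun setT (fun x => ker nu (a x) (b x) (e x)).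
Proof. by move=> ma mb me; rewrite /ker; ms. Qed.

Ltac ms2' := first [ms1' | match goal with
  | |- measurable_fun _ (fun x => ker _ _ _ _) => apply: mker
  | |- measurable_fun _ (fun x => integral _ _ _) => apply: measurable_tonelli; [|by nn] end].
Ltac ms ::= repeat ms2'.

Lemma nnm_mass f : nnm f -> nnm (mass f).
Proof.
case=> mf f0; split; last by move=> s; exact: integral_ge0.
by apply: (measurable_tonelli mu (F := fun s x => f (s, x))) => //; ms.
Qed.

Lemma nnm_sec (f : P -> \bar R) s : nnm f -> nnm (fun x => f (s, x)).
Proof. by case=> mf f0; split=> //; ms. Qed.

Lemma nnm_cv f g : nnm f -> nnm g -> nnm (cv f g).
Proof.
case=> mf f0 [mg g0]; split; last by move=> s; apply: integral_ge0 => x _; exact: mule_ge0.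
by apply: (measurable_tonelli mu (F := fun p y => f (p.1, y) * g (p.1, sub p.2 y)));
  [ms|move=> x y; exact: mule_ge0].
Qed.

Lemma nnm_KK nu f g : nnm f -> nnm g -> nnm (KK nu f g).
Proof.
move=> nf ng; have [mc c0] := nnm_cv nf ng; split; last first.
  by rewrite /KK; nn.
apply: (measurable_tonelli lam (F := fun p s => (ker nu p.1 s p.2)%:E * ((r p.2)%:E * cv f g (s, p.2)))).
  by ms.
by nn.
Qed.

(** Tonelli, then invariance under translation in the inner integral; nonnegativity makes the usual
    bound for convolutions in [L^1] an equality. *)
Lemma mass_cv f g s : nnm f -> nnm g -> mass (cv f g) s = mass f s * mass g s.
Proof.
case=> mf f0 [mg g0]; rewrite /mass /cv /=.
rewrite (tonelli mu mu (F := fun x y => f (s, y) * g (s, sub x y))); last 2 first.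
- by ms.
- by move=> x y; exact: mule_ge0.
have mgs : measurable_fun setT (fun x => g (s, x)) by ms.
rewrite -ge0_integralZrT//; last 2 first.
- by ms.
- exact: integral_ge0.
apply: eq_integral => y _; rewrite ge0_integralZlT//; last by ms.
by rewrite (translate y mgs).
Qed.

Lemma cvC f g p : nnm f -> nnm g -> cv f g p = cv g f p.
Proof.
case=> mf f0 [mg g0]; rewrite /cv.
rewrite -(reflect p.2 (f := fun y => f (p.1, y) * g (p.1, sub p.2 y))); last 2 first.
- by ms.
- by move=> x; exact: mule_ge0.
by apply: eq_integral => y _; rewrite subK muleC.
Qed.

Lemma le_cv f g f' g' p : (forall p, 0 <= f p) -> (forall p, 0 <= g p) ->
  (forall p, f p <= f' p) -> (forall p, g p <= g' p) -> cv f g p <= cv f' g' p.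
Proof.
move=> f0 g0 ff gg; apply: ge0_le_integralT => y; first exact: mule_ge0.
exact: lee_pmul.
Qed.

Lemma le_KK nu f g f' g' p : (forall p, 0 <= f p) -> (forall p, 0 <= g p) ->
  (forall p, f p <= f' p) -> (forall p, g p <= g' p) -> KK nu f g p <= KK nu f' g' p.
Proof.
move=> f0 g0 ff gg.
have c0 q : 0 <= cv f g q by apply: integral_ge0 => x _; exact: mule_ge0.
apply: ge0_le_integralT => s; first by nn.
apply: lee_pmul => //; [by nn|by nn|].
by apply: lee_pmul => //; [by rewrite lee_fin|exact: le_cv].
Qed.

Lemma cvDl f f' g p : nnm f -> nnm f' -> nnm g ->
  cv (fun q => f q + f' q) g p = cv f g p + cv f' g p.
Proof.
move=> [mf f0] [mf' f0'] [mg g0]; rewrite /cv -ge0_integralD//.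
- by apply: eq_integral => y _; rewrite ge0_muleDl.
- by move=> x _; exact: mule_ge0.
- by ms.
- by move=> x _; exact: mule_ge0.
- by ms.
Qed.

Lemma KKDl nu f f' g p : nnm f -> nnm f' -> nnm g ->
  KK nu (fun q => f q + f' q) g p = KK nu f g p + KK nu f' g p.
Proof.
move=> nf nf' ng.
have [mc c0] := nnm_cv nf ng; have [mc' c0'] := nnm_cv nf' ng.
rewrite /KK -ge0_integralD//.
- apply: eq_integral => s _; rewrite cvDl// ge0_muleDr//.
  by rewrite ge0_muleDr//; nn.
- by nn.
- by ms.
- by nn.
- by ms.
Qed.

(** For [k > 0] the integral is [k^-1]. For [k = 0] it diverges, but then [v <= c * k] forces
    [v = 0] and the left-hand side vanishes. *)
Lemma exp_tail_le (v k c : R) (s : TT R) (z : \bar R) :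
  0 <= z -> (0 <= v)%R -> (v <= c * k)%R -> (0 <= c)%R -> (0 <= k)%R ->
  v%:E * z * \int[lam]_t (if s <= t :> R then expR (- k * (t - s)) else 0)%R%:E <= c%:E * z.
Proof.
move=> z0 v0 vc c0; rewrite le_eqVlt => /orP[/eqP k0|k0].
  have -> : v = 0%R by apply/eqP; rewrite eq_le v0 andbT (le_trans vc)// -k0 mulr0.
  by rewrite !mul0e mule_ge0.
rewrite integral_exp_after// muleAC -EFinM; apply: lee_pmul => //.
- by rewrite lee_fin mulr_ge0// invr_ge0 ltW.
- by rewrite lee_fin ler_pdivrMr.
Qed.

(* Time integration comes first: the heat kernel contributes [1/(l + nu r^2)]. *)
Lemma KK_time (nu l c : R) (w : X -> R) (f g : P -> \bar R) :
  (0 < nu)%R -> (0 <= l)%R -> (0 <= c)%R -> measurable_fun setT w -> (forall x, 0 <= w x)%R ->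
  (forall x, w x * r x <= c * (l + nu * r x ^+ 2))%R -> nnm f -> nnm g ->
  \int[lam]_t ((expR (- (l * t)))%:E * \int[mu]_x ((w x)%:E * KK nu f g (t, x))) <=
  c%:E * \int[lam]_s ((expR (- (l * s)))%:E * (mass f s * mass g s)).
Proof.
move=> nu0 l0 c0 mw w0 wr nf ng.
have [mc cv0] := nnm_cv nf ng; have [mK K0] := nnm_KK nu nf ng.
have kp t s x : 0 <= (ker nu t s x)%:E by rewrite lee_fin ker_ge0.
have ep t : 0 <= (expR (- (l * t)))%:E by rewrite lee_fin expR_ge0.
have wp x : 0 <= (w x)%:E by rewrite lee_fin.
have rp x : 0 <= (r x)%:E by rewrite lee_fin.
have me : measurable_fun setT (fun t : TT R => expR (- (l * t))).
  by ms.
pose G t x s := (expR (- (l * t)))%:E * (w x)%:E * ((ker nu t s x)%:E * ((r x)%:E * cv f g (s, x))).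
have G0 t x s : 0 <= G t x s by rewrite /G !mule_ge0.
have E1 : \int[lam]_t ((expR (- (l * t)))%:E * \int[mu]_x ((w x)%:E * KK nu f g (t, x))) =
   \int[lam]_t \int[mu]_x \int[lam]_s G t x s.
  apply: eq_integral => t _; rewrite -ge0_integralZlT//; last 2 first.
  - by ms.
  - by move=> x; rewrite mule_ge0.
  apply: eq_integral => x _; rewrite /KK /= /G ge0_integralZlT//.
  - by rewrite muleA.
  - by ms.
  - by move=> s; rewrite !mule_ge0.
  - by rewrite mule_ge0.
have E2 : \int[lam]_t \int[mu]_x \int[lam]_s G t x s =
   \int[lam]_s \int[mu]_x \int[lam]_t G t x s.
  transitivity (\int[lam]_t \int[lam]_s \int[mu]_x G t x s).
    apply: eq_integral => t _; apply: (tonelli _ _) => //.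
    by rewrite /G; ms.
  rewrite (tonelli lam lam); last 2 first.
  - apply: (measurable_tonelli mu (F := fun (p : TT R * TT R) x => G p.1 x p.2)) => //.
    by rewrite /G; ms.
  - by move=> x y; exact: integral_ge0.
  apply: eq_integral => s _; apply: (tonelli _ _) => //.
  by rewrite /G; ms.
rewrite E1 E2 -(@ge0_integralZlT _ _ _ lam (fun s => (expR (- (l * s)))%:E * (mass f s * mass g s))); last 3 first.
- have [mmf mf0] := nnm_mass nf; have [mmg mg0] := nnm_mass ng.
  by ms.
- by rewrite /mass; nn.
- by nn.
apply: ge0_le_integralT => s; first by apply: integral_ge0 => x _; exact: integral_ge0.
have mcs : measurable_fun setT (fun x => cv f g (s, x)) by ms.
have -> : c%:E * ((expR (- (l * s)))%:E * (mass f s * mass g s)) =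
    \int[mu]_x (c%:E * ((expR (- (l * s)))%:E * cv f g (s, x))).
  rewrite ge0_integralZlT; [|by ms|by nn|by nn].
  by rewrite ge0_integralZlT; [rewrite -mass_cv|by ms|by nn|by nn].
apply: ge0_le_integralT => x; first exact: integral_ge0.
have -> : \int[lam]_t G t x s = (w x * r x)%:E * ((expR (- (l * s)))%:E * cv f g (s, x)) *
   \int[lam]_t ((if s <= t :> R then expR (- (l + nu * r x ^+ 2) * (t - s)) else 0)%R)%:E.
  rewrite -[RHS]ge0_integralZlT; last 3 first.
  - by ms.
  - by move=> t; rewrite lee_fin; case: ifP => // _; exact: expR_ge0.
  - by nn.
  apply: eq_integral => t _; rewrite /G /ker; case: ifP => _; last by rewrite !(mul0e, mule0).
  (* The weight [exp(- l t)] is split at time [s]: the part [exp(- l s)] stays with the source and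
     [exp(- l (t - s))] joins the heat kernel, whose rate becomes [l + nu r^2]. *)
  have -> : (expR (- (l + nu * r x ^+ 2) * (t - s)) = expR (- (l * t)) *
      expR (- (nu * r x ^+ 2) * (t - s)) / expR (- (l * s)))%R.
    rewrite -expRN -!expRD; congr expR; ring.
  rewrite [RHS]muleAC !muleA -!EFinM; congr (_%:E * _).
  move: (expR_gt0 (- (l * s))); move: (expR (- (l * s))) (expR (- (l * t))) (expR _) => e1 e2 e3 e10.
  by field; rewrite gt_eqF.
have z0 : 0 <= (expR (- (l * s)))%:E * cv f g (s, x) by nn.
apply: exp_tail_le; [exact: z0|nn|exact: wr|nn|nn].
Qed.

(** The factor [r^-1] cancels the derivative [r] inside [KK], and the heat kernel is at most 1. What
    is left is the integral of a convolution. *)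
Lemma KK_rinv (nu : R) (f g : P -> \bar R) (t : TT R) : (0 <= nu)%R -> nnm f -> nnm g ->
  \int[mu]_x ((r x)^-1%:E * KK nu f g (t, x)) <= \int[lam]_s (mass f s * mass g s).
Proof.
move=> nu0 nf ng; have [mc c0] := nnm_cv nf ng.
have -> : \int[lam]_s (mass f s * mass g s) = \int[mu]_x \int[lam]_s cv f g (s, x).
  rewrite (tonelli mu lam (F := fun x s => cv f g (s, x))); [|by ms|by nn].
  by apply: eq_integral => s _; rewrite -mass_cv.
apply: ge0_le_integralT => x.
  by apply: mule_ge0; [nn|rewrite /KK; nn].
rewrite /KK -ge0_integralZlT; [|by ms|by nn|by nn].
apply: ge0_le_integralT => s; first by nn.
rewrite !muleA -!EFinM /=; rewrite -[leRHS]mul1e; apply: lee_pmul => //.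
  by rewrite lee_fin; nn.
rewrite lee_fin mulrAC; have [->|rx] := eqVneq (r x) 0%R.
  by rewrite mulr0 mul0r ler01.
by rewrite mulVf// mul1r ker_le1.
Qed.

(** The time integral of the heat kernel is [1 / (nu r^2)], a gain of two powers that turns [r] into
    [r^-1]; both sides vanish where [r = 0]. *)
Lemma S_time (nu : R) (t0 : TT R) (f0 : X -> \bar R) : (0 < nu)%R -> measurable_fun setT f0 ->
  (forall x, 0 <= f0 x) ->
  \int[lam]_t \int[mu]_x ((r x)%:E * ((ker nu t t0 x)%:E * f0 x)) <=
  nu^-1%:E * \int[mu]_x ((r x)^-1%:E * f0 x).
Proof.
move=> nu0 mf0 f00.
rewrite (tonelli lam mu (F := fun t x => (r x)%:E * ((ker nu t t0 x)%:E * f0 x))); last 2 first.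
- by ms.
- by nn.
rewrite -ge0_integralZlT; [|by ms|by nn|by nn].
apply: ge0_le_integralT => x; first by nn.
have -> : \int[lam]_t ((r x)%:E * ((ker nu t t0 x)%:E * f0 x)) = (r x)%:E * f0 x *
   \int[lam]_t ((if t0 <= t :> R then expR (- (nu * r x ^+ 2) * (t - t0)) else 0)%R)%:E.
  rewrite -[RHS]ge0_integralZlT; last 3 first.
  - by ms.
  - by move=> t; rewrite lee_fin; case: ifP => // _; exact: expR_ge0.
  - by nn.
  by apply: eq_integral => t _; rewrite /ker muleA muleAC.
have [rx|rx] := eqVneq (r x) 0%R; first by rewrite rx !mul0e; nn; rewrite invr0.
have rxp : (0 < r x)%R by rewrite lt_def rx r0.
rewrite integral_exp_after; last by rewrite mulr_gt0// exprn_gt0.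
rewrite muleAC !muleA -!EFinM; apply: lee_pmul => //; first by nn.
by rewrite lee_fin le_eqVlt; apply/orP; left; apply/eqP; field; rewrite rx gt_eqF.
Qed.

(** Young's inequality for [L^2] convolved with [L^1]: Cauchy-Schwarz writes [f g] as the geometric
    mean of [f^2 g] and [g], and the mass of a convolution is a product. *)
Lemma mass_cv_sq (f g : P -> \bar R) s : nnm f -> nnm g ->
  mass (fun p => cv f g p * cv f g p) s <=
  mass g s * mass g s * mass (fun p => f p * f p) s.
Proof.
move=> nf ng; have [mf f0] := nf; have [mg g0] := ng.
have nf2 : nnm (fun p => f p * f p) by split; [ms|nn].
have [mc c0] := nnm_cv nf2 ng; have [mmg mg0] := nnm_mass ng.
apply: (@le_trans _ _ (\int[mu]_x (cv (fun p => f p * f p) g (s, x) * mass g s))).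
  apply: ge0_le_integralT => x; first by rewrite /cv; nn.
  have -> : mass g s = \int[mu]_y g (s, sub x y).
    by rewrite (reflect x (f := fun x => g (s, x)))//; ms.
  apply: cauchy_schwarz; [by ms|by nn|by ms|by nn|by ms|by nn|].
  by move=> y /=; rewrite -!muleA; apply: lee_pmul => //; [nn|rewrite muleCA].
rewrite ge0_integralZrT; [|by ms|by nn|by nn].
have := mass_cv s nf2 ng; rewrite {1}/mass => ->.
by rewrite -muleA muleC.
Qed.

Definition before (t s : TT R) : R := (if s <= t :> R then 1 else 0)%R.

Lemma mbefore d' (T : measurableType d') (a b : T -> TT R) :
  measurable_fun setT a -> measurable_fun setT b ->
  measurable_fun setT (fun x => before (a x) (b x)).
Proof. by move=> ma mb; rewrite /before; ms. Qed.

Lemma before_ge0 t s : (0 <= before t s)%R.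
Proof. by rewrite /before; case: ifP. Qed.

Ltac ms3' := first [ms2' | match goal with
  | |- measurable_fun _ (fun x => before _ _) => apply: mbefore end].
Ltac ms ::= repeat ms3'.
Ltac nn3 := first [nn2 | match goal with
  | |- is_true (@Order.le _ _ _ (before _ _)) => exact: before_ge0 end].
Ltac nn ::= repeat nn3.

Lemma ker_before nu t s x : ker nu t s x = (before t s * ker nu t s x)%R.
Proof. by rewrite /before /ker; case: ifP; rewrite ?mul1r ?mul0r. Qed.

(** Cauchy-Schwarz in time puts [(ker * r)^2] alone in one factor. Its integral is
    [r^2 / (2 nu r^2)]: heat smoothing pays exactly for the derivative. Young's inequality handles
    the other factor. *)
Lemma KK_sq (nu : R) (f g : P -> \bar R) (t : TT R) : (0 < nu)%R -> nnm f -> nnm g ->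
  \int[mu]_x (KK nu f g (t, x) * KK nu f g (t, x)) <=
  (2 * nu)^-1%:E * \int[lam]_s ((before t s)%:E *
      (mass g s * mass g s * mass (fun p => f p * f p) s)).
Proof.
move=> nu0 nf ng; have [mc c0] := nnm_cv nf ng.
have nf2 : nnm (fun p => f p * f p) by case: nf => mf f0; split; [ms|nn].
have [mmg mg0] := nnm_mass ng; have [mmf mf0] := nnm_mass nf2.
have mb : measurable_fun setT (fun s => before t s) by apply: mbefore; ms.
have b0 s : (0 <= before t s)%R by exact: before_ge0.
have nu20 : (0 <= (2 * nu)^-1)%R by rewrite invr_ge0 mulr_ge0// ltW.
apply: (@le_trans _ _ (\int[mu]_x ((2 * nu)^-1%:E *
   \int[lam]_s ((before t s)%:E * (cv f g (s, x) * cv f g (s, x)))))).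
  apply: ge0_le_integralT => x; first by rewrite /KK; nn.
  have CS := @cauchy_schwarz _ _ _ lam
    (fun s => ((ker nu t s x * r x) ^+ 2)%:E)
    (fun s => (ker nu t s x)%:E * ((r x)%:E * cv f g (s, x)))
    (fun s => (before t s)%:E * (cv f g (s, x) * cv f g (s, x))).
  apply: (le_trans (CS _ _ _ _ _ _ _)); rewrite {CS}.
  - by ms.
  - by nn.
  - by ms.
  - by nn.
  - by ms.
  - by nn.
  - move=> s; rewrite {1}ker_before EFinM.
    rewrite muleACA [X in _ * X <= _]muleACA -!EFinM [leLHS]muleA -EFinM [leRHS]muleA -EFinM.
    rewrite [X in X%:E * _ <= _](_ : _ = (ker nu t s x * r x) ^+ 2 * before t s)%R//.
    by move: (ker _ _ _ _) (before _ _) (r x) => a b e; ring.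
  - apply: lee_pmul; [by nn|by nn| |by []].
    under eq_integral => s _.
      rewrite (_ : (ker nu t s x * r x) ^+ 2 = r x ^+ 2 *
        (if s <= t :> R then expR (- (2 * nu * r x ^+ 2) * (t - s)) else 0))%R; last first.
        rewrite /ker; case: ifP => _; last by rewrite mulr0 mul0r expr0n.
        rewrite exprMn mulrC -expRM_natl; congr (_ * expR _)%R.
        by move: (r x) => rx; ring.
      rewrite EFinM.
      over.
    rewrite ge0_integralZlT; last 3 first.
    + by ms.
    + by move=> s; rewrite lee_fin; case: ifP => // _; exact: expR_ge0.
    + by nn.
    have [rx|rx] := eqVneq (r x) 0%R; first by rewrite rx expr0n mul0e lee_fin.
    have rxp : (0 < r x)%R by rewrite lt_def rx r0.
    rewrite integral_exp_before; last by rewrite !mulr_gt0// exprn_gt0.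
    rewrite -EFinM lee_fin le_eqVlt; apply/orP; left; apply/eqP.
    by field; rewrite rx gt_eqF.
rewrite ge0_integralZlT; [|by ms|by nn|by nn].
apply: lee_pmul; [by nn|by nn|by []|].
rewrite (tonelli mu lam (F := fun x s => (before t s)%:E * (cv f g (s, x) * cv f g (s, x)))); [|by ms|by nn].
apply: ge0_le_integralT => s; first by nn.
rewrite ge0_integralZlT; [|by ms|by nn|by nn].
apply: lee_pmul; [by nn|by nn|by []|].
exact: mass_cv_sq.
Qed.

(** [L^1] is the midpoint of [X^-1] and [X^1]: Cauchy-Schwarz with [r^-1 * r = 1]. Frequencies with
    [r = 0], where the inverse is 0 by convention, require that [f] vanish there. *)
Lemma mass_sq (f : P -> \bar R) s : nnm f -> (forall p, r p.2 = 0%R -> f p = 0) ->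
  mass f s * mass f s <=
  (\int[mu]_x ((r x)^-1%:E * f (s, x))) * (\int[mu]_x ((r x)%:E * f (s, x))).
Proof.
case=> mf f0 fz; apply: cauchy_schwarz; [by ms|by nn|by ms|by nn|by ms|by nn|].
move=> x; have [rx|rx] := eqVneq (r x) 0%R.
  by rewrite (fz (s, x) rx) !mule0.
by rewrite muleACA -EFinM mulVf// mul1e.
Qed.

(** The basic pair of bounds for the critical space [X^-1]: the supremum in time costs nothing, and
    the heat kernel yields integrability of the [X^1] norm with the factor [nu^-1]. Both have the
    same quadratic right-hand side, which [mass_sq] controls in turn. *)
Lemma mild_XY (nu C : R) (t0 : TT R) (f0 : X -> \bar R) (f h : P -> \bar R) :
  (0 < nu)%R -> (0 <= C)%R -> measurable_fun setT f0 -> (forall x, 0 <= f0 x) -> nnm f -> nnm h ->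
  (forall p, f p <= (ker nu p.1 t0 p.2)%:E * f0 p.2 + C%:E * KK nu h h p) ->
  (forall t, \int[mu]_x ((r x)^-1%:E * f (t, x)) <=
     \int[mu]_x ((r x)^-1%:E * f0 x) + C%:E * \int[lam]_s (mass h s * mass h s)) /\
  (\int[lam]_t \int[mu]_x ((r x)%:E * f (t, x)) <=
     nu^-1%:E * (\int[mu]_x ((r x)^-1%:E * f0 x) + C%:E * \int[lam]_s (mass h s * mass h s))).
Proof.
move=> nu0 C0 mf0 f00 [mf fge] nh fle; have [mK K0] := nnm_KK nu nh nh.
have [mm m0] := nnm_mass nh.
have ri x : (0 <= (r x)^-1)%R by rewrite invr_ge0.
split=> [t|].
  apply: (@le_trans _ _ (\int[mu]_x ((r x)^-1%:E * f0 x + C%:E * ((r x)^-1%:E * KK nu h h (t, x))))).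
    apply: ge0_le_integralT => x; first by nn.
    apply: (@le_trans _ _ ((r x)^-1%:E * ((ker nu t t0 x)%:E * f0 x + C%:E * KK nu h h (t, x)))).
      by apply: lee_pmul; [nn|nn| |exact: fle].
    rewrite ge0_muleDr; [|by nn|by nn]; apply: leeD; last by rewrite muleCA.
    apply: lee_pmul; [by nn|by nn|by []|].
    rewrite -[leRHS]mul1e; apply: lee_pmul; [by nn|by nn| |by []].
    by rewrite lee_fin ker_le1// ltW.
  rewrite ge0_integralD//; last 4 first.
  - by move=> x _; nn.
  - by ms.
  - by move=> x _; nn.
  - by ms.
  apply: leeD; first by [].
  rewrite ge0_integralZlT; [|by ms|by nn|by nn].
  by apply: lee_pmul; [nn|nn|by []|exact: (KK_rinv _ (ltW nu0) nh nh)].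
apply: (@le_trans _ _ (\int[lam]_t (\int[mu]_x ((r x)%:E * ((ker nu t t0 x)%:E * f0 x)) +
   C%:E * \int[mu]_x ((r x)%:E * KK nu h h (t, x))))).
  apply: ge0_le_integralT => t; first by nn.
  rewrite -ge0_integralZlT; [|by ms|by nn|by nn].
  rewrite -ge0_integralD//; last 4 first.
  - by move=> x _; nn.
  - by ms.
  - by move=> x _; nn.
  - by ms.
  apply: ge0_le_integralT => x; first by nn.
  rewrite [X in _ + X]muleCA -ge0_muleDr; [|by nn|by nn].
  by apply: lee_pmul; [nn|nn| |exact: fle].
have mI : measurable_fun setT (fun t => \int[mu]_x ((r x)%:E * KK nu h h (t, x))).
  by apply: (measurable_tonelli mu (F := fun t x => (r x)%:E * KK nu h h (t, x))); [ms|nn].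
rewrite ge0_integralD//; last 4 first.
- by move=> t _; nn.
- by apply: (measurable_tonelli mu (F := fun t x => (r x)%:E * ((ker nu t t0 x)%:E * f0 x))); [ms|nn].
- by move=> t _; nn.
- by ms.
rewrite ge0_muleDr; [|by nn|by nn]; apply: leeD; first exact: S_time.
rewrite ge0_integralZlT; [|by ms|by nn|by nn].
rewrite muleCA; apply: lee_pmul; [by nn|by nn|by []|].
(* With [l = 0] and [w = r] the condition on the weight reads [r^2 <= nu^-1 * (nu * r^2)]. *)
have := @KK_time nu 0 nu^-1 r h h nu0 (lexx _) _ mr r0 _ nh nh.
under [X in _ -> _ -> X <= _]eq_integral do rewrite mul0r oppr0 expR0 mul1e.
under [X in _ -> _ -> _ <= _ * X]eq_integral do rewrite mul0r oppr0 expR0 mul1e.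
apply; first by rewrite invr_ge0 ltW.
by move=> x; rewrite add0r mulKf ?gt_eqF// expr2.
Qed.

(** * Exponentially weighted mass and the [L^2] bound for linear Duhamel inequalities *)

Definition wmass (l : R) (f : P -> \bar R) := \int[lam]_t ((expR (- (l * t)))%:E * mass f t).

Lemma wmass_ge0 l f : nnm f -> 0 <= wmass l f.
Proof. by move=> nf; have [mm m0] := nnm_mass nf; rewrite /wmass; nn. Qed.

Lemma wmass_nneseries l (D : nat -> P -> \bar R) : (forall n, nnm (D n)) ->
  wmass l (fun p => \sum_(0 <= n <oo) D n p) = \sum_(0 <= n <oo) wmass l (D n).
Proof.
move=> nD; rewrite /wmass.
transitivity (\int[lam]_t \sum_(0 <= n <oo) ((expR (- (l * t)))%:E * mass (D n) t)).
  apply: eq_integral => t _; rewrite nneseriesZl; last by move=> n _; exact: (nnm_mass (nD n)).2.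
  congr (_ * _); rewrite /mass integral_nneseries//.
  - by move=> n; exact: (nnm_sec t (nD n)).1.
  - by move=> n x _; exact: (nD n).2.
apply: integral_nneseries => //.
- by move=> n; have [mm m0] := nnm_mass (nD n); ms.
- by move=> n t _; have [mm m0] := nnm_mass (nD n); nn.
Qed.

(** The weighted mass of the sum is finite by Tonelli, and a nonnegative function with finite
    integral is finite almost everywhere. Positivity of the exponential removes the weight. *)
Lemma summable_ae l (D : nat -> P -> \bar R) : (forall n, nnm (D n)) ->
  \sum_(0 <= n <oo) wmass l (D n) < +oo ->
  {ae lam, forall t, {ae mu, forall x, \sum_(0 <= n <oo) D n (t, x) < +oo}}.
Proof.
move=> nD; rewrite -wmass_nneseries// => fin.
have nS := nnm_nneseries nD; have [mm m0] := nnm_mass nS.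
have [] := @nnm_finite_ae _ _ _ lam _ _ fin; first by split; [ms|nn].
move=> N [mN N0 sN]; exists N; split=> // t /= H; apply: sN => /= wt; apply: H.
apply: (nnm_finite_ae (nnm_sec t nS)).
rewrite ltNge leye_eq; apply/negP => /eqP mt; move: wt.
by rewrite /mass mt gt0_muley ?ltxx// lte_fin expR_gt0.
Qed.

(* On the time-weighted space, [KK _ g] is a contraction for large weight [l]:
   [r <= c (l + nu r^2)] with [c] as small as wanted. *)
Lemma KK_contraction (nu C A : R) : (0 < nu)%R -> (0 <= C)%R -> (0 <= A)%R ->
  exists l : R, (0 < l)%R /\ forall D g, nnm D -> nnm g ->
    {ae lam, forall s, mass g s <= A%:E} ->
    wmass l (fun p => C%:E * KK nu D g p) <= 2^-1%:E * wmass l D.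
Proof.
(* Chosen so that [C * c * A <= 1/2], the contraction factor. *)
move=> nu0 C0 A0; pose c := ((2 * (C * A + 1))^-1)%R.
have CA0 : (0 <= C * A)%R by rewrite mulr_ge0.
have c0 : (0 < c)%R by rewrite invr_gt0; lra.
(* The value for which [c * (l + nu * r^2) - r] is the perfect square
   [c * nu * (r - 1 / (2 c nu))^2]. *)
pose l := ((4 * c * c * nu)^-1)%R.
have l0 : (0 < l)%R by rewrite invr_gt0 !mulr_gt0.
exists l; split=> // D g nD ng gA.
have [mK K0] := nnm_KK nu nD ng; have [mmK mK0] := nnm_mass (nnm_KK nu nD ng).
have [mm m0] := nnm_mass nD; have [mmg mg0] := nnm_mass ng.
have -> : wmass l (fun p => C%:E * KK nu D g p) = C%:E * wmass l (KK nu D g).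
  rewrite /wmass -[RHS]ge0_integralZlT; [|by ms|by nn|by nn].
  apply: eq_integral => t _; rewrite muleCA; congr (_ * _).
  by rewrite /mass ge0_integralZlT; [|by ms|by nn|by nn].
have := @KK_time nu l c (fun _ => 1%R) D g nu0 (ltW l0) (ltW c0) _ _ _ nD ng.
under [X in _ -> _ -> _ -> X <= _]eq_integral => t _.
  under [X in _ * X]eq_integral do rewrite mul1e.
  over.
move=> H; have {}H : wmass l (KK nu D g) <=
    c%:E * \int[lam]_s ((expR (- (l * s)))%:E * (mass D s * mass g s)).
  apply: H; [by ms|by []|move=> x; rewrite mul1r].
  have : (0 <= c * nu * (r x - (2 * c * nu)^-1) ^+ 2)%R by rewrite mulr_ge0 ?sqr_ge0 ?mulr_ge0 ?ltW.
  have -> : (c * nu * (r x - (2 * c * nu)^-1) ^+ 2 = c * (l + nu * r x ^+ 2) - r x)%R.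
    by rewrite /l; move: (r x) => rx; field; rewrite !gt_eqF.
  by rewrite subr_ge0.
apply: (@le_trans _ _ (C%:E * (c%:E * (A%:E * wmass l D)))).
  apply: lee_pmul; [by nn|exact: wmass_ge0|by []|].
  apply: (le_trans H); apply: lee_pmul; [by nn|by nn|by []|].
  rewrite /wmass -ge0_integralZlT; [|by ms|by nn|by nn].
  apply: ae_ge0_le_integral; [exact: measurableT|by move=> s _; nn|by ms|by move=> s _; nn|by ms|].
  apply: (filterS _ gA) => s gs _.
  rewrite muleA [leRHS]muleCA; rewrite -[leLHS]muleA; apply: lee_pmul; [by nn|by nn|by []|].
  by rewrite muleC; apply: lee_pmul; [nn|nn|exact: gs|].
rewrite !muleA -!EFinM; apply: lee_pmul; [by nn; exact: ltW|exact: wmass_ge0| |by []].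
rewrite lee_fin /c.
by move: CA0; rewrite mulrAC; move: (C * A)%R => z z0; rewrite ler_pdivrMr; lra.
Qed.

Lemma wmass_iter_KK (nu C : R) l (g f : P -> \bar R) (D : nat -> P -> \bar R) :
  nnm f -> D 0%N = f -> (forall n, nnm (D n)) ->
  (forall n, wmass l (D n.+1) <= 2^-1%:E * wmass l (D n)) -> wmass l f < +oo ->
  \sum_(0 <= n <oo) wmass l (D n) < +oo.
Proof.
move=> nf D0 nD Dn fin; have f0 := wmass_ge0 l nf.
have ff : wmass l f \is a fin_num by rewrite ge0_fin_numE.
apply: (@geometric_bound _ _ (fine (wmass l f))) => n; first exact: wmass_ge0.
elim: n => [|n IH]; first by rewrite D0 expr0 divr1 fineK.
apply: le_trans (Dn n) _; apply: (@le_trans _ _ (2^-1%:E * (fine (wmass l f) / 2 ^+ n)%:E)).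
  by apply: lee_pmul; [nn|exact: wmass_ge0| |].
by rewrite -EFinM lee_fin exprS invfM mulrCA.
Qed.

(** The constant 4 is reproduced: squaring a sum costs a factor 2, so the datum contributes
    [2 * E0]. The integral term is bounded by [2 * (2 C^2 A^2 / (nu k)) * E0] times the exponential,
    again at most [2 * E0] for [k] as large as assumed. *)
Lemma mild_L2_step (nu C A k E0 : R) (t0 : TT R) (f0 : X -> \bar R) (f F g : P -> \bar R) :
  (0 < nu)%R -> (0 <= C)%R -> (0 <= A)%R -> (0 < k)%R -> (2 * C ^+ 2 * A ^+ 2 / nu <= k)%R ->
  measurable_fun setT f0 -> (forall x, 0 <= f0 x) -> nnm f -> nnm F -> nnm g ->
  {ae lam, forall s, mass g s <= A%:E} ->
  \int[mu]_x (f0 x * f0 x) <= E0%:E ->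
  (forall p, f p <= (ker nu p.1 t0 p.2)%:E * f0 p.2 + C%:E * KK nu F g p) ->
  {ae lam, forall s, mass (fun p => F p * F p) s <= (4 * E0 * expR (k * (s - t0)))%:E} ->
  forall t, mass (fun p => f p * f p) t <= (4 * E0 * expR (k * (t - t0)))%:E.
Proof.
move=> nu0 C0 A0 k0 kle mf0 f00 nf nF ng gA f0E fle FE t.
have [mK K0] := nnm_KK nu nF ng; have [mf fge0] := nf.
have nF2 : nnm (fun p => F p * F p) by case: nF => mF F0; split; [ms|nn].
have [mm2 m20] := nnm_mass nF2; have [mmg mg0] := nnm_mass ng.
have E00 : (0 <= E0)%R by rewrite -lee_fin (le_trans _ f0E)//; nn.
have S2 : \int[mu]_x (((ker nu t t0 x)%:E * f0 x) * ((ker nu t t0 x)%:E * f0 x)) <=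
    (E0 * expR (k * (t - t0)))%:E.
  apply: (@le_trans _ _ ((expR (k * (t - t0)))%:E * \int[mu]_x (f0 x * f0 x))).
    rewrite -ge0_integralZlT; [|by ms|by nn|by nn].
    apply: ge0_le_integralT => x; first by nn.
    rewrite muleACA -EFinM; apply: lee_pmul; [by nn|by nn| |by []].
    rewrite lee_fin; have [tt|tt] := leP t0 t; last first.
      have -> : ker nu t t0 x = 0%R by rewrite /ker ifF//; apply/negbTE; rewrite -ltNge.
      by rewrite mul0r; exact: expR_ge0.
    apply: (@le_trans _ _ 1%R).
      by rewrite -[leRHS]mulr1; apply: ler_pM; rewrite ?ker_ge0// ker_le1// ltW.
    by rewrite -expR0 ler_expR mulr_ge0 ?(ltW k0)// subr_ge0.
  rewrite [X in _ <= X%:E]mulrC EFinM; apply: lee_pmul; [by nn|by nn|by []|exact: f0E].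
have K2 : \int[mu]_x (KK nu F g (t, x) * KK nu F g (t, x)) <=
    ((2 * nu)^-1 * (A ^+ 2 * (4 * E0)) / k * expR (k * (t - t0)))%:E.
  apply: le_trans (KK_sq t nu0 nF ng) _.
  rewrite -!mulrA EFinM; apply: lee_pmul; [by nn|by nn|by []|].
  apply: (@le_trans _ _ (\int[lam]_s ((A ^+ 2 * (4 * E0) * expR (k * (t - t0)))%:E *
     ((if s <= t :> R then expR (- k * (t - s)) else 0)%R)%:E))).
    apply: ae_ge0_le_integral; [exact: measurableT|by move=> s _; nn|by ms| |by ms|].
    - move=> s _; apply: mule_ge0; first by nn.
      by rewrite lee_fin; case: ifP => // _; exact: expR_ge0.
    apply: (filterS2 _ _ gA FE) => s gs Fs _.
    rewrite /before; case: ifP => _; last by rewrite mul0e mule0.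
    rewrite mul1e -EFinM.
    have -> : (A ^+ 2 * (4 * E0) * expR (k * (t - t0)) * expR (- k * (t - s)) =
       A * A * (4 * E0 * expR (k * (s - t0))))%R.
      rewrite -[LHS]mulrA -expRD (_ : k * (t - t0) + _ = k * (s - t0))%R; last by ring.
      by move: (expR _) => z; ring.
    rewrite !EFinM; apply: lee_pmul; [by nn|by nn| |by rewrite -!EFinM].
    by apply: lee_pmul; [nn|nn| |].
  rewrite ge0_integralZlT; last 3 first.
  - by ms.
  - by move=> s; rewrite lee_fin; case: ifP => // _; exact: expR_ge0.
  - by nn.
  rewrite integral_exp_before// -EFinM lee_fin.
  by move: (expR _) => e; rewrite le_eqVlt; apply/orP; left; apply/eqP; field; rewrite gt_eqF.
apply: (@le_trans _ _ (\int[mu]_x (2%:E * (((ker nu t t0 x)%:E * f0 x) * ((ker nu t t0 x)%:E * f0 x)) +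
    2%:E * ((C ^+ 2)%:E * (KK nu F g (t, x) * KK nu F g (t, x)))))).
  apply: ge0_le_integralT => x; first by nn.
  apply: (@le_trans _ _ (((ker nu t t0 x)%:E * f0 x + C%:E * KK nu F g (t, x)) *
     ((ker nu t t0 x)%:E * f0 x + C%:E * KK nu F g (t, x)))).
    by apply: lee_pmul; [nn|nn|exact: fle|exact: fle].
  apply: le_trans (sqrDe_le _ _) _; [by nn|by nn|].
  by rewrite [X in _ + 2%:E * X <= _]muleACA -EFinM -expr2.
rewrite ge0_integralD//; last 4 first.
- by move=> x _; nn.
- by ms.
- by move=> x _; nn.
- by ms.
rewrite ge0_integralZlT; [|by ms|by nn|by nn].
rewrite ge0_integralZlT; [|by ms|by nn|by nn].
rewrite ge0_integralZlT; [|by ms|by nn|by nn].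
apply: (@le_trans _ _ (2%:E * (E0 * expR (k * (t - t0)))%:E + 2%:E * ((C ^+ 2)%:E *
  ((2 * nu)^-1 * (A ^+ 2 * (4 * E0)) / k * expR (k * (t - t0)))%:E))).
  apply: leeD; first by apply: lee_pmul; [nn|nn|by []|exact: S2].
  apply: lee_pmul; [by nn|by nn|by []|].
  by apply: lee_pmul; [nn|nn|by []|exact: K2].
rewrite -!EFinM -EFinD lee_fin; have := expR_ge0 (k * (t - t0)).
move: (expR _) => e e0.
have -> : (2 * (E0 * e) + 2 * (C ^+ 2 * ((2 * nu)^-1 * (A ^+ 2 * (4 * E0)) / k * e)) =
  2 * E0 * e + 2 * (2 * C ^+ 2 * A ^+ 2 / nu / k) * E0 * e)%R.
  by field; rewrite !gt_eqF.
have : (2 * C ^+ 2 * A ^+ 2 / nu / k <= 1)%R by rewrite ler_pdivrMr// mul1r.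
move: (_ / k)%R => q q1; have : (0 <= E0 * e)%R by rewrite mulr_ge0.
nra.
Qed.
(** The [L^2] norm of [f] is not known to be finite, so it cannot be bounded by Gronwall. The
    inequality is iterated instead: [F n] collects what comes from the datum and keeps a uniform
    [L^2] bound, [D n] is the remainder carried by [f] and has summable weighted mass. Fatou's lemma
    transfers the bound from [F n] to [f]. *)
Lemma mild_L2 (nu C A E0 : R) : (0 < nu)%R -> (0 <= C)%R -> (0 <= A)%R ->
  exists k : R, (0 < k)%R /\
  forall (t0 : TT R) (f0 : X -> \bar R) (f g : P -> \bar R),
  measurable_fun setT f0 -> (forall x, 0 <= f0 x) -> nnm f -> nnm g ->
  (forall p, f p < +oo) -> (forall l, (0 < l)%R -> wmass l f < +oo) ->
  {ae lam, forall s, mass g s <= A%:E} ->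
  \int[mu]_x (f0 x * f0 x) <= E0%:E ->
  (forall p, f p <= (ker nu p.1 t0 p.2)%:E * f0 p.2 + C%:E * KK nu f g p) ->
  forall t, mass (fun p => f p * f p) t <= (4 * E0 * expR (k * (t - t0)))%:E.
Proof.
move=> nu0 C0 A0; pose k := (2 * C ^+ 2 * A ^+ 2 / nu + 1)%R.
have kp : (0 <= 2 * C ^+ 2 * A ^+ 2 / nu)%R.
  by rewrite divr_ge0 ?(ltW nu0)// !mulr_ge0// sqr_ge0.
have k0 : (0 < k)%R by rewrite /k; lra.
have kle : (2 * C ^+ 2 * A ^+ 2 / nu <= k)%R by rewrite /k lerDl.
exists k; split=> // t0 f0 f g mf0 f00 nf ng ffin ff gA f0E fle.
have [l [l0 lD]] := KK_contraction nu0 C0 A0.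
have CK h : nnm h -> nnm (fun p => C%:E * KK nu h g p).
  by move=> nh; have [mK K0] := nnm_KK nu nh ng; split; [ms|nn].
pose D := fix D n := if n is m.+1 then (fun p => C%:E * KK nu (D m) g p) else f.
have nD n : nnm (D n) by elim: n => [//|n IH] /=; exact: CK.
pose F := fix F n := if n is m.+1 then
  (fun p => (ker nu p.1 t0 p.2)%:E * f0 p.2 + C%:E * KK nu (F m) g p) else (fun=> 0).
have nS : nnm (fun p : P => (ker nu p.1 t0 p.2)%:E * f0 p.2) by split; [ms|nn].
have nF n : nnm (F n).
  elim: n => [|n IH] /=; first by split => //; exact: measurable_cst.
  by have [m1 p1] := CK _ IH; case: nS => m2 p2; split; [apply: emeasurable_funD|move=> p; apply: adde_ge0].
(* The inequality for [f] is substituted into itself, [KK] being additive in its first argument. *)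
have f_le n p : f p <= F n p + D n p.
  elim: n p => [|n IH] p /=; first by rewrite add0e.
  apply: (le_trans (fle p)); rewrite -addeA; apply: leeD; first by [].
  have [_ a1] := nnm_KK nu (nF n) ng; have [_ a2] := nnm_KK nu (nD n) ng.
  rewrite -ge0_muleDr//.
  apply: lee_pmul; [by nn|exact: (nnm_KK nu nf ng).2|by []|].
  rewrite -KKDl//; apply: le_KK => // q; [exact: nf.2|exact: ng.2].
have F2 n : forall t, mass (fun p => F n p * F n p) t <= (4 * E0 * expR (k * (t - t0)))%:E.
  have E00 : (0 <= E0)%R by rewrite -lee_fin (le_trans _ f0E)//; nn.
  elim: n => [|n IH] t /=.
    by rewrite /mass; under eq_integral do rewrite mul0e; rewrite integral0; nn.
  apply: (mild_L2_step (F := F n) nu0 C0 A0 k0 kle mf0 f00 (nF n.+1) (nF n) ng gA f0E) => //.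
  exact: aeW.
have Fmono n p : F n p <= F n.+1 p.
  elim: n p => [|n IH] p; first exact: (nF 1%N).2.
  apply: leeD => //; apply: lee_pmul; [by nn|exact: (nnm_KK nu (nF n) ng).2|by []|].
  by apply: le_KK => //; [exact: (nF n).2|exact: ng.2].
have Fmon p : {homo (F ^~ p) : n m / (n <= m)%N >-> n <= m}.
  by apply: homo_leq => //; exact: le_trans.
have sumD := wmass_iter_KK C l g nf erefl nD (fun n => lD _ _ (nD n) ng gA) (ff l l0).
have fae := summable_ae nD sumD.
have f2 : {ae lam, forall t, mass (fun p => f p * f p) t <= (4 * E0 * expR (k * (t - t0)))%:E}.
  apply: (filterS _ fae) => t ft.
  apply: (@le_trans _ _ (\int[mu]_x limn_einf (fun n => F n (t, x) * F n (t, x)))); last first.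
    apply: le_trans (fatou _ _ _ _) _ => //.
    - by move=> n; have [m1 p1] := nF n; ms.
    - by move=> n x _; have [m1 p1] := nF n; nn.
    - by apply: limn_einf_le => n; exact: F2.
  have mlim : measurable_fun setT (fun x => limn_einf (fun n => F n (t, x) * F n (t, x))).
    by apply: measurable_limn_einf => n; have [m1 p1] := nF n; ms.
  apply: ae_ge0_le_integral; [exact: measurableT|by have [m1 p1] := nf; move=> x _; nn|
    by have [m1 p1] := nf; ms| |exact: mlim|].
    by move=> x _; apply: (@le_limn_einf _ _ _ 0) => n _; have [m1 p1] := nF n; nn.
  apply: (filterS _ ft) => x fx _.
  have := ffin (t, x); have := nf.2 (t, x); have := f_le ^~ (t, x).
  case: (f (t, x)) => [a| |]//; move=> fFD; rewrite lee_fin => a0 _.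
  rewrite -EFinM; apply: sqe_le => //; last first.
    by apply: (@le_limn_einf _ _ _ 0) => n _; have [m1 p1] := nF n; nn.
  move=> b b0 ba; have ab0 : (0 < a - b)%R by rewrite subr_gt0.
  (* Where the series of the [D n] converges, its terms fall below [f - b], so [F n] eventually
     exceeds any [b < f]. *)
  have [N HN] := nneseries_small (fun n => (nD n).2 (t, x)) fx ab0.
  apply: (@le_limn_einf _ _ _ N) => n Nn.
  have bF : b%:E <= F n (t, x).
    have := fFD n; have := HN n Nn; have := (nD n).2 (t, x); have := (nF n).2 (t, x).
    case: (F n (t, x)) => [u| |]//; rewrite ?leey//.
    by case: (D n (t, x)) => [v| |]//; rewrite -?EFinD !lee_fin; lra.
  by rewrite EFinM; apply: lee_pmul; nn.
(* One more step with [F := f] upgrades the bound from almost every time to every time. *)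
exact: (mild_L2_step (F := f) nu0 C0 A0 k0 kle mf0 f00 nf nf ng gA f0E fle f2).
Qed.

(* Bootstrap by time steps of fixed length: while the dissipation stays below
   [1/(2C)], the smallness of the data forces it below [1/(4C)]. *)
Lemma mild_small (nu C e B : R) (t0 : TT R) (f0 : X -> \bar R) (f : P -> \bar R) :
  (0 < nu)%R -> (0 < C)%R -> (0 <= e)%R -> (8 * C * e <= nu)%R -> (0 < B)%R ->
  measurable_fun setT f0 -> (forall x, 0 <= f0 x) -> nnm f ->
  (forall p, r p.2 = 0%R -> f p = 0) -> (forall p, p.1 < t0 :> R -> f p = 0)%R ->
  (forall s, \int[mu]_x ((r x)^-1%:E * f (s, x)) <= B%:E) ->
  (forall s, \int[mu]_x ((r x)%:E * f (s, x)) <= B%:E) ->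
  \int[mu]_x ((r x)^-1%:E * f0 x) <= e%:E ->
  (forall p, f p <= (ker nu p.1 t0 p.2)%:E * f0 p.2 + C%:E * KK nu f f p) ->
  forall t, \int[mu]_x ((r x)^-1%:E * f (t, x)) <= (2 * e)%:E.
Proof.
move=> nu0 C0 e0 Ce B0 mf0 f00 nf fz ft0 fB1 fB2 f0e fle.
have [mf fge0] := nf.
pose cut (T : R) (p : P) := (before T p.1)%:E * f p.
have ncut T : nnm (cut T) by rewrite /cut; split; [ms|nn].
have cutle T p : cut T p <= f p.
  rewrite /cut -[leRHS]mul1e; apply: lee_pmul; [by nn|by nn| |by []].
  by rewrite lee_fin /before; case: ifP.
have cuteq T p : (p.1 <= T :> R)%R -> cut T p = f p.
  by rewrite /cut /before => ->; rewrite mul1e.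
have cutne T p : ~~ (p.1 <= T :> R)%R -> cut T p = 0.
  by rewrite /cut /before => /negbTE ->; rewrite mul0e.
(* Duhamel's integral at time [p.1] sees only earlier times, so truncation at [T] preserves the
   inequality. *)
have cutfle T p : cut T p <= (ker nu p.1 t0 p.2)%:E * f0 p.2 + C%:E * KK nu (cut T) (cut T) p.
  have [pT|pT] := boolP (p.1 <= T :> R)%R; last first.
    rewrite cutne//; have [_ K0] := nnm_KK nu (ncut T) (ncut T); by nn.
  rewrite cuteq//; suff -> : KK nu (cut T) (cut T) p = KK nu f f p by exact: fle.
  apply: eq_integral => s _; rewrite /ker; case: ifP => sp; last by rewrite !mul0e.
  congr (_ * (_ * _)); apply: eq_integral => y _ /=.
  by rewrite !cuteq//=; exact: le_trans sp pT.
pose Y T := \int[lam]_s \int[mu]_x ((r x)%:E * cut T (s, x)).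
pose XX T := ereal_sup (range (fun s => \int[mu]_x ((r x)^-1%:E * cut T (s, x)))).
have Y0 T : 0 <= Y T by have [m1 p1] := ncut T; rewrite /Y; nn.
have le_XX T s : \int[mu]_x ((r x)^-1%:E * cut T (s, x)) <= XX T.
  by apply: ereal_sup_ubound; exists s.
have X0 T : 0 <= XX T.
  by apply: le_trans (le_XX T 0%R); have [m1 p1] := ncut T; nn.
have XB T : XX T <= B%:E.
  apply: ge_ereal_sup => _ [s _ <-]; apply: le_trans (fB1 s); apply: ge0_le_integralT => x.
    by have [m1 p1] := ncut T; nn.
  by apply: lee_pmul; [nn|exact: (ncut T).2|by []|].
have Q T : \int[lam]_s (mass (cut T) s * mass (cut T) s) <= XX T * Y T.
  have [m1 p1] := ncut T; have [m2 p2] := nnm_mass (ncut T).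
  rewrite /Y -ge0_integralZlT; [|by ms|by nn|by []].
  apply: ge0_le_integralT => s; first by nn.
  apply: le_trans (mass_sq s (ncut T) _) _; first by move=> p rp; rewrite /cut fz// mule0.
  by apply: lee_pmul; [nn|nn|exact: le_XX|by []].
have main T : Y T <= ((2 * C)^-1)%:E -> XX T <= (2 * e)%:E /\ Y T <= ((4 * C)^-1)%:E.
  move=> YC; have [H1 H2] := mild_XY (t0 := t0) nu0 (ltW C0) mf0 f00 (ncut T) (ncut T) (cutfle T).
  have hx : XX T <= e%:E + C%:E * (XX T * Y T).
    apply: ge_ereal_sup => _ [s _ <-]; apply: le_trans (H1 s) _.
    apply: leeD; first exact: f0e.
    have [m2 p2] := nnm_mass (ncut T).
    by apply: lee_pmul; [nn|nn|by []|exact: Q].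
  have hy : Y T <= nu^-1%:E * (e%:E + C%:E * (XX T * Y T)).
    apply: le_trans H2 _; have [m2 p2] := nnm_mass (ncut T).
    apply: lee_pmul; [by nn|by nn|by []|].
    apply: leeD; first exact: f0e.
    by apply: lee_pmul; [nn|nn|by []|exact: Q].
  move: YC hx hy (Y0 T) (X0 T) (XB T).
  case: (Y T) => [y| |]//; case: (XX T) => [x| |]//.
  rewrite !lee_fin => yC hx hy y0 x0 _.
  exact: bootstrap_arith Ce x0 y0 yC hx hy.
(* The [X^1] norm is at most [B], so a step of length [h] adds at most [B * h = 1 / (4 C)] to the
   dissipation. From [1 / (4 C)] it can only reach [1 / (2 C)], where [main] brings it back. *)
pose h := ((4 * C * B)^-1)%R.
have h0 : (0 < h)%R by rewrite invr_gt0 !mulr_gt0.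
have step T : Y (T + h)%R <= Y T + ((4 * C)^-1)%:E.
  have [m1 p1] := ncut T; have [m2 p2] := ncut (T + h)%R.
  have mI : measurable_fun setT (fun s : TT R => \1_(`]T, (T + h)%R]%classic) s : R).
    exact: measurable_indic.
  have I0 s : (0 <= \1_(`]T, (T + h)%R]%classic) s :> R)%R by rewrite indicE.
  have -> : ((4 * C)^-1)%:E = \int[lam]_s (B%:E * (\1_(`]T, (T + h)%R]%classic) s)%:E).
    rewrite ge0_integralZlT; [|by ms|by nn|by nn].
    rewrite integral_indic//= setIT lebesgue_measure_itv/= lte_fin ltrDl h0 -EFinD -EFinM.
    by congr (_%:E); rewrite /h; field; rewrite !gt_eqF.
  rewrite -ge0_integralD//; last 4 first.
  - by move=> s _; nn.
  - by ms.
  - by move=> s _; nn.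
  - by ms.
  apply: ge0_le_integralT => s; first by nn.
  have [sT|sT] := boolP (s <= T :> R)%R.
    apply: (@le_trans _ _ (\int[mu]_x ((r x)%:E * cut T (s, x)))); last first.
      by rewrite leeDl//; nn.
    apply: ge0_le_integralT => x; first by nn.
    by rewrite !cuteq//= (le_trans sT)// lerDl ltW.
  have [sT'|sT'] := boolP (s <= (T + h)%R :> R)%R; last first.
    under eq_integral do rewrite cutne// mule0.
    by rewrite integral0; nn.
  rewrite indicE mem_set ?mule1; last by rewrite /= in_itv/= ltNge sT.
  apply: (@le_trans _ _ B%:E); last by rewrite leeDr//; nn.
  apply: le_trans (fB2 s); apply: ge0_le_integralT => x; first by nn.
  by apply: lee_pmul; [nn|nn|by []|].
(* The induction starts at [t0 - h], before which [f] vanishes. *)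
have Yn n : Y (t0 - h + n%:R * h)%R <= ((4 * C)^-1)%:E.
  elim: n => [|n IH].
    rewrite mul0r addr0 /Y; under eq_integral => s _.
      under eq_integral => x _.
        have -> : cut (t0 - h)%R (s, x) = 0.
          have [st|st] := boolP (s <= (t0 - h)%R :> R)%R; last by rewrite cutne.
          by rewrite /cut ft0 ?mule0//= (le_lt_trans st)// ltrBlDr ltrDl.
        rewrite mule0; over.
      rewrite integral0; over.
    by rewrite integral0 lee_fin invr_ge0 mulr_ge0// ltW.
  apply: (main _ _).2.
  have -> : (t0 - h + n.+1%:R * h = t0 - h + n%:R * h + h)%R by rewrite -natr1 mulrDl mul1r addrA.
  apply: le_trans (step _) _; apply: le_trans (leeD IH (lexx _)) _.
  by rewrite -EFinD lee_fin; rewrite le_eqVlt; apply/orP; left; apply/eqP; field; rewrite gt_eqF.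
move=> t; pose n := (Num.truncn ((t - t0 + h) / h)).+1.
have tn : (t <= t0 - h + n%:R * h)%R.
  have := ltW (truncnS_gt ((t - t0 + h) / h)); rewrite -/n ler_pdivrMr//; lra.
have [H _] : XX (t0 - h + n%:R * h)%R <= (2 * e)%:E /\ Y (t0 - h + n%:R * h)%R <= ((4 * C)^-1)%:E.
  apply: main; apply: le_trans (Yn n) _; rewrite lee_fin lef_pV2 ?posrE ?mulr_gt0// ler_pM2r//.
  by rewrite ler_nat.
apply: le_trans H; apply: le_trans (le_XX _ t).
by apply: ge0_le_integralT => x; [nn|rewrite cuteq].
Qed.

(** * Submultiplicative weights and the Gevrey weight *)

(** The two arguments of a convolution at [x] are [y] and [sub x y], so a submultiplicative weight
    at [x] can be shared between them. *)
Lemma cv_weight (om : R -> X -> R) (f g : P -> \bar R) s x : (forall s x, (0 <= om s x)%R) ->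
  (forall y, om s x <= om s y * om s (sub x y))%R -> measurable_fun setT (om s) -> nnm f -> nnm g ->
  (om s x)%:E * cv f g (s, x) <=
  cv (fun p => (om p.1 p.2)%:E * f p) (fun p => (om p.1 p.2)%:E * g p) (s, x).
Proof.
move=> om0 omM mom [mf f0] [mg g0]; rewrite /cv /= -ge0_integralZlT; [|by ms|by nn|by rewrite lee_fin].
apply: ge0_le_integralT => y; first by rewrite !mule_ge0// lee_fin.
by rewrite muleACA; apply: lee_pmul; rewrite ?lee_fin//; nn.
Qed.

Lemma KK_weight (nu : R) (om : X -> R) (f g : P -> \bar R) p : (forall x, (0 <= om x)%R) ->
  (forall x y, om x <= om y * om (sub x y))%R -> measurable_fun setT om -> nnm f -> nnm g ->
  (om p.2)%:E * KK nu f g p <= KK nu (fun p => (om p.2)%:E * f p) (fun p => (om p.2)%:E * g p) p.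
Proof.
move=> om0 omM mom nf ng; have [mc c0] := nnm_cv nf ng.
rewrite /KK -ge0_integralZlT; [|by ms|by nn|by nn].
apply: ge0_le_integralT => s; first by nn.
rewrite muleCA; apply: lee_pmul; [by nn|by nn|by []|].
rewrite muleCA; apply: lee_pmul; [by nn|by nn|by []|].
by apply: (cv_weight (om := fun _ => om)).
Qed.

(* Gevrey weight [exp(a (t - t1) min(r, rho))]; half of the heat kernel pays for
   its growth, up to the factor [exp(a^2/(2 nu))] over a unit time. *)
Definition gev (a rho : R) (t1 : R) (t : R) (x : X) : R := expR (a * (t - t1) * Num.min (r x) rho)%R.

(** The truncated modulus [min(r, rho)] is still subadditive, so the weight at time [s] distributes
    over the convolution. The change of weight from [s] to the later time is absorbed by half of the
    heat kernel, leaving the viscosity [nu / 2] and the factor [c]; this needs elapsed times at most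
    1, hence the support condition on [f]. *)
Lemma mild_gevrey (nu C a rho : R) (t1 : R) (f0 : X -> \bar R) (f : P -> \bar R) :
  (forall x y, r x <= r y + r (sub x y))%R ->
  (0 < nu)%R -> (0 < a)%R -> (0 <= rho)%R -> (0 <= C)%R ->
  measurable_fun setT f0 -> (forall x, 0 <= f0 x) -> nnm f ->
  (forall p, ~~ (t1 <= p.1 :> R)%R || ~~ (p.1 <= t1 + 1 :> R)%R -> f p = 0) ->
  (forall p, f p <= (ker nu p.1 t1 p.2)%:E * f0 p.2 + C%:E * KK nu f f p) ->
  let c := expR (a ^+ 2 / (2 * nu)) in
  let h := fun p => (gev a rho t1 p.1 p.2)%:E * f p in
  forall p, h p <= (ker (nu / 2) p.1 t1 p.2)%:E * (c%:E * f0 p.2) + (c * C)%:E * KK (nu / 2) h h p.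
Proof.
move=> rD nu0 a0 rho0 C0 mf0 f00 nf ft fle c h p.
have [mf fp] := nf; have gp t x : (0 <= gev a rho t1 t x)%R by exact: expR_ge0.
have mgev d' (T : measurableType d') (u : T -> TT R) (v : T -> X) : measurable_fun setT u ->
    measurable_fun setT v -> measurable_fun setT (fun z => gev a rho t1 (u z) (v z)).
  by move=> mu' mv; rewrite /gev; ms; apply: measurable_minr; ms.
have nh : nnm h by split; [rewrite /h; apply: emeasurable_funM => //; apply: mEFin; apply: mgev; ms|move=> q; rewrite /h mule_ge0// lee_fin].
have [_ K0] := nnm_KK (nu / 2) nh nh; have [mc c0] := nnm_cv nf nf; have [mch ch0] := nnm_cv nh nh.
have cp : (0 <= c)%R by exact: expR_ge0.
have rhs0 : 0 <= (ker (nu / 2) p.1 t1 p.2)%:E * (c%:E * f0 p.2) + (c * C)%:E * KK (nu / 2) h h p.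
  by nn.
have [tp|tp] := boolP (t1 <= p.1 :> R)%R; last by rewrite /h ft ?tp// mule0.
have [tp'|tp'] := boolP (p.1 <= t1 + 1 :> R)%R; last by rewrite /h ft ?tp' ?orbT// mule0.
have kg s : (t1 <= s)%R -> (gev a rho t1 p.1 p.2 * ker nu p.1 s p.2 <=
    c * (gev a rho t1 s p.2 * ker (nu / 2) p.1 s p.2))%R.
  move=> ts; rewrite /ker; case: ifP => sp; last by rewrite !mulr0.
  rewrite /gev /c -!expRD ler_expR.
  have m0 : (0 <= Num.min (r p.2) rho)%R by rewrite le_min r0.
  have mr' : (Num.min (r p.2) rho <= r p.2)%R by rewrite ge_min lexx.
  have d0 : (0 <= p.1 - s :> R)%R by rewrite subr_ge0.
  have d1 : (p.1 - s <= 1 :> R)%R by move: tp' ts; lra.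
  by apply: gevrey_arith2 => //; rewrite addrA subrK.
apply: (@le_trans _ _ ((gev a rho t1 p.1 p.2)%:E * ((ker nu p.1 t1 p.2)%:E * f0 p.2 + C%:E * KK nu f f p))).
  by apply: lee_pmul; [nn|nn|by []|exact: fle].
have [_ Kf0] := nnm_KK nu nf nf.
rewrite ge0_muleDr; [|by nn|by nn]; apply: leeD.
  rewrite muleA muleA -!EFinM; apply: lee_pmul; [by nn|by nn| |by []].
  rewrite lee_fin [leRHS]mulrC; apply: (le_trans (kg t1 (lexx _))).
  by rewrite {1}/gev subrr mulr0 mul0r expR0 mul1r.
rewrite EFinM -muleA [leLHS]muleCA [leRHS]muleCA; apply: lee_pmul; [by nn|by nn|by []|].
rewrite /KK -!ge0_integralZlT; [|by ms|by nn|by nn|by ms|by nn|by nn].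
apply: ge0_le_integralT => s; first by nn.
have [ts|ts] := boolP (t1 <= s :> R)%R; last first.
  rewrite [X in _ * (_ * (_ * X))](_ : _ = 0) ?mule0; first by nn.
  rewrite /cv /=; under eq_integral do rewrite ft ?ts// mul0e.
  by rewrite integral0.
have cvw : (gev a rho t1 s p.2)%:E * cv f f (s, p.2) <= cv h h (s, p.2).
  apply: (cv_weight (om := gev a rho t1)) => //; last first.
    by have := @mgev _ X (fun=> s) id; apply; ms.
  move=> y; rewrite /gev -expRD ler_expR -mulrDr; apply: ler_wpM2l.
    by rewrite mulr_ge0 ?(ltW a0)// subr_ge0.
  have := rD p.2 y; have := r0 y; have := r0 (sub p.2 y); move: (r _) (r _) (r _) => u v w u0 v0 uvw.
  by rewrite /Num.min; case: ifP; case: ifP; case: ifP => *; lra.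
apply: (@le_trans _ _ ((c * (gev a rho t1 s p.2 * ker (nu / 2) p.1 s p.2))%:E * ((r p.2)%:E * cv f f (s, p.2)))).
  rewrite muleA -EFinM; apply: lee_pmul; [by nn|by nn| |by []].
  by rewrite lee_fin; exact: kg.
rewrite EFinM -!muleA; apply: lee_pmul; [by nn|by nn|by []|].
rewrite [X in X%:E * _]mulrC EFinM -muleA; apply: lee_pmul; [by nn|by nn|by []|].
rewrite muleCA; apply: lee_pmul; [by nn|by nn|by []|exact: cvw].
Qed.
(* [B] is the symbol of [P div (u (x) v)], acting on vectors of real components. *)
Variables (I : finType) (B : X -> I -> (I -> R) -> (I -> R) -> R) (C1 : R).
Hypothesis C10 : (0 <= C1)%R.

Definition n1 (v : I -> R) : R := (\sum_c `|v c|)%R.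

Hypothesis Bbound : forall x c u v, (`|B x c u v| <= C1 * r x * (n1 u * n1 v))%R.
Hypothesis Bl : forall x c u u' v, (B x c (fun i => u i - u' i) v = B x c u v - B x c u' v)%R.
Hypothesis Br : forall x c u v v', (B x c u (fun i => v i - v' i) = B x c u v - B x c u v')%R.
Hypothesis mB : forall d' (T : measurableType d') (e : T -> X) (u v : T -> I -> R) c,
  measurable_fun setT e -> (forall i, measurable_fun setT (fun t => u t i)) ->
  (forall i, measurable_fun setT (fun t => v t i)) ->
  measurable_fun setT (fun t => B (e t) c (u t) (v t)).

(** * The bilinear term on vector fields *)

Definition mfield (F : P -> I -> R) := forall i, measurable_fun setT (fun p => F p i).
Definition en1 (F : P -> I -> R) (p : P) : \bar R := (n1 (F p))%:E.
Definition fsub (F G : P -> I -> R) (p : P) (i : I) : R := (F p i - G p i)%R.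

Lemma n1_ge0 v : (0 <= n1 v)%R. Proof. by apply: sumr_ge0 => c _. Qed.

Lemma n1_comp v c : (`|v c| <= n1 v)%R.
Proof. by rewrite /n1 (bigD1 c)//= lerDl sumr_ge0. Qed.

Lemma n1_sub u v : (n1 (fun i => u i - v i) <= n1 u + n1 v)%R.
Proof. by rewrite /n1 -big_split/=; apply: ler_sum => c _; exact: ler_normB. Qed.

Lemma n1_le_sub u v : (n1 u <= n1 v + n1 (fun i => u i - v i))%R.
Proof.
rewrite /n1 -big_split/=; apply: ler_sum => c _.
by have := ler_normD (v c) (u c - v c)%R; rewrite [(v c + _)%R]addrC subrK.
Qed.

Lemma mn1 d' (T : measurableType d') (u : T -> I -> R) :
  (forall i, measurable_fun setT (fun t => u t i)) -> measurable_fun setT (fun t => n1 (u t)).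
Proof.
move=> mu'; rewrite /n1; apply: measurable_sum => c.
by apply: (measurableT_comp (@normr_measurable R setT)).
Qed.

Lemma nnm_en1 F : mfield F -> nnm (en1 F).
Proof.
move=> mF; split; last by move=> p; rewrite lee_fin n1_ge0.
by apply: mEFin; exact: mn1.
Qed.

Lemma mfield_sub F G : mfield F -> mfield G -> mfield (fsub F G).
Proof. by move=> mF mG i; apply: measurable_funB. Qed.

Definition NLi (F G : P -> I -> R) (p : P) (c : I) (y : X) : R := B p.2 c (F (p.1, y)) (G (p.1, sub p.2 y)).
Definition NL (F G : P -> I -> R) (p : P) (c : I) : R := Rintegral mu setT (NLi F G p c).

Lemma mNLi F G p c : mfield F -> mfield G -> measurable_fun setT (NLi F G p c).
Proof.
move=> mF mG; rewrite /NLi; apply: mB; first by ms.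
- by move=> i; have := mF i => mFi; apply: (measurableT_comp mFi (g := fun y => (p.1, y))); ms.
- by move=> i; have := mG i => mGi; apply: (measurableT_comp mGi (g := fun y => (p.1, sub p.2 y))); ms.
Qed.

Lemma NLi_bound F G p c : mfield F -> mfield G ->
  \int[mu]_y `|(NLi F G p c y)%:E| <= (C1 * r p.2)%:E * cv (en1 F) (en1 G) p.
Proof.
move=> mF mG; have [mf f0] := nnm_en1 mF; have [mg g0] := nnm_en1 mG.
rewrite /cv -ge0_integralZlT; [|by ms|by nn|by nn].
apply: ge0_le_integralT => y; first exact: abse_ge0.
by rewrite lee_fin; exact: Bbound.
Qed.

(** When the extended integral is infinite the left-hand side is 0, the default value of [fine], so
    integrability does not have to be checked first. *)
Lemma le_abse_Rintegral d' (T : measurableType d') (m : {measure set T -> \bar R}) (h : T -> R) :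
  measurable_fun setT h ->
  (`|Rintegral m setT h|)%:E <= \int[m]_y `|(h y)%:E|.
Proof.
move=> mh; have mh' : measurable_fun setT (EFin \o h) by exact/measurable_EFinP.
have := le_abse_integral m measurableT mh'; rewrite /Rintegral.
have := integral_ge0 m (fun y (_ : setT y) => abse_ge0 (h y)%:E).
have -> : \int[m]_x (EFin \o h) x = \int[m]_x (h x)%:E by [].
by case: (\int[m]_x (h x)%:E) => [z| |] //= H _; rewrite normr0.
Qed.

Lemma NL_bound F G p c : mfield F -> mfield G ->
  (`|NL F G p c|)%:E <= (C1 * r p.2)%:E * cv (en1 F) (en1 G) p.
Proof.
move=> mF mG; apply: le_trans (NLi_bound p c mF mG).
exact: (le_abse_Rintegral mu (mNLi p c mF mG)).
Qed.

Lemma measurable_Rintegral d1 d2 (T1 : measurableType d1) (T2 : measurableType d2)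
  (m2 : {sigma_finite_measure set T2 -> \bar R}) (h : T1 -> T2 -> R) :
  measurable_fun setT (fun p : T1 * T2 => h p.1 p.2) ->
  measurable_fun setT (fun x => Rintegral m2 setT (h x)).
Proof.
move=> mh; rewrite /Rintegral; apply: (measurableT_comp (fine_measurable measurableT)).
have -> : (fun x => \int[m2]_y (h x y)%:E) = (fun x =>
    \int[m2]_y ((EFin \o h x)^\+ y) - \int[m2]_y ((EFin \o h x)^\- y)).
  by apply/funext => x; rewrite integralE.
apply: emeasurable_funB.
- apply: (measurable_tonelli m2 (F := fun x y => (EFin \o h x)^\+ y)).
    have : measurable_fun setT (fun p : T1 * T2 => (h p.1 p.2)%:E) by exact: mEFin.
    by move=> H; under eq_fun do rewrite funeposE; apply: measurable_maxe; [exact: H|exact: measurable_cst].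
  by move=> x y; exact: funepos_ge0.
- apply: (measurable_tonelli m2 (F := fun x y => (EFin \o h x)^\- y)).
    have : measurable_fun setT (fun p : T1 * T2 => (h p.1 p.2)%:E) by exact: mEFin.
    by move=> H; under eq_fun do rewrite funenegE; apply: measurable_maxe; [exact: (mEFin (mopp mh))|exact: measurable_cst].
  by move=> x y; exact: funeneg_ge0.
Qed.

Lemma mfield_NL F G : mfield F -> mfield G -> mfield (NL F G).
Proof.
move=> mF mG c; rewrite /NL /NLi.
apply: (measurable_Rintegral mu (h := fun p y => B p.2 c (F (p.1, y)) (G (p.1, sub p.2 y)))).
apply: mB; first by ms.
- move=> i; have mFi := mF i.
  by apply: (measurableT_comp mFi (g := fun q : P * X => (q.1.1, q.2))); ms.
- move=> i; have mGi := mG i.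
  by apply: (measurableT_comp mGi (g := fun q : P * X => (q.1.1, sub q.1.2 q.2))); ms.
Qed.

Lemma NLi_integrable F G p c : mfield F -> mfield G -> cv (en1 F) (en1 G) p < +oo ->
  mu.-integrable setT (EFin \o NLi F G p c).
Proof.
move=> mF mG fin; apply/integrableP; split; first exact/measurable_EFinP/mNLi.
apply: le_lt_trans (NLi_bound p c mF mG) _; by apply: lte_mul_pinfty => //; nn.
Qed.

(** Under the integral, [F G - F' G' = (F - F') G + F' (G - G')]. Each finiteness condition makes
    one of the four integrals convergent, since [Rintegral] is additive on integrable functions
    only. *)
Lemma NL_diff F G F' G' p c : mfield F -> mfield G -> mfield F' -> mfield G' ->
  cv (en1 F) (en1 G) p < +oo -> cv (en1 F') (en1 G') p < +oo ->
  cv (en1 (fsub F F')) (en1 G) p < +oo -> cv (en1 F') (en1 (fsub G G')) p < +oo ->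
  (NL F G p c - NL F' G' p c = NL (fsub F F') G p c + NL F' (fsub G G') p c)%R.
Proof.
move=> mF mG mF' mG' f1 f2 f3 f4; rewrite /NL.
rewrite -RintegralB//; [|exact: NLi_integrable|exact: NLi_integrable].
rewrite -RintegralD//; [|apply: NLi_integrable => //; exact: mfield_sub..].
by apply: eq_Rintegral => y _; rewrite /NLi /fsub Bl Br; ring.
Qed.

Lemma le_cv_en1 F G (f g : P -> \bar R) p : (forall q, en1 F q <= f q) -> (forall q, en1 G q <= g q) ->
  cv (en1 F) (en1 G) p <= cv f g p.
Proof. by move=> Ff Gg; apply: le_cv => // q; rewrite lee_fin n1_ge0. Qed.

Lemma en1_sub F G p : en1 (fsub F G) p <= en1 F p + en1 G p.
Proof. by rewrite /en1 -EFinD lee_fin; exact: n1_sub. Qed.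

(** * Monotone limits and the small scalar majorant *)

Lemma nd_le_lim (a : nat -> \bar R) n : nondecreasing_seq a -> a n <= limn a.
Proof.
move=> na; rewrite (cvg_lim (@ereal_hausdorff R) (ereal_nondecreasing_cvgn na)).
by apply: ereal_sup_ubound; exists n.
Qed.

(** Multiplication is discontinuous at [(0, +oo)], but a nondecreasing nonnegative sequence with
    limit 0 vanishes identically, so the product stays 0 there. *)
Lemma nd_limM (a b : nat -> \bar R) : (forall n, 0 <= a n) -> (forall n, 0 <= b n) ->
  nondecreasing_seq a -> nondecreasing_seq b -> (fun n => a n * b n) @ \oo --> limn a * limn b.
Proof.
move=> a0 b0 na nb.
have ca := ereal_nondecreasing_is_cvgn na; have cb := ereal_nondecreasing_is_cvgn nb.
have la n : a n <= limn a by exact: nd_le_lim.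
have lb n : b n <= limn b by exact: nd_le_lim.
have [A0|A0] := eqVneq (limn a) 0.
  rewrite A0 mul0e (_ : (fun n => _) = cst 0); first exact: cvg_cst.
  apply/funext => n; have -> : a n = 0 by apply/eqP; rewrite eq_le a0 -A0 la.
  by rewrite mul0e.
have [B0|B0] := eqVneq (limn b) 0.
  rewrite B0 mule0 (_ : (fun n => _) = cst 0); first exact: cvg_cst.
  apply/funext => n; have -> : b n = 0 by apply/eqP; rewrite eq_le b0 -B0 lb.
  by rewrite mule0.
have Ap : 0 < limn a by rewrite lt0e A0 (le_trans (a0 0%N) (la 0%N)).
have Bp : 0 < limn b by rewrite lt0e B0 (le_trans (b0 0%N) (lb 0%N)).
apply: cvgeM => //; apply: neq0_mule_def; by rewrite mule_neq0.
Qed.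

(** Monotone convergence twice: in the convolution variable, then in time. *)
Lemma KK_lim nu (m : nat -> P -> \bar R) (M : P -> \bar R) p : (forall n, nnm (m n)) ->
  (forall q, nondecreasing_seq (m ^~ q)) -> (forall q, M q = limn (m ^~ q)) ->
  (fun n => KK nu (m n) (m n) p) @ \oo --> KK nu M M p.
Proof.
move=> nm mm ME.
have E q : cv M M q = limn (fun n => cv (m n) (m n) q).
  rewrite /cv; transitivity (\int[mu]_y limn (fun n => m n (q.1, y) * m n (q.1, sub q.2 y))).
    apply: eq_integral => y _; rewrite !ME; apply/esym/cvg_lim => //.
    by apply: nd_limM => //; [move=> n; exact: (nm n).2..].
  rewrite monotone_convergence//.
  - by move=> n; have [m1 m0] := nm n; ms.
  - by move=> n y _; have [m1 m0] := nm n; nn.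
  - move=> y _ i j ij; have [m1 m0] := nm i; apply: lee_pmul; by [exact: m0|exact: mm].
have cm q : nondecreasing_seq (fun n => cv (m n) (m n) q).
  move=> i j ij; apply: le_cv; [exact: (nm i).2|exact: (nm i).2| |]; by move=> z; exact: mm.
have K : KK nu M M p = \int[lam]_s limn (fun n =>
    (ker nu p.1 s p.2)%:E * ((r p.2)%:E * cv (m n) (m n) (s, p.2))).
  apply: eq_integral => s _; rewrite E; apply/esym/cvg_lim => //.
  by apply: cvgeZl => //; apply: cvgeZl => //; exact: ereal_nondecreasing_is_cvgn.
rewrite K; apply: cvg_monotone_convergence => //.
- by move=> n; have [m1 m0] := nnm_cv (nm n) (nm n); ms.
- by move=> n s _; have [m1 m0] := nnm_cv (nm n) (nm n); nn.
- move=> s _ i j ij; have [m1 m0] := nnm_cv (nm i) (nm i).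
  by apply: lee_pmul; [nn|nn|by []|apply: lee_pmul; [nn|nn|by []|exact: cm]].
Qed.

Lemma lim_le_seq (a : nat -> \bar R) L c : a @ \oo --> L -> (forall n, a n <= c) -> L <= c.
Proof.
move=> aL ac; have := cvg_lim (@ereal_hausdorff R) aL => <-.
by apply: lime_le; [apply/cvg_ex; exists L|exact: nearW].
Qed.

(** Scalar Picard iteration from 0: the iterates increase, and their limit satisfies the Duhamel
    inequality in the direction that makes it dominate vector iterates. The bounds [2 * e] and
    [2 * e / nu] are kept by the induction and pass to the limit by monotone convergence. *)
Lemma majorant (nu C e : R) (om : X -> R) (a0 : X -> \bar R) :
  (0 < nu)%R -> (0 < C)%R -> (0 <= e)%R -> (4 * C * e <= nu)%R ->
  (forall x, (0 <= om x)%R) -> (forall x y, om x <= om y * om (sub x y))%R -> measurable_fun setT om ->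
  nnm a0 -> (forall x, r x = 0%R -> a0 x = 0) ->
  \int[mu]_x ((r x)^-1%:E * ((om x)%:E * a0 x)) <= e%:E ->
  exists M : P -> \bar R, [/\ nnm M, forall p, r p.2 = 0%R \/ (p.1 < 0 :> R)%R -> M p = 0,
    forall p, (ker nu p.1 0 p.2)%:E * a0 p.2 + C%:E * KK nu M M p <= M p,
    forall t, \int[mu]_x ((r x)^-1%:E * ((om x)%:E * M (t, x))) <= (2 * e)%:E &
    \int[lam]_t \int[mu]_x ((r x)%:E * ((om x)%:E * M (t, x))) <= (nu^-1 * (2 * e))%:E].
Proof.
move=> nu0 C0 e0 Ce om0 omM mom [ma0 a00] az a0e.
have om0' x : (0 <= om x)%R by exact: om0.
pose m := fix m n : P -> \bar R := if n is k.+1 then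
  (fun p : P => (ker nu p.1 0%R p.2)%:E * a0 p.2 + C%:E * KK nu (m k) (m k) p) else (fun _ => 0).
have nm n : nnm (m n).
  have nstep h : nnm h -> nnm (fun p : P => (ker nu p.1 0%R p.2)%:E * a0 p.2 + C%:E * KK nu h h p).
    move=> nh; have [mK K0] := nnm_KK nu nh nh; split; [apply: emeasurable_funD; ms|by nn].
  by elim: n => [|n IH]; [split; [exact: measurable_cst|by []]|exact: nstep].
have step n p : m n p <= m n.+1 p.
  elim: n p => [|n IH] p; first exact: (nm 1%N).2.
  apply: leeD; [by []|apply: lee_pmul; [by nn|exact: (nnm_KK nu (nm n) (nm n)).2|by []|]].
  by apply: le_KK; [exact: (nm n).2|exact: (nm n).2|exact: IH|exact: IH].
have mono p : nondecreasing_seq (m ^~ p).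
  by apply/nondecreasing_seqP => n; exact: step.
pose M p := limn (m ^~ p).
have mM n p : m n p <= M p.
  exact: nd_le_lim.
have nM : nnm M.
  split; last by move=> p; exact: le_trans (mM 0%N p).
  apply: (emeasurable_fun_cvg m); first by move=> n; exact: (nm n).1.
  by move=> p _; exact: ereal_nondecreasing_is_cvgn.
have mz n p : r p.2 = 0%R \/ (p.1 < 0 :> R)%R -> m n p = 0.
  elim: n p => [//|n IH] p [rp|tp] /=.
    rewrite az// mule0 add0e /KK rp.
    by under eq_integral do rewrite mul0e mule0; rewrite integral0 mule0.
  rewrite {1}/ker leNgt tp mul0e add0e /KK.
  under eq_integral => s _.
    rewrite (_ : _ * _ = 0); first over.
    have [sp|sp] := leP s p.1; last by rewrite /ker leNgt sp mul0e.
    rewrite /cv/=; have mz' y : m n (s, y) = 0 by apply: IH; right; exact: le_lt_trans tp.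
    by under eq_integral do rewrite mz' mul0e; rewrite integral0 !mule0.
  by rewrite integral0 mule0.
have bounds n : (forall t, \int[mu]_x ((r x)^-1%:E * ((om x)%:E * m n (t, x))) <= (2 * e)%:E) /\
    \int[lam]_t \int[mu]_x ((r x)%:E * ((om x)%:E * m n (t, x))) <= (nu^-1 * (2 * e))%:E.
  elim: n => [|n [IHx IHy]].
    have z (g : X -> \bar R) t : \int[mu]_x (g x * ((om x)%:E * m 0%N (t, x))) = 0.
      by under eq_integral do rewrite !mule0; rewrite integral0.
    by split=> [t|]; rewrite ?z; [|under eq_integral do rewrite z; rewrite integral0]; nn; exact: ltW.
  have [m1 m0] := nm n.
  pose h (p : P) := (om p.2)%:E * m n p.
  have nh : nnm h by rewrite /h; split; [ms|nn].
  have [mh h0] := nh; have [mmh mh0] := nnm_mass nh.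
  have [m1' m0'] := nm n.+1.
  have hle (p : P) : (om p.2)%:E * m n.+1 p <=
      (ker nu p.1 0%R p.2)%:E * ((om p.2)%:E * a0 p.2) + C%:E * KK nu h h p.
    rewrite [m n.+1 p]/= ge0_muleDr; [|by nn|by apply: mule_ge0; [nn|exact: (nnm_KK nu (nm n) (nm n)).2]].
    rewrite muleCA; apply: leeD => //; rewrite muleCA; apply: lee_pmul; [by nn| |by []|].
      by apply: mule_ge0; [nn|exact: (nnm_KK nu (nm n) (nm n)).2].
    exact: (KK_weight nu p om0 omM mom (nm n) (nm n)).
  have q : \int[lam]_s (mass h s * mass h s) <= ((2 * e) * (nu^-1 * (2 * e)))%:E.
    apply: (@le_trans _ _ (\int[lam]_s ((2 * e)%:E * \int[mu]_x ((r x)%:E * h (s, x))))).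
      apply: ge0_le_integralT => s; first by nn.
      apply: le_trans (mass_sq s nh _) _; first by move=> p rp; rewrite /h mz ?mule0//; left.
      by apply: lee_pmul; [nn|nn|exact: IHx|].
    rewrite ge0_integralZlT; [|by ms|by nn|by nn].
    by rewrite [leRHS]EFinM; apply: lee_pmul; [nn|nn|by []|exact: IHy].
  (* By interpolation the quadratic term is at most [C * (2 e) * (2 e / nu) = (4 C e) * e / nu],
     hence at most [e] by the smallness condition. *)
  have Cq : C%:E * \int[lam]_s (mass h s * mass h s) <= e%:E.
    apply: (@le_trans _ _ (C%:E * ((2 * e) * (nu^-1 * (2 * e)))%:E)).
      by apply: lee_pmul; [nn|nn|by []|exact: q].
    rewrite -EFinM lee_fin.
    rewrite (_ : (C * _)%R = (4 * C * e * e / nu)%R); last by ring.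
    by rewrite ler_pdivrMr// [leRHS]mulrC; apply: ler_wpM2r.
  have [|||B1 B2] := @mild_XY nu C 0%R (fun x => (om x)%:E * a0 x) (fun p => (om p.2)%:E * m n.+1 p) h nu0 (ltW C0) _ _ _ nh hle.
  - by ms.
  - by nn.
  - by split; [ms|nn].
  have sm : \int[mu]_x ((r x)^-1%:E * ((om x)%:E * a0 x)) + C%:E * \int[lam]_s (mass h s * mass h s) <= (2 * e)%:E.
    by rewrite mulr2n mulrDl mul1r EFinD; exact: leeD.
  split=> [t|]; first exact: le_trans (B1 t) sm.
  apply: (le_trans B2); rewrite [leRHS]EFinM; apply: lee_pmul; [by nn; exact: ltW| |by []|exact: sm].
  by nn.
exists M; split.
- exact: nM.
- move=> p rp; rewrite /M; rewrite (_ : m ^~ p = cst 0) ?lim_cst//.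
  by apply/funext => n; exact: mz.
- move=> p; have cK := @KK_lim nu m M p nm mono (fun q => erefl).
  apply: (@lim_le_seq (fun n => m n.+1 p)); last by move=> n; exact: mM.
  rewrite /=; apply: cvgeD.
  + apply: ge0_adde_def; rewrite inE; first by nn.
    by apply: mule_ge0; [rewrite lee_fin ltW|exact: (nnm_KK nu nM nM).2].
  + exact: cvg_cst.
  + by apply: cvgeZl.
- move=> t; apply: (@lim_le_seq (fun n => \int[mu]_x ((r x)^-1%:E * ((om x)%:E * m n (t, x))))); last first.
    by move=> n; exact: (bounds n).1.
  rewrite /M; under [X in _ --> X]eq_integral => x _.
    have cm : cvgn (m ^~ (t, x)) by exact: ereal_nondecreasing_is_cvgn.
    rewrite -limeMl// -limeMl//; last exact: is_cvgeZl.
    over.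
  apply: cvg_monotone_convergence => //.
  + by move=> n; have [m1 m0] := nm n; ms.
  + by move=> n x _; have [m1 m0] := nm n; nn.
  + move=> x _ i j ij; have [m1 m0] := nm i.
    by apply: lee_pmul; [nn|nn|by []|apply: lee_pmul; [nn|nn|by []|exact: mono]].
- pose Z (n : nat) t := \int[mu]_x ((r x)%:E * ((om x)%:E * m n (t, x))).
  have nZ n : nnm (Z n) by have [m1 m0] := nm n; rewrite /Z; split; [ms|nn].
  have Zmono t : nondecreasing_seq (Z ^~ t).
    move=> i j ij; have [m1 m0] := nm i; rewrite /Z; apply: ge0_le_integralT => x; first by nn.
    by apply: lee_pmul; [nn|nn|by []|apply: lee_pmul; [nn|nn|by []|exact: mono]].
  apply: (@lim_le_seq (fun n => \int[lam]_t Z n t)); last first.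
    by move=> n; exact: (bounds n).2.
  rewrite (_ : \int[lam]_t _ = \int[lam]_t limn (Z ^~ t)); last first.
    apply: eq_integral => t _; rewrite /Z -monotone_convergence//; last 3 first.
    + by move=> n; have [m1 m0] := nm n; ms.
    + by move=> n x _; have [m1 m0] := nm n; nn.
    + move=> x _ i j ij; have [m1 m0] := nm i.
      by apply: lee_pmul; [nn|nn|by []|apply: lee_pmul; [nn|nn|by []|exact: mono]].
    apply: eq_integral => x _; rewrite /M.
    have cm : cvgn (m ^~ (t, x)) by exact: ereal_nondecreasing_is_cvgn.
    by rewrite -limeMl// -limeMl//; exact: is_cvgeZl.
  apply: cvg_monotone_convergence => //.
  + by move=> n; exact: (nZ n).1.
  + by move=> n t _; exact: (nZ n).2.

Qed.
Ltac ms4' := first [ms3' | match goal with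
  | |- measurable_fun _ (fun x => @GRing.add _ _ _) => first [apply: emeasurable_funD|apply: measurable_funD] end].
Ltac ms ::= repeat ms4'.

(** * Duhamel's formula for vector fields and the small global solution *)

Definition duh_int (nu : R) (N : P -> I -> R) (p : P) (c : I) : R :=
  Rintegral lam setT (fun s => ker nu p.1 s p.2 * N (s, p.2) c)%R.
Definition duh (nu : R) (a : X -> I -> R) (F : P -> I -> R) (p : P) (c : I) : R :=
  (ker nu p.1 0 p.2 * a p.2 c - duh_int nu (NL F F) p c)%R.
(** The increment of the quadratic term: for [D = F - G] this is [NL F F - NL G G] wherever the
    integrals converge. *)
Definition pert (D F G : P -> I -> R) (p : P) (c : I) : R := (NL D F p c + NL G D p c)%R.

Lemma mfield_duh_int nu N : mfield N -> mfield (duh_int nu N).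
Proof.
move=> mN c; have mNc := mN c; rewrite /duh_int.
apply: (measurable_Rintegral lam (h := fun p s => ker nu p.1 s p.2 * N (s, p.2) c)%R).
apply: measurable_funM; first by ms.
by apply: (measurableT_comp mNc (g := fun q : P * TT R => (q.2, q.1.2))); ms.
Qed.

Lemma mfield_duh nu a F : (forall c, measurable_fun setT (fun x => a x c)) -> mfield F ->
  mfield (duh nu a F).
Proof.
move=> ma mF c; have mac := ma c; rewrite /duh; apply: measurable_funB.
  apply: measurable_funM; first by ms.
  by apply: (measurableT_comp mac (g := snd)); ms.
by apply: mfield_duh_int; exact: mfield_NL.
Qed.

Lemma mfield_pert D F G : mfield D -> mfield F -> mfield G -> mfield (pert D F G).
Proof. by move=> mD mF mG c; apply: measurable_funD; exact: mfield_NL. Qed.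

Lemma ker_N_bound nu (k : R) N f g p c : mfield N -> nnm f -> nnm g -> (0 <= k)%R ->
  (forall q, (`|N q c|)%:E <= (k * r q.2)%:E * cv f g q) ->
  \int[lam]_s `|(ker nu p.1 s p.2 * N (s, p.2) c)%:E| <= k%:E * KK nu f g p.
Proof.
move=> mN nf ng k0 Nb; have [mc c0] := nnm_cv nf ng.
rewrite /KK -ge0_integralZlT; [|by ms|by nn|by nn].
apply: ge0_le_integralT => s; first exact: abse_ge0.
rewrite abse_EFin normrM (ger0_norm (ker_ge0 _ _ _ _)) EFinM.
rewrite muleCA; apply: lee_pmul; [by nn|by nn|by []|].
by rewrite muleA -EFinM; exact: (Nb (s, p.2)).
Qed.

Lemma mker_N nu N p c : mfield N -> measurable_fun setT (fun s : TT R => ker nu p.1 s p.2 * N (s, p.2) c)%R.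
Proof.
move=> mN; have mNc := mN c; apply: measurable_funM; first by ms.
by apply: (measurableT_comp mNc (g := fun s : TT R => (s, p.2))); ms.
Qed.

Lemma duh_int_bound nu (k : R) N f g p c : mfield N -> nnm f -> nnm g -> (0 <= k)%R ->
  (forall q, (`|N q c|)%:E <= (k * r q.2)%:E * cv f g q) ->
  (`|duh_int nu N p c|)%:E <= k%:E * KK nu f g p.
Proof.
move=> mN nf ng k0 Nb; apply: le_trans (ker_N_bound nu p mN nf ng k0 Nb).
exact: (le_abse_Rintegral lam (mker_N nu p c mN)).
Qed.

Lemma duh_integrable nu (k : R) N f g p c : mfield N -> nnm f -> nnm g -> (0 <= k)%R ->
  (forall q, (`|N q c|)%:E <= (k * r q.2)%:E * cv f g q) -> KK nu f g p < +oo ->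
  lam.-integrable setT (EFin \o (fun s => ker nu p.1 s p.2 * N (s, p.2) c)%R).
Proof.
move=> mN nf ng k0 Nb fin; apply/integrableP; split; first by apply/measurable_EFinP; exact: mker_N.
apply: le_lt_trans (ker_N_bound nu p mN nf ng k0 Nb) _.
by apply: lte_mul_pinfty; [nn|by []|exact: fin].
Qed.

(** A finite integral has an almost everywhere finite integrand, and a product with a positive
    finite factor is finite only if the convolution is. This supplies the convergence conditions of
    [NL_diff] inside the time integral. *)
Lemma KK_fin_ae nu M p : nnm M -> KK nu M M p < +oo ->
  {ae lam, forall s, [\/ r p.2 = 0%R, ker nu p.1 s p.2 = 0%R | cv M M (s, p.2) < +oo]}.
Proof.
move=> nM fin; have [mc c0] := nnm_cv nM nM.
have H := nnm_finite_ae (mu := lam)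
  (h := fun s => (ker nu p.1 s p.2)%:E * ((r p.2)%:E * cv M M (s, p.2))) _ fin.
apply: (filterS _ (H _)) => [s|]; last by split; [ms|nn].
have [->|rp] := eqVneq (r p.2) 0%R; first by constructor 1.
have [->|kp] := eqVneq (ker nu p.1 s p.2) 0%R; first by constructor 2.
move=> Hs; constructor 3; rewrite ltNge leye_eq; apply/negP => /eqP cE; move: Hs.
rewrite cE gt0_muley ?lte_fin ?lt_def ?rp ?r0// gt0_muley ?lte_fin ?lt_def ?kp ?ker_ge0//.
Qed.

Lemma NL_diff_fin F G M p c : mfield F -> mfield G -> nnm M -> (forall q, en1 F q <= M q) ->
  (forall q, en1 G q <= M q) -> cv M M p < +oo ->
  (NL F F p c - NL G G p c = pert (fsub F G) F G p c)%R.
Proof.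
move=> mF mG nM FM GM fin; have mD := mfield_sub mF mG.
have [mf f0] := nnm_en1 mF; have [mg g0] := nnm_en1 mG; have [mM M0] := nM.
have DM q : en1 (fsub F G) q <= M q + M q by apply: le_trans (en1_sub F G q) _; exact: leeD.
have nMM : nnm (fun q => M q + M q) by split; [ms|nn].
have [md d0] := nnm_en1 mD.
have fin2 : cv (fun q => M q + M q) M p < +oo by rewrite cvDl// lte_add_pinfty.
apply: NL_diff; [by []|by []|by []|by []| | | |].
- by apply: le_lt_trans fin; exact: le_cv.
- by apply: le_lt_trans fin; exact: le_cv.
- by apply: le_lt_trans fin2; exact: le_cv.
- by apply: le_lt_trans fin2; rewrite cvC//; apply: le_cv => //; exact: (nnm_en1 _).
Qed.

Lemma NL_bound' F G f g p c : mfield F -> mfield G -> nnm f -> nnm g -> (forall q, en1 F q <= f q) ->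
  (forall q, en1 G q <= g q) -> (`|NL F G p c|)%:E <= (C1 * r p.2)%:E * cv f g p.
Proof.
move=> mF mG nf ng Ff Gg; apply: le_trans (NL_bound p c mF mG) _.
have nF := nnm_en1 mF; have nG := nnm_en1 mG; have nc := nnm_cv nF nG.
by apply: lee_pmul; [nn|exact: nc.2|by []|exact: le_cv_en1].
Qed.

Lemma pert_bound D F G g p c : mfield D -> mfield F -> mfield G -> nnm g -> (forall q, en1 F q <= g q) ->
  (forall q, en1 G q <= g q) -> (`|pert D F G p c|)%:E <= (2 * C1 * r p.2)%:E * cv (en1 D) g p.
Proof.
move=> mD mF mG ng Fg Gg; have nD := nnm_en1 mD; have nc := nnm_cv nD ng.
have H1 := NL_bound' p c mD mF nD ng (fun q => lexx _) Fg.
have H2 := NL_bound' p c mG mD ng nD Gg (fun q => lexx _).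
apply: (@le_trans _ _ (`|NL D F p c| + `|NL G D p c|)%:E).
  by rewrite lee_fin; exact: ler_normD.
rewrite EFinD; apply: (le_trans (leeD H1 H2)).
rewrite (cvC p ng nD) -ge0_muleDl; [|by nn|by nn].
by rewrite -EFinD -mulrA mulr2n mulrDl mul1r.
Qed.

Lemma duh_int_diff nu F G M p c : mfield F -> mfield G -> nnm M -> (forall q, en1 F q <= M q) ->
  (forall q, en1 G q <= M q) -> KK nu M M p < +oo ->
  (duh_int nu (NL F F) p c - duh_int nu (NL G G) p c = duh_int nu (pert (fsub F G) F G) p c)%R.
Proof.
move=> mF mG nM FM GM fin.
have iF := duh_integrable (mfield_NL mF mF) nM nM C10 (fun q => NL_bound' q c mF mF nM nM FM FM) fin.
have iG := duh_integrable (mfield_NL mG mG) nM nM C10 (fun q => NL_bound' q c mG mG nM nM GM GM) fin.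
rewrite /duh_int -RintegralB//; rewrite /Rintegral; congr fine.
apply: ae_eq_integral => //.
- apply/measurable_EFinP; apply: measurable_funB; exact: (mker_N nu p c (mfield_NL _ _)).
- by apply/measurable_EFinP; apply: mker_N; exact: mfield_pert (mfield_sub mF mG) mF mG.
apply: (filterS _ (KK_fin_ae nM fin)) => s Hs _; congr (_%:E); rewrite -mulrBr.
case: Hs => [rp|->|cs]; [|by rewrite !mul0r|by rewrite (NL_diff_fin (M := M))].
have NL0 F1 G1 : mfield F1 -> mfield G1 -> NL F1 G1 (s, p.2) c = 0%R.
  move=> m1 m2; have := NL_bound (s, p.2) c m1 m2.
  by rewrite /= rp mulr0 mul0e lee_fin normr_le0 => /eqP.
have mD := mfield_sub mF mG.
by rewrite /pert !NL0// subr0 addr0.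
Qed.
Variable C : R.
Hypothesis C0 : (0 < C)%R.
Hypothesis CC1 : (#|I|%:R * C1 <= C)%R.

Lemma n1_le (k : R) (v : I -> R) (K : \bar R) : (0 <= k)%R -> 0 <= K ->
  (forall c, (`|v c|)%:E <= (k * C1)%:E * K) -> (n1 v)%:E <= (k * C)%:E * K.
Proof.
move=> k0; case: K => [K| |]// K0 vK; last first.
  have [kn|kn] := eqVneq k 0%R; last by rewrite gt0_muley ?leey// lte_fin mulr_gt0// lt_def kn.
  rewrite kn mul0r mul0e lee_fin /n1 big1// => c _; apply/eqP; rewrite -normr_le0 -lee_fin normr_id.
  by have := vK c; rewrite kn mul0r mul0e.
rewrite lee_fin in K0; rewrite -EFinM lee_fin /n1.
apply: (@le_trans _ _ (\sum_(c : I) k * C1 * K)%R).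
  by apply: ler_sum => c _; have := vK c; rewrite -EFinM lee_fin.
rewrite sumr_const -[X in (X <= _)%R]mulr_natl mulrA; apply: ler_wpM2r => //.
by rewrite mulrCA; apply: ler_wpM2l.
Qed.

Lemma n1Z (k : R) v : (0 <= k)%R -> n1 (fun i => k * v i)%R = (k * n1 v)%R.
Proof.
by move=> k0; rewrite /n1 mulr_sumr; apply: eq_bigr => c _; rewrite normrM ger0_norm.
Qed.

Lemma duh_en1 nu a F g p : mfield F -> nnm g -> (forall q, en1 F q <= g q) ->
  en1 (duh nu a F) p <= (ker nu p.1 0 p.2)%:E * (n1 (a p.2))%:E + C%:E * KK nu g g p.
Proof.
move=> mF ng Fg; have [mK K0] := nnm_KK nu ng ng.
apply: (@le_trans _ _ (n1 (fun i => ker nu p.1 0 p.2 * a p.2 i)%R + n1 (duh_int nu (NL F F) p))%:E).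
  by rewrite lee_fin; exact: n1_sub.
rewrite EFinD n1Z ?ker_ge0// EFinM; apply: leeD; first by [].
rewrite -[C]mul1r; apply: n1_le => // c; rewrite mul1r.
apply: duh_int_bound => //; first exact: mfield_NL.
by move=> q; exact: NL_bound'.
Qed.

Lemma duh_sub nu a a' F G M p : mfield F -> mfield G -> nnm M -> (forall q, en1 F q <= M q) ->
  (forall q, en1 G q <= M q) -> KK nu M M p < +oo ->
  en1 (fsub (duh nu a F) (duh nu a' G)) p <=
  (ker nu p.1 0 p.2)%:E * (n1 (fun i => a p.2 i - a' p.2 i)%R)%:E +
  (2 * C)%:E * KK nu (en1 (fsub F G)) M p.
Proof.
move=> mF mG nM FM GM fin; have mD := mfield_sub mF mG; have nD := nnm_en1 mD.
have [mK K0] := nnm_KK nu nD nM.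
rewrite /en1 (_ : fsub _ _ p = fun i => (ker nu p.1 0 p.2 * (a p.2 i - a' p.2 i) -
  duh_int nu (pert (fsub F G) F G) p i)%R); last first.
  apply/funext => i; rewrite /fsub /duh -(duh_int_diff i mF mG nM FM GM fin).
  move: (ker _ _ _ _) (duh_int _ _ _ _) (duh_int _ _ _ _) => k x y; ring.
apply: (@le_trans _ _ (n1 (fun i => ker nu p.1 0 p.2 * (a p.2 i - a' p.2 i))%R +
   n1 (duh_int nu (pert (fsub F G) F G) p))%:E).
  by rewrite lee_fin; exact: n1_sub.
rewrite EFinD n1Z ?ker_ge0// EFinM; apply: leeD; first by [].
apply: n1_le => // c; apply: duh_int_bound => //; first exact: mfield_pert.
- by rewrite mulr_ge0.
- by move=> q; exact: pert_bound.
Qed.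

Definition cut (b : P -> bool) (F : P -> I -> R) (p : P) (c : I) : R := if b p then F p c else 0%R.

Lemma mfield_cut b F : measurable_fun setT b -> mfield F -> mfield (cut b F).
Proof. by move=> mb mF c; apply: measurable_fun_ifT => //; exact: mF. Qed.

Lemma n1_0 (v : I -> R) : (forall i, v i = 0%R) -> n1 v = 0%R.
Proof. by move=> v0; rewrite /n1 big1// => i _; rewrite v0 normr0. Qed.

(** Telescoping with a summable extended-valued bound on the increments gives absolute convergence;
    the tails then control the distance to the limit. *)
Lemma summable_limit (u : nat -> R) (D : nat -> \bar R) : (forall n, 0 <= D n) ->
  (forall n, (`|u n.+1 - u n|)%:E <= D n) -> \sum_(0 <= n <oo) D n < +oo ->
  cvgn u /\ forall n, (`|limn u - u n|)%:E <= \sum_(n <= k <oo) D k.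
Proof.
move=> D0 uD fin.
pose S := \sum_(0 <= n <oo) D n; have S0 : 0 <= S by apply: nneseries_ge0.
have SE : S = (fine S)%:E by rewrite fineK// ge0_fin_numE.
have bnd n m : (n <= m)%N -> (`|u m - u n|)%:E <= \sum_(n <= k < m) D k.
  elim: m => [|m IH]; first by rewrite leqn0 => /eqP ->; rewrite subrr normr0 big_geq.
  rewrite leq_eqVlt => /orP[/eqP <-|]; first by rewrite subrr normr0 big_geq.
  rewrite ltnS => nm; rewrite big_nat_recr//=.
  apply: le_trans (leeD (IH nm) (uD m)); rewrite -EFinD lee_fin [leRHS]addrC.
  by have := ler_normD (u m.+1 - u m)%R (u m - u n)%R; rewrite addrA subrK.
have cs : cvgn (series (fun k => u k.+1 - u k)%R).
  apply: normed_cvg; apply: nondecreasing_is_cvgn.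
    by apply/nondecreasing_seqP => n; rewrite /= /series/= big_nat_recr//= lerDl.
  exists (fine S) => _ [n _ <-]; rewrite -lee_fin -SE /series/= -sumEFin.
  apply: (@le_trans _ _ (\sum_(0 <= k < n) D k)); first by apply: lee_sum => k _; exact: uD.
  by apply: nneseries_lim_ge => k _ _; exact: D0.
have cu : cvgn u.
  rewrite (_ : u = (fun n => u 0%N + series (fun k => u k.+1 - u k) n)%R).
    by apply: is_cvgD; [exact: is_cvg_cst|exact: cs].
  by apply/funext => n; rewrite /series/= telescope_sumr// addrC subrK.
split=> // n; have t0 : 0 <= \sum_(n <= k <oo) D k by apply: nneseries_ge0 => k _ _; exact: D0.
have tb m : (n <= m)%N -> (`|u m - u n|)%:E <= \sum_(n <= k <oo) D k.
  move=> nm; apply: le_trans (bnd _ _ nm) _.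
  by apply: nneseries_lim_ge => k _ _; exact: D0.
move: t0 tb; case: (\sum_(n <= k <oo) D k) => [t| |]//; last by move=> _ _; exact: leey.
rewrite lee_fin => t0 tb; rewrite lee_fin.
have cn : (fun m => `|u m - u n|)%R @ \oo --> (`|limn u - u n|)%R.
  by apply: cvg_norm; apply: cvgB; [exact: cu|exact: cvg_cst].
rewrite -(cvg_lim _ cn)//; apply: limr_le; first by apply/cvg_ex; eexists; exact: cn.
by exists n => // m /= nm; rewrite -lee_fin; exact: tb.
Qed.

Lemma mass_le_weight (om : X -> R) (h : X -> \bar R) : (forall x, r x <= om x)%R -> (forall x, 0 <= h x) ->
  (forall x, r x = 0%R -> h x = 0) ->
  \int[mu]_x h x <= \int[mu]_x ((r x)^-1%:E * ((om x)%:E * h x)).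
Proof.
move=> rom h0 hz; apply: ge0_le_integralT => // x.
have [rx|rx] := eqVneq (r x) 0%R; first by rewrite hz// !mule0.
rewrite muleA -EFinM -[leLHS]mul1e; apply: lee_pmul; [by []|exact: h0| |by []].
by rewrite lee_fin mulrC ler_pdivlMr ?mul1r// lt_def rx r0.
Qed.

Lemma wmass_fin (l A : R) (f : P -> \bar R) : (0 < l)%R -> (0 <= A)%R -> nnm f ->
  (forall p, (p.1 < 0 :> R)%R -> f p = 0) -> (forall t, mass f t <= A%:E) -> wmass l f < +oo.
Proof.
move=> l0 A0 nf fz fA; have [mm m0] := nnm_mass nf.
apply: (@le_lt_trans _ _ (A%:E * l^-1%:E)); last by rewrite -EFinM ltry.
rewrite -(integral_exp_after (0%R : TT R) l0) -ge0_integralZlT; last 3 first.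
- by ms.
- by move=> t; rewrite lee_fin; case: ifP => // _; exact: expR_ge0.
- by rewrite lee_fin.
apply: ge0_le_integralT => t; first by nn.
case: ifPn => [_|]; last first.
  rewrite -ltNge => t0; rewrite /mass; under eq_integral do rewrite fz//.
  by rewrite integral0 !mule0.
rewrite subr0 mulNr muleC; apply: lee_pmul; [exact: m0|by nn|exact: fA|by []].
Qed.

Definition tail (D : nat -> P -> \bar R) n p := \sum_(0 <= k <oo) D (k + n)%N p.

Lemma nnm_tail D n : (forall n, nnm (D n)) -> nnm (tail D n).
Proof. by move=> nD; apply: (nnm_nneseries (D := fun k => D (k + n)%N)). Qed.

Lemma tailE D n p : (forall n, nnm (D n)) -> tail D n p = \sum_(n <= k <oo) D k p.
Proof. by move=> nD; rewrite /tail (nneseries_addn (f := fun k => D k p))// => k; exact: (nD k).2. Qed.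

Lemma nneseriesZr (u : nat -> \bar R) (x : \bar R) : (forall n, 0 <= u n) -> 0 <= x ->
  \sum_(0 <= k <oo) (u k * x) = (\sum_(0 <= k <oo) u k) * x.
Proof.
move=> u0 x0; have xE : limn (fun _ => x) = x by exact: lim_cst.
rewrite -[in RHS]xE; apply/cvg_lim => //.
rewrite (_ : (fun n => _) = fun n => (\sum_(0 <= k < n) u k) * x).
  apply: (@nd_limM _ (fun _ => x)); [by move=> n; apply: sume_ge0|by []| |by move=> n m _].
  by apply/nondecreasing_seqP => n; rewrite big_nat_recr//= leeDl.
by apply/funext => n; rewrite ge0_sume_distrl.
Qed.

Lemma KKZl nu (k : R) f g p : (0 <= k)%R -> nnm f -> nnm g ->
  KK nu (fun q => k%:E * f q) g p = k%:E * KK nu f g p.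
Proof.
move=> k0 nf ng; have [mf f0] := nf; have [mg g0] := ng; have [mc c0] := nnm_cv nf ng.
rewrite /KK -ge0_integralZlT; [|by ms|by nn|by nn].
apply: eq_integral => s _; rewrite (_ : cv _ _ _ = k%:E * cv f g (s, p.2)); last first.
  rewrite /cv -ge0_integralZlT; [|by ms|by nn|by nn].
  by apply: eq_integral => y _; rewrite muleA.
by rewrite (muleCA (r p.2)%:E k%:E) (muleCA (ker nu p.1 s p.2)%:E k%:E).
Qed.

Lemma KK_nneseries nu D M p : (forall n, nnm (D n)) -> nnm M ->
  KK nu (fun q => \sum_(0 <= k <oo) D k q) M p = \sum_(0 <= k <oo) KK nu (D k) M p.
Proof.
move=> nD nM; have [mM M0] := nM.
have cT q : cv (fun q => \sum_(0 <= k <oo) D k q) M q = \sum_(0 <= k <oo) cv (D k) M q.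
  rewrite /cv -integral_nneseries//; last 2 first.
  - by move=> k; have [m1 m0] := nD k; ms.
  - by move=> k y _; have [m1 m0] := nD k; nn.
  apply: eq_integral => y _; rewrite nneseriesZr//.
  by move=> k; exact: (nD k).2.
rewrite /KK -integral_nneseries//; last 2 first.
- by move=> k; have [m1 m0] := nnm_cv (nD k) nM; ms.
- by move=> k s _; have [m1 m0] := nnm_cv (nD k) nM; nn.
apply: eq_integral => s _; rewrite cT -nneseriesZl; last by move=> k _; exact: (nnm_cv (nD k) nM).2.
rewrite -nneseriesZl//; move=> k _; have [m1 m0] := nnm_cv (nD k) nM; nn.
Qed.

(** The vector iterates stay below the scalar majorant [M], so only their increments need control.
    These are dominated by a linear iteration that contracts in weighted mass, hence are summable at
    almost every point. [b] marks the points of summability, where [W] is the limit and solves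
    Duhamel's equation. *)
Lemma small_solution (nu e : R) (om : X -> R) (a : X -> I -> R) :
  (0 < nu)%R -> (0 <= e)%R -> (4 * C * e <= nu)%R ->
  (forall x, (r x <= om x)%R) -> (forall x y, om x <= om y * om (sub x y))%R -> measurable_fun setT om ->
  (forall c, measurable_fun setT (fun x => a x c)) -> (forall x c, r x = 0%R -> a x c = 0%R) ->
  \int[mu]_x ((r x)^-1%:E * ((om x)%:E * (n1 (a x))%:E)) <= e%:E ->
  exists M : P -> \bar R, exists W : P -> I -> R, exists b : P -> bool,
  [/\ nnm M, forall p, r p.2 = 0%R \/ (p.1 < 0 :> R)%R -> M p = 0,
    forall t, \int[mu]_x ((r x)^-1%:E * ((om x)%:E * M (t, x))) <= (2 * e)%:E &
    \int[lam]_t \int[mu]_x ((r x)%:E * ((om x)%:E * M (t, x))) <= (nu^-1 * (2 * e))%:E] /\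
  [/\ mfield W /\ measurable_fun setT b,
    forall p, en1 W p <= M p,
    forall p c, ~~ b p -> W p c = 0%R,
    forall p c, b p -> KK nu M M p < +oo /\ W p c = duh nu a W p c &
    {ae lam, forall t, {ae mu, forall x, b (t, x)}}].
Proof.
move=> nu0 e0 Ce rom omM mom ma az ae.
have om0 x : (0 <= om x)%R by exact: le_trans (r0 x) (rom x).
have ma1 : measurable_fun setT (fun x => n1 (a x)) by exact: mn1.
have na0 : nnm (fun x => (n1 (a x))%:E) by split; [ms|move=> x; rewrite lee_fin n1_ge0].
have [|M [nM Mz Mfix Mx My]] := majorant nu0 C0 e0 Ce om0 omM mom na0 _ ae.
  by move=> x rx; rewrite n1_0// => i; exact: az.
have mA t : mass M t <= (2 * e)%:E.
  apply: le_trans (Mx t); apply: mass_le_weight => // x; first exact: nM.2.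
  by move=> rx; apply: Mz; left.
have twoC : (0 <= 2 * C)%R by rewrite mulr_ge0// ltW.
have [l [l0 lD]] := KK_contraction nu0 twoC (mulr_ge0 (ler0n _ 2) e0).
(* The factor [2 * C] comes from the two terms of [pert]. *)
pose D := fix D n : P -> \bar R := if n is k.+1 then (fun p => (2 * C)%:E * KK nu (D k) M p) else M.
have nD n : nnm (D n).
  elim: n => [//|n IH] /=; have [mK K0] := nnm_KK nu IH nM; split; [ms|nn].
have wD : \sum_(0 <= n <oo) wmass l (D n) < +oo.
  apply: (@wmass_iter_KK nu (2 * C)%R l M M D) => //.
  - by move=> n; apply: lD => //; apply: aeW => s; exact: mA.
  - apply: (@wmass_fin l (2 * e)) => //; first by rewrite mulr_ge0.
    by move=> p tp; apply: Mz; right.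
have nT n := nnm_tail n nD.
pose b (p : P) := (tail D 0 p < +oo).
have mb : measurable_fun setT b.
  by apply: measurable_fun_lte; [exact: (nT 0%N).1|exact: measurable_cst].
have MS p : M p <= tail D 0 p.
  have := @nneseries_lim_ge R (fun n => D n p) xpredT 0 1 (fun n _ _ => (nD n).2 p).
  by rewrite big_nat1 tailE.
have bM p : b p -> M p < +oo by move=> bp; exact: le_lt_trans (MS p) bp.
have KKfin p : b p -> KK nu M M p < +oo.
  move=> /bM Mp; have [mK K0] := nnm_KK nu nM nM.
  have : C%:E * KK nu M M p < +oo.
    by apply: le_lt_trans Mp; apply: le_trans (Mfix p); rewrite leeDr//; apply: mule_ge0; [nn|exact: na0.2].
  rewrite !ltNge !leye_eq => H; apply/negP => /eqP KE.
  by move/negP: H; apply; rewrite KE gt0_muley ?lte_fin.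
(* Cutting every iterate to 0 off [b] makes the pointwise bounds true everywhere, so the comparison
   with [M] and [D] carries no exceptional set. *)
pose w := fix w n : P -> I -> R := if n is k.+1 then cut b (duh nu a (w k)) else (fun _ _ => 0%R).
have mw n : mfield (w n).
  elim: n => [|n IH] /=; first by move=> c; exact: measurable_cst.
  by apply: mfield_cut => //; exact: mfield_duh.
have wM n p : en1 (w n) p <= M p.
  elim: n p => [|n IH] p; first by rewrite /en1 n1_0//; exact: nM.2.
  rewrite /en1 /= /cut; case: (b p); last by rewrite n1_0//; exact: nM.2.
  apply: le_trans (Mfix p).
  exact: (duh_en1 nu a p (mw n) nM IH).
have wd n p : en1 (fsub (w n.+1) (w n)) p <= D n p.
  elim: n p => [|n IH] p.
    apply: le_trans (wM 1%N p); rewrite lee_fin /n1; apply: ler_sum => c _.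
    by rewrite /fsub subr0.
  have [bp|bp] := boolP (b p); last first.
    rewrite /en1 n1_0; first exact: (nD n.+1).2.
    by move=> i; rewrite /fsub /= /cut (negbTE bp) subrr.
  have -> : en1 (fsub (w n.+2) (w n.+1)) p = en1 (fsub (duh nu a (w n.+1)) (duh nu a (w n))) p.
    by congr (_%:E); apply: eq_bigr => i _; rewrite /fsub /= /cut bp.
  apply: (le_trans (duh_sub a a (mw n.+1) (mw n) nM (wM n.+1) (wM n) (KKfin p bp))).
  rewrite n1_0 ?mule0 ?add0e; last by move=> i; rewrite subrr.
  apply: lee_pmul; [by nn|exact: (nnm_KK nu (nnm_en1 (mfield_sub (mw n.+1) (mw n))) nM).2|by []|].
  apply: le_KK; [exact: (nnm_en1 (mfield_sub (mw n.+1) (mw n))).2|exact: nM.2|exact: IH|by []].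
have wdc n p c : (`|w n.+1 p c - w n p c|)%:E <= D n p.
  by apply: le_trans (wd n p); rewrite lee_fin; exact: (n1_comp (fsub (w n.+1) (w n) p)).
have lim p c : b p -> cvgn (fun n => w n p c) /\
    forall n, (`|limn (fun n => w n p c) - w n p c|)%:E <= tail D n p.
  rewrite /b tailE// => bp; have [cw H] := summable_limit (fun n => (nD n).2 p) (fun n => wdc n p c) bp.
  by split=> // n; rewrite tailE.
have wz n p c : ~~ b p -> w n p c = 0%R.
  by move=> bp; case: n => [//|n] /=; rewrite /cut (negbTE bp).
pose W p c : R := limn (fun n => w n p c).
have Wz p c : ~~ b p -> W p c = 0%R.
  by move=> bp; rewrite /W (_ : (fun n => _) = cst 0%R) ?lim_cst//; apply/funext => n; exact: wz.
have Ww n p c : (`|W p c - w n p c|)%:E <= tail D n p.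
  have [bp|bp] := boolP (b p); first exact: (lim p c bp).2.
  by rewrite Wz// wz// subrr normr0; exact: (nT n).2.
have mW : mfield W.
  move=> c; apply: (measurable_fun_cvg (h := fun n p => w n p c)); first by move=> n; exact: mw.
  move=> p _; have [bp|bp] := boolP (b p); first exact: (lim p c bp).1.
  rewrite /= Wz// (_ : (fun n => _) = cst 0%R); first exact: cvg_cst.
  by apply/funext => n; exact: wz.
have tail0 p : b p -> tail D ^~ p @ \oo --> 0.
  rewrite /b tailE// => bp; rewrite (_ : tail D ^~ p = fun n => \sum_(n <= k <oo) D k p).
    by apply: nneseries_tail_cvg => // k _; exact: (nD k).2.
  by apply/funext => n; rewrite tailE.
(* The number of components plus one, so that [k] is positive even for an empty index type and
   [k * +oo = +oo]. *)
pose k := (#|I|%:R + 1)%R : R; have k0 : (0 <= k)%R by rewrite /k addr_ge0.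
have en1Ww n p : en1 (fsub W (w n)) p <= k%:E * tail D n p.
  have T0 := (nT n).2 p; move: T0 (Ww n p).
  case: (tail D n p) => [t| |]//; last by rewrite gt0_muley ?leey// lte_fin /k ltr_wpDl.
  rewrite lee_fin => t0 H; rewrite /en1 -EFinM lee_fin /n1.
  apply: (@le_trans _ _ (\sum_(i : I) t)%R).
    by apply: ler_sum => i _; have := H i; rewrite lee_fin.
  by rewrite sumr_const -[X in (X <= _)%R]mulr_natl; apply: ler_wpM2r => //; rewrite /k lerDl.
have kT p (z k' : R) (y : \bar R) : b p -> (forall n, y <= z%:E + k'%:E * tail D n.+1 p) -> y <= z%:E.
  move=> bp H; have : (fun n => z%:E + k'%:E * tail D n.+1 p) @ \oo --> z%:E + k'%:E * 0.
    apply: cvgeD => //; [exact: cvg_cst|apply: cvgeZl => //].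
    by rewrite (cvg_shiftS (tail D ^~ p)); exact: tail0.
  rewrite mule0 adde0 => ct; have := cvg_lim (@ereal_hausdorff R) ct => <-.
  by apply: lime_ge; [apply/cvg_ex; eexists; exact: ct|exact: nearW].
have WM p : en1 W p <= M p.
  have [bp|bp] := boolP (b p); last by rewrite /en1 n1_0; [exact: nM.2|move=> i; exact: Wz].
  have Mf : M p \is a fin_num by rewrite ge0_fin_numE; [exact: bM|exact: nM.2].
  rewrite -(fineK Mf); apply: (kT p _ k) => // n; rewrite (fineK Mf).
  apply: le_trans (leeD (wM n.+1 p) (en1Ww n.+1 p)); rewrite -EFinD lee_fin.
  exact: n1_le_sub.
exists M, W, b; split; first by [].
split; [by []|exact: WM|exact: Wz| |]; last first.
  apply: (filterS _ (summable_ae nD wD)) => t; apply: filterS => x; by rewrite /b tailE.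
move=> p c bp; split; first exact: KKfin.
apply/eqP; rewrite -subr_eq0 -normr_le0 -lee_fin; apply: (kT p 0%R (k + 1)%R) => // n; rewrite add0e.
have H1 := Ww n.+1 p c.
have H2 : (`|duh nu a W p c - w n.+1 p c|)%:E <= k%:E * tail D n.+1 p.
  rewrite /= /cut bp.
  apply: (@le_trans _ _ (en1 (fsub (duh nu a W) (duh nu a (w n))) p)).
    by rewrite lee_fin; exact: (n1_comp (fsub (duh nu a W) (duh nu a (w n)) p)).
  apply: (le_trans (duh_sub a a mW (mw n) nM WM (wM n) (KKfin p bp))).
  rewrite n1_0 ?mule0 ?add0e; last by move=> i; rewrite subrr.
  have nkT : nnm (fun q => k%:E * tail D n q) by have [m1 m0] := nT n; split; [ms|nn].
  apply: (@le_trans _ _ ((2 * C)%:E * KK nu (fun q => k%:E * tail D n q) M p)).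
    apply: lee_pmul; [by nn|exact: (nnm_KK nu (nnm_en1 (mfield_sub mW (mw n))) nM).2|by []|].
    apply: le_KK; [exact: (nnm_en1 (mfield_sub mW (mw n))).2|exact: nM.2|exact: en1Ww|by []].
  rewrite KKZl// muleCA; apply: lee_pmul; [by nn|apply: mule_ge0; [by nn|exact: (nnm_KK nu (nT n) nM).2]|by []|].
  rewrite (KK_nneseries nu p (fun j => nD (j + n)%N) nM) -nneseriesZl; last first.
    by move=> j _; exact: (nnm_KK nu (nD _) nM).2.
  by rewrite /tail; under [leRHS]eq_eseriesr do rewrite addnS.
rewrite EFinD ge0_muleDl; [|by nn|by nn]; rewrite mul1e addeC.
apply: le_trans (leeD H1 H2); rewrite -EFinD lee_fin.
have := ler_normB (W p c - w n.+1 p c)%R (duh nu a W p c - w n.+1 p c)%R.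
by rewrite opprB addrA subrK.
Qed.

(** * The exact solution and its perturbation equation *)

Hypothesis rsub : forall x y, (r x <= r y + r (sub x y))%R.
Hypothesis rne0 : {ae mu, forall x, r x != 0%R}.

Definition within (T s : R) : bool := (0 <= s <= T)%R.

Lemma mwithin T : measurable_fun setT (fun s : TT R => within T s).
Proof. by apply: measurable_and; apply: measurable_fun_ler. Qed.

Lemma time_bound (A T : R) (h : TT R -> \bar R) : (0 <= A)%R -> (0 <= T)%R -> (forall s, 0 <= h s) ->
  (forall s, h s <= A%:E) -> (forall s, ~~ within T s -> h s = 0) ->
  \int[lam]_s h s <= (A * T)%:E.
Proof.
move=> A0 T0 h0 hA hz.
apply: (@le_trans _ _ (\int[lam]_(s in `[0%R, T]%classic) (cst A%:E) s)).
  rewrite [leRHS]integral_mkcond; apply: ge0_le_integralT => // s; rewrite /patch mem_setE in_itv /=.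
  by rewrite -/(within T s); case: ifPn => [_|/hz ->].
have E : lam `[0%R, T]%classic = T%:E.
  have := lebesgue_measure_itv `[0%R, T]; rewrite /= lte_fin => ->.
  case: ifPn => [_|]; first by rewrite -EFinB subr0.
  by rewrite -leNgt => T0'; congr (_%:E); apply/eqP; rewrite eq_le T0 T0'.
rewrite integral_cst// EFinM; apply: lee_pmul => //.
by rewrite le_eqVlt; apply/orP; left; apply/eqP; exact: E.
Qed.

(** Null sets are preserved because the integral of an indicator is invariant under reflection. *)
Lemma ae_reflect c (Q : X -> Prop) : {ae mu, forall y, Q y} -> {ae mu, forall y, Q (sub c y)}.
Proof.
move=> [N [mN N0 sN]]; exists (sub c @^-1` N).
have mS : measurable_fun setT (sub c) by ms.
have mSN : measurable (sub c @^-1` N) by rewrite -[X in measurable X]setTI; exact: mS.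
split=> //; last by move=> y /= H; apply: sN.
have m1 : measurable_fun setT (fun y => (\1_N y)%:E : \bar R).
  by apply/measurable_EFinP; exact: measurable_indic.
have E : \int[mu]_y (\1_N (sub c y))%:E = 0.
  rewrite (reflect c m1) => [|y]; last by rewrite lee_fin.
  by rewrite integral_indic// setIT.
by have := integral_indic mu measurableT mSN; rewrite setIT => <-.
Qed.

Lemma NL_ae_l F F' G s x c : mfield F -> mfield F' -> mfield G ->
  {ae mu, forall y, forall i, F (s, y) i = F' (s, y) i} -> NL F G (s, x) c = NL F' G (s, x) c.
Proof.
move=> mF mF' mG FF; rewrite /NL /Rintegral; congr fine; apply: ae_eq_integral => //.
- by apply/measurable_EFinP; exact: mNLi.
- by apply/measurable_EFinP; exact: mNLi.
apply: filterS FF => y Hy _; rewrite /NLi/=; congr (B _ _ _ _)%:E; exact/funext.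
Qed.

Lemma NL_ae_r F G G' s x c : mfield F -> mfield G -> mfield G' ->
  {ae mu, forall y, forall i, G (s, y) i = G' (s, y) i} -> NL F G (s, x) c = NL F G' (s, x) c.
Proof.
move=> mF mG mG' GG; rewrite /NL /Rintegral; congr fine; apply: ae_eq_integral => //.
- by apply/measurable_EFinP; exact: mNLi.
- by apply/measurable_EFinP; exact: mNLi.
apply: filterS (ae_reflect x GG) => y Hy _; rewrite /NLi/=; congr (B _ _ _ _)%:E; exact/funext.
Qed.

Definition cutb (T : R) (f : P -> \bar R) (p : P) : \bar R := (before T p.1)%:E * f p.

Lemma nnm_cutb T f : nnm f -> nnm (cutb T f).
Proof. by move=> [mf f0]; rewrite /cutb; split; [ms|nn]. Qed.

Lemma cutb_le T f p : 0 <= f p -> cutb T f p <= f p.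
Proof.
move=> f0; rewrite /cutb /before; case: ifP => _; first by rewrite mul1e.
by rewrite mul0e.
Qed.

Lemma cutbE (T : R) f p : (p.1 <= T :> R)%R -> cutb T f p = f p.
Proof. by move=> pT; rewrite /cutb /before pT mul1e. Qed.

Lemma cutb0 (T : R) f p : (T < p.1 :> R)%R -> cutb T f p = 0.
Proof. by move=> pT; rewrite /cutb /before leNgt pT mul0e. Qed.

(** The heat kernel vanishes at times later than [p.1], so only arguments before [T] are used. *)
Lemma KK_cutb nu T f g p : (p.1 <= T :> R)%R -> KK nu (cutb T f) (cutb T g) p = KK nu f g p.
Proof.
move=> pT; apply: eq_integral => s _; rewrite ker_before /before.
case: ifPn => [sp|]; last by rewrite mul0r !mul0e.
have sT : (s <= T :> R)%R := le_trans sp pT.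
by congr (_ * (_ * _)); apply: eq_integral => y _; rewrite !cutbE.
Qed.

(** [KK_rinv] bounds the integral of [r^-1 * KK] by the square of the mass times the length of the
    interval; since [r] is almost everywhere nonzero, [KK] itself is finite almost everywhere. *)
Lemma KK_ae_fin nu (T A : R) g t : (0 <= nu)%R -> (0 <= T)%R -> (0 <= A)%R -> nnm g ->
  (forall p, ~~ within T p.1 -> g p = 0) -> (forall s, mass g s <= A%:E) ->
  {ae mu, forall x, KK nu g g (t, x) < +oo}.
Proof.
move=> nu0 T0 A0 ng gz gA; have [mK K0] := nnm_KK nu ng ng; have [mm m0] := nnm_mass ng.
have H : \int[mu]_x ((r x)^-1%:E * KK nu g g (t, x)) < +oo.
  apply: le_lt_trans (KK_rinv t nu0 ng ng) _.
  apply: (@le_lt_trans _ _ (A * A * T)%:E); last by rewrite ltry.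
  apply: time_bound => //; first by rewrite mulr_ge0.
  - by move=> s; nn.
  - by move=> s; rewrite EFinM; apply: lee_pmul.
  - by move=> s sT; rewrite /mass; under eq_integral do rewrite gz//; rewrite integral0 mul0e.

have H' : {ae mu, forall x, (r x)^-1%:E * KK nu g g (t, x) < +oo} by apply: (nnm_finite_ae _ H); split; [ms|nn].
apply: filterS2 H' rne0 => x Hx rx; rewrite ltNge leye_eq; apply/negP => /eqP KE; move: Hx.
by rewrite KE gt0_muley ?ltxx// lte_fin invr_gt0 lt_def rx r0.
Qed.

(** Of the two factors [1 + r], one absorbs the [r^-1] of [X^-1] and the other remains as a weight
    on the mass, which lets convolution bounds propagate one derivative in [L^2]. The weight is
    submultiplicative because [r] is subadditive. *)
Definition om (x : X) : R := ((1 + r x) ^+ 2)%R.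

(* The exact solution [V], extended by zero to negative times, in integrated form off a null set. *)
Record mild_field (nu : R) (u0 : X -> I -> R) (V : P -> I -> R) (bV : P -> bool) : Prop := MildField {
  mild_init : forall c, measurable_fun setT (fun x => u0 x c);
  mild_meas : mfield V;
  mild_good : measurable_fun setT bV;
  mild_z : forall p c, r p.2 = 0%R \/ (p.1 < 0 :> R)%R -> V p c = 0%R;
  mild_eq : forall p c, bV p -> V p c = duh nu u0 V p c;
  mild_ae : {ae lam, forall t, (0 <= t :> R)%R -> {ae mu, forall x, bV (t, x)}};
  mild_bd : forall T : R, exists2 A : R, (0 <= A)%R & forall t : TT R, within T t ->
    \int[mu]_x ((r x)^-1%:E * ((om x)%:E * en1 V (t, x))) <= A%:E }.

Lemma om_ge x : (1 + r x <= om x)%R.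
Proof. by rewrite /om expr2; have := r0 x; nra. Qed.

Lemma rom x : (r x <= om x)%R.
Proof. by have := om_ge x; lra. Qed.

Lemma omM x y : (om x <= om y * om (sub x y))%R.
Proof.
rewrite /om -exprMn ler_sqr ?nnegrE ?addr_ge0// ?mulr_ge0 ?addr_ge0//.
by have := rsub x y; have := r0 y; have := r0 (sub x y); nra.
Qed.

Lemma mom : measurable_fun setT om.
Proof. by rewrite /om; ms. Qed.

Lemma mass_le_om (h : X -> \bar R) : (forall x, 0 <= h x) -> (forall x, r x = 0%R -> h x = 0) ->
  \int[mu]_x ((1 + r x)%:E * h x) <= \int[mu]_x ((r x)^-1%:E * ((om x)%:E * h x)).
Proof.
move=> h0 hz; apply: le_trans (@mass_le_weight (fun x => 1 + r x)%R (fun x => (1 + r x)%:E * h x) _ _ _) _.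
- by move=> x; rewrite lerDr.
- by move=> x; nn.
- by move=> x rx; rewrite hz ?mule0.
apply: ge0_le_integralT => x; first by nn.
apply: lee_pmul; [by nn|by nn|by []|].
by rewrite muleA -EFinM /om expr2.
Qed.

Lemma pert_ae D D' F G s x c : mfield D -> mfield D' -> mfield F -> mfield G ->
  {ae mu, forall y, forall i, D (s, y) i = D' (s, y) i} -> pert D F G (s, x) c = pert D' F G (s, x) c.
Proof. by move=> mD mD' mF mG H; rewrite /pert (NL_ae_l _ _ mD mD' mF H) (NL_ae_r _ _ mG mD mD' H). Qed.

(** Subtracting the two Duhamel equations is legitimate where all integrals converge; [b'] collects
    these points and [v] is 0 elsewhere. The common majorant [g] of [v], [V] and [W] is cut to the
    window [[0, T]], which makes its time integrals finite. *)
Lemma perturbation (nu T e : R) (u0 a : X -> I -> R) (V W : P -> I -> R) (bV b : P -> bool) (M : P -> \bar R) :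
  (0 < nu)%R -> (0 <= e)%R -> (0 <= T)%R -> mild_field nu u0 V bV ->
  (forall c, measurable_fun setT (fun x => a x c)) ->
  nnm M -> (forall p, r p.2 = 0%R \/ (p.1 < 0 :> R)%R -> M p = 0) ->
  (forall t, \int[mu]_x ((r x)^-1%:E * ((om x)%:E * M (t, x))) <= (2 * e)%:E) ->
  mfield W -> measurable_fun setT b -> (forall p, en1 W p <= M p) ->
  (forall p c, b p -> W p c = duh nu a W p c) ->
  {ae lam, forall t, {ae mu, forall x, b (t, x)}} ->
  exists v : P -> I -> R, exists b' : P -> bool, exists g : P -> \bar R, exists A : R,
  [/\ mfield v, measurable_fun setT b',
    forall p c, ~~ b' p -> v p c = 0%R,
    {ae lam, forall t, within T t -> {ae mu, forall x, b' (t, x)}} &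
    forall p, b' p -> [/\ within T p.1, (0 < r p.2)%R, b p, bV p & forall c, v p c = W p c - V p c]%R] /\
  [/\ nnm g, forall p, ~~ within T p.1 -> g p = 0,
    forall p, en1 v p <= g p /\ (within T p.1 -> en1 V p <= g p /\ en1 W p <= g p),
    (0 <= A)%R /\ forall t, \int[mu]_x ((1 + r x)%:E * g (t, x)) <= A%:E &
    forall p c, b' p -> KK nu g g p < +oo /\
      v p c = (ker nu p.1 0 p.2 * (a p.2 c - u0 p.2 c) - duh_int nu (pert v W V) p c)%R].
Proof.
move=> nu0 e0 T0 [mu0 mV mbV Vz Veq Vae Vbd] ma nM Mz Mx mW mb WM Weq Wae.
have [AV AV0 VA] := Vbd T.
have nV := nnm_en1 mV; have nW := nnm_en1 mW; have [mM M0] := nM; have [mV1 V10] := nV.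
pose MM p := M p + en1 V p.
have nMM : nnm MM by rewrite /MM; split; [ms|nn].
have MMz p : r p.2 = 0%R \/ (p.1 < 0 :> R)%R -> MM p = 0.
  move=> H; rewrite /MM Mz// add0e; congr (_%:E); apply: n1_0 => i; exact: Vz.
pose g := cutb T MM.
have ng : nnm g := nnm_cutb T nMM.
have gz p : ~~ within T p.1 -> g p = 0.
  rewrite /within negb_and -!ltNge => /orP[H|H]; last by rewrite /g cutb0.
  by rewrite /g /cutb MMz ?mule0//; right.
have [mg g0] := ng.
have gA t : \int[mu]_x ((1 + r x)%:E * g (t, x)) <= (2 * e + AV)%:E.
  have [H|H] := boolP (within T t); last first.
    under eq_integral do rewrite gz// mule0; rewrite integral0 lee_fin; lra.
  have tT : (t <= T :> R)%R by case/andP: H.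
  apply: le_trans (mass_le_om (h := fun x => g (t, x)) _ _) _.
  - by move=> x; exact: g0.
  - by move=> x rx; rewrite /g /cutb MMz ?mule0//; left.
  have mMt : measurable_fun setT (fun x => M (t, x)) by ms.
  have om0 x : (0 <= om x)%R by exact: sqr_ge0.
  have mom' := mom.
  rewrite EFinD; apply: (@le_trans _ _ (\int[mu]_x ((r x)^-1%:E * ((om x)%:E * M (t, x)) +
      (r x)^-1%:E * ((om x)%:E * en1 V (t, x))))).
    apply: ge0_le_integralT => x; first by nn.
    rewrite /g cutbE// /MM ge0_muleDr; [|exact: M0|exact: V10].
    by rewrite ge0_muleDr; [|by nn|by nn].
  rewrite ge0_integralD//; [|by nn|by ms|by nn|by ms].
  by apply: leeD; [exact: Mx|exact: VA].
pose b' (p : P) := [&& within T p.1, (0 < r p.2)%R, b p, bV p & (KK nu g g p < +oo)].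
have mb' : measurable_fun setT b'.
  have [mK K0] := nnm_KK nu ng ng.
  apply: measurable_and; first by apply: (measurableT_comp (mwithin T) (g := fst)); ms.
  apply: measurable_and; first by apply: measurable_fun_ltr; ms.
  apply: measurable_and => //; apply: measurable_and => //.
  by apply: measurable_fun_lte; ms.
pose v := cut b' (fsub W V).
have mF : mfield (fsub W V) := mfield_sub mW mV.
have mv : mfield v by exact: mfield_cut.
have A0 : (0 <= 2 * e + AV)%R by lra.
have massg t : mass g t <= (2 * e + AV)%:E.
  apply: le_trans (gA t); apply: ge0_le_integralT => x; first exact: g0.
  by rewrite -[leLHS]mul1e; apply: lee_pmul; [by []|exact: g0|rewrite lee_fin lerDl|by []].
have ae' : {ae lam, forall t, within T t -> {ae mu, forall x, b' (t, x)}}.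
  apply: filterS2 Wae Vae => t Wt Vt Tt.
  have Kt := KK_ae_fin t (ltW nu0) T0 A0 ng gz massg.
  have {}Vt := Vt (proj1 (andP Tt)).
  apply: filterS2 (filterI Wt Vt) (filterI Kt rne0) => x [Wx Vx] [Kx rx].
  by apply/and5P; split => //=; rewrite lt_def rx r0.
exists v, b', g, (2 * e + AV)%R; split.
  split=> //.
  - by move=> p c; rewrite /v /cut => /negbTE ->.
  - by move=> p bp; case/and5P: (bp) => Tp rp bp' Vp _; split=> // c; rewrite /v /cut bp.
split=> //.
- move=> p; split=> [|Tp]; last first.
    rewrite /g cutbE; last by case/andP: Tp.
    by split; [rewrite /MM leeDr//|apply: le_trans (WM p) _; rewrite /MM leeDl//].
  have [bp|bp] := boolP (b' p); last first.
    by rewrite /en1 n1_0; [exact: g0|move=> i; rewrite /v /cut (negbTE bp)].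
  have [Tp _ _ _ _] := and5P bp.
  rewrite /g cutbE; last by case/andP: Tp.
  rewrite (_ : en1 v p = en1 (fsub W V) p); last by rewrite /en1 /v /cut bp.
  by apply: le_trans (en1_sub W V p) _; apply: leeD => //; exact: WM.
move=> p c bp; have [Tp rp Wp Vp Kp] := and5P bp; split=> //.
have {}Kp : KK nu MM MM p < +oo by rewrite -(@KK_cutb nu T)//; case/andP: Tp.
have WMM q : en1 W q <= MM q by apply: le_trans (WM q) _; rewrite /MM leeDl.
have VMM q : en1 V q <= MM q by rewrite /MM leeDr.
rewrite /v /cut bp /fsub Weq// Veq// /duh.
have := duh_int_diff c mW mV nMM WMM VMM Kp.
(* Inside the integral [v] may replace [W - V]: at almost every time of the window they agree at
   almost every frequency, and at negative times all fields vanish. *)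
have -> : duh_int nu (pert (fsub W V) W V) p c = duh_int nu (pert v W V) p c.
  rewrite /duh_int /Rintegral; congr fine; apply: ae_eq_integral => //.
  - by apply/measurable_EFinP; apply: mker_N; exact: mfield_pert.
  - by apply/measurable_EFinP; apply: mker_N; exact: mfield_pert.
  case: ae' => N [mN N0 sN]; exists N; split=> // s /= H; apply: sN => /= Hs; apply: H => _; congr (_%:E).
  have [sp|sp] := leP s p.1; last by rewrite /ker leNgt sp !mul0r.
  congr (_ * _)%R; apply: pert_ae => //.
  have [s0|s0] := leP 0%R (s : R).
    have sT : within T s by rewrite /within s0; case/andP: Tp => _; exact: le_trans.
    by apply: filterS (Hs sT) => y by' i; rewrite /v /cut by'.
  apply: aeW => y i; rewrite /v /cut; case: ifP => // _.
  have Wz : W (s, y) i = 0%R.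
    apply/eqP; rewrite -normr_le0; apply: le_trans (n1_comp _ _) _.
    by rewrite -lee_fin; apply: le_trans (WM (s, y)) _; rewrite Mz//; right.
  by rewrite /fsub Wz Vz ?subr0//; right.
move: (duh_int _ _ _ _) (duh_int _ _ _ _) (duh_int _ _ _ _) (ker _ _ _ _) => x y z k H.
by rewrite -H; ring.
Qed.
(** The majorant [g] is available only inside the window; outside, [D] and with it the bilinear
    terms vanish. *)
Lemma pert_bound_within T D F G g p c : mfield D -> mfield F -> mfield G -> nnm g ->
  (forall q, within T q.1 -> en1 F q <= g q /\ en1 G q <= g q) ->
  (forall q i, ~~ within T q.1 -> D q i = 0%R) ->
  (`|pert D F G p c|)%:E <= (2 * C1 * r p.2)%:E * cv (en1 D) g p.
Proof.
move=> mD mF mG ng FGg Dz; have [Tp|Tp] := boolP (within T p.1).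
  pose b (q : P) := within T q.1.
  have mb : measurable_fun setT b by apply: (measurableT_comp (mwithin T) (g := fst)); ms.
  have E H : mfield H -> NL D H p c = NL D (cut b H) p c.
    by move=> mH; apply: eq_Rintegral => y _; congr (B _ _ _ _); apply/funext => i; rewrite /cut /b /= Tp.
  have E' H : mfield H -> NL H D p c = NL (cut b H) D p c.
    by move=> mH; apply: eq_Rintegral => y _; congr (B _ _ _ _); apply/funext => i; rewrite /cut /b /= Tp.
  rewrite /pert E// E'//; apply: pert_bound => //; [exact: mfield_cut|exact: mfield_cut| |].
  - by move=> q; rewrite /en1 /cut; have [/FGg[]|_] := boolP (b q); [|rewrite n1_0//; exact: ng.2].
  - by move=> q; rewrite /en1 /cut; have [/FGg[]|_] := boolP (b q); [|rewrite n1_0//; exact: ng.2].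
have nF := nnm_en1 mF; have nG := nnm_en1 mG; have [m1 p1] := nF; have [m2 p2] := nG.
have nFG : nnm (fun q => en1 F q + en1 G q) by split; [ms|nn].
apply: (@le_trans _ _ ((2 * C1 * r p.2)%:E * cv (en1 D) (fun q => en1 F q + en1 G q) p)).
  apply: pert_bound => // q; [by rewrite leeDl|by rewrite leeDr].
have Dz' y : en1 D (p.1, y) = 0 by rewrite /en1 n1_0// => i; exact: Dz.
rewrite /cv; under eq_integral do rewrite Dz' mul0e.
rewrite integral0 mule0; have [m3 p3] := nnm_cv (nnm_en1 mD) ng.
by apply: mule_ge0; [nn|exact: (p3 p)].
Qed.

Lemma perturbation_le nu T w0 v V W g p : mfield v -> mfield V -> mfield W -> nnm g ->
  (forall q, within T q.1 -> en1 V q <= g q /\ en1 W q <= g q) ->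
  (forall q i, ~~ within T q.1 -> v q i = 0%R) ->
  (forall c, v p c = (ker nu p.1 0 p.2 * w0 p.2 c - duh_int nu (pert v W V) p c)%R) ->
  en1 v p <= (ker nu p.1 0 p.2)%:E * (n1 (w0 p.2))%:E + (2 * C)%:E * KK nu (en1 v) g p.
Proof.
move=> mv mV mW ng VWg vz veq; have nv := nnm_en1 mv.
apply: (@le_trans _ _ (n1 (fun i => ker nu p.1 0 p.2 * w0 p.2 i)%R + n1 (duh_int nu (pert v W V) p))%:E).
  rewrite /en1 lee_fin (_ : v p = fun i => (ker nu p.1 0 p.2 * w0 p.2 i - duh_int nu (pert v W V) p i)%R).
    exact: n1_sub.
  by apply/funext => i; exact: veq.
rewrite EFinD n1Z ?ker_ge0// EFinM; apply: leeD; first by [].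
have [mK K0] := nnm_KK nu nv ng.
apply: n1_le => // c; apply: duh_int_bound; [exact: mfield_pert|exact: nv|exact: ng|by rewrite mulr_ge0|].
by move=> q; apply: (@pert_bound_within T) => // q' /VWg[].
Qed.

(** The [L^2] estimate is applied to [(1 + r) |v|]: the weight [1 + r] is submultiplicative, so it
    passes through the convolution, and the weighted [g] still has bounded mass. The outcome is the
    [H^1] bound on the window. *)
Lemma perturbation_L2 (nu T A E0 : R) (w0 : X -> I -> R) (v : P -> I -> R) (g : P -> \bar R) :
  (0 < nu)%R -> (0 <= T)%R -> (0 <= A)%R -> (forall c, measurable_fun setT (fun x => w0 x c)) ->
  mfield v -> nnm g -> (forall p, ~~ within T p.1 -> g p = 0) -> (forall p, en1 v p <= g p) ->
  (forall t, \int[mu]_x ((1 + r x)%:E * g (t, x)) <= A%:E) ->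
  \int[mu]_x (((1 + r x) * n1 (w0 x)) * ((1 + r x) * n1 (w0 x)))%:E <= E0%:E ->
  (forall p, en1 v p <= (ker nu p.1 0 p.2)%:E * (n1 (w0 p.2))%:E + (2 * C)%:E * KK nu (en1 v) g p) ->
  exists2 K : R, (0 <= K)%R & forall t,
    \int[mu]_x (((1 + r x) * n1 (v (t, x))) * ((1 + r x) * n1 (v (t, x))))%:E <= K%:E.
Proof.
move=> nu0 T0 A0 mw0 mv ng gz vg gA w0E vle; have nv := nnm_en1 mv; have [mg g0] := ng.
have mn : measurable_fun setT (fun x => n1 (w0 x)) by exact: mn1.
have n10 x : (0 <= n1 (w0 x))%R by exact: n1_ge0.
have twoC : (0 <= 2 * C)%R by rewrite mulr_ge0// ltW.
have [k [k0 H]] := mild_L2 E0 nu0 twoC A0.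
pose om1 x := (1 + r x)%R.
have om10 x : (0 <= om1 x)%R by rewrite /om1; nn.
have mom1 : measurable_fun setT om1 by rewrite /om1; ms.
have om1M x y : (om1 x <= om1 y * om1 (sub x y))%R.
  by rewrite /om1; have := rsub x y; have := r0 y; have := r0 (sub x y); nra.
pose f (p : P) := (om1 p.2)%:E * en1 v p.
pose g' (p : P) := (om1 p.2)%:E * g p.
have [mev ev0] := nv.
have nf : nnm f by rewrite /f; split; [ms|nn].
have ng' : nnm g' by rewrite /g'; split; [ms|nn].
have fg p : f p <= g' p by apply: lee_pmul; [nn|nn|by []|exact: vg].
have fz p : ~~ within T p.1 -> f p = 0.
  move=> pT; apply/eqP; rewrite eq_le (nf.2 p) andbT; apply: le_trans (fg p) _.
  by rewrite /g' gz// mule0.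
have fA t : mass f t <= A%:E.
  by apply: le_trans (gA t); apply: ge0_le_integralT => x; [exact: nf.2|exact: fg].
have E00 : (0 <= E0)%R.
  rewrite -lee_fin; apply: le_trans w0E; apply: integral_ge0 => x _.
  by rewrite lee_fin -expr2 sqr_ge0.
have B1 := H 0%R (fun x => (om1 x)%:E * (n1 (w0 x))%:E) f g'.
exists (4 * E0 * expR (k * T))%R; first by rewrite !mulr_ge0// expR_ge0.
move=> t; have [tT|tT] := boolP (within T t); last first.
  rewrite (_ : (fun x => _) = (fun x => f (t, x) * f (t, x))); last first.
    by apply/funext => x; rewrite /f /en1 /om1 -!EFinM.
  under eq_integral do rewrite fz// mul0e; rewrite integral0 lee_fin !mulr_ge0// expR_ge0//.
apply: (@le_trans _ _ (4 * E0 * expR (k * (t - 0)))%:E); last first.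
  rewrite lee_fin; apply: ler_wpM2l; first by rewrite mulr_ge0.
  by rewrite ler_expR; apply: ler_wpM2l; [exact: ltW|rewrite subr0; case/andP: tT].
rewrite (_ : (fun x => _) = (fun x => f (t, x) * f (t, x))); last first.
  by apply/funext => x; rewrite /f /en1 /om1 -!EFinM.
apply: B1 => //.
- by ms.
- by nn.
- by move=> p; rewrite /f /en1 -EFinM ltry.
- move=> l l0; apply: (wmass_fin l0 A0 nf) => // p tp.
  by apply: fz; rewrite /within negb_and -ltNge tp.
- by apply: aeW => s; exact: gA.
move=> p; apply: (@le_trans _ _ ((om1 p.2)%:E * ((ker nu p.1 0 p.2)%:E * (n1 (w0 p.2))%:E +
    (2 * C)%:E * KK nu (en1 v) g p))); first by apply: lee_pmul; [nn|nn|by []|exact: vle].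
have [mK K0] := nnm_KK nu nv ng.
rewrite ge0_muleDr; [|by nn|by nn]; rewrite muleCA; apply: leeD; first by [].
rewrite muleCA; apply: lee_pmul; [by nn|by nn|by []|exact: KK_weight].
Qed.

(** * Real-valued integrals: linearity and Fubini *)

Definition L1 d' (T : measurableType d') (m : {measure set T -> \bar R}) (h : T -> R) :=
  m.-integrable setT (EFin \o h).
Notation RI m h := (Rintegral m setT h).

Lemma L1_meas d' (T : measurableType d') (m : {measure set T -> \bar R}) (h : T -> R) :
  L1 m h -> measurable_fun setT h.
Proof. by move=> /integrableP[/measurable_EFinP]. Qed.

Lemma L1_dom d' (T : measurableType d') (m : {measure set T -> \bar R}) (h g : T -> R) :
  L1 m g -> measurable_fun setT h -> (forall x, `|h x| <= `|g x|)%R -> L1 m h.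
Proof.
move=> ig mh hg; apply: (le_integrable measurableT _ _ ig); first exact/measurable_EFinP.
by move=> x _; rewrite /= lee_fin.
Qed.

Lemma L1_fin d' (T : measurableType d') (m : {measure set T -> \bar R}) (h : T -> R) :
  measurable_fun setT h -> \int[m]_x (`|h x|)%:E < +oo -> L1 m h.
Proof. by move=> mh fin; apply/integrableP; split; [exact/measurable_EFinP|]. Qed.

Lemma L1D d' (T : measurableType d') (m : {measure set T -> \bar R}) (h g : T -> R) :
  L1 m h -> L1 m g -> L1 m (fun x => h x + g x)%R.
Proof. by move=> ih ig; exact: (integrableD measurableT ih ig). Qed.

Lemma L1B d' (T : measurableType d') (m : {measure set T -> \bar R}) (h g : T -> R) :
  L1 m h -> L1 m g -> L1 m (fun x => h x - g x)%R.
Proof. by move=> ih ig; exact: (integrableB measurableT ih ig). Qed.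

Lemma L1Z d' (T : measurableType d') (m : {measure set T -> \bar R}) (k : R) (h : T -> R) :
  L1 m h -> L1 m (fun x => k * h x)%R.
Proof. by move=> ih; exact: (integrableZl measurableT k ih). Qed.

Lemma ae_mono d' (T : measurableType d') (m : {measure set T -> \bar R}) (A A' : T -> Prop) :
  {ae m, forall x, A x} -> (forall x, A x -> A' x) -> {ae m, forall x, A' x}.
Proof. by move=> [N [mN N0 sN]] AA; exists N; split=> // x /= H; apply: sN => /= /AA. Qed.

Lemma RI_ae d' (T : measurableType d') (m : {measure set T -> \bar R}) (h g : T -> R) :
  measurable_fun setT h -> measurable_fun setT g -> {ae m, forall x, h x = g x} -> RI m h = RI m g.
Proof.
move=> mh mg hg; congr fine; apply: ae_eq_integral => //; [exact/measurable_EFinP..|].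
by case: hg => N [mN N0 sN]; exists N; split=> // x /= H; apply: sN => /= hx; apply: H => _; rewrite hx.
Qed.

Section RIlinear.
Context d' (T : measurableType d') (m : {measure set T -> \bar R}).
Implicit Types h g : T -> R.

Lemma RIZ (k : R) h : L1 m h -> RI m (fun x => k * h x)%R = (k * RI m h)%R.
Proof. by move=> ih; exact: RintegralZl. Qed.

Lemma RIZr (k : R) h : L1 m h -> RI m (fun x => h x * k)%R = (RI m h * k)%R.
Proof. by move=> ih; exact: RintegralZr. Qed.

Lemma RIB h g : L1 m h -> L1 m g -> RI m (fun x => h x - g x)%R = (RI m h - RI m g)%R.
Proof. by move=> ih ig; exact: RintegralB. Qed.

Lemma RID h g : L1 m h -> L1 m g -> RI m (fun x => h x + g x)%R = (RI m h + RI m g)%R.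
Proof. by move=> ih ig; exact: RintegralD. Qed.

Lemma L1_eq h g : L1 m h -> (forall x, h x = g x) -> L1 m g.
Proof. by move=> ih hg; rewrite (_ : g = h)//; apply/funext => x. Qed.

Lemma RI_eq h g : (forall x, h x = g x) -> RI m h = RI m g.
Proof. by move=> hg; apply: eq_Rintegral => x _. Qed.

Lemma L1_bounded h g (b : R) : L1 m g -> measurable_fun setT h -> (forall x, `|h x| <= b)%R ->
  L1 m (fun x => h x * g x)%R.
Proof.
move=> ig mh hb; have mg := L1_meas ig; apply: L1_dom (L1Z b ig) _ _; first by ms.
move=> x; rewrite !normrM; apply: ler_wpM2r => //.
exact: le_trans (hb x) (ler_norm b).
Qed.

End RIlinear.

Section FubiniR.
Context d1 d2 (T1 : measurableType d1) (T2 : measurableType d2).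
Variables (m1 : {sigma_finite_measure set T1 -> \bar R}).
Variables (m2 : {sigma_finite_measure set T2 -> \bar R}).
Variable h : T1 -> T2 -> R.
Hypothesis mh : measurable_fun setT (fun p : T1 * T2 => h p.1 p.2).
Hypothesis ih : \int[m1]_x \int[m2]_y (`|h x y|)%:E < +oo.

Lemma fubini_L1 : (m1 \x m2).-integrable setT (fun p : T1 * T2 => (h p.1 p.2)%:E).
Proof. by apply/integrable12ltyP => //; exact/measurable_EFinP. Qed.

Lemma L1_RI : L1 m1 (fun x => RI m2 (h x)).
Proof.
have H := integrable_fubini_F fubini_L1.
have A := ae_integrable1 fubini_L1.
apply: L1_fin; first by apply: (measurable_Rintegral m2 (h := h)).
move/integrableP: H => [_]; apply: le_lt_trans.
apply: ge0_le_integralT => x; first by rewrite lee_fin.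
by rewrite /Rintegral /fubini_F /=; case: (integral _ _ _) => [z| |] //=; rewrite normr0 leey.
Qed.

Lemma fubiniR : RI m1 (fun x => RI m2 (h x)) = RI m2 (fun y => RI m1 (h ^~ y)).
Proof.
have A1 := ae_integrable1 fubini_L1; have A2 := ae_integrable2 fubini_L1.
transitivity (fine (\int[m1]_x \int[m2]_y (h x y)%:E)).
  congr fine; apply: ae_eq_integral => //.
  - by apply/measurable_EFinP; apply: (measurable_Rintegral m2 (h := h)).
  - exact: (measurable_fubini_F fubini_L1).
  - case: A1 => N [mN N0 sN]; exists N; split=> // x /= H; apply: sN => /= ix; apply: H => _.
    by rewrite /Rintegral fineK//; exact: integrable_fin_num.
rewrite (Fubini fubini_L1); congr fine; apply: ae_eq_integral => //.
- exact: (measurable_fubini_G fubini_L1).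
- apply/measurable_EFinP; apply: (measurable_Rintegral m1 (h := fun y x => h x y)).
  by apply: (measurableT_comp mh (g := fun q : T2 * T1 => (q.2, q.1))); ms.
- case: A2 => N [mN N0 sN]; exists N; split=> // x /= H; apply: sN => /= ix; apply: H => _.
  by rewrite /Rintegral fineK//; exact: integrable_fin_num.
Qed.
End FubiniR.

(** * The energy identity at a single frequency *)

Definition ek (k t s : R) : R := (if s <= t then expR (- k * (t - s)) else 0)%R.

(** By the fundamental theorem of calculus, [k exp(- k (q - s))] integrates from [s] to [t] to
    [1 - exp(- k (t - s))]; both sides vanish for [t < s]. *)
Lemma exp_primitive (k : R) (s t : TT R) : (0 <= k)%R ->
  RI lam (fun q : TT R => before t q * (k * ek k q s))%R =
  (before t s - ek k t s)%R.
Proof.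
move=> k0; rewrite /before /ek; have [st|ts] := leP s t; last first.
  rewrite subr0 (_ : (fun q => _) = cst 0%R) ?/Rintegral; first by rewrite integral0.
  apply/funext => q; have [qt|] := leP q t; last by rewrite mul0r.
  by rewrite leNgt (le_lt_trans qt ts) !mulr0.
transitivity (Rintegral (@lebesgue_measure R) `[s : R, t : R] (fun q : R => k * expR (- k * (q - s)))%R).
  rewrite [RHS]Rintegral_mkcond; apply: eq_Rintegral => q _; rewrite /patch mem_setE in_itv/=.
  by case: (q <= t)%R; case: (s <= q)%R; rewrite /= ?mul1r ?mul0r ?mulr0.
move: st; rewrite le_eqVlt => /orP[/eqP ->|st].
  by rewrite set_itv1 Rintegral_set1 subrr mulr0 expR0 subrr.
have dF (q : R) : is_derive q (1%R : R) (fun q : R => - expR (- k * (q - s)))%R (k * expR (- k * (q - s)))%R.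
  by apply: is_derive_eq; rewrite /GRing.scale/=; ring.
have cE : continuous (fun q : R => expR (- k * (q - s)))%R.
  move=> q; apply: continuous_comp; last exact: continuous_expR.
  by apply: continuousM; [exact: cst_continuous|apply: cvgB; [exact: cvg_id|exact: cvg_cst]].
have cF : continuous (fun q : R => - expR (- k * (q - s)))%R by move=> q; apply: cvgN; exact: cE.
have cf : continuous (fun q : R => k * expR (- k * (q - s)))%R.
  by move=> q; apply: cvgM; [exact: cvg_cst|exact: cE].
rewrite /Rintegral (@continuous_FTC2 _ _ (fun q : R => - expR (- k * (q - s)))%R _ _ st).
- by rewrite /= subrr mulr0 expR0 opprK addrC.
- exact: continuous_subspaceT.
- split=> [q _| |]; first exact: ex_derive.
  + by apply: cvg_at_right_filter; exact: cF.
  + by apply: cvg_at_left_filter; exact: cF.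
- by move=> q _; rewrite derive1E; exact: derive_val.
Qed.

Lemma ek_ge0 k t s : (0 <= ek k t s)%R.
Proof. by rewrite /ek; case: ifP => // _; exact: expR_ge0. Qed.

Lemma ek_le1 k t s : (0 <= k)%R -> (ek k t s <= 1)%R.
Proof.
move=> k0; rewrite /ek; case: ifP => // st; rewrite -expR0 ler_expR.
by rewrite mulNr oppr_le0 mulr_ge0 ?subr_ge0.
Qed.

Lemma mek k d' (T : measurableType d') (a b : T -> TT R) : measurable_fun setT a ->
  measurable_fun setT b -> measurable_fun setT (fun x => ek k (a x) (b x)).
Proof. by move=> ma mb; rewrite /ek; ms. Qed.

Lemma before_le1 t s : (before t s <= 1)%R.
Proof. by rewrite /before; case: ifP. Qed.

Lemma L1_within (T c : R) : (0 <= T)%R -> L1 lam (fun s => if within T s then c else 0)%R.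
Proof.
move=> T0; apply: L1_fin.
  by apply: measurable_fun_ifT => //; exact: mwithin.
apply: (@le_lt_trans _ _ (`|c| * T)%:E); last by rewrite ltry.
apply: time_bound => //.
- by move=> s; case: ifP => _; rewrite lee_fin// normr0.
- by move=> s /negbTE ->; rewrite normr0.
Qed.

(** The triangle [s <= t] and its mirror image cover the plane up to the null diagonal, and the
    integrand [G t * G s] is symmetric. This replaces the chain rule for the square of a
    primitive. *)
Lemma RI_square (G : TT R -> R) : L1 lam G ->
  (2 * RI lam (fun t => G t * RI lam (fun s => before t s * G s)) = RI lam G ^+ 2)%R.
Proof.
move=> iG; have mG := L1_meas iG.
have mGG : measurable_fun setT (fun p : TT R * TT R => G p.1 * (before p.1 p.2 * G p.2))%R by ms.
have iB t : L1 lam (fun s => before t s * G s)%R.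
  apply: L1_dom iG _ _; first by ms.
  by move=> s; rewrite normrM ger0_norm ?before_ge0// ler_piMl// before_le1.
have iB' t : L1 lam (fun s => before s t * G s)%R.
  apply: L1_dom iG _ _; first by ms.
  by move=> s; rewrite normrM ger0_norm ?before_ge0// ler_piMl// before_le1.
have E t : (RI lam (fun s => before t s * G s) = RI lam G - RI lam (fun s => before s t * G s))%R.
  rewrite -RintegralB; [|by []|exact: iG|exact: iB']; apply: (@RI_ae _ _ lam); [by ms|by ms|].
  exists [set t]; split=> //; first exact: lebesgue_measure_set1.
  move=> s /= H; have [//|st] := eqVneq (s : R) (t : R); exfalso; apply: H; rewrite /before.
  by case: (ltgtP s t) st => //= _ _; rewrite ?mul1r ?mul0r ?subr0 ?subrr.
set q := RI lam (fun t => _).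
have fin : \int[lam]_x \int[lam]_y (`|G x * (before x y * G y)|)%:E < +oo.
  have fG : \int[lam]_x `|(G x)%:E| < +oo by case/integrableP: iG.
  apply: (@le_lt_trans _ _ ((\int[lam]_x `|(G x)%:E|) * (\int[lam]_x `|(G x)%:E|))); last first.
    by apply: lte_mul_pinfty; rewrite ?ge0_fin_numE//; apply: integral_ge0.
  have mG' : measurable_fun setT (fun x => `|(G x)%:E|) by apply: measurableT_comp => //; exact/measurable_EFinP.
  rewrite -ge0_integralZrT//; last by apply: integral_ge0.
  apply: ge0_le_integralT => x; first by apply: integral_ge0.
  rewrite -ge0_integralZlT//.
  apply: ge0_le_integralT => y; first by rewrite lee_fin.
  rewrite -EFinM lee_fin normrM; apply: ler_wpM2l => //.
  by rewrite normrM ger0_norm ?before_ge0// ler_piMl// before_le1.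
have iq : L1 lam (fun t => G t * RI lam (fun s => before t s * G s))%R.
  by apply: L1_eq (L1_RI mGG fin) _ => t; exact: RIZ.
have q' : q = RI lam (fun t => G t * RI lam (fun s => before s t * G s))%R.
  transitivity (RI lam (fun x => RI lam (fun y => G x * (before x y * G y)))%R).
    by apply: RI_eq => t; rewrite RIZ.
  rewrite (fubiniR mGG fin); apply: RI_eq => t; rewrite -RIZ//.
  by apply: RI_eq => s; ring.
have iq' : L1 lam (fun t => G t * RI lam (fun s => before s t * G s))%R.
  apply: L1_eq (L1B (L1Z (RI lam G) iG) iq) _ => t; rewrite E; ring.
have : q = (RI lam G * RI lam G - q)%R.
  rewrite {2}q' -[in X in (X - _)%R]RIZ; [|exact: iG]; rewrite -RIB; [|exact: L1Z|exact: iq'].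
  by apply: RI_eq => t; rewrite E; ring.
by rewrite expr2 => H; lra.
Qed.

Section Frequency.
Variables (k tau y0 : R) (h : TT R -> R).
Hypotheses (k0 : (0 <= k)%R) (tau0 : (0 <= tau)%R) (ih : L1 lam h).
Hypothesis hz : forall s, ~~ within tau s -> h s = 0%R.

Definition yt (t : TT R) : R := (ek k t 0 * y0 - RI lam (fun s => ek k t s * h s))%R.
(** Minus the time derivative of [yt] on the window: the equation is [y' = - k y - h]. *)
Definition gt (s : TT R) : R := (if within tau s then k * yt s + h s else 0)%R.

Let mh := L1_meas ih.

Lemma L1_ek t : L1 lam (fun s => ek k t s * h s)%R.
Proof.
apply: (@L1_bounded _ _ _ _ _ 1%R); [exact: ih|exact: mek|].
by move=> s; rewrite ger0_norm ?ek_ge0// ek_le1.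
Qed.

Lemma L1_before t (f : TT R -> R) : L1 lam f -> L1 lam (fun s => before t s * f s)%R.
Proof.
move=> jf; apply: (@L1_bounded _ _ _ _ _ 1%R); [exact: jf|by ms|].
by move=> s; rewrite ger0_norm ?before_ge0// before_le1.
Qed.

Lemma myt : measurable_fun setT yt.
Proof.
rewrite /yt; apply: measurable_funB; first by apply: measurable_funM; [exact: mek|ms].
apply: (measurable_Rintegral lam (h := fun t s => ek k t s * h s)%R).
by apply: measurable_funM; [apply: mek; ms|ms].
Qed.

Lemma yt_bound : exists b : R, forall t, (`|yt t| <= b)%R.
Proof.
exists (`|y0| + RI lam (fun s => `|h s|))%R => t; rewrite /yt.
apply: le_trans (ler_normB _ _) _; apply: lerD.
  by rewrite normrM ger0_norm ?ek_ge0// ler_piMl// ek_le1.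
apply: le_trans (le_normr_Rintegral measurableT (L1_ek t)) _.
apply: le_Rintegral => //.
- exact: (integrable_norm (L1_ek t)).
- exact: (integrable_norm ih).
- by move=> s _; rewrite normrM ger0_norm ?ek_ge0// ler_piMl// ek_le1.
Qed.

Lemma gtE s : gt s = (k * ((if within tau s then 1 else 0) * yt s) + h s)%R.
Proof. by rewrite /gt; case: ifPn => [_|/hz ->]; rewrite ?mul1r ?mul0r ?mulr0 ?addr0. Qed.

Lemma L1_wyt (f : TT R -> R) : measurable_fun setT f -> (exists b : R, forall t, (`|f t| <= b)%R) ->
  L1 lam (fun s => (if within tau s then 1 else 0) * f s)%R.
Proof.
move=> mf [b fb]; apply: L1_eq (L1_bounded (L1_within 1 tau0) mf fb) _ => s.
by rewrite mulrC.
Qed.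

Lemma L1_gt : L1 lam gt.
Proof.
apply: L1_eq (L1D (L1Z k (L1_wyt myt yt_bound)) ih) _ => s.
by rewrite gtE.
Qed.

(** The equation in integrated form. Fubini and [exp_primitive] derive it from Duhamel's formula, so
    [h] need only be integrable. *)
Lemma RI_gt t : within tau t -> RI lam (fun s => before t s * gt s)%R = (y0 - yt t)%R.
Proof.
move=> /andP[t0 tT].
pose e (s : TT R) : R := (before t s * (k * ek k s 0))%R.
have me : measurable_fun setT e.
  by rewrite /e; apply: measurable_funM; [by ms|apply: measurable_funM; [by ms|apply: mek; ms]].
pose f (s q : TT R) : R := (before t s * (k * ek k s q) * h q)%R.
have mf : measurable_fun setT (fun p : TT R * TT R => f p.1 p.2).
  rewrite /f; apply: measurable_funM; last by ms.
  by apply: measurable_funM; [by ms|apply: measurable_funM; [by ms|apply: mek; ms]].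
have ie : L1 lam e.
  apply: L1_dom (L1_within k tau0) me _ => s; rewrite /e /before /ek /within.
  have [st|_] := leP s t; last by rewrite mul0r normr0.
  have [s0|_] := leP 0%R s; last by rewrite !mulr0 normr0.
  rewrite (le_trans st tT) /= mul1r subr0 (ger0_norm k0) ger0_norm ?mulr_ge0 ?expR_ge0//.
  by apply: ler_piMr => //; rewrite -expR0 ler_expR mulNr oppr_le0 mulr_ge0.
have fin : \int[lam]_s \int[lam]_q (`|f s q|)%:E < +oo.
  apply: (@le_lt_trans _ _ (\int[lam]_s \int[lam]_q (`|(if within tau s then k else 0) * h q|)%:E)).
    apply: ge0_le_integralT => s; first by apply: integral_ge0 => q _; rewrite lee_fin.
    apply: ge0_le_integralT => q; first by rewrite lee_fin.
    have [q0|q0] := boolP (within tau q); last by rewrite /f hz ?mulr0 ?normr0.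
    rewrite lee_fin /f !normrM; apply: ler_wpM2r => //.
    rewrite /before /ek; have [st|_] := leP s t; last by rewrite normr0 mul0r.
    have [qs|_] := leP q s; last by rewrite normr0 !mulr0.
    have -> : within tau s by rewrite /within (le_trans st tT) andbT; case/andP: q0 => + _; move/le_trans; exact.
    rewrite normr1 mul1r; apply: ler_piMr => //; rewrite ger0_norm ?expR_ge0//.
    by rewrite -expR0 ler_expR mulNr oppr_le0 mulr_ge0// subr_ge0.
  have [mk ik] : measurable_fun setT (fun s : TT R => `|(if within tau s then k else 0)%R%:E|) /\
      \int[lam]_s `|(if within tau s then k else 0)%R%:E| < +oo.
    case/integrableP: (L1_within k tau0) => m1 ->; split=> //.
    by apply: measurableT_comp => //; exact: m1.
  have fh : \int[lam]_x `|(h x)%:E| < +oo by case/integrableP: ih.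
  have mh' : measurable_fun setT (fun x => `|(h x)%:E|) by apply: measurableT_comp => //; exact/measurable_EFinP.
  have h0 : 0 <= \int[lam]_x `|(h x)%:E| by apply: integral_ge0.
  apply: (@le_lt_trans _ _ ((\int[lam]_s `|(if within tau s then k else 0)%R%:E|) * (\int[lam]_x `|(h x)%:E|))); last first.
    by apply: lte_mul_pinfty; rewrite ?ge0_fin_numE//; apply: integral_ge0.
  rewrite -ge0_integralZrT//.
  apply: ge0_le_integralT => s; first by apply: integral_ge0 => q _; rewrite lee_fin.
  rewrite -ge0_integralZlT//.
  apply: ge0_le_integralT => q; first by rewrite lee_fin.
  by rewrite -EFinM normrM.
have ieq s : L1 lam (fun q => f s q).
  apply: L1_eq (L1Z (before t s * k)%R (L1_ek s)) _ => q; rewrite /f; ring.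
have E s : (before t s * gt s = e s * y0 - RI lam (f s) + before t s * h s)%R.
  have -> : RI lam (f s) = (before t s * k * RI lam (fun q => ek k s q * h q))%R.
    by rewrite -RIZ; [apply: RI_eq => q; rewrite /f; ring|exact: L1_ek].
  rewrite gtE /e /yt; have [s0|s0] := boolP (within tau s); first by ring.
  have [st|st] := leP s t; last by rewrite /before leNgt st !mul0r subr0 addr0.
  have sn : (s < 0)%R.
    by move: s0; rewrite /within negb_and -!ltNge => /orP[//|]; rewrite ltNge (le_trans st tT).
  have -> : RI lam (fun q => ek k s q * h q)%R = 0%R.
    rewrite (_ : (fun q => _) = cst 0%R); first by rewrite /Rintegral integral0.
    apply/funext => q; rewrite /ek; have [qs|_] := leP q s; last by rewrite mul0r.
    by rewrite hz ?mulr0// /within negb_and -ltNge (le_lt_trans qs sn).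
  have ek0 : ek k s 0 = 0%R by rewrite /ek leNgt sn.
  rewrite hz// ek0; ring.
have iRI := L1_RI mf fin.
have ib : L1 lam (fun s => before t s * h s)%R by exact: L1_before.
have iey : L1 lam (fun s => e s * y0)%R by apply: L1_eq (L1Z y0 ie) _ => s; rewrite mulrC.
rewrite (_ : RI lam _ = RI lam (fun s => e s * y0 - RI lam (f s) + before t s * h s)%R); last exact: RI_eq.
rewrite RID; [|exact: L1B|exact: ib]; rewrite RIB; [|exact: iey|exact: iRI].
rewrite RIZr; last exact: ie.
rewrite (fubiniR mf fin).
have -> : RI lam (fun q => RI lam (f^~ q)) = RI lam (fun q => before t q * h q - ek k t q * h q)%R.
  apply: RI_eq => q; have [q0|q0] := boolP (within tau q); last first.
    rewrite hz// !mulr0 subr0 (RI_eq _ (g := fun=> 0%R)) ?/Rintegral ?integral0// => s.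
    by rewrite /f hz// mulr0.
  rewrite -mulrBl -exp_primitive// -RIZr//.
  apply: L1_dom (L1_within k tau0) _ _.
    by apply: measurable_funM; [by ms|apply: measurable_funM; [by ms|apply: mek; ms]].
  move=> s; rewrite /before /ek; have [st|_] := leP s t; last by rewrite mul0r normr0.
  have [qs|_] := leP q s; last by rewrite !mulr0 normr0.
  have -> : within tau s by rewrite /within (le_trans st tT) andbT; case/andP: q0 => + _; move/le_trans; exact.
  rewrite mul1r (ger0_norm k0) ger0_norm ?mulr_ge0 ?expR_ge0//; apply: ler_piMr => //.
  by rewrite -expR0 ler_expR mulNr oppr_le0 mulr_ge0// subr_ge0.
rewrite RIB; [|exact: ib|exact: L1_ek].
rewrite /e (exp_primitive 0%R t k0) /yt /before t0.
move: (RI lam _) (RI lam _) (ek _ _ _) => A1 A2 A3; ring.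
Qed.

(** Apply [RI_square] to [gt], whose primitive is [y0 - yt]: this gives
    [2 * int gt * (y0 - yt) = (y0 - yt tau)^2], and expanding produces the identity. It is stated
    for any [y] that equals [yt] at [tau] and at almost every time of the window. *)
Lemma energy_identity (y : TT R -> R) : y tau = yt tau -> measurable_fun setT y ->
  {ae lam, forall t, within tau t -> y t = yt t} ->
  [/\ L1 lam (fun t => (if within tau t then 1 else 0) * (y t) ^+ 2)%R, L1 lam (fun t => y t * h t)%R &
   (y tau ^+ 2 + 2 * k * RI lam (fun t => (if within tau t then 1 else 0) * y t ^+ 2) =
   y0 ^+ 2 - 2 * RI lam (fun t => y t * h t))%R].
Proof.
move=> yT my yy; have mw := mwithin tau; have my' := myt.
have i2 : L1 lam (fun t => (if within tau t then 1 else 0) * (yt t) ^+ 2)%R.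
  apply: L1_wyt; first by ms.
  have [b yb] := yt_bound; exists (b ^+ 2)%R => t; rewrite normrX.
  by apply: lerXn2r; rewrite ?nnegrE ?yb// (le_trans (normr_ge0 _) (yb t)).
have ih2 : L1 lam (fun t => yt t * h t)%R.
  have [b yb] := yt_bound; exact: L1_bounded ih my' yb.
have E : (yt tau ^+ 2 + 2 * k * RI lam (fun t => (if within tau t then 1 else 0) * yt t ^+ 2) =
   y0 ^+ 2 - 2 * RI lam (fun t => yt t * h t))%R.
  have tt : within tau tau by rewrite /within tau0 lexx.
  have H := RI_square L1_gt.
  have G1 : RI lam gt = (y0 - yt tau)%R.
    rewrite -(RI_gt tt); apply: RI_eq => s; rewrite /before.
    case: leP => [_|sT]; first by rewrite mul1r.
    by rewrite mul0r /gt /within [(s <= tau)%R]leNgt sT andbF.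
  have G2 : RI lam (fun t => gt t * RI lam (fun s => before t s * gt s))%R =
      (y0 * RI lam gt - (k * RI lam (fun t => (if within tau t then 1 else 0) * yt t ^+ 2) + RI lam (fun t => yt t * h t)))%R.
    rewrite -(RIZ k i2) -(RID (L1Z k i2) ih2) -(RIZ y0 L1_gt) -(RIB (L1Z _ L1_gt) (L1D (L1Z k i2) ih2)).
    apply: RI_eq => s; rewrite gtE; have [ws|ws] := boolP (within tau s).
      by rewrite RI_gt//; ring.
    by rewrite hz//; ring.
  move: H; rewrite G2 G1; set P1 := RI _ _; set P2 := RI _ _ => H.
  by move: (yt tau) P1 P2 H => Y Q1 Q2 H; lra.
have my2 : measurable_fun setT (fun t => (if within tau t then 1 else 0) * y t ^+ 2)%R.
  by apply: measurable_funM; [apply: measurable_fun_ifT => //|apply: measurable_funX].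
have myt2 := L1_meas i2; have myth := L1_meas ih2.
have myh : measurable_fun setT (fun t => y t * h t)%R by exact: measurable_funM.
have L1_ae (f g : TT R -> R) : L1 lam f -> measurable_fun setT g -> {ae lam, forall t, f t = g t} -> L1 lam g.
  move=> jf mg fg; apply: L1_fin => //; rewrite (_ : integral _ _ _ = \int[lam]_t (`|f t|)%:E).
    by case/integrableP: jf.
  apply: ae_eq_integral => //.
  - by apply/measurable_EFinP; apply: measurableT_comp.
  - by apply/measurable_EFinP; apply: measurableT_comp => //; exact: L1_meas jf.
  - case: fg => N [mN N0 sN]; exists N; split=> // x /= H; apply: sN => /= hx; apply: H => _; by rewrite hx.
have a1 : {ae lam, forall t, ((if within tau t then 1 else 0) * yt t ^+ 2 = (if within tau t then 1 else 0) * y t ^+ 2)%R}.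
  by apply: (ae_mono yy) => t; case: ifP => [_ /(_ isT) ->//|]; rewrite !mul0r.
have a2 : {ae lam, forall t, (yt t * h t = y t * h t)%R}.
  apply: (ae_mono yy) => t yt'; have [wt|wt] := boolP (within tau t); first by rewrite yt'.
  by rewrite hz// !mulr0.
split; [exact: L1_ae i2 my2 a1|exact: L1_ae ih2 myh a2|].
by rewrite yT -(RI_ae myt2 my2 a1) -(RI_ae myth myh a2).
Qed.
End Frequency.

(** * Sums over components, the trilinear form and null sets in time and frequency *)

Lemma RI_sum d' (T : measurableType d') (m : {measure set T -> \bar R}) (f : I -> T -> R) :
  (forall c, L1 m (f c)) ->
  L1 m (fun x => \sum_c f c x)%R /\ RI m (fun x => \sum_c f c x)%R = (\sum_c RI m (f c))%R.
Proof.
move=> jf; rewrite -[index_enum I]/(index_enum I); elim: (index_enum I) => [|c s [IH1 IH2]].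
  split; last by rewrite big_nil (RI_eq _ (g := fun=> 0%R)) ?/Rintegral ?integral0// => x; rewrite big_nil.
  apply: (@L1_eq _ _ _ (fun=> 0%R)) => [|x]; last by rewrite big_nil.
  exact: integrable0.
split; first by apply: L1_eq (L1D (jf c) IH1) _ => x; rewrite big_cons.
rewrite big_cons -IH2 -(RID (jf c) IH1); apply: RI_eq => x; by rewrite big_cons.
Qed.

Definition sq (u : I -> R) : R := (\sum_c u c ^+ 2)%R.

Lemma sq_ge0 u : (0 <= sq u)%R.
Proof. by apply: sumr_ge0 => c _; exact: sqr_ge0. Qed.

Lemma n1_sq u : (n1 u * n1 u <= #|I|%:R * sq u)%R.
Proof.
rewrite /n1 mulr_suml; under eq_bigr do rewrite mulr_sumr.
apply: (@le_trans _ _ (\sum_(i : I) \sum_(j : I) (2^-1 * (u i ^+ 2) + 2^-1 * (u j ^+ 2)))%R).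
  apply: ler_sum => i _; apply: ler_sum => j _.
  have := sqr_ge0 (`|u i| - `|u j|)%R; rewrite -(real_normK (num_real (u i))) -(real_normK (num_real (u j))).
  by move: (`|u i|)%R (`|u j|)%R => x y; nra.
rewrite (eq_bigr (fun i => #|I|%:R * (2^-1 * u i ^+ 2) + 2^-1 * sq u))%R; last first.
  by move=> i _; rewrite big_split /= sumr_const -mulr_sumr -/(sq u) -[X in (X + _)%R]mulr_natl.
rewrite big_split /= sumr_const -!mulr_sumr -/(sq u) -[X in (_ + X)%R]mulr_natl.
by move: (sq u) (#|_|%:R)%R => x y; lra.
Qed.

Lemma sq_n1 u : (sq u <= n1 u * n1 u)%R.
Proof.
rewrite /sq {1}/n1 mulr_suml; apply: ler_sum => c _.
rewrite -(real_normK (num_real (u c))) expr2; apply: ler_wpM2l => //; exact: n1_comp.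
Qed.

Lemma msq d' (T : measurableType d') (u : T -> I -> R) :
  (forall i, measurable_fun setT (fun t => u t i)) -> measurable_fun setT (fun t => sq (u t)).
Proof. by move=> m; rewrite /sq; apply: measurable_sum => c; apply: measurable_funX. Qed.

(** The derivative is moved onto the factor [f], which leaves the convolution in [L^2], where
    Young's inequality applies. *)
Lemma trilinear (f g : P -> \bar R) s : nnm f -> nnm g ->
  (\int[mu]_x (f (s, x) * ((r x)%:E * cv f g (s, x)))) * (\int[mu]_x (f (s, x) * ((r x)%:E * cv f g (s, x)))) <=
  (\int[mu]_x (((r x)%:E * f (s, x)) * ((r x)%:E * f (s, x)))) *
  (mass g s * mass g s * mass (fun p => f p * f p) s).
Proof.
move=> nf ng; have [mf f0] := nf; have [mg g0] := ng; have [mc c0] := nnm_cv nf ng.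
apply: (@le_trans _ _ ((\int[mu]_x (((r x)%:E * f (s, x)) * ((r x)%:E * f (s, x)))) *
   \int[mu]_x (cv f g (s, x) * cv f g (s, x)))).
  apply: cauchy_schwarz; [by ms|by nn|by ms|by nn|by ms|by nn|].
  by move=> x; rewrite le_eqVlt; apply/orP; left; apply/eqP; rewrite (muleCA (f _)) muleA muleACA.
apply: lee_pmul; [by nn|by nn|by []|exact: mass_cv_sq].
Qed.

(** Tonelli on the indicator of the exceptional set: its double integral vanishes in either
    order. *)
Lemma ae_swap (b : P -> bool) : measurable_fun setT b ->
  {ae lam, forall t, {ae mu, forall x, b (t, x)}} -> {ae mu, forall x, {ae lam, forall t, b (t, x)}}.
Proof.
move=> mb bae; pose h (t : TT R) (x : X) : \bar R := (if b (t, x) then 0 else 1)%R%:E.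
have h0 t x : 0 <= h t x by rewrite /h; case: ifP => _; rewrite lee_fin.
have mh : measurable_fun setT (fun p : TT R * X => h p.1 p.2).
  apply: mEFin; apply: measurable_fun_ifT => //.
  by apply: (measurableT_comp mb (g := fun p : TT R * X => (p.1, p.2))); ms.
have mhx x : measurable_fun setT (fun t => h t x).
  by apply: (measurableT_comp mh (g := fun t : TT R => (t, x))); ms.
have mht t : measurable_fun setT (h t).
  by apply: (measurableT_comp mh (g := fun x : X => (t, x))); ms.
have I0 : \int[lam]_t \int[mu]_x h t x = 0.
  rewrite (ae_eq_integral (cst 0)) ?integral0//; first exact: (measurable_tonelli mu mh h0).
  apply: (ae_mono bae) => t bt _; rewrite (ae_eq_integral (cst 0)) ?integral0//.
  by apply: (ae_mono bt) => x bx _; rewrite /h bx.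
rewrite (tonelli lam mu mh h0) in I0.
have mI : measurable_fun setT (fun x => \int[lam]_t h t x).
  apply: (measurable_tonelli lam (F := fun x t => h t x)) => //.
  by apply: (measurableT_comp mh (g := fun p : X * TT R => (p.2, p.1))); ms.
have : \int[mu]_x `|\int[lam]_t h t x| = 0.
  by rewrite -[RHS]I0; apply: eq_integral => x _; rewrite gee0_abs//; apply: integral_ge0.
move=> /(ae_eq_integral_abs mu measurableT mI) H; apply: (ae_mono H) => x /(_ Logic.I) Hx.
have : \int[lam]_t `|h t x| = 0.
  by rewrite -[RHS]Hx; apply: eq_integral => t _; rewrite gee0_abs.
move=> /(ae_eq_integral_abs lam measurableT (mhx x)) {}H; apply: (ae_mono H) => t /(_ Logic.I).
by rewrite /h; case: ifP => // _ /eqP; rewrite eqe oner_eq0.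
Qed.

Lemma ae_pick (A : TT R -> Prop) (a b : R) : {ae lam, forall t, A t} -> (a < b)%R ->
  exists t : R, (a <= t <= b)%R /\ A t.
Proof.
move=> [N [mN N0 sN]] ab; apply: contrapT => H.
have abN : `[a, b]%classic `<=` (N : set R).
  move=> t /=; rewrite in_itv /= => tab; apply: sN => /= At; apply: H; by exists t.
have : (lebesgue_measure (`[a, b]%classic : set R) <= lebesgue_measure (N : set R))%E.
  by apply: le_measure => //; rewrite inE.
by rewrite [X in (_ <= X)%E]N0 lebesgue_measure_itv /= lte_fin ab -EFinB lee_fin subr_le0 leNgt ab.
Qed.

Lemma sqe_cancel (x : \bar R) (k : R) : 0 <= x -> (0 <= k)%R -> x * x <= (k * k)%:E -> x <= k%:E.
Proof.
case: x => [x| |]//.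
by rewrite !lee_fin => x0 k0; rewrite -!expr2 ler_sqr.
Qed.

(** * Energy estimate for the perturbation *)

Section Energy.
Variables (nu T A K q : R) (w0 : X -> I -> R) (v V W : P -> I -> R) (b' : P -> bool) (g M : P -> \bar R).
Hypotheses (nu0 : (0 < nu)%R) (T0 : (0 <= T)%R) (A0 : (0 <= A)%R) (K0 : (0 <= K)%R).
Hypotheses (mw0 : forall c, measurable_fun setT (fun x => w0 x c)) (mv : mfield v) (mV : mfield V) (mW : mfield W).
Hypotheses (vz : forall p c, ~~ b' p -> v p c = 0%R) (bT : forall p, b' p -> within T p.1).
Hypothesis mb : measurable_fun setT b'.
Hypothesis bae : {ae lam, forall t, within T t -> {ae mu, forall x, b' (t, x)}}.
Hypotheses (ng : nnm g) (vg : forall p, en1 v p <= g p).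
Hypothesis VWg : forall p, within T p.1 -> en1 V p <= g p /\ en1 W p <= g p.
Hypothesis gA : forall t, mass g t <= A%:E.
Hypothesis veq : forall p c, b' p -> KK nu g g p < +oo /\
  v p c = (ker nu p.1 0 p.2 * w0 p.2 c - duh_int nu (pert v W V) p c)%R.
Hypothesis vK : forall t,
  \int[mu]_x (((1 + r x) * n1 (v (t, x))) * ((1 + r x) * n1 (v (t, x))))%:E <= K%:E.
Hypothesis cancel : forall s, within T s ->
  RI mu (fun x => \sum_c v (s, x) c * NL V v (s, x) c)%R = 0%R.
Hypotheses (nM : nnm M) (WM : forall p, en1 W p <= M p).
Hypothesis Mq : \int[lam]_s (mass M s * mass M s) <= q%:E.

Let N := pert v W V.

Lemma v_out p c : ~~ within T p.1 -> v p c = 0%R.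
Proof. by move=> H; apply: vz; apply/negP => /bT; exact/negP. Qed.

Lemma N_out p c : ~~ within T p.1 -> N p c = 0%R.
Proof.
move=> Tp; have := @pert_bound_within T v W V g p c mv mW mV ng _ _.
have vz0 y : en1 v (p.1, y) = 0 by rewrite /en1 n1_0// => i; exact: v_out.
rewrite /cv; under eq_integral do rewrite vz0 mul0e.
rewrite integral0 mule0 -/N lee_fin normr_le0 => H; apply/eqP; apply: H.
- by move=> p' /VWg[].
- by move=> p' i; exact: v_out.
Qed.

Lemma N_bound p c : (`|N p c|)%:E <= (2 * C1 * r p.2)%:E * cv (en1 v) g p.
Proof.
apply: (@pert_bound_within T) => //; first by move=> p' /VWg[].
by move=> p' i; exact: v_out.
Qed.

Lemma mN : mfield N. Proof. exact: mfield_pert. Qed.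

(** The scalar identity with rate [nu r^2], forcing [N] and initial value [w0], summed over the
    components. *)
Lemma freq tau x : b' (tau, x) -> {ae lam, forall t, within tau t -> b' (t, x)} ->
  [/\ L1 lam (fun t => (if within tau t then 1 else 0) * sq (v (t, x)))%R,
    L1 lam (fun t => \sum_c v (t, x) c * (if within tau t then N (t, x) c else 0))%R &
   (sq (v (tau, x)) + 2 * (nu * r x ^+ 2) * RI lam (fun t => (if within tau t then 1 else 0) * sq (v (t, x))) =
   sq (w0 x) - 2 * RI lam (fun t => \sum_c v (t, x) c * (if within tau t then N (t, x) c else 0)))%R].
Proof.
move=> btau btx; have /andP[/= tau0 tauT] := bT btau.
pose k := (nu * r x ^+ 2)%R; have k0 : (0 <= k)%R by rewrite mulr_ge0 ?sqr_ge0// ltW.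
pose h c (s : TT R) : R := (if within tau s then N (s, x) c else 0)%R.
have mNx c : measurable_fun setT (fun s : TT R => N (s, x) c).
  by have mNc := mN c; apply: (measurableT_comp mNc (g := fun s : TT R => (s, x))); ms.
have mh c : measurable_fun setT (h c) by apply: measurable_fun_ifT => //; exact: mwithin.
have kerE (t s : TT R) : ker nu t s x = ek k t s by [].
have ih c : L1 lam (h c).
  have [fin _] := veq c btau.
  have C10' : (0 <= 2 * C1)%R by rewrite mulr_ge0.
  have nv := nnm_en1 mv.
  have Kf : KK nu (en1 v) g (tau, x) < +oo.
    by apply: le_lt_trans fin; apply: le_KK => //; [exact: nv.2|exact: ng.2].
  have i1 := duh_integrable mN nv ng C10' (fun q => N_bound q c) Kf.
  (* Integrability is known with the heat kernel in front. On the window the kernel is at least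
     [exp(- k * tau)], so multiplication by [exp(k * tau)] dominates the bare forcing. *)
  apply: L1_dom (L1Z (expR (k * tau)) i1) (mh c) _ => s; rewrite /h.
  case: ifPn => [/andP[s0 st]|_]; last by rewrite normr0.
  rewrite /= mulrA normrM; rewrite -[leLHS]mul1r; apply: ler_wpM2r => //.
  rewrite ger0_norm ?mulr_ge0 ?expR_ge0 ?ker_ge0// kerE /ek st -expRD -expR0 ler_expR.
  by rewrite mulNr -mulrBr mulr_ge0// subr_ge0 lerBlDr lerDl.
have hz c s : ~~ within tau s -> h c s = 0%R by move=> /negbTE ws; rewrite /h ws.
have vyt c t : within tau t -> b' (t, x) -> v (t, x) c = yt k (w0 x c) (h c) t.
  move=> /andP[t0 tt] bt; have [_ ->] := veq c bt.
  rewrite /yt /duh_int /= !kerE; congr (_ - _)%R; apply: RI_eq => s; rewrite kerE /h.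
  rewrite /ek; have [st|_] := leP s t; last by rewrite !mul0r.
  rewrite /within (le_trans st tt) andbT; case: ifPn => // s0.
  by rewrite -/N N_out// /within negb_and s0.
have mvx c : measurable_fun setT (fun s : TT R => v (s, x) c).
  by have mvc := mv c; apply: (measurableT_comp mvc (g := fun s : TT R => (s, x))); ms.
have H c := energy_identity k0 tau0 (ih c) (hz c) (y := fun t => v (t, x) c).
have tt : within tau tau by rewrite /within tau0 lexx.
have {}H c := H (w0 x c) c (vyt c tau tt btau) (mvx c) (ae_mono btx (fun t bt wt => vyt c t wt (bt wt))).
have i2 c : L1 lam (fun t => (if within tau t then 1 else 0) * (v (t, x) c) ^+ 2)%R by have [] := H c.
have i3 c : L1 lam (fun t => v (t, x) c * h c t)%R by have [] := H c.
have [j2 e2] := RI_sum i2; have [j3 e3] := RI_sum i3.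
have E2 : forall t, (\sum_c (if within tau t then 1 else 0) * (v (t, x) c) ^+ 2 = (if within tau t then 1 else 0) * sq (v (t, x)))%R.
  by move=> t; rewrite -mulr_sumr.
split; [exact: L1_eq j2 E2|exact: j3|].
rewrite -(RI_eq lam E2) e2 e3 mulr_sumr /sq -big_split /= mulr_sumr -sumrB.
by apply: eq_bigr => c _; have [_ _ ->] := H c.
Qed.

(** Kinetic energy on the Fourier side, up to the Parseval constant; [Dt] is the squared norm of the
    gradient in the same normalization. *)
Definition Et (t : TT R) : \bar R := \int[mu]_x (sq (v (t, x)))%:E.
Definition Dt (t : TT R) : \bar R := \int[mu]_x (r x ^+ 2 * sq (v (t, x)))%:E.
Definition win (tau t : R) : R := (if within tau t then 1 else 0)%R.

Lemma win_ge0 tau t : (0 <= win tau t)%R. Proof. by rewrite /win; case: ifP. Qed.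

Lemma mwin tau : measurable_fun setT (win tau : TT R -> R).
Proof. by apply: measurable_fun_ifT => //; exact: mwithin. Qed.

Let msqv : measurable_fun setT (fun p => sq (v p)).
Proof. exact: msq. Qed.

Lemma nnm_Et : nnm Et.
Proof.
apply: (nnm_mass (f := fun p => (sq (v p))%:E)); split; first by ms.
by move=> p; rewrite lee_fin sq_ge0.
Qed.

Lemma nnm_Dt : nnm Dt.
Proof.
apply: (nnm_mass (f := fun p : P => (r p.2 ^+ 2 * sq (v p))%:E)); split; first by ms.
by move=> p; rewrite lee_fin mulr_ge0 ?sq_ge0 ?sqr_ge0.
Qed.

Lemma EtK t : Et t <= K%:E.
Proof.
apply: le_trans (vK t); apply: ge0_le_integralT => x; first by rewrite lee_fin sq_ge0.
rewrite lee_fin; apply: le_trans (sq_n1 _) _; have := n1_ge0 (v (t, x)); have := r0 x.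
by move: (r x) (n1 _) => a b a0 b0; apply: ler_pM => //; rewrite mulrDl mul1r lerDl mulr_ge0.
Qed.

Lemma DtK t : Dt t <= K%:E.
Proof.
apply: le_trans (vK t); apply: ge0_le_integralT => x; first by rewrite lee_fin mulr_ge0 ?sq_ge0 ?sqr_ge0.
rewrite lee_fin; have := sq_n1 (v (t, x)); have := n1_ge0 (v (t, x)); have := r0 x; have := sq_ge0 (v (t, x)).
move: (r x) (n1 _) (sq _) => a b c c0 a0 b0 cb; rewrite mulrACA; apply: ler_pM => //; first exact: sqr_ge0.
by rewrite expr2; apply: ler_pM => //; lra.
Qed.

Definition tri (f : P -> \bar R) (s : TT R) : \bar R := \int[mu]_x (en1 v (s, x) * ((r x)%:E * cv (en1 v) f (s, x))).

Lemma tri_sq f s : nnm f ->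
  tri f s * tri f s <= (#|I|%:R%:E * Dt s) * (mass f s * mass f s * (#|I|%:R%:E * Et s)).
Proof.
move=> nf; have nv := nnm_en1 mv; have [mv1 v10] := nv; have [mmf mf0] := nnm_mass nf.
have [mD D0] := nnm_Dt; have [mE E0] := nnm_Et.
have mvs : measurable_fun setT (fun x => sq (v (s, x))).
  by apply: msq => i; have mvi := mv i; apply: (measurableT_comp mvi (g := fun x : X => (s, x))); ms.
apply: le_trans (trilinear s nv nf) _; apply: lee_pmul.
- by nn.
- by apply: mule_ge0; [nn|rewrite /mass; nn].
- rewrite /Dt -ge0_integralZlT; last 3 first.
  + by ms.
  + by move=> x; rewrite lee_fin mulr_ge0 ?sq_ge0 ?sqr_ge0.
  + by rewrite lee_fin.
  apply: ge0_le_integralT => x; first by nn.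
  rewrite -!EFinM lee_fin; have := n1_sq (v (s, x)); move: (n1 _) (sq _) (#|I|%:R)%R => a b c H.
  by rewrite [leRHS]mulrCA mulrACA -expr2; apply: ler_wpM2l => //; exact: sqr_ge0.
- apply: lee_pmul; [by nn|by rewrite /mass; nn|by []|].
  rewrite /Et /mass -ge0_integralZlT; last 3 first.
  + by ms.
  + by move=> x; rewrite lee_fin sq_ge0.
  + by rewrite lee_fin.
  by apply: ge0_le_integralT => x; [nn|rewrite -!EFinM lee_fin; exact: n1_sq].
Qed.

Let vN (s : TT R) (x : X) : R := (\sum_c v (s, x) c * N (s, x) c)%R.

Lemma tri_le f s (k : R) (F : P -> I -> R) : (0 <= k)%R -> nnm f -> mfield F ->
  (forall x c, (`|F (s, x) c|)%:E <= (k * r x)%:E * cv (en1 v) f (s, x)) ->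
  \int[mu]_x (`|\sum_c v (s, x) c * F (s, x) c|%R)%:E <= k%:E * tri f s.
Proof.
move=> k0 nf mF Fb; have nv := nnm_en1 mv; have [mv1 v10] := nv; have [mc c0] := nnm_cv nv nf.
rewrite /tri -ge0_integralZlT; [|by ms|by nn|by nn].
apply: ge0_le_integralT => x; first by rewrite lee_fin.
apply: (@le_trans _ _ (\sum_c (`|v (s, x) c|)%:E * (k%:E * ((r x)%:E * cv (en1 v) f (s, x))))).
  apply: (@le_trans _ _ (\sum_c (`|v (s, x) c|)%:E * (`|F (s, x) c|)%:E)).
    under [leRHS]eq_bigr do rewrite -EFinM -normrM.
    by rewrite sumEFin lee_fin; exact: ler_norm_sum.
  apply: lee_sum => c _; apply: lee_pmul; rewrite ?lee_fin//.
  by have := Fb x c; rewrite EFinM muleA.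
rewrite -ge0_sume_distrl; last by move=> c _; rewrite lee_fin.
by rewrite sumEFin muleCA.
Qed.

Lemma mvN : measurable_fun setT (fun p : TT R * X => vN p.1 p.2).
Proof.
rewrite /vN; apply: measurable_sum => c; have mvc := mv c; have mNc := mN c.
by apply: measurable_funM; [apply: (measurableT_comp mvc (g := fun p : P => (p.1, p.2)))|
  apply: (measurableT_comp mNc (g := fun p : P => (p.1, p.2)))]; ms.
Qed.

(** A crude bound, uniform in time and in no way small: it gives the absolute convergence behind
    Fubini and behind the cancellation. *)
Lemma tri_g s : tri g s <= (#|I|%:R * K * A)%:E.
Proof.
have nv := nnm_en1 mv; have [mv1 v10] := nv; have [mc c0] := nnm_cv nv ng.
apply: sqe_cancel; [by rewrite /tri; nn|by rewrite !mulr_ge0|].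
apply: le_trans (tri_sq s ng) _; have [mmg mg0] := nnm_mass ng.
have [mD D0] := nnm_Dt; have [mE E0] := nnm_Et.
apply: (@le_trans _ _ ((#|I|%:R%:E * K%:E) * (A%:E * A%:E * (#|I|%:R%:E * K%:E)))).
  apply: lee_pmul; [by nn|by nn| |].
    by apply: lee_pmul; [by nn|by nn|by []|exact: DtK].
  apply: lee_pmul; [by nn|by nn| |by apply: lee_pmul; [by nn|by nn|by []|exact: EtK]].
  by apply: lee_pmul; [by nn|by nn|exact: gA|exact: gA].
rewrite -!EFinM lee_fin le_eqVlt; apply/orP; left; apply/eqP; ring.
Qed.

(** The identity of [freq] is integrated over frequencies. Tonelli exchanges the integrals in the
    dissipation, and Fubini those of the trilinear term. *)
Lemma energy_eq tau : within T tau -> {ae mu, forall x, b' (tau, x)} ->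
  \int[mu]_x (sq (w0 x))%:E < +oo ->
  Et tau + (2 * nu)%:E * \int[lam]_s ((win tau s)%:E * Dt s) =
  (RI mu (fun x => sq (w0 x)) - 2 * RI lam (fun s => RI mu (fun x => win tau s * vN s x)))%:E.
Proof.
move=> Tt bt w0f; have [/andP[tau0 tauT]] := (Tt, isT).
have [mD D0] := nnm_Dt; have [mE E0] := nnm_Et.
have mw := mwin tau; have w0' s : (0 <= win tau s)%R := win_ge0 tau s.
have mvN' := mvN.
have mH : measurable_fun setT (fun p : TT R * X => win tau p.1 * vN p.1 p.2)%R.
  by apply: measurable_funM; [by ms|exact: mvN'].
have fin : \int[lam]_s \int[mu]_x (`|win tau s * vN s x|)%:E < +oo.
  apply: (@le_lt_trans _ _ ((2 * C1 * (#|I|%:R * K * A)) * tau)%:E); last by rewrite ltry.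
  apply: time_bound; [by rewrite !mulr_ge0|exact: tau0|by move=> s; apply: integral_ge0 => x _; rewrite lee_fin| |].
  - move=> s; apply: (@le_trans _ _ ((2 * C1)%:E * tri g s)).
      apply: le_trans (tri_le _ ng mN (fun x c => N_bound (s, x) c)); last by rewrite mulr_ge0.
      apply: ge0_le_integralT => x; first by rewrite lee_fin.
      rewrite lee_fin normrM; rewrite -[leRHS]mul1r; apply: ler_wpM2r => //.
      by rewrite /win; case: ifP; rewrite ?normr1 ?normr0.
    rewrite [leRHS]EFinM; apply: lee_pmul; [by nn|by have [mc c0] := nnm_cv (nnm_en1 mv) ng; have [m1 p1] := nnm_en1 mv; rewrite /tri; nn|by []|exact: tri_g].
  - move=> s /negbTE ws; rewrite /win ws; under eq_integral do rewrite mul0r normr0.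
    by rewrite integral0.
have fin' : \int[mu]_x \int[lam]_s (`|win tau s * vN s x|)%:E < +oo.
  rewrite (tonelli mu lam (F := fun x s => (`|win tau s * vN s x|)%:E)); [exact: fin| |by move=> x s; rewrite lee_fin].
  apply: mEFin; apply: measurableT_comp => //.
  by apply: (measurableT_comp mH (g := fun p : X * TT R => (p.2, p.1))); ms.
have mH' : measurable_fun setT (fun p : X * TT R => win tau p.2 * vN p.2 p.1)%R.
  by apply: (measurableT_comp mH (g := fun p : X * TT R => (p.2, p.1))); ms.
have iH := @L1_RI _ _ _ _ mu lam (fun x s => win tau s * vN s x)%R mH' fin'.
have msw0 : measurable_fun setT (fun x => sq (w0 x)) by exact: msq.
have iw0 : L1 mu (fun x => sq (w0 x)).
  apply: L1_fin => //; under eq_integral do rewrite ger0_norm ?sq_ge0//.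
  exact: w0f.
have msvt : measurable_fun setT (fun x => sq (v (tau, x))).
  by apply: msq => i; have mvi := mv i; apply: (measurableT_comp mvi (g := fun x : X => (tau, x))); ms.
pose S x := \int[lam]_s ((win tau s)%:E * (sq (v (s, x)))%:E).
have nSx : nnm S.
  split; last by move=> x; apply: integral_ge0 => s _; apply: mule_ge0; rewrite lee_fin ?sq_ge0.
  apply: (measurable_tonelli lam (F := fun x s => (win tau s)%:E * (sq (v (s, x)))%:E)).
    apply: emeasurable_funM; first by ms.
    by apply: mEFin; apply: (measurableT_comp msqv (g := fun p : X * TT R => (p.2, p.1))); ms.
  by move=> x s; apply: mule_ge0; rewrite lee_fin ?sq_ge0.
have [mS S0] := nSx.
have swap : \int[lam]_s ((win tau s)%:E * Dt s) = \int[mu]_x ((r x ^+ 2)%:E * S x).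
  transitivity (\int[lam]_s \int[mu]_x ((r x ^+ 2)%:E * ((win tau s)%:E * (sq (v (s, x)))%:E))).
    apply: eq_integral => s _; rewrite /Dt -ge0_integralZlT; last 3 first.
    - have mvs : measurable_fun setT (fun x => sq (v (s, x))).
        by apply: msq => i; have mvi := mv i; apply: (measurableT_comp mvi (g := fun x : X => (s, x))); ms.
      by ms.
    - by move=> x; rewrite lee_fin mulr_ge0 ?sq_ge0 ?sqr_ge0.
    - by nn.
    by apply: eq_integral => x _; rewrite EFinM muleCA.
  rewrite (tonelli lam mu (F := fun s x => (r x ^+ 2)%:E * ((win tau s)%:E * (sq (v (s, x)))%:E))); last 2 first.
  - apply: emeasurable_funM; first by ms.
    apply: emeasurable_funM; first by ms.
    by apply: mEFin; apply: (measurableT_comp msqv (g := fun p : P => (p.1, p.2))); ms.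
  - by move=> s x; apply: mule_ge0; [nn|apply: mule_ge0; rewrite lee_fin ?sq_ge0].
  apply: eq_integral => x _; rewrite ge0_integralZlT//.
  - have mvs : measurable_fun setT (fun s : TT R => sq (v (s, x))).
      by apply: msq => i; have mvi := mv i; apply: (measurableT_comp mvi (g := fun s : TT R => (s, x))); ms.
    by ms.
  - by move=> s; apply: mule_ge0; rewrite lee_fin ?sq_ge0.
  - by nn.
rewrite swap -ge0_integralZlT; [|by ms|by nn|by nn; exact: ltW].
rewrite /Et -ge0_integralD//; last 4 first.
- by move=> x _; rewrite lee_fin sq_ge0.
- by ms.
- by move=> x _; apply: mule_ge0; [rewrite lee_fin mulr_ge0// ltW|nn].
- by ms.
(* At almost every frequency, almost all times of [[0, tau]] are good, by exchanging the order of
   the quantifiers. *)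
have key : {ae mu, forall x, (sq (v (tau, x)))%:E + (2 * nu)%:E * ((r x ^+ 2)%:E * S x) =
    (sq (w0 x) - 2 * RI lam (fun s => win tau s * vN s x))%:E}.
  have btx : {ae mu, forall x, {ae lam, forall t, within tau t -> b' (t, x)}}.
    pose bb (p : P) := ~~ within tau p.1 || b' p.
    have mbb : measurable_fun setT bb.
      by apply: measurable_or => //; apply: measurable_neg; apply: (measurableT_comp (mwithin tau) (g := fst)); ms.
    have := @ae_swap bb mbb _; case.
      apply: (ae_mono bae) => t Ht; rewrite /bb /=; have [wt|wt] := boolP (within tau t); last exact: aeW.
      by apply: Ht; rewrite /within; case/andP: wt => -> /le_trans; exact.
    move=> NN [mNN N0 sN]; exists NN; split=> // x /= H; apply: sN => /= Hx; apply: H.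
    by apply: (ae_mono Hx) => t; rewrite /bb /=; case: (within tau t).
  apply: filterS2 bt btx => x bx tx; have [i1 i2 e] := freq bx tx.
  have -> : S x = (RI lam (fun t => win tau t * sq (v (t, x))))%:E.
    rewrite /Rintegral fineK; last exact: (integrable_fin_num measurableT i1).
    by apply: eq_integral => s _; rewrite EFinM.
  rewrite -!EFinM -EFinD; congr (_%:E).
  transitivity (sq (v (tau, x)) + 2 * (nu * r x ^+ 2) * RI lam (fun t => win tau t * sq (v (t, x))))%R; first by ring.
  rewrite e; congr (_ - 2 * _)%R; apply: RI_eq => s; rewrite /win /vN; case: ifP => _.
    by rewrite mul1r.
  by rewrite mul0r big1// => c _; rewrite mulr0.
have iR : L1 mu (fun x => sq (w0 x) - 2 * RI lam (fun s => win tau s * vN s x))%R.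
  by apply: L1B => //; exact: L1Z.
rewrite (ae_eq_integral (fun x => (sq (w0 x) - 2 * RI lam (fun s => win tau s * vN s x))%:E))//; last 3 first.
- by apply: emeasurable_funD; ms.
- by apply/measurable_EFinP; exact: L1_meas iR.
- by apply: (ae_mono key) => x -> _.
transitivity (RI mu (fun x => sq (w0 x) - 2 * RI lam (fun s => win tau s * vN s x))%R)%:E.
  by rewrite /Rintegral fineK//; exact: (integrable_fin_num measurableT iR).
congr (_%:E); rewrite RIB//; last exact: L1Z.
rewrite RIZ; last exact: iH.
by rewrite (@fubiniR _ _ _ _ mu lam (fun x s => win tau s * vN s x)%R mH' fin').
Qed.
Lemma mule_factor1 (a c : R) (m b : \bar R) : a%:E * (c%:E * m * b) = (c * a)%:E * (m * b).
Proof. by rewrite EFinM -!muleA (muleCA a%:E c%:E). Qed.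

Lemma mule_factor2 (c n : R) (a b m : \bar R) :
  c%:E * c%:E * ((n%:E * a) * (m * (n%:E * b))) = ((n * c) ^+ 2)%:E * (a * (m * b)).
Proof.
have -> : ((n * c) ^+ 2)%:E = c%:E * c%:E * (n%:E * n%:E) by congr EFin; ring.
by rewrite (muleCA m n%:E) (muleACA n%:E a) [LHS]muleA.
Qed.

Lemma nnm_tri f : nnm f -> nnm (tri f).
Proof.
move=> nf; have nv := nnm_en1 mv; have [mv1 v10] := nv; have [mc c0] := nnm_cv nv nf.
by rewrite /tri; split; [ms|nn].
Qed.

Lemma mvs s : measurable_fun setT (vN s).
Proof. by apply: (measurableT_comp mvN (g := fun x : X => (s, x))); ms. Qed.

Lemma mvF s (F : P -> I -> R) : mfield F -> measurable_fun setT (fun x => \sum_c v (s, x) c * F (s, x) c)%R.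
Proof.
move=> mF; apply: measurable_sum => c; have mvc := mv c; have mFc := mF c.
by apply: measurable_funM; [apply: (measurableT_comp mvc (g := fun x : X => (s, x)))|
  apply: (measurableT_comp mFc (g := fun x : X => (s, x)))]; ms.
Qed.

(** Transport by [V] drops out by [cancel], and only the stretching of [W] by [v] remains. It is
    bounded with the small majorant [M] of [W], and the arithmetic-geometric inequality with
    parameter [nu] isolates [nu * Dt]. *)
Lemma psi_bound s : within T s ->
  (2 * `|RI mu (vN s)|)%:E <= nu%:E * Dt s + nu^-1%:E * ((C ^+ 2)%:E * (mass M s * mass M s) * Et s).
Proof.
move=> Ts; have nv := nnm_en1 mv; have [mv1 v10] := nv; have nV := nnm_en1 mV; have nW := nnm_en1 mW.
have [mg g0] := ng; have [mmM mM0] := nnm_mass nM.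
have [mD D0] := nnm_Dt; have [mE E0] := nnm_Et; have [mt t0] := nnm_tri nM.
have cg (F : P -> I -> R) x : mfield F -> (forall y, en1 F (s, y) <= g (s, y)) ->
    cv (en1 v) (en1 F) (s, x) <= cv (en1 v) g (s, x).
  move=> mF Fg; have [m1 p1] := nnm_en1 mF; apply: ge0_le_integralT => y; first by nn.
  by apply: lee_pmul; [by nn|by nn|by []|exact: Fg].
have gF x : 0 <= cv (en1 v) g (s, x) by exact: (nnm_cv nv ng).2.
have L1F (F : P -> I -> R) : mfield F ->
    (forall x c, (`|F (s, x) c|)%:E <= (C1 * r x)%:E * cv (en1 v) g (s, x)) ->
    L1 mu (fun x => \sum_c v (s, x) c * F (s, x) c)%R.
  move=> mF Fb; apply: L1_fin; first exact: mvF.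
  apply: le_lt_trans (tri_le C10 ng mF Fb) _.
  by apply: (@le_lt_trans _ _ (C1%:E * (#|I|%:R * K * A)%:E)); [apply: lee_pmul; [by nn|exact: (nnm_tri ng).2|by []|exact: tri_g]|rewrite -EFinM ltry].
have i1 : L1 mu (fun x => \sum_c v (s, x) c * NL v W (s, x) c)%R.
  apply: (L1F (NL v W)); first exact: mfield_NL.
  move=> x c; apply: le_trans (NL_bound (s, x) c mv mW) _; apply: lee_pmul; [by nn|exact: (nnm_cv nv nW).2|by []|].
  by apply: cg => // y; have [] := VWg (p := (s, y)) Ts.
have i2 : L1 mu (fun x => \sum_c v (s, x) c * NL V v (s, x) c)%R.
  apply: (L1F (NL V v)); first exact: mfield_NL.
  move=> x c; apply: le_trans (NL_bound (s, x) c mV mv) _; apply: lee_pmul; [by nn|exact: (nnm_cv nV nv).2|by []|].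
  by rewrite cvC//; apply: cg => // y; have [] := VWg (p := (s, y)) Ts.
have -> : RI mu (vN s) = RI mu (fun x => \sum_c v (s, x) c * NL v W (s, x) c)%R.
  have E1 := RID i1 i2; rewrite (cancel Ts) addr0 in E1; rewrite -E1; apply: RI_eq => x.
  rewrite /vN -big_split /=; apply: eq_bigr => c _.
  by rewrite /N /pert mulrDr.
apply: (@le_trans _ _ (2%:E * (C1%:E * tri M s))).
  rewrite EFinM; apply: lee_pmul; [by []|by rewrite lee_fin|by []|].
  apply: le_trans (le_abse_Rintegral mu (L1_meas i1)) _.
  apply: (tri_le C10 nM (mfield_NL mv mW)) => x c.
  apply: le_trans (NL_bound (s, x) c mv mW) _; apply: lee_pmul; [by nn|exact: (nnm_cv nv nW).2|by []|].
  by apply: le_cv_en1.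
apply: mule_amgm; [exact: nu0|exact: D0|by apply: mule_ge0; [rewrite lee_fin|exact: t0]|by apply: mule_ge0; [by nn|exact: E0]|].
rewrite muleACA; apply: (@le_trans _ _ (C1%:E * C1%:E * ((#|I|%:R%:E * Dt s) * (mass M s * mass M s * (#|I|%:R%:E * Et s))))).
  by apply: lee_pmul; [by nn|by apply: mule_ge0; exact: t0|by []|exact: tri_sq].
have -> : C1%:E * C1%:E * ((#|I|%:R%:E * Dt s) * (mass M s * mass M s * (#|I|%:R%:E * Et s))) =
   ((#|I|%:R * C1) ^+ 2)%:E * (Dt s * ((mass M s * mass M s) * Et s)).
  exact: mule_factor2.
rewrite -[in leRHS]muleA [leRHS]muleCA; apply: lee_pmul; [by nn|by nn| |by []].
by rewrite lee_fin ler_sqr ?nnegrE ?mulr_ge0// ltW.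
Qed.

Lemma win_D tau : within T tau -> \int[lam]_s ((win tau s)%:E * Dt s) <= (K * T)%:E.
Proof.
move=> /andP[tau0 tauT]; apply: (@le_trans _ _ (K * tau)%:E); last by rewrite lee_fin; apply: ler_wpM2l.
have [mD D0] := nnm_Dt; apply: time_bound => //.
- by move=> s; apply: mule_ge0; [rewrite lee_fin win_ge0|exact: D0].
- move=> s; apply: le_trans (DtK s); rewrite -[leRHS]mul1e; apply: lee_pmul; [by rewrite lee_fin win_ge0|exact: D0| |by []].
  by rewrite lee_fin /win; case: ifP.
- by move=> s /negbTE ws; rewrite /win ws mul0e.
Qed.

(** Of the dissipation [2 * nu * Dt], one half absorbs the term produced by [psi_bound]. The
    subtraction is legitimate because the total dissipation over the window is finite, by
    [win_D]. *)
Lemma energy_ineq tau : within T tau -> {ae mu, forall x, b' (tau, x)} ->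
  \int[mu]_x (sq (w0 x))%:E < +oo ->
  Et tau + nu%:E * \int[lam]_s ((win tau s)%:E * Dt s) <=
  \int[mu]_x (sq (w0 x))%:E + (C ^+ 2 / nu)%:E * \int[lam]_s ((win tau s)%:E * (mass M s * mass M s * Et s)).
Proof.
move=> Tt bt w0f; have e := energy_eq Tt bt w0f.
have [mD D0] := nnm_Dt; have [mE E0] := nnm_Et; have [mmM mM0] := nnm_mass nM; have mw := mwin tau.
have w0' s : (0 <= win tau s)%R := win_ge0 tau s.
set J := \int[lam]_s ((win tau s)%:E * Dt s) in e *.
set J2 := \int[lam]_s ((win tau s)%:E * (mass M s * mass M s * Et s)).
have J0 : 0 <= J by rewrite /J; nn.
have JK : J <= (K * T)%:E by exact: win_D.
have Jf : J \is a fin_num by rewrite ge0_fin_numE//; apply: le_lt_trans JK _; rewrite ltry.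
have w0E : \int[mu]_x (sq (w0 x))%:E = (RI mu (fun x => sq (w0 x)))%:E.
  rewrite /Rintegral fineK// ge0_fin_numE//; apply: integral_ge0 => x _; by rewrite lee_fin sq_ge0.
have psi : (2 * `|RI lam (fun s => RI mu (fun x => win tau s * vN s x))|)%:E <= nu%:E * J + (C ^+ 2 / nu)%:E * J2.
  have Cn0 : (0 <= C ^+ 2 / nu)%R by rewrite mulr_ge0 ?sqr_ge0// invr_ge0 ltW.
  rewrite /J /J2 -ge0_integralZlT; [|by ms|by nn|by nn].
  rewrite -ge0_integralZlT; [|by ms|by nn|by nn].
  rewrite -ge0_integralD//; [|by nn|by ms|by nn|by ms].
  have mPsi : measurable_fun setT (fun s : TT R => RI mu (fun x => win tau s * vN s x))%R.
    apply: (measurable_Rintegral mu (h := fun s x => win tau s * vN s x)%R).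
    by apply: measurable_funM; [by ms|exact: mvN].
  have mPsi' : measurable_fun setT (fun s : TT R => `|(RI mu (fun x => win tau s * vN s x))%:E|).
    by apply: measurableT_comp => //; exact: mEFin.
  apply: (@le_trans _ _ (\int[lam]_s (2%:E * `|(RI mu (fun x => win tau s * vN s x))%:E|))).
    rewrite ge0_integralZlT; [|exact: mPsi'|by []|by []].
    by rewrite EFinM; apply: lee_pmul; [by []|by rewrite lee_fin|by []|exact: le_abse_Rintegral].
  apply: ge0_le_integralT => s; first by apply: mule_ge0; rewrite ?lee_fin.
  rewrite /win; case: ifPn => ws; last first.
    rewrite (RI_eq _ (g := fun=> 0%R)) ?/Rintegral ?integral0 ?normr0 ?mule0; last by move=> x; rewrite mul0r.
    by rewrite /= normr0 mule0 !mul0e !mule0 adde0.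
  have Ts : within T s by case/andP: ws => s0 st; rewrite /within s0 (le_trans st)//; case/andP: Tt.
  have := psi_bound Ts; rewrite (RI_eq _ (g := vN s)); last by move=> x; rewrite mul1r.
  rewrite !mul1e EFinM => /le_trans; apply; apply: leeD; first by [].
  by rewrite mule_factor1.
have J20 : 0 <= (C ^+ 2 / nu)%:E * J2 by apply: mule_ge0; [rewrite lee_fin mulr_ge0 ?sqr_ge0// invr_ge0 ltW|rewrite /J2; nn].
rewrite w0E; move: psi e J20; rewrite -(fineK Jf).
move: (RI lam _) (RI mu _) (fine J) => p1 p2 j.
have := E0 tau; case: (Et tau) => [E| |]//; case: ((C ^+ 2 / nu)%:E * J2) => [j2| |]//; rewrite ?lee_fin.
  move=> E0' psi e j20; have {}e : (E + 2 * nu * j = p2 - 2 * p1)%R by apply: EFin_inj.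
  have := ler_norm (- p1)%R; rewrite normrN; lra.
by move=> _ _ _ _; rewrite addey// leey.
Qed.

Let good tau := within T tau /\ {ae mu, forall x, b' (tau, x)}.

(** The source is at most [C^2 / nu * b * q], and the condition on [q] makes this at most
    [b / 2]. *)
Lemma energy_step (b E0 : R) tau : (0 <= b)%R -> (0 <= q)%R -> (2 * C ^+ 2 / nu * q <= 1)%R -> good tau ->
  \int[mu]_x (sq (w0 x))%:E <= E0%:E -> (forall t, good t -> Et t <= b%:E) ->
  Et tau + nu%:E * \int[lam]_s ((win tau s)%:E * Dt s) <= (E0 + b / 2)%:E.
Proof.
move=> b0 q0 qs [Tt bt] w0E Eb.
have [mD D0] := nnm_Dt; have [mE Et0] := nnm_Et; have [mmM mM0] := nnm_mass nM; have mw := mwin tau.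
have w0' s : (0 <= win tau s)%R := win_ge0 tau s.
have w0f : \int[mu]_x (sq (w0 x))%:E < +oo by apply: le_lt_trans w0E _; rewrite ltry.
apply: le_trans (energy_ineq Tt bt w0f) _; rewrite EFinD; apply: leeD => //.
have Cn0 : (0 <= C ^+ 2 / nu)%R by rewrite mulr_ge0 ?sqr_ge0// invr_ge0 ltW.
apply: (@le_trans _ _ ((C ^+ 2 / nu)%:E * (b%:E * q%:E))).
  apply: lee_pmul; [by nn|by nn|by []|].
  apply: (@le_trans _ _ (\int[lam]_s (b%:E * (mass M s * mass M s)))); last first.
    rewrite ge0_integralZlT; [|by ms|by nn|by nn].
    by apply: lee_pmul; [by nn|by nn|by []|exact: Mq].
  apply: ae_ge0_le_integral => //.
  - by move=> s _; nn.
  - by ms.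
  - by move=> s _; nn.
  - by ms.
  apply: (ae_mono bae) => s bs _; rewrite /win; case: ifPn => ws; last by rewrite mul0e; nn.
  have Ts : within T s by case/andP: ws => s0 st; rewrite /within s0 (le_trans st)//; case/andP: Tt.
  rewrite mul1e muleC; apply: lee_pmul; [by nn|by nn| |by []].
  by apply: Eb; split=> //; exact: bs.
rewrite -!EFinM lee_fin mulrCA; apply: ler_wpM2l => //.
by move: qs; rewrite -[(2 * _ / _)%R]mulrA; move: (C ^+ 2 / nu)%R => z; lra.
Qed.

(** The supremum [S] of the energy over good times is finite by the crude bound [K], so
    [S <= E0 + S / 2] can be solved to give [S <= 2 * E0]. Integrability of the squared mass of [M]
    over all times keeps this independent of [T]. *)
Lemma energy_final (E0 : R) tau : (0 <= q)%R -> (2 * C ^+ 2 / nu * q <= 1)%R -> good tau ->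
  \int[mu]_x (sq (w0 x))%:E <= E0%:E ->
  Et tau + nu%:E * \int[lam]_s ((win tau s)%:E * Dt s) <= (2 * E0)%:E.
Proof.
move=> q0 qs gt0 w0E; have [mD D0] := nnm_Dt; have [mE Et0] := nnm_Et.
pose S := ereal_sup [set Et t | t in good].
have SK : S <= K%:E by apply: ge_ereal_sup => _ [t _ <-]; exact: EtK.
have S0 : 0 <= S.
  by apply: le_trans (Et0 tau) _; apply: ereal_sup_ubound; exists tau.
have Sf : S \is a fin_num by rewrite ge0_fin_numE//; apply: le_lt_trans SK _; rewrite ltry.
have ES t : good t -> Et t <= (fine S)%:E.
  by move=> gt'; rewrite fineK//; apply: ereal_sup_ubound; exists t.
have s0 : (0 <= fine S)%R by rewrite fine_ge0.
have step t : good t -> Et t + nu%:E * \int[lam]_s ((win t s)%:E * Dt s) <= (E0 + fine S / 2)%:E.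
  by move=> gt'; exact: energy_step ES.
have S2 : (fine S)%:E <= (E0 + fine S / 2)%:E.
  rewrite fineK//; apply: ge_ereal_sup => _ [t gt' <-]; apply: le_trans (step t gt').
  rewrite leeDl//; apply: mule_ge0; first by nn.
  by apply: integral_ge0 => s _; apply: mule_ge0; [rewrite lee_fin win_ge0|exact: D0].
by apply: le_trans (step tau gt0) _; move: S2; rewrite !lee_fin; lra.
Qed.

(** Otherwise the dissipation would be at least [e] at every good time, hence at least
    [nu * e * T / 2] in total up to some good [tau] in [[T / 2, T]]. This exceeds the bound
    [2 * E0]. *)
Lemma energy_pick (E0 e : R) : (0 <= q)%R -> (2 * C ^+ 2 / nu * q <= 1)%R -> (0 < T)%R -> (0 < e)%R ->
  (4 * E0 < nu * e * T)%R -> \int[mu]_x (sq (w0 x))%:E <= E0%:E ->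
  exists t : R, [/\ within T t, {ae mu, forall x, b' (t, x)}, Et t <= (2 * E0)%:E & Dt t <= e%:E].
Proof.
move=> q0 qs T0' e0 ET w0E; have [mD D0] := nnm_Dt; have [mE Et0] := nnm_Et.
have gae : {ae lam, forall t, within T t -> good t}.
  by apply: (ae_mono bae) => t bt wt; split=> //; exact: bt.
apply: contrapT => H.
have De t : good t -> e%:E <= Dt t.
  move=> gt'; rewrite leNgt; apply/negP => Dte; apply: H; exists t; split; [exact: gt'.1|exact: gt'.2| |exact: ltW].
  apply: le_trans (energy_final q0 qs gt' w0E); rewrite leeDl//; apply: mule_ge0; first by nn.
  by apply: integral_ge0 => s _; apply: mule_ge0; [rewrite lee_fin win_ge0|exact: D0].
have [tau [/andP[t1 t2] gtau]] := ae_pick gae (ltac:(lra) : (T / 2 < T)%R).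
have tau0 : (0 <= tau)%R by lra.
have Ttau : within T tau by rewrite /within tau0.
have := energy_final q0 qs (gtau Ttau) w0E.
have H1 : (e * tau)%:E <= \int[lam]_s ((win tau s)%:E * Dt s).
  have -> : (e * tau)%:E = \int[lam]_s ((win tau s)%:E * e%:E).
    rewrite ge0_integralZrT; last 3 first.
    - by have mw := mwin tau; ms.
    - by move=> s; rewrite lee_fin win_ge0.
    - by rewrite lee_fin ltW.
    rewrite (_ : integral _ _ _ = tau%:E) -?EFinM; first by rewrite mulrC.
    rewrite (_ : (fun s => _) = fun s => (((cst 1) : R -> \bar R) \_ `[0%R, tau]) s); last first.
      by apply/funext => s; rewrite /patch mem_setE in_itv /= /win /within; case: ifP.
    rewrite -integral_mkcond integral_cst// mul1e.
    have := lebesgue_measure_itv `[0%R, tau]; rewrite /= lte_fin => ->.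
    by rewrite -EFinB subr0 (lt_le_trans _ t1)//; lra.
  have mw := mwin tau; apply: ae_ge0_le_integral => //.
  - by move=> s _; apply: mule_ge0; rewrite lee_fin ?win_ge0// ltW.
  - by ms.
  - by move=> s _; apply: mule_ge0; [rewrite lee_fin win_ge0|exact: D0].
  - by ms.
  apply: (ae_mono gae) => s gs _; rewrite /win; case: ifPn => ws; last by rewrite !mul0e.
  rewrite !mul1e; apply: De; apply: gs; case/andP: ws => s0 st; rewrite /within s0 (le_trans st)//.
apply/negP; rewrite -ltNge; apply: (@lt_le_trans _ _ (nu%:E * (e * tau)%:E)).
  rewrite -EFinM lte_fin; apply: lt_le_trans (_ : nu * e * T / 2 <= _)%R; first by lra.
  by rewrite -!mulrA; do 2 (apply: ler_wpM2l; first exact: ltW).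
apply: (@le_trans _ _ (nu%:E * \int[lam]_s ((win tau s)%:E * Dt s))).
  by apply: lee_pmul => //; rewrite lee_fin ?mulr_ge0// ltW.
by rewrite leeDr.
Qed.
End Energy.

(** * From small gradient to small [X^-1] norm *)

Lemma dominated_small (F : nat -> X -> R) (G : X -> R) (eps : R) : (forall n, measurable_fun setT (F n)) ->
  measurable_fun setT G -> (forall n x, 0 <= F n x)%R -> (forall n x, F n x <= G x)%R ->
  \int[mu]_x (G x)%:E < +oo -> (forall x, (F ^~ x) @ \oo --> (0%R : R)) -> (0 < eps)%R ->
  exists n, \int[mu]_x (F n x)%:E <= eps%:E.
Proof.
move=> mF mG F0 FG Gf Fx eps0.
have G0 x : (0 <= G x)%R := le_trans (F0 0%N x) (FG 0%N x).
have iG : mu.-integrable setT (fun x => (G x)%:E).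
  apply/integrableP; split; first exact: mEFin.
  by under eq_integral do rewrite gee0_abs ?lee_fin//.
have cF : {ae mu, forall x, setT x -> (fun n => (F n x)%:E) @ \oo --> (cst 0 x : \bar R)}.
  by apply: aeW => x _; apply: cvg_EFin; [exact: nearW|exact: Fx].
have dF : {ae mu, forall x n, setT x -> `|(F n x)%:E| <= (G x)%:E}.
  by apply: aeW => x n _; rewrite /= lee_fin ger0_norm.
have [_ _ H] := dominated_convergence measurableT (fun n => mEFin (mF n)) (measurable_cst _) cF iG dF.
rewrite integral0 in H; have := H [set x | x < eps%:E]; case.
  by apply: open_nbhs_nbhs; split; [exact: open_ereal_lt_ereal|rewrite /= lte_fin].
by move=> n _ Hn; exists n; apply: ltW; apply: Hn => /=.
Qed.

Lemma inv_linear_cvg0 (c a : R) : (0 <= c)%R -> (0 < a)%R ->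
  (fun n : nat => c / (1 + n.+1%:R * a))%R @ \oo --> (0%R : R).
Proof.
move=> c0 a0; apply: (@squeeze_cvgr _ _ _ _ (cst 0%R) (fun n => (c / a) * harmonic n)%R).
- apply: nearW => n /=; have n0 : (0 < n.+1%:R :> R)%R by rewrite ltr0n.
  have d0 : (0 < 1 + n.+1%:R * a)%R by rewrite addr_gt0// mulr_gt0.
  apply/andP; split; first by rewrite mulr_ge0// invr_ge0 ltW.
  rewrite -mulrA -invfM; apply: ler_wpM2l => //.
  by rewrite lef_pV2 ?posrE ?mulr_gt0// mulrC lerDr.
- exact: cvg_cst.
- by rewrite -(mulr0 (c / a)%R); apply: cvgM; [exact: cvg_cst|exact: cvg_harmonic].
Qed.

(** True in dimension 3: in polar coordinates [r^-2] cancels the Jacobian and [1 / (1 + r^2)] is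
    integrable on the half-line. *)
Hypothesis rint : \int[mu]_x ((r x)^-1 ^+ 2 * (1 + r x ^+ 2)^-1)%:E < +oo.

Let iw (n : nat) (x : X) : R := ((r x)^-1 ^+ 2 / (1 + n.+1%:R * r x ^+ 2))%R.

Lemma iw_ge0 n x : (0 <= iw n x)%R.
Proof. by rewrite /iw mulr_ge0 ?sqr_ge0// invr_ge0 addr_ge0// mulr_ge0 ?sqr_ge0. Qed.

Lemma miw n : measurable_fun setT (iw n).
Proof. by rewrite /iw; ms. Qed.

Lemma iw_small (eps : R) : (0 < eps)%R -> exists n, \int[mu]_x (iw n x)%:E <= eps%:E.
Proof.
move=> eps0; apply: (@dominated_small iw (iw 0)) => //.
- exact: miw.
- exact: miw.
- exact: iw_ge0.
- move=> n x; apply: ler_wpM2l; first exact: sqr_ge0.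
  have r2 : (0 <= r x ^+ 2)%R by exact: sqr_ge0.
  rewrite lef_pV2 ?posrE ?ltr_pwDl// ?mulr_ge0//.
  by rewrite lerD2l; apply: ler_wpM2r => //; rewrite ler_nat.
- by rewrite /iw; under eq_integral do rewrite mul1r.
- move=> x; have [rx|rx] := eqVneq (r x) 0%R.
    by rewrite /iw rx invr0 expr0n /=; under eq_fun do rewrite mul0r; exact: cvg_cst.
  by apply: inv_linear_cvg0; [exact: sqr_ge0|rewrite exprn_gt0// lt_def rx r0].
Qed.

(* Cauchy-Schwarz with the weight [1 + n r^2], for [n] large. *)
Lemma small_X1 (E0 eta : R) : (0 <= E0)%R -> (0 < eta)%R -> exists2 del : R, (0 < del)%R &
  forall f : X -> R, measurable_fun setT f -> (forall x, 0 <= f x)%R ->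
  \int[mu]_x (f x * f x)%:E <= E0%:E -> \int[mu]_x (r x ^+ 2 * (f x * f x))%:E <= del%:E ->
  \int[mu]_x ((r x)^-1 * f x)%:E <= eta%:E.
Proof.
move=> E00 eta0; have e0 : (0 < eta ^+ 2 / (E0 + 1))%R by rewrite divr_gt0 ?exprn_gt0//; lra.
have [n In] := iw_small e0.
have n0 : (0 < n.+1%:R :> R)%R by rewrite ltr0n.
(* With this [del] the weighted norm of [f] is at most [E0 + 1], and [n] was chosen so that the
   other Cauchy-Schwarz factor is at most [eta^2 / (E0 + 1)]. *)
exists (n.+1%:R^-1)%R; first by rewrite invr_gt0.
move=> f mf f0 fE fD; have mi := miw n; have i0 := iw_ge0 n.
apply: sqe_cancel; [by nn|exact: ltW|].
pose w x := (1 + n.+1%:R * r x ^+ 2)%R.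
have w0 x : (0 < w x)%R by rewrite /w ltr_pwDl// mulr_ge0 ?sqr_ge0.
have mw : measurable_fun setT w by rewrite /w; ms.
have H : \int[mu]_x (w x * (f x * f x))%:E <= (E0 + 1)%:E.
  rewrite (_ : (fun x => _) = (fun x => (f x * f x)%:E + n.+1%:R%:E * (r x ^+ 2 * (f x * f x))%:E)); last first.
    by apply/funext => x; rewrite -EFinM -EFinD /w; congr (_%:E); ring.
  rewrite ge0_integralD//; [|by nn|by ms|by nn|by ms].
  rewrite ge0_integralZlT; [|by ms|by nn|by nn].
  rewrite EFinD; apply: leeD => //.
  apply: (@le_trans _ _ (n.+1%:R%:E * (n.+1%:R^-1)%:E)); first by apply: lee_pmul; [by nn|by nn|by []|exact: fD].
  by rewrite -EFinM divff// gt_eqF.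
apply: (@le_trans _ _ ((\int[mu]_x (iw n x)%:E) * (\int[mu]_x (w x * (f x * f x))%:E))).
  apply: cauchy_schwarz; [by ms|by nn|by ms|by nn|by ms|by move=> x; rewrite lee_fin mulr_ge0// ?mulr_ge0// ltW|].
  move=> x; rewrite -!EFinM lee_fin /iw -/(w x) le_eqVlt; apply/orP; left; apply/eqP.
  by move: (w0 x) ((r x)^-1)%R => w0' z; field; rewrite gt_eqF.
apply: (@le_trans _ _ ((eta ^+ 2 / (E0 + 1))%:E * (E0 + 1)%:E)).
  by apply: lee_pmul => //; [nn|apply: integral_ge0 => x _; rewrite lee_fin mulr_ge0 ?mulr_ge0// ltW].
by rewrite -EFinM lee_fin mulfVK ?expr2// gt_eqF//; lra.
Qed.
(** * Eventual smallness and Gevrey decay *)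

Section Divergence.
(* The functionals [phi j x] express the divergence at the frequency [x]. *)
Variables (J : Type) (phi : J -> X -> I -> R).
Hypothesis phiB : forall j x u v, (\sum_c phi j x c * B x c u v = 0)%R.

Definition divfree (x : X) (u : I -> R) := forall j, (\sum_c phi j x c * u c = 0)%R.

Lemma divfree_sub x u v : divfree x u -> divfree x v -> divfree x (fun i => u i - v i)%R.
Proof.
move=> du dv j; under eq_bigr do rewrite mulrBr.
by rewrite sumrB du dv subr0.
Qed.

Lemma divfree0 x (u : I -> R) : (forall i, u i = 0%R) -> divfree x u.
Proof. by move=> u0 j; rewrite big1// => i _; rewrite u0 mulr0. Qed.

Lemma RI_lincomb d' (T : measurableType d') (m : {measure set T -> \bar R}) (a : I -> R) (f : I -> T -> R) :
  (forall c, L1 m (f c)) -> (\sum_c a c * RI m (f c) = RI m (fun x => \sum_c a c * f c x))%R.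
Proof.
move=> jf; have [_ ->] := RI_sum (fun c => L1Z (a c) (jf c)).
by apply: eq_bigr => c _; rewrite RIZ.
Qed.

Lemma divfree_NL F G p : mfield F -> mfield G -> cv (en1 F) (en1 G) p < +oo -> divfree p.2 (NL F G p).
Proof.
move=> mF mG fin j; rewrite RI_lincomb; last by move=> c; exact: NLi_integrable.
by rewrite (RI_eq _ (g := fun=> 0%R)) ?/Rintegral ?integral0// => y; exact: phiB.
Qed.

Lemma divfree_duh nu a F M p : mfield F -> nnm M -> (forall q, en1 F q <= M q) -> KK nu M M p < +oo ->
  divfree p.2 (a p.2) -> divfree p.2 (duh nu a F p).
Proof.
move=> mF nM FM fin da.
have i1 c := duh_integrable (mfield_NL mF mF) nM nM C10 (fun q => NL_bound' q c mF mF nM nM FM FM) fin.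
apply: divfree_sub.
  by move=> j; under eq_bigr do rewrite mulrCA; rewrite -mulr_sumr da mulr0.
move=> j; rewrite RI_lincomb; last exact: i1.
rewrite (RI_ae (g := fun=> 0%R)) ?/Rintegral ?integral0//.
  by apply: measurable_sum => c; apply: measurable_funM => //; exact: L1_meas (i1 c).
apply: (ae_mono (KK_fin_ae nM fin)) => s [rp|->|cs].
- apply: big1 => c _; have := NL_bound (s, p.2) c mF mF.
  by rewrite /= rp mulr0 mul0e lee_fin normr_le0 => /eqP ->; rewrite !mulr0.
- by apply: big1 => c _; rewrite mul0r mulr0.
- under eq_bigr do rewrite mulrCA; rewrite -mulr_sumr (divfree_NL (p := (s, p.2)))// ?mulr0//.
  by apply: le_lt_trans cs; apply: le_cv_en1.
Qed.

(** Each frequency is eventually removed, since both its modulus and the size of the datum there are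
    finite; dominated convergence makes the rest small. The part removed is bounded with bounded
    support. *)
Lemma small_tail (u0 : X -> I -> R) (e : R) : (0 < e)%R -> (forall c, measurable_fun setT (fun x => u0 x c)) ->
  \int[mu]_x ((r x)^-1%:E * ((om x)%:E * (n1 (u0 x))%:E)) < +oo ->
  exists n : nat, \int[mu]_x ((r x)^-1%:E * ((om x)%:E *
    (n1 (fun c => if (r x <= n%:R) && (n1 (u0 x) <= n%:R) then 0 else u0 x c))%R%:E)) <= e%:E.
Proof.
move=> e0 mu0 fin.
pose a (n : nat) x (c : I) : R := (if (r x <= n%:R) && (n1 (u0 x) <= n%:R) then 0 else u0 x c)%R.
have mn : measurable_fun setT (fun x => n1 (u0 x)) by exact: mn1.
have ma n c : measurable_fun setT (fun x => a n x c).
  have m0 := mu0 c; apply: measurable_fun_ifT => //.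
  by apply: measurable_and; apply: measurable_fun_ler; ms.
have man n : measurable_fun setT (fun x => n1 (a n x)) by exact: mn1.
have om0 x : (0 <= om x)%R by exact: sqr_ge0.
have mom' := mom.
have aE n x : n1 (a n x) = (if (r x <= n%:R) && (n1 (u0 x) <= n%:R) then 0 else n1 (u0 x))%R.
  by rewrite /a; case: ifP => // _; rewrite n1_0.
have m1 n : measurable_fun setT (fun x => (r x)^-1 * (om x * n1 (a n x)))%R by have := man n => m; ms.
have m2 : measurable_fun setT (fun x => (r x)^-1 * (om x * n1 (u0 x)))%R by ms.
have p1 n x : (0 <= (r x)^-1 * (om x * n1 (a n x)))%R by apply: mulr_ge0; [rewrite invr_ge0|apply: mulr_ge0; [exact: om0|exact: n1_ge0]].
have FG n x : ((r x)^-1 * (om x * n1 (a n x)) <= (r x)^-1 * (om x * n1 (u0 x)))%R.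
  apply: ler_wpM2l; first by rewrite invr_ge0.
  by apply: ler_wpM2l => //; rewrite aE; case: ifP => // _; exact: n1_ge0.
have cv0 x : (fun n => (r x)^-1 * (om x * n1 (a n x)))%R @ \oo --> (0 : R)%R.
  apply: cvg_near_cst; near=> n; rewrite aE.
  have -> : (r x <= n%:R)%R by near: n; exact: nbhs_infty_ger.
  have -> : (n1 (u0 x) <= n%:R)%R by near: n; exact: nbhs_infty_ger.
  by rewrite /= !mulr0.
by have [n Hn] := dominated_small m1 m2 p1 FG fin cv0 e0; exists n.
Unshelve. all: by end_near. Qed.

(* The energy identity [<P div (V (x) G), G> = 0] for solenoidal [G]. *)
Definition cancels (V : P -> I -> R) := forall G s, mfield G -> (forall p, divfree p.2 (G p)) ->
  \int[mu]_x (en1 G (s, x) * ((r x)%:E * cv (en1 G) (en1 V) (s, x))) < +oo ->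
  RI mu (fun x => \sum_c G (s, x) c * NL V G (s, x) c)%R = 0%R.

(** The constants are fixed in this order: [e] from the target [eta], the splitting level [n] from
    [e], the energy [E0] of the removed part from [n], the gradient threshold from [E0], and last
    the length [T] of the window. *)
Lemma eventually_small (nu : R) (u0 : X -> I -> R) (V : P -> I -> R) (bV : P -> bool) (eta : R) :
  (0 < nu)%R -> mild_field nu u0 V bV -> (forall x, divfree x (u0 x)) -> (forall x c, r x = 0%R -> u0 x c = 0%R) ->
  \int[mu]_x ((r x)^-1%:E * ((om x)%:E * (n1 (u0 x))%:E)) < +oo ->
  (forall p, divfree p.2 (V p)) -> cancels V -> (0 < eta)%R ->
  exists t0 : R, [/\ (0 <= t0)%R, {ae mu, forall x, bV (t0, x)} &
    \int[mu]_x ((r x)^-1%:E * en1 V (t0, x)) <= eta%:E].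
Proof.
move=> nu0 mildV du0 u0z u0f dV canV eta0; have [mu0 mV mbV Vz Veq Vae Vbd] := mildV.
have mom' := mom; have om0 x : (0 <= om x)%R by exact: sqr_ge0.
(* The first bound makes the contribution [2 * e] of [W] at most [eta / 2]; the second is the
   smallness required by [small_solution]. *)
pose e := (Num.min (eta / 4) (nu / (4 * C)))%R.
have e0 : (0 < e)%R by rewrite lt_min !divr_gt0// mulr_gt0.
have e1 : (e <= eta / 4)%R by rewrite ge_min lexx.
have e2 : (4 * C * e <= nu)%R.
  have : (e <= nu / (4 * C))%R by rewrite ge_min lexx orbT.
  by rewrite ler_pdivlMr ?mulr_gt0// mulrC.
have [n] := small_tail e0 mu0 u0f.
pose S x := (r x <= n%:R)%R && (n1 (u0 x) <= n%:R)%R.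
pose a x (c : I) : R := (if S x then 0 else u0 x c)%R.
rewrite -/(a _) => ae.
have mn : measurable_fun setT (fun x => n1 (u0 x)) by exact: mn1.
have ma c : measurable_fun setT (fun x => a x c).
  have m0 := mu0 c; apply: measurable_fun_ifT => //.
  by apply: measurable_and; apply: measurable_fun_ler; ms.
have az x c : r x = 0%R -> a x c = 0%R by rewrite /a => rx; case: ifP => // _; exact: u0z.
have da x : divfree x (a x) by rewrite /a; case: (S x); [exact: divfree0|exact: du0].
have [M [W [b [[nM Mz Mx My] [[mW mb] WM Wz Weq Wae]]]]] :=
  small_solution nu0 (ltW e0) e2 rom omM mom ma az ae.
pose w0 x (c : I) : R := (a x c - u0 x c)%R.
have mw0 c : measurable_fun setT (fun x => w0 x c) by apply: measurable_funB.
have w0E x : n1 (w0 x) = (if S x then n1 (u0 x) else 0)%R.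
  rewrite /w0 /a; case: (S x); last by rewrite n1_0// => i; rewrite subrr.
  by apply: eq_bigr => i _; rewrite sub0r normrN.
pose Q := fine (\int[mu]_x (n1 (u0 x))%:E).
have Qf : \int[mu]_x (n1 (u0 x))%:E = Q%:E.
  rewrite fineK// ge0_fin_numE; last by apply: integral_ge0 => x _; rewrite lee_fin n1_ge0.
  apply: le_lt_trans u0f; apply: mass_le_weight; [exact: rom|by move=> x; rewrite lee_fin n1_ge0|].
  by move=> x rx; rewrite n1_0// => i; exact: u0z.
have Q0 : (0 <= Q)%R by rewrite -lee_fin -Qf; apply: integral_ge0 => x _; rewrite lee_fin n1_ge0.
(* On the support of [w0] one has [1 + r <= 1 + n] and [|w0| <= n]; bounding one of the two factors
   [|w0|] by [n] leaves an integral of at most [Q]. *)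
pose E0 := ((1 + n%:R) ^+ 2 * n%:R * Q)%R.
have E00 : (0 <= E0)%R by rewrite /E0 !mulr_ge0// ?sqr_ge0.
have w0L2 : \int[mu]_x (((1 + r x) * n1 (w0 x)) * ((1 + r x) * n1 (w0 x)))%:E <= E0%:E.
  rewrite /E0 [leRHS]EFinM -Qf -ge0_integralZlT; last 3 first.
  - by ms.
  - by move=> x; rewrite lee_fin n1_ge0.
  - by rewrite lee_fin mulr_ge0// sqr_ge0.
  apply: ge0_le_integralT => x; first by rewrite lee_fin -expr2 sqr_ge0.
  rewrite -EFinM lee_fin w0E; have := n1_ge0 (u0 x); have := r0 x; have := ler0n R n.
  rewrite /S; move: (r x) (n1 (u0 x)) (n%:R : R)%R => y z k k0 y0 z0.
  case: ifPn => [/andP[yk zk]|_]; last first.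
    by rewrite mulr0 mul0r; apply: mulr_ge0 => //; apply: mulr_ge0 => //; exact: sqr_ge0.
  rewrite mulrACA -!expr2 -[leRHS]mulrA; apply: ler_pM; rewrite ?sqr_ge0//.
    by apply: lerXn2r; rewrite ?nnegrE; lra.
  by rewrite expr2; apply: ler_wpM2r.
have w0sq : \int[mu]_x (sq (w0 x))%:E <= E0%:E.
  apply: le_trans w0L2; apply: ge0_le_integralT => x; first by rewrite lee_fin sq_ge0.
  rewrite lee_fin; apply: le_trans (sq_n1 _) _; have := n1_ge0 (w0 x); have := r0 x.
  by move: (r x) (n1 _) => y z y0 z0; apply: ler_pM => //; nra.
have eta2 : (0 < eta / 2)%R by rewrite divr_gt0.
have E00' : (0 <= #|I|%:R * (2 * E0))%R by rewrite !mulr_ge0.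
have [del del0 Hdel] := small_X1 E00' eta2.
pose e' := (del / (#|I|%:R + 1))%R.
have e'0 : (0 < e')%R by rewrite divr_gt0// ltr_wpDl.
(* Long enough for [energy_pick], since [nu * e' * T = 4 * E0 + 1]. *)
pose T := ((4 * E0 + 1) / (nu * e'))%R.
have T0 : (0 < T)%R by rewrite divr_gt0 ?mulr_gt0//; lra.
have ET : (4 * E0 < nu * e' * T)%R.
  have -> : (nu * e' * T = 4 * E0 + 1)%R by rewrite /T mulrC divfK// gt_eqF// mulr_gt0.
  by rewrite ltrDl.
have Weq' p c : b p -> W p c = duh nu a W p c by move=> bp; have [] := Weq p c bp.
have [v [b' [g [A [[mv mb' vz bae bin] [ng gz vg [A0 gA] veq]]]]]] :=
  perturbation nu0 (ltW e0) (ltW T0) mildV ma nM Mz Mx mW mb WM Weq' Wae.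
have vout q i : ~~ within T q.1 -> v q i = 0%R.
  move=> Tq; apply: vz; apply/negP => /bin[Tq' _ _ _ _]; by rewrite Tq' in Tq.
have VWg q : within T q.1 -> en1 V q <= g q /\ en1 W q <= g q by move=> Tq; have [_] := vg q; apply.
have vg' q : en1 v q <= g q by have [] := vg q.
have nv := nnm_en1 mv.
have vle p : en1 v p <= (ker nu p.1 0 p.2)%:E * (n1 (w0 p.2))%:E + (2 * C)%:E * KK nu (en1 v) g p.
  have [bp|bp] := boolP (b' p).
    by apply: (@perturbation_le nu T w0 v V W g p) => // c; have [] := veq p c bp.
  rewrite {1}/en1 n1_0; last by move=> i; exact: vz.
  have [mK K0] := nnm_KK nu nv ng.
  by apply: adde_ge0; apply: mule_ge0; rewrite ?lee_fin ?ker_ge0 ?n1_ge0 ?mulr_ge0 ?(ltW C0).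
have [K K0 vK] := perturbation_L2 nu0 (ltW T0) A0 mw0 mv ng gz vg' gA w0L2 vle.
have gA' t : mass g t <= A%:E.
  apply: le_trans (gA t); apply: ge0_le_integralT => x; first exact: ng.2.
  by rewrite -[leLHS]mul1e; apply: lee_pmul; [by []|exact: ng.2|rewrite lee_fin lerDl|by []].
have dv p : divfree p.2 (v p).
  have [bp|bp] := boolP (b' p); last by apply: divfree0 => i; exact: vz.
  move=> j; have : divfree p.2 (fun i => W p i - V p i)%R.
    apply: divfree_sub; last exact: dV.
    have [_ _ Wp _ _] := bin p bp.
    (* Finiteness of [KK] is recorded per component, so one index is needed to extract it; without
       any index the divergence is an empty sum. *)
    have [i0 _|noI] := pickP (fun _ : I => true); last first.
      by move=> j'; rewrite big1// => i; have := noI i.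
    move=> j'; under eq_bigr do rewrite (proj2 (Weq p _ Wp)).
    by apply: (divfree_duh mW nM WM) => //; have [] := Weq p i0 Wp.
  move=> /(_ j) H; rewrite -[RHS]H; apply: eq_bigr => c _; by have [_ _ _ _ ->] := bin p bp.
have can s : within T s -> RI mu (fun x => \sum_c v (s, x) c * NL V v (s, x) c)%R = 0%R.
  move=> Ts; apply: canV => //; apply: (@le_lt_trans _ _ (#|I|%:R * K * A)%:E); last by rewrite ltry.
  apply: le_trans (tri_g A0 K0 mv ng gA' vK s).
  have [mv1 v10] := nv; have [mV1 V10] := nnm_en1 mV; have [mg g0] := ng.
  have [mc c0] := nnm_cv nv (nnm_en1 mV).
  apply: ge0_le_integralT => x; first by nn.
  apply: lee_pmul; [by nn|by nn|by []|apply: lee_pmul; [by nn|by nn|by []|]].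
  apply: ge0_le_integralT => y; first by nn.
  by apply: lee_pmul; [by nn|by nn|by []|have [] := VWg (s, sub x y) Ts].
pose q := (2 * e * (nu^-1 * (2 * e)))%R.
have q0 : (0 <= q)%R by rewrite /q !mulr_ge0 ?invr_ge0// ltW.
have Mq : \int[lam]_s (mass M s * mass M s) <= q%:E.
  have [mM M0] := nM; have [mmM mM0] := nnm_mass nM.
  have Mz' p : r p.2 = 0%R -> M p = 0 by move=> rp; apply: Mz; left.
  have om1 x : (1 <= om x)%R by apply: le_trans (om_ge x); rewrite lerDl.
  apply: (@le_trans _ _ (\int[lam]_s ((2 * e)%:E * \int[mu]_x ((r x)%:E * ((om x)%:E * M (s, x)))))).
    apply: ge0_le_integralT => s; first by nn.
    apply: le_trans (mass_sq s nM Mz') _; apply: lee_pmul; [by nn|by nn| |].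
      apply: le_trans (Mx s); apply: ge0_le_integralT => x; first by nn.
      apply: lee_pmul; [by nn|by nn|by []|]; rewrite -[leLHS]mul1e.
      by apply: lee_pmul; [by []|exact: M0|rewrite lee_fin|by []].
    apply: ge0_le_integralT => x; first by nn.
    apply: lee_pmul; [by nn|by nn|by []|]; rewrite -[leLHS]mul1e.
    by apply: lee_pmul; [by []|exact: M0|rewrite lee_fin|by []].
  rewrite ge0_integralZlT; [|by ms|by nn|by nn; exact: ltW].
  by rewrite /q [leRHS]EFinM; apply: lee_pmul; [by nn; exact: ltW|by nn|by []|exact: My].
(* The left-hand side equals [(4 C e / nu)^2 / 2], so the smallness that built [W] also closes the
   energy estimate. *)
have qs : (2 * C ^+ 2 / nu * q <= 1)%R.
  rewrite (_ : (2 * C ^+ 2 / nu * q = 2^-1 * ((4 * C * e) ^+ 2 / nu ^+ 2))%R); last first.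
    by rewrite /q; field; rewrite gt_eqF.
  have : ((4 * C * e) ^+ 2 / nu ^+ 2 <= 1)%R.
    rewrite ler_pdivrMr ?exprn_gt0// mul1r; apply: lerXn2r => //; rewrite ?nnegrE ?mulr_ge0 ?(ltW C0) ?(ltW e0) ?(ltW nu0)//.
  by move: (_ / _)%R => z; lra.
have b'T p : b' p -> within T p.1 by move=> /bin[].
have [t [Tt bt Ett Dtt]] := energy_pick nu0 A0 K0 mw0 mv mV mW vz b'T mb' bae ng vg' VWg gA' veq vK can nM WM Mq q0 qs T0 e'0 ET w0sq.
exists t; split; [by case/andP: Tt|by apply: (ae_mono bt) => x /bin[]|].
have mvt i : measurable_fun setT (fun x => v (t, x) i).
  by have mvi := mv i; apply: (measurableT_comp mvi (g := fun x : X => (t, x))); ms.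
have msv : measurable_fun setT (fun x => sq (v (t, x))) by exact: msq.
have mnv : measurable_fun setT (fun x => n1 (v (t, x))) by exact: mn1.
have nI : (0 <= #|I|%:R :> R)%R by [].
have vsmall : \int[mu]_x ((r x)^-1 * n1 (v (t, x)))%:E <= (eta / 2)%:E.
  apply: Hdel => //.
  - by move=> x; exact: n1_ge0.
  - apply: (@le_trans _ _ (#|I|%:R%:E * Et v t)); last first.
      by rewrite [leRHS]EFinM; apply: lee_pmul => //; exact: (nnm_Et mv).2.
    rewrite /Et -ge0_integralZlT; last 3 first.
    + by ms.
    + by move=> x; rewrite lee_fin sq_ge0.
    + by rewrite lee_fin.
    apply: ge0_le_integralT => x; first by rewrite lee_fin mulr_ge0 ?n1_ge0.
    by rewrite -EFinM lee_fin; exact: n1_sq.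
  - apply: (@le_trans _ _ (#|I|%:R%:E * Dt v t)); last first.
      apply: (@le_trans _ _ (#|I|%:R%:E * e'%:E)); first by apply: lee_pmul => //; exact: (nnm_Dt mv).2.
      rewrite -EFinM lee_fin /e' mulrA ler_pdivrMr; last by rewrite ltr_wpDl.
      by move: (#|I|%:R : R)%R del0 nI => z del0 z0; nra.
    rewrite /Dt -ge0_integralZlT; last 3 first.
    + by ms.
    + by move=> x; rewrite lee_fin mulr_ge0 ?sq_ge0 ?sqr_ge0.
    + by rewrite lee_fin.
    apply: ge0_le_integralT => x; first by rewrite lee_fin mulr_ge0 ?sqr_ge0// mulr_ge0 ?n1_ge0.
    by rewrite -EFinM lee_fin [leRHS]mulrCA; apply: ler_wpM2l; [exact: sqr_ge0|exact: n1_sq].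
have nW := nnm_en1 mW; have [mW1 W10] := nW; have [mV1 V10] := nnm_en1 mV; have [mv1 v10] := nv.
have [mM M0] := nM.
have Wsmall : \int[mu]_x ((r x)^-1%:E * en1 W (t, x)) <= (2 * e)%:E.
  apply: le_trans (Mx t); apply: ge0_le_integralT => x; first by nn.
  apply: lee_pmul; [by nn|by nn|by []|apply: le_trans (WM _) _]; rewrite -[leLHS]mul1e.
  apply: lee_pmul; [by []|exact: M0| |by []].
  by rewrite lee_fin; apply: le_trans (om_ge x); rewrite lerDl.
apply: (@le_trans _ _ (\int[mu]_x ((r x)^-1%:E * en1 W (t, x) + (r x)^-1%:E * en1 v (t, x)))).
  apply: ae_ge0_le_integral => //.
  - by move=> x _; nn.
  - by ms.
  - by move=> x _; nn.
  - by ms.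
  apply: (ae_mono bt) => x bx _; rewrite -ge0_muleDr//; apply: lee_pmul; [by nn|by nn|by []|].
  have [_ _ _ _ vE] := bin _ bx; rewrite /en1 -EFinD lee_fin.
  rewrite (_ : V (t, x) = fun i => W (t, x) i - v (t, x) i)%R; first exact: n1_sub.
  by apply/funext => i; rewrite vE; ring.
rewrite ge0_integralD//; [|by nn|by ms|by nn|by ms].
apply: (@le_trans _ _ ((2 * e)%:E + (eta / 2)%:E)); first by apply: leeD.
by rewrite -EFinD lee_fin; lra.
Qed.

(** * Restarting the equation, propagation of smallness and Gevrey decay *)

Lemma NL_0 F G p c : (forall y i, F (p.1, y) i = 0%R) -> NL F G p c = 0%R.
Proof.
move=> F0; rewrite /NL (RI_eq _ (g := fun=> 0%R)) ?/Rintegral ?integral0// => y.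
apply/eqP; rewrite -normr_le0; apply: le_trans (Bbound _ _ _ _) _.
by rewrite n1_0 ?mul0r ?mulr0// => i; exact: F0.
Qed.

Lemma kerM nu t0 t s x : (s <= t0)%R -> (t0 <= t)%R -> ker nu t s x = (ker nu t t0 x * ker nu t0 s x)%R.
Proof.
move=> st0 t0t; rewrite /ker st0 t0t (le_trans st0 t0t) -expRD; congr expR.
by rewrite -mulrDr; congr (_ * _)%R; rewrite addrA subrK.
Qed.

Definition all_good (bV : P -> bool) := forall t : TT R, (0 <= t :> R)%R -> {ae mu, forall x, bV (t, x)}.

(** The semigroup property of the heat kernel turns Duhamel's formula from time 0 into one from
    [t0]. The field is cut to []t0, T]] and to good frequencies so that the resulting inequality
    holds at every point. The constant [A] may be large: it only starts the bootstrap of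
    [mild_small]. *)
Lemma continuation (nu : R) (u0 : X -> I -> R) (V : P -> I -> R) (bV : P -> bool) (t0 T : R) :
  (0 < nu)%R -> mild_field nu u0 V bV -> all_good bV -> (0 <= t0)%R -> (t0 <= T)%R ->
  exists F : P -> I -> R, exists b : P -> bool, exists A : R,
  [/\ mfield F, forall p, ~~ b p -> forall c, F p c = 0%R,
     forall p, b p -> [/\ (t0 < p.1)%R, (p.1 <= T)%R, (0 < r p.2)%R & F p = V p],
     forall t : TT R, (t0 < t)%R -> (t <= T)%R -> {ae mu, forall x, b (t, x)} &
   [/\ (0 < A)%R, forall s, \int[mu]_x ((r x)^-1%:E * en1 F (s, x)) <= A%:E,
     forall s, \int[mu]_x ((r x)%:E * en1 F (s, x)) <= A%:E &
     forall p, en1 F p <= (ker nu p.1 t0 p.2)%:E * (n1 (V (t0, p.2)))%:E + C%:E * KK nu (en1 F) (en1 F) p]].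
Proof.
move=> nu0 [mu0 mV mbV Vz Veq Vae Vbd] good t00 t0T.
have T0 : (0 <= T)%R := le_trans t00 t0T.
have [A A0 VA] := Vbd T.
have nV := nnm_en1 mV; have [mV1 V10] := nV.
pose M := cutb T (en1 V); have nM : nnm M := nnm_cutb T nV; have [mM M0] := nM.
have Mz p : ~~ within T p.1 -> M p = 0.
  rewrite /within negb_and -!ltNge => /orP[H|H]; last by rewrite /M cutb0.
  by rewrite /M /cutb /en1 n1_0 ?mule0// => i; apply: Vz; right.
have MA s : mass M s <= A%:E.
  have [sT|sT] := boolP (within T s); last first.
    by rewrite /mass; under eq_integral do rewrite Mz//; rewrite integral0 lee_fin.
  apply: le_trans (VA s sT); apply: (@le_trans _ _ (\int[mu]_x ((1 + r x)%:E * en1 V (s, x)))).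
    apply: ge0_le_integralT => x; first by nn.
    apply: le_trans (cutb_le T (V10 (s, x))) _; rewrite -[leLHS]mul1e.
    by apply: lee_pmul; [by []|exact: V10|rewrite lee_fin lerDl|by []].
  apply: (mass_le_om (h := fun x => en1 V (s, x))); first by move=> x; exact: V10.
  by move=> x rx; rewrite /en1 n1_0// => i; apply: Vz; left.
have KM p : (p.1 <= T)%R -> KK nu (en1 V) (en1 V) p = KK nu M M p.
  by move=> pT; rewrite -(@KK_cutb nu T).
have [mK K0] := nnm_KK nu nM nM.
pose b (p : P) := [&& (t0 < p.1)%R && (p.1 <= T)%R, (0 < r p.2)%R, bV p, bV (t0, p.2) &
  (KK nu M M p < +oo) && (KK nu M M (t0, p.2) < +oo)].
have mb : measurable_fun setT b.
  apply: measurable_and; first by apply: measurable_and; [apply: measurable_fun_ltr; ms|apply: measurable_fun_ler; ms].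
  apply: measurable_and; first by apply: measurable_fun_ltr; ms.
  apply: measurable_and => //; apply: measurable_and.
    by apply: (measurableT_comp mbV (g := fun p : P => (t0, p.2))); ms.
  by apply: measurable_and; apply: measurable_fun_lte; ms.
have aeb (t : TT R) : (t0 < t)%R -> (t <= T)%R -> {ae mu, forall x, b (t, x)}.
  move=> t0t tT; have Kt := KK_ae_fin t (ltW nu0) T0 A0 nM Mz MA.
  have Kt0 := KK_ae_fin t0 (ltW nu0) T0 A0 nM Mz MA.
  have Bt := good t (le_trans t00 (ltW t0t)); have Bt0 := good t0 t00.
  apply: filterS2 (filterI Bt (filterI Bt0 rne0)) (filterI Kt Kt0) => x [? [? rx]] [? ?].
  rewrite /b; apply/and5P; split.
  - by rewrite t0t.
  - by rewrite lt_def rx r0.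
  - by [].
  - by [].
  - by apply/andP; split.
pose F := cut b V; have mF : mfield F := mfield_cut mb mV.
have nF := nnm_en1 mF; have [mF1 F10] := nF.
have FV p : en1 F p <= en1 V p.
  rewrite /F /en1 /cut; have [_|_] := boolP (b p); first by [].
  by rewrite (n1_0 (v := fun=> 0%R))// lee_fin n1_ge0.
have FM p : en1 F p <= M p.
  have [bp|bp] := boolP (b p); last by rewrite /en1 n1_0// => i; rewrite /F /cut (negbTE bp).
  have /and5P[/andP[_ pT] _ _ _ _] := bp.
  by rewrite /M cutbE.
have Feq p c : b p -> V p c = (ker nu p.1 t0 p.2 * V (t0, p.2) c - duh_int nu (NL F F) p c)%R.
  move=> bp; have /and5P[/andP[t0p pT] rp bVp bV0 /andP[Kp Kp0]] := bp.
  rewrite (Veq p c bVp) (Veq (t0, p.2) c bV0) /duh /=.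
  have jV q : q.2 = p.2 -> (q.1 <= T)%R -> KK nu M M q < +oo ->
      L1 lam (fun s => ker nu q.1 s p.2 * NL V V (s, p.2) c)%R.
    move=> qp qT; rewrite -KM// -qp => Kq.
    by apply: (duh_integrable (mfield_NL mV mV) nV nV C10 (fun q => NL_bound' q c mV mV nV nV (fun _ => lexx _) (fun _ => lexx _)) Kq).
  have j1 := jV p erefl pT Kp; have j2 := jV (t0, p.2) erefl t0T Kp0.
  have j3 : L1 lam (fun s => ker nu p.1 s p.2 * NL F F (s, p.2) c)%R.
    by apply: (duh_integrable (mfield_NL mF mF) nM nM C10 (fun q => NL_bound' q c mF mF nM nM FM FM) Kp).
  (* The time integral is split at [t0]: earlier times factor through the kernel from [t0], and
     later ones involve only [F], which agrees with [V] at almost every frequency. *)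
  have -> : duh_int nu (NL V V) p c = (ker nu p.1 t0 p.2 * duh_int nu (NL V V) (t0, p.2) c + duh_int nu (NL F F) p c)%R.
    rewrite /duh_int -RIZ// -RID//; last exact: L1Z.
    apply: RI_ae; [exact: L1_meas j1|exact: L1_meas (L1D (L1Z _ j2) j3)|].
    apply: (ae_mono Vae) => s Hs /=.
    have [st0|t0s] := lerP s t0.
      rewrite (kerM _ _ st0 (ltW t0p)) (NL_0 _ (F := F)) ?mulr0 ?addr0 ?mulrA//= => y i.
      by rewrite /F /cut /b /= ltNge st0.
    have -> : ker nu t0 s p.2 = 0%R by rewrite /ker leNgt t0s.
    rewrite mul0r mulr0 add0r; have [sp|sp] := lerP s p.1; last first.
      by rewrite /ker leNgt sp !mul0r.
    congr (_ * _)%R; have H : {ae mu, forall y, forall i, F (s, y) i = V (s, y) i}.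
      by apply: (ae_mono (aeb s t0s (le_trans sp pT))) => y bs i; rewrite /F /cut bs.
    by rewrite (NL_ae_l _ _ mF mV mF H) (NL_ae_r _ _ mV mF mV H).
  have := kerM nu p.2 t00 (ltW t0p) => /= ->.
  move: (duh_int _ _ _ _) (duh_int _ _ _ _) (ker _ _ _ _) (ker _ _ _ _) => ? ? ? ?; ring.
(* The 1 makes the bound positive, as the step length in [mild_small] requires. *)
exists F, b, (A + 1)%R; split.
- exact: mF.
- by move=> p /negbTE bp c; rewrite /F /cut bp.
- move=> p bp; have /and5P[/andP[? ?] ? _ _ _] := bp; split=> //.
  by apply/funext => c; rewrite /F /cut bp.
- exact: aeb.
have A1 : (A%:E <= (A + 1)%:E)%E by rewrite lee_fin lerDl.
have Fint (w : X -> R) s : (forall x, 0 <= w x)%R -> (forall x, 0 < r x -> w x <= (r x)^-1 * om x)%R ->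
    \int[mu]_x ((w x)%:E * en1 F (s, x)) <= (A + 1)%:E.
  move=> w0 wr; apply: le_trans A1; have [sT|sT] := boolP (within T s); last first.
    under eq_integral => x _.
      rewrite (_ : en1 F (s, x) = 0) ?mule0; last by apply/eqP; rewrite eq_le F10 andbT; apply: le_trans (FM _) _; rewrite Mz.
      over.
    by rewrite integral0 lee_fin.
  apply: le_trans (VA s sT); apply: ge0_le_integralT => x; first by rewrite mule_ge0// lee_fin.
  rewrite [leRHS]muleA -[X in _ <= X * _]EFinM; have := r0 x; rewrite le_eqVlt => /orP[/eqP rx|rx]; last first.
    by apply: lee_pmul; [rewrite lee_fin|exact: F10|rewrite lee_fin; exact: wr|exact: FV].
  rewrite (_ : en1 F (s, x) = 0) ?mule0.
    by apply: mule_ge0; [rewrite lee_fin mulr_ge0 ?invr_ge0// sqr_ge0|exact: V10].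
  apply/eqP; rewrite eq_le F10 andbT; apply: le_trans (FV _) _.
  by rewrite /en1 n1_0// => i; apply: Vz; left.
split.
- by rewrite ltr_wpDl.
- move=> s; apply: (Fint (fun x => (r x)^-1)%R) => x; [by rewrite invr_ge0|move=> rx].
  by apply: ler_peMr; [rewrite invr_ge0 ltW|apply: le_trans (om_ge x); rewrite lerDl ltW].
- move=> s; apply: (Fint r) => // x rx.
  rewrite ler_pdivlMl// /om -expr2; apply: lerXn2r; rewrite ?nnegrE ?ltW//; first by lra.
  by rewrite ltrDr.
move=> p; have [bp|bp] := boolP (b p); last first.
  have [mK1 K10] := nnm_KK nu nF nF.
  rewrite {1}/en1 n1_0; first by nn; first [exact: n1_ge0|exact: ltW].
  by move=> i; rewrite /F /cut (negbTE bp).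
apply: (@le_trans _ _ (n1 (fun i => ker nu p.1 t0 p.2 * V (t0, p.2) i)%R + n1 (duh_int nu (NL F F) p))%:E).
  rewrite /en1 lee_fin (_ : F p = fun i => (ker nu p.1 t0 p.2 * V (t0, p.2) i - duh_int nu (NL F F) p i)%R).
    exact: n1_sub.
  by apply/funext => i; rewrite -Feq// /F /cut bp.
rewrite EFinD n1Z ?ker_ge0// EFinM; apply: leeD; first by [].
have [mK1 K10] := nnm_KK nu nF nF.
rewrite -[C]mul1r; apply: n1_le => // c; rewrite mul1r; apply: duh_int_bound; [exact: mfield_NL|exact: nF|exact: nF|by []|].
by move=> q; apply: NL_bound'.
Qed.
Lemma decay_small (nu e : R) (u0 : X -> I -> R) (V : P -> I -> R) (bV : P -> bool) (t0 : R) :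
  (0 < nu)%R -> mild_field nu u0 V bV -> all_good bV -> (0 <= t0)%R -> (0 <= e)%R -> (8 * C * e <= nu)%R ->
  \int[mu]_x ((r x)^-1%:E * en1 V (t0, x)) <= e%:E ->
  forall t : TT R, (t0 < t)%R -> \int[mu]_x ((r x)^-1%:E * en1 V (t, x)) <= (2 * e)%:E.
Proof.
move=> nu0 mV good t00 e0 Ce Ve t t0t.
have [F [b [A [mF Fz FE aeb [A0 F1 F2 Fle]]]]] := continuation nu0 mV good t00 (ltW t0t).
have nF := nnm_en1 mF; have [mF1 F10] := nF; have [mV1 V10] := nnm_en1 (mild_meas mV).
have mV0 : measurable_fun setT (fun x => (n1 (V (t0, x)))%:E).
  by apply: (measurableT_comp mV1 (g := fun x : X => (t0, x))); ms.
apply: (@le_trans _ _ (\int[mu]_x ((r x)^-1%:E * en1 F (t, x)))).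
  apply: ae_ge0_le_integral => //; [by move=> x _; nn|by ms|by move=> x _; nn|by ms|].
  by apply: (ae_mono (aeb t t0t (lexx _))) => x /FE[_ _ _ E] _; rewrite /en1 E.
apply: (@mild_small nu C e A t0 (fun x => (n1 (V (t0, x)))%:E)) => //.
- by move=> x; rewrite lee_fin n1_ge0.
- move=> p rp; rewrite /en1 n1_0// => i; apply: Fz; apply/negP => /FE[_ _ + _].
  by rewrite rp ltxx.
- move=> p pt; rewrite /en1 n1_0// => i; apply: Fz; apply/negP => /FE[+ _ _ _].
  by rewrite ltNge (ltW pt).
Qed.

(** By [mild_gevrey] the weighted majorant solves the same kind of inequality with viscosity
    [nu / 2], constant [c * C] and datum [c * e]. The condition [8 * (c * C) * (c * e) <= nu / 2] of
    [mild_small] is the one assumed here, and the weight at time [t0 + 1] is the one in the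
    conclusion. *)
Lemma gev_small (nu e al rho : R) (u0 : X -> I -> R) (V : P -> I -> R) (bV : P -> bool) (t0 : R) :
  (0 < nu)%R -> (0 < al)%R -> (0 <= rho)%R -> mild_field nu u0 V bV -> all_good bV -> (0 <= t0)%R -> (0 <= e)%R ->
  let c := expR (al ^+ 2 / (2 * nu)) in (16 * (c * C) * (c * e) <= nu)%R ->
  \int[mu]_x ((r x)^-1%:E * en1 V (t0, x)) <= e%:E ->
  \int[mu]_x ((r x)^-1%:E * ((expR (al * Num.min (r x) rho))%:E * en1 V (t0 + 1, x)%R)) <= (2 * (c * e))%:E.
Proof.
move=> nu0 al0 rho0 mV good t00 e0 c Ce Ve; pose t := (t0 + 1)%R.
have t0t : (t0 < t)%R by rewrite ltrDl.
have [F [b [A [mF Fz FE aeb [A0 F1 F2 Fle]]]]] := continuation nu0 mV good t00 (ltW t0t).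
have nF := nnm_en1 mF; have [mF1 F10] := nF; have [mV1 V10] := nnm_en1 (mild_meas mV).
have mV0 : measurable_fun setT (fun x => (n1 (V (t0, x)))%:E).
  by apply: (measurableT_comp mV1 (g := fun x : X => (t0, x))); ms.
have Fout p : ~~ (t0 <= p.1)%R || ~~ (p.1 <= t0 + 1)%R -> en1 F p = 0.
  move=> H; rewrite /en1 n1_0// => i; apply: Fz; apply/negP => /FE[t0p pt _ _].
  by move: H; rewrite (ltW t0p) pt.
have n10 x : 0 <= (n1 (V (t0, x)))%:E by rewrite lee_fin n1_ge0.
have h0 := mild_gevrey rsub nu0 al0 rho0 (ltW C0) mV0 n10 nF Fout Fle.
pose h p := (gev al rho t0 p.1 p.2)%:E * en1 F p.
have {h0} hle p : h p <= (ker (nu / 2) p.1 t0 p.2)%:E * (c%:E * (n1 (V (t0, p.2)))%:E) + (c * C)%:E * KK (nu / 2) h h p := h0 p.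
have c0 : (0 < c)%R by exact: expR_gt0.
have mgev d' (T' : measurableType d') (u : T' -> TT R) (v : T' -> X) : measurable_fun setT u ->
    measurable_fun setT v -> measurable_fun setT (fun z => gev al rho t0 (u z) (v z)).
  by move=> mu' mv; rewrite /gev; ms; apply: measurable_minr; ms.
have gp t' x : (0 <= gev al rho t0 t' x)%R by exact: expR_ge0.
have nh : nnm h.
  split; last by move=> q; rewrite /h mule_ge0// lee_fin.
  by rewrite /h; apply: emeasurable_funM => //; apply: mEFin; apply: mgev; ms.
have [mh hh0] := nh.
(* Truncation bounds the weight by [D] over the unit interval, so the weighted norms are finite. [D]
   does not enter the final bound, which is uniform in [rho]. *)
pose D := expR (al * rho); have D0 : (0 < D)%R by exact: expR_gt0.
have hF p : h p <= D%:E * en1 F p.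
  have [bp|bp] := boolP (b p); last first.
    by rewrite /h /en1 n1_0 ?mule0// => i; exact: Fz.
  have [t0p pt _ _] := FE p bp.
  apply: lee_pmul; [by rewrite lee_fin|exact: F10| |by []].
  rewrite lee_fin ler_expR; have m1 : (Num.min (r p.2) rho <= rho)%R by rewrite ge_min lexx orbT.
  have m0 : (0 <= Num.min (r p.2) rho)%R by rewrite le_min r0 rho0.
  have q1 : (al * (p.1 - t0) <= al * 1)%R by rewrite ler_pM2l//; move: pt; rewrite /t; lra.
  rewrite mulr1 in q1; apply: ler_pM => //; apply: mulr_ge0; [exact: ltW|].
  by rewrite subr_ge0 ltW.
have hint (w : X -> R) s : (forall x, 0 <= w x)%R -> measurable_fun setT w -> \int[mu]_x ((w x)%:E * en1 F (s, x)) <= A%:E ->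
    \int[mu]_x ((w x)%:E * h (s, x)) <= (D * A)%:E.
  move=> w0 mw H; apply: (@le_trans _ _ (\int[mu]_x (D%:E * ((w x)%:E * en1 F (s, x))))).
    apply: ge0_le_integralT => x; first by nn.
    rewrite [leRHS]muleCA; apply: lee_pmul; [by rewrite lee_fin|exact: hh0|by []|exact: hF].
  rewrite ge0_integralZlT; [|by ms|by nn|by rewrite lee_fin ltW].
  by rewrite EFinM; apply: lee_pmul; [by rewrite lee_fin ltW|by nn|by []|].
apply: (@le_trans _ _ (\int[mu]_x ((r x)^-1%:E * h (t, x)))).
  apply: ae_ge0_le_integral => //.
  - by move=> x _; apply: mule_ge0; [nn|apply: mule_ge0; [rewrite lee_fin expR_ge0|exact: V10]].
  - apply: emeasurable_funM; first by ms.
    by apply: emeasurable_funM; [apply: mEFin; ms; apply: measurable_minr; ms|ms].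
  - by move=> x _; nn.
  - by ms.
  apply: (ae_mono (aeb t t0t (lexx _))) => x /FE[_ _ _ E] _; rewrite /h /en1 E /gev.
  by rewrite /t addrAC subrr add0r mulr1.
apply: (@mild_small (nu / 2) (c * C) (c * e) (D * A) t0 (fun x => c%:E * (n1 (V (t0, x)))%:E)) => //.
- by rewrite divr_gt0.
- by rewrite mulr_gt0.
- by rewrite mulr_ge0// ltW.
- by move: Ce; move: (c * C * (c * e))%R (mulrA 8%R (c * C)%R (c * e)%R) (mulrA 16%R (c * C)%R (c * e)%R) => z <- <-; lra.
- by rewrite mulr_gt0.
- exact: emeasurable_funM (measurable_cst _) mV0.
- by move=> x; apply: mule_ge0; [rewrite lee_fin ltW|].
- move=> p rp; rewrite /h /en1 n1_0 ?mule0// => i; apply: Fz; apply/negP => /FE[_ _ + _].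
  by rewrite rp ltxx.
- move=> p pt; rewrite /h Fout ?mule0//; by rewrite -ltNge pt.
- move=> s; apply: (hint (fun x => (r x)^-1)%R) => //; [by move=> x; rewrite invr_ge0|by ms].
- by move=> s; apply: hint.
- under eq_integral do rewrite muleCA.
  rewrite ge0_integralZlT; [|by apply: emeasurable_funM; [ms|exact: mV0]|by move=> x; apply: mule_ge0; [nn|exact: n10]|by rewrite lee_fin ltW].
  rewrite EFinM; apply: lee_pmul; [by rewrite lee_fin ltW| |by []|exact: Ve].
  by apply: integral_ge0 => x _; nn; exact: n1_ge0.
Qed.

Lemma gevrey_decay (nu : R) (u0 : X -> I -> R) (V : P -> I -> R) (bV : P -> bool) (al eta : R) :
  (0 < nu)%R -> (0 < al)%R -> mild_field nu u0 V bV -> all_good bV ->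
  (forall x, divfree x (u0 x)) -> (forall x c, r x = 0%R -> u0 x c = 0%R) ->
  \int[mu]_x ((r x)^-1%:E * ((om x)%:E * (n1 (u0 x))%:E)) < +oo ->
  (forall p, divfree p.2 (V p)) -> cancels V -> (0 < eta)%R ->
  exists2 t1 : R, (0 <= t1)%R & forall t : TT R, (t1 <= t)%R ->
    \int[mu]_x ((r x)^-1%:E * ((expR (al * r x))%:E * en1 V (t, x))) <= eta%:E.
Proof.
move=> nu0 al0 mV good du0 u0z u0f dV canV eta0.
pose c := expR (al ^+ 2 / (2 * nu)); have c1 : (1 <= c)%R.
  by rewrite -expR0 ler_expR; apply: divr_ge0; [exact: sqr_ge0|rewrite mulr_ge0// ltW].
have c0 : (0 < c)%R by apply: lt_le_trans c1.
(* Each of [decay_small] and [gev_small] doubles the bound, which gives [4 * c * e <= eta]; the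
   doubling before [gev_small] turns its 16 into 32. *)
pose e := (Num.min (eta / (4 * c)) (nu / (32 * (c * C) * c)))%R.
have e0 : (0 < e)%R by rewrite lt_min !divr_gt0// !mulr_gt0.
have e1 : (4 * c * e <= eta)%R by rewrite mulrC -ler_pdivlMr ?mulr_gt0// ge_min lexx.
have e2 : (32 * (c * C) * c * e <= nu)%R by rewrite mulrC -ler_pdivlMr ?mulr_gt0// ge_min lexx orbT.
have e3 : (8 * C * e <= nu)%R.
  apply: le_trans e2; have : (0 <= C * e)%R by rewrite mulr_ge0// ltW.
  have -> : (32 * (c * C) * c * e = 32 * (c * c) * (C * e))%R by ring.
  have -> : (8 * C * e = 8 * (C * e))%R by ring.
  move=> Ce0; apply: ler_wpM2r => //.
  by move: c1; generalize c => y y1; nra.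
have [t0 [t00 _ Vt0]] := eventually_small nu0 mV du0 u0z u0f dV canV e0.
(* Leaves the unit interval before [t] strictly after [t0], where smallness has propagated. *)
exists (t0 + 2)%R => [|t tt]; first by rewrite addr_ge0.
have t1' : (t0 < t - 1)%R by move: tt; lra.
have small := decay_small nu0 mV good t00 (ltW e0) e3 Vt0 t1'.
have t1'0 : (0 <= t - 1)%R by apply: le_trans t00 (ltW t1').
have e20 : (0 <= 2 * e)%R by rewrite mulr_ge0// ltW.
have e4 : (16 * (c * C) * (c * (2 * e)) <= nu)%R by have -> : (16 * (c * C) * (c * (2 * e)) = 32 * (c * C) * c * e)%R by ring.
have G n := gev_small nu0 al0 (ler0n R n) mV good t1'0 e20 e4 small.
rewrite subrK in G.
have [mV1 V10] := nnm_en1 (mild_meas mV).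
pose g (n : nat) x := (r x)^-1%:E * ((expR (al * Num.min (r x) n%:R))%:E * en1 V (t, x)).
have mg n : measurable_fun setT (g n).
  apply: emeasurable_funM; first by ms.
  by apply: emeasurable_funM; [apply: mEFin; ms; apply: measurable_minr; ms|ms].
have g0 n x : 0 <= g n x by apply: mule_ge0; [nn|apply: mule_ge0; [rewrite lee_fin expR_ge0|exact: V10]].
(* At each frequency the truncation at level [n] is inactive for large [n], so Fatou's lemma
   recovers the full weight. *)
apply: (@le_trans _ _ (\int[mu]_x limn_einf (g ^~ x))).
  apply: ge0_le_integralT => x; first by apply: mule_ge0; [nn|apply: mule_ge0; [rewrite lee_fin expR_ge0|exact: V10]].
  apply: (@le_limn_einf _ _ _ (Num.truncn (r x)).+1) => n rn; rewrite /g.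
  rewrite (_ : Num.min (r x) n%:R = r x)//; apply/min_idPl.
  by apply: le_trans (ltW (truncnS_gt _)) _; rewrite ler_nat.
apply: le_trans (fatou _ measurableT mg (fun n x _ => g0 n x)) _.
apply: limn_einf_le => n; apply: le_trans (G n) _.
rewrite lee_fin -/c; apply: le_trans e1.
by have -> : (2 * (c * (2 * e)) = 4 * c * e)%R by ring.
Qed.
End Divergence.

End Majorant.

(** * The frequency space R^3 *)

Section Geometry.
Context (R : realType).
Local Notation X := (X3 R).

Lemma norm3E (x : R * R * R) : norm3 x = Num.sqrt (x.1.1 ^+ 2 + x.1.2 ^+ 2 + x.2 ^+ 2).
Proof. by rewrite /norm3 !big_ord_recl big_ord0 addr0 /coord3 /= addrA. Qed.

Lemma norm3_ge0 (x : R * R * R) : 0 <= norm3 x. Proof. exact: sqrtr_ge0. Qed.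

Lemma norm3_sq (x : R * R * R) : norm3 x ^+ 2 = \sum_k coord3 x k ^+ 2.
Proof. by rewrite sqr_sqrtr// sumr_ge0// => k _; rewrite sqr_ge0. Qed.

Lemma coord3_le (x : R * R * R) k : `|coord3 x k| <= norm3 x.
Proof.
rewrite -(ler_pXn2r (n := 2))// ?nnegrE ?norm3_ge0// norm3_sq (bigD1 k)//= real_normK ?num_real//.
by rewrite lerDl sumr_ge0// => i _; rewrite sqr_ge0.
Qed.

Lemma norm3_eq0 (x : R * R * R) k : norm3 x = 0 -> coord3 x k = 0.
Proof. by move=> x0; apply/eqP; rewrite -normr_le0 -x0 coord3_le. Qed.

(** The Cauchy-Schwarz inequality comes from Lagrange's identity, which writes the difference as a
    sum of three squares. *)
Lemma norm3_triangle (x y : R * R * R) : norm3 x <= norm3 y + norm3 (sub3 x y).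
Proof.
case: x => [[x1 x2] x3]; case: y => [[y1 y2] y3]; rewrite !norm3E /sub3 /=.
have [u1 [u2 [u3 [-> -> ->]]]] : exists u1 u2 u3, [/\ x1 = y1 + u1, x2 = y2 + u2 & x3 = y3 + u3].
  by exists (x1 - y1), (x2 - y2), (x3 - y3); split; ring.
have E (p q : R) : p + q - p = q by ring.
rewrite !E; set S := y1 ^+ 2 + _ + _; set T := u1 ^+ 2 + _ + _.
have S0 : 0 <= S by rewrite !addr_ge0// sqr_ge0.
have T0 : 0 <= T by rewrite !addr_ge0// sqr_ge0.
have ST : y1 * u1 + y2 * u2 + y3 * u3 <= Num.sqrt S * Num.sqrt T.
  rewrite -sqrtrM//; apply: le_trans (ler_norm _) _; rewrite -sqrtr_sqr ler_wsqrtr// -subr_ge0.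
  rewrite (_ : _ - _ = (y1 * u2 - y2 * u1) ^+ 2 + (y1 * u3 - y3 * u1) ^+ 2 + (y2 * u3 - y3 * u2) ^+ 2); last by rewrite /S /T; ring.
  by rewrite !addr_ge0// sqr_ge0.
rewrite -(ler_pXn2r (n := 2))// ?nnegrE ?sqrtr_ge0 ?addr_ge0 ?sqrtr_ge0//.
rewrite sqr_sqrtr ?addr_ge0 ?sqr_ge0// [leRHS]sqrrD !sqr_sqrtr// -subr_ge0.
rewrite (_ : _ - _ = 2 * (Num.sqrt S * Num.sqrt T - (y1 * u1 + y2 * u2 + y3 * u3))).
  by rewrite mulr_ge0// subr_ge0.
by rewrite /S /T; move: (Num.sqrt _) (Num.sqrt _) => *; ring.
Qed.

Lemma sub3K (c x : R * R * R) : sub3 c (sub3 c x) = x.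
Proof. by case: x => [[? ?] ?]; rewrite /sub3 /=; congr (_, _, _); ring. Qed.

Lemma measurable_sub3 : measurable_fun setT (fun p : X * X => sub3 p.1 p.2 : X).
Proof.
rewrite /sub3; apply: mpair; first apply: mpair.
- by apply: (measurable_funB (f := fun p : X * X => p.1.1.1 : R)); ms.
- by apply: (measurable_funB (f := fun p : X * X => p.1.1.2 : R)); ms.
- by apply: (measurable_funB (f := fun p : X * X => p.1.2 : R)); ms.
Qed.

Lemma measurable_coord3 d (T : measurableType d) (e : T -> X) k : measurable_fun setT e ->
  measurable_fun setT (fun t => coord3 (e t) k).
Proof.
by move=> me; rewrite /coord3; case: (val k) => [|[|n]]; ms.
Qed.

Lemma measurable_norm3 : measurable_fun setT (fun x : X => norm3 x).
Proof.
under eq_fun do rewrite norm3E.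
apply: (measurableT_comp (f := @Num.sqrt R)); first exact: continuous_measurable_fun (@sqrt_continuous R).
by do 2?[apply: measurable_funD]; apply: measurable_funX; ms.
Qed.

(** * Dyadic shells and integrability of the dissipation weight *)

Definition ball3 (rho : R) : set X := [set x | norm3 x <= rho].

Lemma measurable_ball3 rho : measurable (ball3 rho).
Proof.
rewrite (_ : ball3 rho = (fun x : X => norm3 x <= rho) @^-1` [set true]); last first.
  by apply/seteqP; split => x /=.
rewrite -[X in measurable X]setTI; apply: measurable_fun_ler => //; first exact: measurable_norm3.
Qed.

Lemma ball3_volume (rho : R) : 0 <= rho -> (mu3 R (ball3 rho) <= ((2 * rho) ^+ 3)%:E)%E.
Proof.
move=> rho0; pose Q : set (TT R) := `[- rho, rho]%classic.
have mQ : measurable Q by exact: measurable_itv.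
have lQ : lam R Q = (2 * rho)%:E.
  rewrite /lam /Q /= lebesgue_measure_itv /= lte_fin; case: ifPn => [_|].
    by rewrite -EFinB; congr (_%:E); ring.
  rewrite -leNgt => H; congr (_%:E); lra.
have sub : ball3 rho `<=` (Q `*` Q) `*` Q.
  move=> x /= xr.
  have H k : - rho <= coord3 x k <= rho by rewrite -ler_norml (le_trans (coord3_le x k)).
  have := H 0; have := H 1; have := H 2%:R; rewrite /coord3 /= => h2 h1 h0.
  by rewrite /Q /= !in_itv/=; split; first split.
apply: (@le_trans _ _ (mu3 R ((Q `*` Q) `*` Q))).
  by apply: le_measure => //; rewrite inE; [exact: measurable_ball3|do 2?apply: measurableX].
rewrite /mu3 /=/prodm product_measure1E//; last exact: measurableX.
have QQ : (lam R \x lam R)%E (Q `*` Q) = ((2 * rho)%:E * (2 * rho)%:E)%E.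
  by rewrite product_measure1E//; congr (_ * _)%E; exact: lQ.
change ((lam R \x lam R)%E (Q `*` Q) * lam R Q <= ((2 * rho) ^+ 3)%:E)%E.
rewrite QQ lQ -!EFinM lee_fin.
by rewrite !exprS expr0 mulr1 mulrA.
Qed.

Lemma norm3_neq0 : {ae mu3 R, forall x, norm3 x != 0}.
Proof.
exists (ball3 0); split; first exact: measurable_ball3.
  by apply/eqP; rewrite eq_le measure_ge0 andbT; apply: le_trans (ball3_volume (lexx _)) _; rewrite mulr0 expr0n.
by move=> x /= /negP; rewrite negbK => /eqP x0; rewrite /ball3 /= x0.
Qed.

Lemma dyadic_small (y : R) : 0 < y -> y <= 1 -> exists n : nat, 2^-1 ^+ n.+1 < y /\ y <= 2^-1 ^+ n.
Proof.
move=> y0 y1.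
have ex : exists n : nat, 2^-1 ^+ n < y.
  exists (Num.truncn y^-1).+1; set n := (Num.truncn y^-1).+1.
  have yn : y^-1 < n%:R by exact: truncnS_gt.
  rewrite -[ltRHS]invrK exprVn ltf_pV2 ?posrE ?exprn_gt0 ?invr_gt0//.
  apply: (lt_trans yn); rewrite -natrX ltr_nat; exact: ltn_expl.
case: (ex_minnP ex) => -[|n] Hn Hmin; first by rewrite expr0 ltNge y1 in Hn.
exists n; split=> //; rewrite leNgt; apply/negP => /Hmin; by rewrite ltnn.
Qed.

Lemma dyadic_large (y : R) : 1 < y -> exists n : nat, 2 ^+ n < y /\ y <= 2 ^+ n.+1.
Proof.
move=> y1.
have ex : exists n : nat, y <= 2 ^+ n.
  exists (Num.truncn y).+1; set n := (Num.truncn y).+1.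
  have yn : y < n%:R by exact: truncnS_gt.
  apply: (le_trans (ltW yn)); rewrite -natrX ler_nat; exact: ltnW (ltn_expl _ _).
case: (ex_minnP ex) => -[|n] Hn Hmin; first by rewrite expr0 leNgt y1 in Hn.
exists n; split=> //; rewrite ltNge; apply/negP => /Hmin; by rewrite ltnn.
Qed.

(** Dominates [r^-2 (1 + r^2)^-1] on two shells: it is at most [4^(n+1)] for [2^-(n+1) < r <= 2^-n],
    and at most [16^-n] for [2^n < r <= 2^(n+1)]. Each shell is enlarged to a ball. *)
Definition layer (n : nat) (x : X) : R :=
  4 ^+ n.+1 * \1_(ball3 (2^-1 ^+ n)) x + 16^-1 ^+ n * \1_(ball3 (2 ^+ n.+1)) x.

Lemma layer_ge0 n x : 0 <= layer n x.
Proof. by rewrite addr_ge0// mulr_ge0// ?exprn_ge0// ?invr_ge0// indicE. Qed.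

Lemma measurable_layer n : measurable_fun setT (layer n).
Proof.
by apply: measurable_funD; apply: measurable_funM => //; apply: measurable_indic; exact: measurable_ball3.
Qed.

(** Balls are bounded by cubes of volume [(2 rho)^3]. The inner one contributes [32 * 2^-n] and the
    outer one [64 * 2^-n]. *)
Lemma integral_layer n : (\int[mu3 R]_x (layer n x)%:E <= (96 * 2^-1 ^+ n)%:E)%E.
Proof.
have I A : measurable A -> (\int[mu3 R]_x (\1_A x)%:E = mu3 R A)%E.
  by move=> mA; rewrite integral_indic// setIT.
have m1 : measurable_fun setT (fun x : X => (\1_(ball3 (2^-1 ^+ n)) x : R)%:E).
  by apply: mEFin; apply: measurable_indic; exact: measurable_ball3.
have m2 : measurable_fun setT (fun x : X => (\1_(ball3 (2 ^+ n.+1)) x : R)%:E).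
  by apply: mEFin; apply: measurable_indic; exact: measurable_ball3.
have q1 : 0 <= 4 ^+ n.+1 :> R by rewrite exprn_ge0.
have q2 : 0 <= 16^-1 ^+ n :> R by rewrite exprn_ge0// invr_ge0.
have i1 : 0 <= 2^-1 ^+ n :> R by rewrite exprn_ge0// invr_ge0.
have i2 : 0 <= 2 ^+ n.+1 :> R by rewrite exprn_ge0.
under eq_integral do rewrite /layer EFinD !EFinM.
rewrite ge0_integralD//; try by [move=> x _; rewrite -EFinM lee_fin mulr_ge0// indicE|apply: emeasurable_funM].
rewrite ge0_integralZlT//.
rewrite ge0_integralZlT//.
rewrite !I; [|exact: measurable_ball3..].
apply: (@le_trans _ _ ((4 ^+ n.+1)%:E * ((2 * 2^-1 ^+ n) ^+ 3)%:E + (16^-1 ^+ n)%:E * ((2 * 2 ^+ n.+1) ^+ 3)%:E)%E).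
  by apply: leeD; apply: lee_pmul => //; exact: ball3_volume.
rewrite -!EFinM -EFinD lee_fin.
have E4 : 4 ^+ n = (2 ^+ n) ^+ 2 :> R by rewrite -exprM mulnC exprM; congr (_ ^+ _); ring.
have E16 : 16^-1 ^+ n = (2^-1 ^+ n) ^+ 4 :> R by rewrite -exprM mulnC exprM; congr (_ ^+ _); field.
have u : 2 ^+ n * 2^-1 ^+ n = 1 :> R by rewrite -exprMn mulfV// expr1n.
rewrite [4 ^+ n.+1]exprS [2 ^+ n.+1]exprS E4 E16; move: (2 ^+ n) (2^-1 ^+ n) u => A B u.
rewrite le_eqVlt; apply/orP; left; apply/eqP.
transitivity (32 * B * (A * B) ^+ 2 + 64 * B * (A * B) ^+ 3); first by ring.
by rewrite u; ring.
Qed.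

Lemma layer_bound x : exists n, (norm3 x)^-1 ^+ 2 * (1 + norm3 x ^+ 2)^-1 <= layer n x.
Proof.
have r0 := norm3_ge0 x; set r := norm3 x in r0 *.
have I A : 0 <= \1_A x :> R by rewrite indicE.
have [rE|rn] := eqVneq r 0.
  by exists 0%N; rewrite rE invr0 expr0n mul0r layer_ge0.
have rp : 0 < r by rewrite lt_def rn.
have q2 n : 0 <= 16^-1 ^+ n :> R by rewrite exprn_ge0// invr_ge0.
have q1 n : 0 <= 4 ^+ n :> R by rewrite exprn_ge0.
have [r1|r1] := leP r 1.
  have [n [n1 n2]] := dyadic_small rp r1; exists n.
  apply: (@le_trans _ _ (4 ^+ n.+1)); last first.
    by rewrite /layer [\1_(ball3 (2^-1 ^+ n)) x]indicE mem_set// mulr1 lerDl mulr_ge0.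
  apply: (@le_trans _ _ (r^-1 ^+ 2)).
    by apply: ler_piMr; rewrite ?sqr_ge0// invf_le1 ?lerDl ?sqr_ge0// ltr_pwDl// sqr_ge0.
  rewrite (_ : 4 = 2 ^+ 2); last by ring.
  rewrite -exprM mulnC exprM; apply: lerXn2r; rewrite ?nnegrE ?invr_ge0 ?exprn_ge0//.
  by rewrite -[leRHS]invrK lef_pV2 ?posrE ?invr_gt0 ?exprn_gt0// -exprVn ltW.
have [n [n1 n2]] := dyadic_large r1; exists n.
apply: (@le_trans _ _ (16^-1 ^+ n)); last first.
  by rewrite /layer [\1_(ball3 (2 ^+ n.+1)) x]indicE mem_set// mulr1 lerDr mulr_ge0.
have q3 : 0 <= 2^-1 ^+ n :> R by rewrite exprn_ge0// invr_ge0.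
have rV : r^-1 <= 2^-1 ^+ n by rewrite exprVn lef_pV2 ?posrE ?exprn_gt0// ltW.
have rV0 : 0 <= r^-1 by rewrite invr_ge0.
have rV2 : r^-1 ^+ 2 <= (2^-1 ^+ n) ^+ 2 by apply: lerXn2r.
have -> : 16^-1 ^+ n = (2^-1 ^+ n) ^+ 2 * (2^-1 ^+ n) ^+ 2 :> R.
  by rewrite -exprD -exprM mulnC exprM; congr (_ ^+ _); field.
apply: ler_pM => //; rewrite ?sqr_ge0//; first by rewrite invr_ge0 addr_ge0// sqr_ge0.
apply: le_trans rV2; rewrite exprVn lef_pV2 ?posrE ?exprn_gt0//; first by rewrite lerDr.
by rewrite ltr_pwDl// sqr_ge0.
Qed.

Lemma dissipation_weight_fin : (\int[mu3 R]_x ((norm3 x)^-1 ^+ 2 * (1 + norm3 x ^+ 2)^-1)%:E < +oo)%E.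
Proof.
have mn := measurable_norm3.
have ml n : measurable_fun setT (fun x => (layer n x)%:E) by apply: mEFin; exact: measurable_layer.
have l0 n x : (0 <= (layer n x)%:E)%E by rewrite lee_fin layer_ge0.
apply: (@le_lt_trans _ _ (\int[mu3 R]_x \sum_(0 <= n <oo) (layer n x)%:E)%E).
  apply: ge0_le_integralT => x.
    by rewrite lee_fin mulr_ge0 ?sqr_ge0// invr_ge0 addr_ge0// sqr_ge0.
  have [n Hn] := layer_bound x; apply: (@le_trans _ _ (layer n x)%:E); first by rewrite lee_fin.
  by rewrite (nneseriesD1 (n := n))// leeDl// nneseries_ge0.
rewrite integral_nneseries//; apply: (@geometric_bound _ _ 96) => n; first by apply: integral_ge0.
by apply: le_trans (integral_layer n) _; rewrite exprVn.
Qed.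
End Geometry.

(** * The nonlinearity of the Navier-Stokes system *)

Section Bilinear.
Context (R : realType).
Local Notation X := (X3 R).
Local Notation I := ('I_3 * bool)%type.
Local Notation vec := (I -> R).

Lemma sumI (f : I -> R) : \sum_c f c = \sum_j (f (j, false) + f (j, true)).
Proof.
transitivity (\sum_j \sum_b f (j, b)); first by rewrite pair_bigA; apply: eq_bigr => -[].
by apply: eq_bigr => j _; rewrite big_bool addrC.
Qed.

(* [(j, false)] indexes the real part of the component [j], [(j, true)] its imaginary part. *)
Definition enc (v : 'I_3 -> cplx R) (c : I) : R := if c.2 then (v c.1).2 else (v c.1).1.

(** The constant in the Fourier transform of a product. *)
Definition c0 : R := (2 * pi) ^- 3.

Lemma c0_ge0 : 0 <= c0. Proof. by rewrite invr_ge0 exprn_ge0// mulr_ge0// pi_ge0. Qed.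

Definition pairre (u v : vec) (k l : 'I_3) : R := u (k, false) * v (l, false) - u (k, true) * v (l, true).
Definition pairim (u v : vec) (k l : 'I_3) : R := u (k, false) * v (l, true) + u (k, true) * v (l, false).

Definition leray (x : X) (S : 'I_3 -> 'I_3 -> R) (j : 'I_3) : R :=
  c0 * (\sum_k coord3 x k * S k j - coord3 x j / norm3 x ^+ 2 * (\sum_l coord3 x l * \sum_k coord3 x k * S k l)).

(** The divergence carries a factor [i]: the imaginary part of the result comes from the real part
    of the products, and the real part from minus their imaginary part. *)
Definition bilin (x : X) (c : I) (u v : vec) : R :=
  if c.2 then leray x (pairre u v) c.1 else - leray x (pairim u v) c.1.

Lemma lerayB x S S' S'' j : (forall k l, S k l = S' k l - S'' k l) -> leray x S j = leray x S' j - leray x S'' j.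
Proof.
move=> SS; rewrite /leray; move: (coord3 x j / norm3 x ^+ 2) => k.
rewrite !big_ord_recl !big_ord0 !SS; ring.
Qed.

Lemma bilinl x c u u' v : bilin x c (fun i => u i - u' i) v = bilin x c u v - bilin x c u' v.
Proof.
rewrite /bilin; case: c => j [] /=.
  by rewrite (@lerayB x _ (pairre u v) (pairre u' v))// => k l; rewrite /pairre; ring.
by rewrite (@lerayB x _ (pairim u v) (pairim u' v)) 1?opprB ?opprK 1?addrC// => k l; rewrite /pairim; ring.
Qed.

Lemma bilinr x c u v v' : bilin x c u (fun i => v i - v' i) = bilin x c u v - bilin x c u v'.
Proof.
rewrite /bilin; case: c => j [] /=.
  by rewrite (@lerayB x _ (pairre u v) (pairre u v'))// => k l; rewrite /pairre; ring.
by rewrite (@lerayB x _ (pairim u v) (pairim u v')) 1?opprB ?opprK 1?addrC// => k l; rewrite /pairim; ring.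
Qed.

(** The constant is [12 = 3 + 9]: three terms in the divergence, nine in the double sum of the
    gradient part, where the two extra coordinates are compensated by [|x|^-2]. At the zero
    frequency all coordinates vanish. *)
Lemma leray_bound x S j (m : R) : (forall k l, `|S k l| <= m) -> `|leray x S j| <= 12 * c0 * norm3 x * m.
Proof.
move=> Sm; have m0 : 0 <= m := le_trans (normr_ge0 _) (Sm 0 0).
have r0 := norm3_ge0 x; set r := norm3 x in r0 *.
have cr k : `|coord3 x k| <= r := coord3_le x k.
pose s l := \sum_k coord3 x k * S k l.
have sb l : `|s l| <= 3 * r * m.
  rewrite /s; apply: (le_trans (ler_norm_sum _ _ _)).
  apply: (@le_trans _ _ (\sum_(k < 3) r * m)).
    by apply: ler_sum => k _; rewrite normrM ler_pM.
  by rewrite sumr_const card_ord -mulrA mulr_natl.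
have qb : `|\sum_l coord3 x l * s l| <= 9 * r ^+ 2 * m.
  apply: (le_trans (ler_norm_sum _ _ _)).
  apply: (@le_trans _ _ (\sum_(k < 3) r * (3 * r * m))).
    by apply: ler_sum => k _; rewrite normrM ler_pM.
  by rewrite sumr_const card_ord -mulr_natl le_eqVlt; apply/orP; left; apply/eqP; ring.
rewrite (_ : 12 * c0 * r * m = c0 * (12 * r * m)); last by ring.
rewrite /leray -/r normrM (ger0_norm c0_ge0); apply: ler_wpM2l; first exact: c0_ge0.
apply: (le_trans (ler_normB _ _)); apply: (@le_trans _ _ (3 * r * m + 9 * r * m)); last by rewrite le_eqVlt; apply/orP; left; apply/eqP; ring.
apply: lerD; first exact: sb.
have [rE|rn] := eqVneq r 0.
  by rewrite norm3_eq0// mul0r mul0r normr0 !mulr_ge0.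
rewrite normrM normrM normfV (ger0_norm (sqr_ge0 _)).
apply: (@le_trans _ _ (r / r ^+ 2 * (9 * r ^+ 2 * m))); last first.
  by rewrite le_eqVlt; apply/orP; left; apply/eqP; field.
apply: ler_pM => //; first by rewrite mulr_ge0// invr_ge0 sqr_ge0.
by apply: ler_wpM2r => //; rewrite invr_ge0 sqr_ge0.
Qed.

Lemma pair_bound (u v : vec) k l (b b' c c' : bool) : b != b' -> c != c' ->
  `|u (k, b) * v (l, c)| + `|u (k, b') * v (l, c')| <= n1 u * n1 v.
Proof.
move=> bb cc; have H (w : vec) k' d d' : d != d' -> `|w (k', d)| + `|w (k', d')| <= n1 w.
  move=> dd; rewrite /n1 (bigD1 (k', d))//= (bigD1 (k', d'))/=; last by rewrite xpair_eqE eqxx/= eq_sym.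
  by rewrite addrA lerDl sumr_ge0.
have := H u k _ _ bb; have := H v l _ _ cc; rewrite !normrM.
have := normr_ge0 (u (k, b)); have := normr_ge0 (u (k, b')).
have := normr_ge0 (v (l, c)); have := normr_ge0 (v (l, c')).
move: `|u (k, b)| `|u (k, b')| `|v (l, c)| `|v (l, c')| => p q s t t0 s0 q0 p0 st pq.
apply: (@le_trans _ _ ((p + q) * (s + t))); first by nra.
by apply: ler_pM => //; rewrite addr_ge0.
Qed.

Lemma bilin_bound x c u v : `|bilin x c u v| <= 12 * c0 * norm3 x * (n1 u * n1 v).
Proof.
rewrite /bilin; case: c => j [] /=; rewrite ?normrN; apply: leray_bound => k l.
  by apply: (le_trans (ler_normB _ _)); exact: pair_bound.
by apply: (le_trans (ler_normD _ _)); exact: pair_bound.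
Qed.

Lemma measurable_bilin d' (T : measurableType d') (e : T -> X) (u v : T -> vec) c :
  measurable_fun setT e -> (forall i, measurable_fun setT (fun t => u t i)) ->
  (forall i, measurable_fun setT (fun t => v t i)) ->
  measurable_fun setT (fun t => bilin (e t) c (u t) (v t)).
Proof.
move=> me mu mv; have mco k := measurable_coord3 k me.
have mn : measurable_fun setT (fun t => norm3 (e t)) by exact: (measurableT_comp (@measurable_norm3 R) me).
have L (S : T -> 'I_3 -> 'I_3 -> R) j : (forall k l, measurable_fun setT (fun t => S t k l)) ->
    measurable_fun setT (fun t => leray (e t) (S t) j).
  move=> mS; have ms1 l : measurable_fun setT (fun t => \sum_k coord3 (e t) k * S t k l).
    by apply: measurable_sum => k; apply: measurable_funM.
  rewrite /leray; apply: measurable_funM => //; apply: measurable_funB => //.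
  apply: measurable_funM; first by apply: measurable_funM => //; apply: minvr; exact: measurable_funX.
  by apply: measurable_sum => l; apply: measurable_funM.
rewrite /bilin; case: c => j [] /=; last apply: mopp; apply: L => k l.
  by apply: measurable_funB; apply: measurable_funM.
by apply: measurable_funD; apply: measurable_funM.
Qed.

Definition divf (b : bool) (x : X) (c : I) : R := if c.2 == b then coord3 x c.1 else 0.

Lemma divf_sum b x (u : vec) : \sum_c divf b x c * u c = \sum_j coord3 x j * u (j, b).
Proof.
rewrite sumI; apply: eq_bigr => j _; rewrite /divf /=.
by case: b; rewrite /= mul0r ?add0r ?addr0.
Qed.

Lemma leray_div x S : \sum_j coord3 x j * leray x S j = 0.
Proof.
rewrite /leray; pose s l := \sum_k coord3 x k * S k l; rewrite -/(s _).
pose q := \sum_l coord3 x l * s l; rewrite -/q.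
have [rE|rn] := eqVneq (norm3 x) 0.
  by apply: big1 => j _; rewrite norm3_eq0// mul0r.
transitivity (c0 * (q - (\sum_j coord3 x j ^+ 2) / norm3 x ^+ 2 * q)); last first.
  by rewrite -norm3_sq divff ?mul1r ?subrr ?mulr0// sqrf_eq0.
rewrite /q !mulr_suml mulrBr mulr_sumr mulr_sumr -sumrB; apply: eq_bigr => j _; rewrite -/(s j) -/q; ring.
Qed.

Lemma divf_bilin b x u v : \sum_c divf b x c * bilin x c u v = 0.
Proof.
rewrite divf_sum /bilin /=; case: b; first exact: leray_div.
by under eq_bigr do rewrite mulrN; rewrite sumrN leray_div oppr0.
Qed.
End Bilinear.

Local Notation RI m h := (Rintegral m setT h).

(** * Cancellation of the transport term *)

Section Invariance.
Context d (T : measurableType d) (R : realType) (m : {measure set T -> \bar R}).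
Local Open Scope ereal_scope.

(** Positive and negative parts are preserved separately, so the equality also covers the default
    values of divergent integrals. *)
Lemma RI_preserve (phi : T -> T) (h : T -> R) : measurable_fun setT h ->
  (forall f : T -> \bar R, measurable_fun setT f -> (forall x, 0 <= f x) ->
    \int[m]_x f (phi x) = \int[m]_x f x) -> RI m (fun x => h (phi x)) = RI m h.
Proof.
move=> mh H; have mE : measurable_fun setT (fun x => (h x)%:E) by exact: mEFin.
rewrite /Rintegral [in LHS]integralE [in RHS]integralE; congr (fine (_ - _)).
  have mp : measurable_fun setT (fun x => maxe (h x)%:E 0).
    by have := measurable_funepos mE; congr measurable_fun; apply/funext => x; rewrite funeposE.
  under eq_integral do rewrite funeposE; under [RHS]eq_integral do rewrite funeposE.
  by apply: (H (fun x => maxe (h x)%:E 0)) => // x; rewrite le_max lexx orbT.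
have mn : measurable_fun setT (fun x => maxe (- (h x)%:E) 0).
  by have := measurable_funeneg mE; congr measurable_fun; apply/funext => x; rewrite funenegE.
under eq_integral do rewrite funenegE; under [RHS]eq_integral do rewrite funenegE.
by apply: (H (fun x => maxe (- (h x)%:E) 0)) => // x; rewrite le_max lexx orbT.
Qed.

Lemma RIN (h : T -> R) : RI m (fun x => - h x)%R = (- RI m h)%R.
Proof.
rewrite /Rintegral [in LHS]integralE [in RHS]integralE.
have -> : (fun x => (- h x)%R%:E)^\+ = (fun x => (h x)%:E)^\- by apply/funext => x; rewrite funeposE funenegE.
have -> : (fun x => (- h x)%R%:E)^\- = (fun x => (h x)%:E)^\+.
  by apply/funext => x; rewrite funeposE funenegE; congr (maxe _ _); rewrite EFinN oppeK.
have A : 0 <= \int[m]_x (fun x => (h x)%:E)^\+ x by apply: integral_ge0 => x _; exact: funepos_ge0.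
have B : 0 <= \int[m]_x (fun x => (h x)%:E)^\- x by apply: integral_ge0 => x _; exact: funeneg_ge0.
by move: (integral _ _ _) (integral _ _ _) A B => [a| |] [b| |] //= _ _; rewrite ?oppr0// opprB.
Qed.
End Invariance.

Section Cancellation.
Context (R : realType).
Local Notation X := (X3 R).
Local Notation I := ('I_3 * bool)%type.
Local Notation vec := (I -> R).
Local Notation mu := (mu3 R).

Lemma sub3_0 (y : R * R * R) : sub3 (0, 0, 0) y = opp3 y.
Proof. by rewrite /sub3 /opp3 /= !sub0r. Qed.

Lemma coord3_sub (x y : R * R * R) k : coord3 (sub3 x y) k = coord3 x k - coord3 y k.
Proof. by rewrite /coord3 /sub3; case: (val k) => [|[|n]]. Qed.

(** A vector orthogonal to [x] does not see the gradient part that the Leray projector subtracts. *)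
Lemma leray_pair (x : X) S (h : 'I_3 -> R) : \sum_j coord3 x j * h j = 0 ->
  \sum_j h j * leray x S j = c0 R * \sum_j h j * \sum_k coord3 x k * S k j.
Proof.
move=> xh; rewrite /leray; set q := \sum_l _ * _ in xh *; set z := \sum_l coord3 x l * _.
transitivity (c0 R * (\sum_j h j * (\sum_k coord3 x k * S k j) - q * (z / norm3 x ^+ 2))).
  rewrite /q mulr_suml -sumrB mulr_sumr; apply: eq_bigr => j _; ring.
by rewrite xh mul0r subr0.
Qed.

Lemma bilin_pair (x : X) (g u w : vec) : divfree (@divf R) x g ->
  \sum_c g c * bilin x c u w = c0 R *
    ((\sum_k coord3 x k * u (k, false)) * (\sum_j (g (j, true) * w (j, false) - g (j, false) * w (j, true))) -
     (\sum_k coord3 x k * u (k, true)) * (\sum_j (g (j, false) * w (j, false) + g (j, true) * w (j, true)))).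
Proof.
move=> dg; rewrite sumI /bilin /=.
have H b : \sum_j coord3 x j * g (j, b) = 0 by have := dg b; rewrite divf_sum.
rewrite big_split /=; under eq_bigr do rewrite mulrN.
rewrite sumrN !leray_pair// /pairre /pairim !big_ord_recl !big_ord0; ring.
Qed.

(** The integrand [H x y] couples [G] at [x], [V] at [y] and [G] at [x - y]. The substitution of
    [x - y] for [x] and [- y] for [y] exchanges the two values of [G] and changes the sign of [H].
    After Fubini, translation in [x] and reflection in [y] show that the double integral equals its
    opposite. *)
Lemma cancels_bilin (V : TT R * X -> vec) : mfield V ->
  (forall t x j, V (t, opp3 x) (j, false) = V (t, x) (j, false) /\ V (t, opp3 x) (j, true) = - V (t, x) (j, true)) ->
  (forall p, divfree (@divf R) p.2 (V p)) -> cancels mu (@sub3 R) (@norm3 R) (@bilin R) (@divf R) V.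
Proof.
move=> mV hV dV G s mG dG fin.
have msub := @measurable_sub3 R; have mn := @measurable_norm3 R.
pose H x y := \sum_c G (s, x) c * bilin x c (V (s, y)) (G (s, sub3 x y)).
have mGs d' (T' : measurableType d') (e : T' -> X) c : measurable_fun setT e -> measurable_fun setT (fun z => G (s, e z) c).
  by move=> me; have mGc := mG c; apply: (measurableT_comp mGc (g := fun z => (s, e z))); ms.
have mVs d' (T' : measurableType d') (e : T' -> X) c : measurable_fun setT e -> measurable_fun setT (fun z => V (s, e z) c).
  by move=> me; have mVc := mV c; apply: (measurableT_comp mVc (g := fun z => (s, e z))); ms.
have mH : measurable_fun setT (fun p : X * X => H p.1 p.2).
  apply: measurable_sum => c; apply: measurable_funM; first by apply: mGs; ms.
  apply: measurable_bilin; [by ms|by move=> i; apply: mVs; ms|move=> i; apply: mGs; exact: msub].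
have nG := nnm_en1 mG; have nV := nnm_en1 mV; have [mG1 G10] := nG; have [mV1 V10] := nV.
have sub3K' := @sub3K R; have refl := @mu3_reflect R.
have cvE x : cv mu (@sub3 R) (en1 G) (en1 V) (s, x) = cv mu (@sub3 R) (en1 V) (en1 G) (s, x).
  exact: (cvC msub sub3K' refl).
have [mcv cv0] := nnm_cv mu msub nV nG.
have [mcv' cv0'] := nnm_cv mu msub nG nV.
have Hb x y : (`|H x y|%:E <= (12 * c0 R)%:E * ((en1 G (s, x) * ((norm3 x)%:E * (en1 V (s, y) * en1 G (s, sub3 x y))))))%E.
  rewrite /en1 -!EFinM lee_fin; apply: (le_trans (ler_norm_sum _ _ _)).
  set k := 12 * c0 R * _; apply: (@le_trans _ _ (\sum_c `|G (s, x) c| * (12 * c0 R * norm3 x * (n1 (V (s, y)) * n1 (G (s, sub3 x y)))))).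
    by apply: ler_sum => c _; rewrite normrM; apply: ler_wpM2l => //; exact: bilin_bound.
  by rewrite -mulr_suml -/(n1 (G (s, x))) /k le_eqVlt; apply/orP; left; apply/eqP; ring.
have c12 : 0 <= 12 * c0 R by rewrite mulr_ge0// c0_ge0.
have msx x : measurable_fun setT (fun y : X => (s, sub3 x y) : TT R * X).
  by apply: mpair; [ms|apply: (measurableT_comp msub (g := fun y : X => (x, y))); ms].
have HL : (\int[mu]_x \int[mu]_y `|H x y|%:E < +oo)%E.
  apply: (@le_lt_trans _ _ ((12 * c0 R)%:E * \int[mu]_x (en1 G (s, x) * ((norm3 x)%:E * cv mu (@sub3 R) (en1 G) (en1 V) (s, x))))%E); last first.
    by apply: lte_mul_pinfty; rewrite ?lee_fin.
  rewrite -ge0_integralZlT; last 3 first.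
  - by ms.
  - by move=> x; apply: mule_ge0; [exact: G10|apply: mule_ge0; [rewrite lee_fin norm3_ge0|exact: cv0']].
  - by rewrite lee_fin.
  apply: ge0_le_integralT => x; first by apply: integral_ge0 => y _; rewrite lee_fin.
  have mq : measurable_fun setT (fun y => (en1 V (s, y) * en1 G (s, sub3 x y))%E).
    by apply: emeasurable_funM; [ms|exact: (measurableT_comp mG1 (msx x))].
  have q0 y : (0 <= en1 V (s, y) * en1 G (s, sub3 x y))%E by apply: mule_ge0; [exact: V10|exact: G10].
  rewrite cvE /cv /= -ge0_integralZlT//; last by rewrite lee_fin norm3_ge0.
  rewrite -ge0_integralZlT//; last 2 first.
  - by apply: emeasurable_funM.
  - by move=> y; apply: mule_ge0 => //; rewrite lee_fin norm3_ge0.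
  rewrite -ge0_integralZlT//; last 2 first.
  - by do 2?apply: emeasurable_funM.
  - by move=> y; apply: mule_ge0; [exact: G10|apply: mule_ge0 => //; rewrite lee_fin norm3_ge0].
  by apply: ge0_le_integralT => y; [rewrite lee_fin|exact: Hb].
have mfin : measurable_fun setT (fun x => (en1 G (s, x) * ((norm3 x)%:E * cv mu (@sub3 R) (en1 G) (en1 V) (s, x)))%E) by ms.
have LHS : RI mu (fun x => \sum_c G (s, x) c * NL mu (@sub3 R) (@bilin R) V G (s, x) c) = RI mu (fun x => RI mu (H x)).
  apply: RI_ae.
  - apply: measurable_sum => c; apply: measurable_funM; first by apply: mGs; ms.
    have := mfield_NL mu msub (@measurable_bilin R) mV mG c => mNL.
    by apply: (measurableT_comp mNL (g := fun x : X => (s, x))); ms.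
  - exact: (measurable_Rintegral mu (h := H)).
  (* At almost every [x] either the convolution converges and sum and integral may be exchanged, or
     [G] or the modulus of [x] vanishes and both sides are 0. *)
  apply: (ae_mono (nnm_finite_ae _ fin)) => [|x xfin].
    by split=> // x; apply: mule_ge0; [exact: G10|apply: mule_ge0; [rewrite lee_fin norm3_ge0|exact: cv0']].
  have zero (Q : forall y c, G (s, x) c * bilin x c (V (s, y)) (G (s, sub3 x y)) = 0) :
      \sum_c G (s, x) c * NL mu (@sub3 R) (@bilin R) V G (s, x) c = RI mu (H x).
    rewrite (RI_eq mu (g := fun=> 0)); last by move=> y; rewrite /H big1// => c _; exact: Q.
    rewrite /Rintegral integral0 big1// => c _.
    have [->|gn] := eqVneq (G (s, x) c) 0; first by rewrite mul0r.
    rewrite /NL (RI_eq mu (g := fun=> 0)) ?/Rintegral ?integral0 ?mulr0// => y.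
    by have /eqP := Q y c; rewrite mulf_eq0 (negbTE gn) => /eqP.
  have [g0|g0] := eqVneq (n1 (G (s, x))) 0.
    apply: zero => y c; have : `|G (s, x) c| <= 0 by rewrite -g0 n1_comp.
    by rewrite normr_le0 => /eqP ->; rewrite mul0r.
  have [r0|r0] := eqVneq (norm3 x) 0.
    apply: zero => y c; have := bilin_bound x c (V (s, y)) (G (s, sub3 x y)).
    by rewrite r0 mulr0 mul0r normr_le0 => /eqP ->; rewrite mulr0.
  have cfin : (cv mu (@sub3 R) (en1 V) (en1 G) (s, x) < +oo)%E.
    rewrite -cvE ltey; apply/eqP => cE; move: xfin; rewrite cE.
    rewrite gt0_muley ?lte_fin ?lt_def ?r0 ?norm3_ge0// gt0_muley ?ltxx//.
    by rewrite /en1 lte_fin lt_def g0 n1_ge0.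
  rewrite (RI_lincomb (m := mu) (fun c => G (s, x) c) (f := fun c y => bilin x c (V (s, y)) (G (s, sub3 x y))))//.
  move=> c; apply: (NLi_integrable msub (@norm3_ge0 R) c12 (@bilin_bound R) (@measurable_bilin R) (p := (s, x)) c mV mG cfin).
(* Solenoidality of [V] gives [(x - y) . V(y) = x . V(y)]. Conjugate symmetry keeps the real part of
   this product at [- y] and reverses its imaginary part; the factors they multiply are
   antisymmetric and symmetric in the two values of [G]. *)
have anti x y : H (sub3 x y) (opp3 y) = - H x y.
  rewrite /H !bilin_pair; [|exact: (dG (s, x))|exact: (dG (s, sub3 x y))].
  have -> : sub3 (sub3 x y) (opp3 y) = x by case: (x) => [[? ?] ?]; rewrite /sub3 /opp3 /=; congr (_, _, _); ring.
  have E b : \sum_k coord3 (sub3 x y) k * V (s, y) (k, b) = \sum_k coord3 x k * V (s, y) (k, b).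
    have D := dV (s, y) b; rewrite divf_sum /= in D.
    by under eq_bigr do rewrite coord3_sub mulrBl; rewrite sumrB D subr0.
  have -> : \sum_k coord3 (sub3 x y) k * V (s, opp3 y) (k, false) = \sum_k coord3 x k * V (s, y) (k, false).
    by rewrite -E; apply: eq_bigr => k _; rewrite (hV s y k).1.
  have -> : \sum_k coord3 (sub3 x y) k * V (s, opp3 y) (k, true) = - \sum_k coord3 x k * V (s, y) (k, true).
    by rewrite -E -sumrN; apply: eq_bigr => k _; rewrite (hV s y k).2 mulrN.
  rewrite !big_ord_recl !big_ord0; ring.
have mHy y : measurable_fun setT (fun x => H x y).
  by apply: (measurableT_comp mH (g := fun x : X => (x, y))); ms.
rewrite LHS (fubiniR mH HL); set h := fun y => _.
have mh : measurable_fun setT h.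
  apply: (measurable_Rintegral mu (h := fun y x => H x y)).
  by apply: (measurableT_comp mH (g := fun p : X * X => (p.2, p.1))); ms.
have hN y : h (sub3 (0, 0, 0) y) = - h y.
  rewrite /h /= -RIN sub3_0; transitivity (RI mu (fun x => H (sub3 x y) (opp3 y))).
    symmetry; apply: (@RI_preserve _ _ _ mu (fun x => sub3 x y) (fun x => H x (opp3 y))) => //.
    by move=> f mf f0; exact: mu3_translate.
  by apply: RI_eq => x; exact: anti.
have := @RI_preserve _ _ _ mu (fun y => sub3 (0, 0, 0) y) _ mh (fun f mf f0 => mu3_reflect _ mf f0).
have -> : RI mu (fun y => h (sub3 (0, 0, 0) y)) = - RI mu h.
  by rewrite -RIN; apply: RI_eq => y; exact: hN.
by move: (RI mu h) => z zE; lra.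
Qed.
End Cancellation.

(** * Identification of the abstract bilinear term with [NLterm] *)

Section Nonlinearity.
Context (R : realType).
Local Notation X := (X3 R).
Local Notation I := ('I_3 * bool)%type.
Local Notation vec := (I -> R).
Local Notation mu := (mu3 R).
Local Notation cvv := (cv mu (@sub3 R)).

(** Coefficients of the projected divergence as a linear form in the nine products, so that it can
    be exchanged with the convolution integral in one stroke. *)
Definition lcoef (x : X) (j : 'I_3) (kl : 'I_3 * 'I_3) : R :=
  c0 R * coord3 x kl.1 * ((kl.2 == j)%:R - coord3 x j / norm3 x ^+ 2 * coord3 x kl.2).

Lemma lerayE x S j : leray x S j = \sum_kl lcoef x j kl * S kl.1 kl.2.
Proof.
transitivity (\sum_k \sum_l lcoef x j (k, l) * S k l); last by rewrite pair_bigA.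
have E k : \sum_l lcoef x j (k, l) * S k l = c0 R * (coord3 x k * S k j) -
    c0 R * (coord3 x j / norm3 x ^+ 2) * \sum_l coord3 x l * (coord3 x k * S k l).
  transitivity (\sum_l ((if l == j then c0 R * (coord3 x k * S k l) else 0) -
      c0 R * (coord3 x j / norm3 x ^+ 2) * (coord3 x l * (coord3 x k * S k l)))).
    by apply: eq_bigr => l _; rewrite /lcoef /=; case: ifP => _ /=; ring.
  by rewrite sumrB -mulr_sumr -big_mkcond big_pred1_eq.
under [RHS]eq_bigr do rewrite E.
rewrite sumrB -!mulr_sumr exchange_big /= /leray mulrBr; congr (_ - _); rewrite -!mulrA.
by congr (_ * (_ * (_ * _))); apply: eq_bigr => l _; rewrite mulr_sumr.
Qed.

Lemma cadd_sum1 (f : 'I_3 -> cplx R) : (\big[@Defs.cadd R/(0, 0)]_(k < 3) f k).1 = \sum_(k < 3) (f k).1.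
Proof. by apply: (big_morph (fun z : cplx R => z.1)). Qed.

Lemma cadd_sum2 (f : 'I_3 -> cplx R) : (\big[@Defs.cadd R/(0, 0)]_(k < 3) f k).2 = \sum_(k < 3) (f k).2.
Proof. by apply: (big_morph (fun z : cplx R => z.2)). Qed.

Lemma NLterm_leray (u : fvec R) x j :
  NLterm u x j = (- leray x (fun k l => (Defs.conv (u^~ k) (u^~ l) x).2) j,
                  leray x (fun k l => (Defs.conv (u^~ k) (u^~ l) x).1) j).
Proof.
have D l : divuu u x l = (- (c0 R * \sum_k coord3 x k * (Defs.conv (u^~ k) (u^~ l) x).2),
                          c0 R * \sum_k coord3 x k * (Defs.conv (u^~ k) (u^~ l) x).1).
  by rewrite /divuu /cmulI /cscale [_.2 in LHS]/= [_.1 in LHS]/= cadd_sum1 cadd_sum2.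
rewrite /NLterm; set W := \big[_/_]_(k < 3) _.
have W1 : W.1 = - (c0 R * \sum_l coord3 x l * \sum_k coord3 x k * (Defs.conv (u^~ k) (u^~ l) x).2).
  by rewrite /W cadd_sum1 mulr_sumr -sumrN; apply: eq_bigr => l _; rewrite D /Defs.cscale /=; ring.
have W2 : W.2 = c0 R * \sum_l coord3 x l * \sum_k coord3 x k * (Defs.conv (u^~ k) (u^~ l) x).1.
  by rewrite /W cadd_sum2 mulr_sumr; apply: eq_bigr => l _; rewrite D /Defs.cscale /=; ring.
by move: W W1 W2 => [w1 w2] /= -> ->; rewrite D /csub /Defs.cscale /leray /=; congr (_, _); ring.
Qed.

Lemma conv_pair (u : fvec R) (V : TT R * X -> vec) s x k l : mfield V ->
  (forall j, measurable_fun (setT : set X) (fun x => (u x j).1) /\ measurable_fun (setT : set X) (fun x => (u x j).2)) ->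
  {ae mu, forall y, forall c, V (s, y) c = enc (u y) c} ->
  Defs.conv (u^~ k) (u^~ l) x = (RI mu (fun y => pairre (V (s, y)) (V (s, sub3 x y)) k l),
    RI mu (fun y => pairim (V (s, y)) (V (s, sub3 x y)) k l)).
Proof.
move=> mV mu' Vu; have Vu' := ae_reflect (@measurable_sub3 R) (@mu3_reflect R) x Vu.
have ms1 : measurable_fun setT (fun y : X => (s, y) : TT R * X) by ms.
have ms2 : measurable_fun setT (fun y : X => sub3 x y : X).
  by apply: (measurableT_comp (@measurable_sub3 R) (g := fun y : X => (x, y))); ms.
have ms3 : measurable_fun setT (fun y : X => (s, sub3 x y) : TT R * X) by apply: mpair; [ms|].
have mV1 c : measurable_fun setT (fun y : X => V (s, y) c) by exact: (measurableT_comp (mV c) ms1).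
have mV2 c : measurable_fun setT (fun y : X => V (s, sub3 x y) c) by exact: (measurableT_comp (mV c) ms3).
have mu1 j : measurable_fun setT (fun y : X => (u y j).1) by case: (mu' j).
have mu2 j : measurable_fun setT (fun y : X => (u y j).2) by case: (mu' j).
have mu3 j : measurable_fun setT (fun y : X => (u (sub3 x y) j).1) by exact: (measurableT_comp (mu1 j) ms2).
have mu4 j : measurable_fun setT (fun y : X => (u (sub3 x y) j).2) by exact: (measurableT_comp (mu2 j) ms2).
have -> : Defs.conv (u^~ k) (u^~ l) x = (RI mu (fun y => (Defs.cmul (u y k) (u (sub3 x y) l)).1),
    RI mu (fun y => (Defs.cmul (u y k) (u (sub3 x y) l)).2)) by [].
rewrite /pairre /pairim /Defs.cmul /=; congr (_, _); apply: RI_ae.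
- by apply: measurable_funB; apply: measurable_funM.
- by apply: measurable_funB; apply: measurable_funM.
- by apply: (ae_mono (filterI Vu Vu')) => y [E1 E2]; rewrite !E1 !E2.
- by apply: measurable_funD; apply: measurable_funM.
- by apply: measurable_funD; apply: measurable_funM.
- by apply: (ae_mono (filterI Vu Vu')) => y [E1 E2]; rewrite !E1 !E2.
Qed.

(** [NLterm] projects after integrating, [NL] integrates the projected integrand. The two agree
    where the convolution converges absolutely, which makes each product integrable. *)
Lemma NLterm_NL (u : fvec R) (V : TT R * X -> vec) s x c : mfield V ->
  (forall j, measurable_fun (setT : set X) (fun x => (u x j).1) /\ measurable_fun (setT : set X) (fun x => (u x j).2)) ->
  {ae mu, forall y, forall c, V (s, y) c = enc (u y) c} -> (cvv (en1 V) (en1 V) (s, x) < +oo)%E ->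
  enc (NLterm u x) c = NL mu (@sub3 R) (@bilin R) V V (s, x) c.
Proof.
move=> mV mu' Vu cfin.
have ms1 : measurable_fun setT (fun y : X => (s, y) : TT R * X) by ms.
have ms2 : measurable_fun setT (fun y : X => sub3 x y : X).
  by apply: (measurableT_comp (@measurable_sub3 R) (g := fun y : X => (x, y))); ms.
have ms3 : measurable_fun setT (fun y : X => (s, sub3 x y) : TT R * X) by apply: mpair; [ms|].
have mV1 c' : measurable_fun setT (fun y : X => V (s, y) c') by exact: (measurableT_comp (mV c') ms1).
have mV2 c' : measurable_fun setT (fun y : X => V (s, sub3 x y) c') by exact: (measurableT_comp (mV c') ms3).
have L (f : X -> R) : measurable_fun setT f -> (forall y, `|f y| <= n1 (V (s, y)) * n1 (V (s, sub3 x y))) -> L1 mu f.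
  move=> mf fb; apply: L1_fin => //; apply: le_lt_trans cfin.
  by apply: ge0_le_integralT => y; [rewrite lee_fin|rewrite -EFinM lee_fin; exact: fb].
have Lre kl : L1 mu (fun y => pairre (V (s, y)) (V (s, sub3 x y)) kl.1 kl.2).
  apply: L; first by rewrite /pairre /pairim; apply: measurable_funB; apply: measurable_funM.
  by move=> y; apply: (le_trans (ler_normB _ _)); exact: pair_bound.
have Lim kl : L1 mu (fun y => pairim (V (s, y)) (V (s, sub3 x y)) kl.1 kl.2).
  apply: L; first by rewrite /pairre /pairim; apply: measurable_funD; apply: measurable_funM.
  by move=> y; apply: (le_trans (ler_normD _ _)); exact: pair_bound.
have cE k l := conv_pair x k l mV mu' Vu.
have E1 : (fun k l => (Defs.conv (u^~ k) (u^~ l) x).1) = (fun k l => RI mu (fun y => pairre (V (s, y)) (V (s, sub3 x y)) k l)).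
  by apply/funext => k; apply/funext => l; rewrite (cE k l).
have E2 : (fun k l => (Defs.conv (u^~ k) (u^~ l) x).2) = (fun k l => RI mu (fun y => pairim (V (s, y)) (V (s, sub3 x y)) k l)).
  by apply/funext => k; apply/funext => l; rewrite (cE k l).
rewrite /enc NLterm_leray E1 E2 /NL /NLi /bilin; case: c => j [] /=.
  rewrite lerayE.
  rewrite (RI_lincomb (m := mu) (fun kl => lcoef x j kl) Lre).
  by apply: RI_eq => y; rewrite lerayE.
rewrite RIN lerayE; congr (- _).
rewrite (RI_lincomb (m := mu) (fun kl => lcoef x j kl) Lim).
by apply: RI_eq => y; rewrite lerayE.
Qed.
End Nonlinearity.

(** * Left limits in time of Duhamel's formula *)

Section TimeLimit.
Context (R : realType).
Local Notation lam := (lam R).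

Lemma ae_neq (t : R) : {ae lam, forall s, s != t}.
Proof.
exists [set t]; split; [exact: measurable_set1|exact: lebesgue_measure_set1|].
by move=> s /= /negP; rewrite negbK => /eqP.
Qed.

(** The kernel jumps only at [s = t], a single point that the time integral ignores. For [s < t] the
    exponential is continuous; for [s > t] every [ek k (tn n) s] is 0. *)
Lemma ek_cvg (k t s : R) (tn : nat -> R) : s != t -> (forall n, tn n <= t) -> tn n @[n --> \oo] --> t ->
  ek k (tn n) s @[n --> \oo] --> ek k t s.
Proof.
move=> st tnt tc; have [ts|ts|e] := ltgtP s t; last by rewrite e eqxx in st.
  have E : expR (- k * (tn n - s)) @[n --> \oo] --> expR (- k * (t - s)).
    apply: continuous_cvg; first exact: continuous_expR.
    by apply: cvgMr; apply: cvgB => //; exact: cvg_cst.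
  rewrite /ek (ltW ts); apply: cvg_trans E; apply: near_eq_cvg; near=> n.
  rewrite ifT//; apply: ltW; near: n; exact: (cvgr_gt _ tc).
apply: cvg_near_cst; near=> n.
by rewrite /ek leNgt (le_lt_trans (tnt n) ts)/= leNgt ts.
Unshelve. all: by end_near. Qed.

Lemma ek0_cvg (k t : R) (tn : nat -> R) : (forall n, 0 <= tn n <= t) -> tn n @[n --> \oo] --> t ->
  ek k (tn n) 0 @[n --> \oo] --> ek k t 0.
Proof.
move=> tnt tc; have t0 : 0 <= t by have /andP[/le_trans h /h] := tnt 0%N.
have E : expR (- k * (tn n - 0)) @[n --> \oo] --> expR (- k * (t - 0)).
  apply: continuous_cvg; first exact: continuous_expR.
  by apply: cvgMr; apply: cvgB => //; exact: cvg_cst.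
rewrite {2}/ek t0; apply: cvg_trans E; apply: near_eq_cvg; apply: nearW => n.
by rewrite /ek ifT//; case/andP: (tnt n).
Qed.

(** Dominated convergence: all kernels are at most 1 and vanish after [t], so the restriction of [N]
    to [[0, t]] dominates. *)
Lemma ek_int_cvg (k t : R) (tn : nat -> R) (N : R -> R) : 0 <= k -> (forall n, 0 <= tn n <= t) ->
  tn n @[n --> \oo] --> t -> (forall s, s < 0 -> N s = 0) ->
  L1 lam (fun s => if within t s then N s else 0) ->
  RI lam (fun s => ek k (tn n) s * N s) @[n --> \oo] --> RI lam (fun s => ek k t s * N s).
Proof.
move=> k0 tnt tc N0 iN; pose M s := if within t s then N s else 0; rewrite -/M in iN.
have mM : measurable_fun setT M := L1_meas iN.
have tle n : tn n <= t by case/andP: (tnt n).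
have E u : u <= t -> (fun s => ek k u s * N s) = (fun s => ek k u s * M s).
  move=> ut; apply/funext => s; rewrite /ek; case: ifP => su; last by rewrite !mul0r.
  congr (_ * _); rewrite /M /within; case: ifPn => //.
  by rewrite negb_and -!ltNge => /orP[/N0//|]; rewrite ltNge (le_trans su ut).
rewrite (E t (lexx t)); under eq_cvg do rewrite (E _ (tle _)).
have me u : measurable_fun setT (ek k u : TT R -> R).
  rewrite /ek; apply: measurable_fun_ifT; [apply: measurable_fun_ler; ms| |by ms].
  by apply: mexpR; apply: measurable_funM; [ms|apply: measurable_funB; ms].
have mF u : measurable_fun setT (fun s : TT R => (ek k u s * M s)%:E) by apply: mEFin; apply: measurable_funM.
have ek1 u s : `|ek k u s| <= 1.
  rewrite /ek; case: ifP => su; last by rewrite normr0.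
  rewrite ger0_norm ?expR_ge0// -expR0 ler_expR mulNr oppr_le0 mulr_ge0// subr_ge0//.
have cF : {ae lam, forall s, setT s -> (fun n => (ek k (tn n) s * M s)%:E) @ \oo --> (ek k t s * M s)%:E}.
  apply: (ae_mono (ae_neq t)) => s st _; apply: cvg_EFin; first exact: nearW.
  by apply: cvgMl; exact: ek_cvg.
have dF : {ae lam, forall s n, setT s -> (`|(ek k (tn n) s * M s)%:E| <= `|M s|%:E)%E}.
  by apply: aeW => s n _; rewrite /= lee_fin normrM ler_piMl.
have iM : lam.-integrable setT (fun s => `|M s|%:E) by exact: integrable_abse iN.
have [_ _ H] := dominated_convergence measurableT (fun n => mF (tn n)) (mF t) cF iM dF.
have it : L1 lam (fun s => ek k t s * M s) by apply: L1_bounded iN (me t) (ek1 t).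
rewrite -[RI lam (fun s => ek k t s * M s)]/(fine _) in H *.
by apply: fine_cvg; rewrite /Rintegral fineK//; exact: integrable_fin_num.
Qed.

(** At a fixed frequency the heat factor is bounded below on [[0, T]], so multiplication by its
    inverse preserves integrability. *)
Lemma heat_L1 (nu r2 T : R) (N : R -> R) : 0 <= nu -> 0 <= r2 -> 0 <= T ->
  lam.-integrable `[0, T] (fun s => (expR (- nu * (T - s) * r2) * N s)%:E) ->
  L1 lam (fun s => if within T s then N s else 0).
Proof.
move=> nu0 r20 T0 i0.
have i1 := (integrable_mkcond (mu := lam) (fun s => (expR (- nu * (T - s) * r2) * N s)%:E) (measurable_itv (`[0, T] : interval R))).1 i0.
have i2 : L1 lam (fun s => if within T s then expR (- nu * (T - s) * r2) * N s else 0).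
  move: i1; congr (_.-integrable _ _); apply/funext => s.
  rewrite /patch /within /= -[(_ <= _ <= _)]/(s \in `[0, T]) mem_setE.
  by case: ifP.
pose h (s : TT R) := if within T s then expR (nu * (T - s) * r2) else 0.
have mh : measurable_fun setT h.
  apply: measurable_fun_ifT; [exact: mwithin| |by ms].
  by apply: mexpR; apply: measurable_funM; [|by ms]; apply: measurable_funM; [by ms|apply: measurable_funB; ms].
have hb s : `|h s| <= expR (nu * T * r2).
  rewrite /h; case: ifPn => [/andP[s0 sT]|_]; last by rewrite normr0 expR_ge0.
  by rewrite ger0_norm ?expR_ge0// ler_expR; apply: ler_wpM2r => //; apply: ler_wpM2l => //; rewrite gerBl.
have i3 := L1_bounded i2 mh hb; apply: (L1_eq i3) => s; rewrite /h; case: ifPn => _; last by rewrite mul0r.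
rewrite mulrA -expRD (_ : _ + _ = 0) ?expR0 ?mul1r//; ring.
Qed.

Lemma heat_RI (nu r2 T : R) (N : R -> R) : (forall s, s < 0 -> N s = 0) ->
  Rintegral lam `[0, T] (fun s => expR (- nu * (T - s) * r2) * N s) =
  RI lam (fun s => ek (nu * r2) T s * N s).
Proof.
move=> N0; rewrite Rintegral_mkcond; apply: RI_eq => s.
rewrite /patch mem_setE /= in_itv /= /ek.
have [s0|s0] := leP (0 : R) (s : R); last by rewrite /= N0// mulr0.
rewrite andTb; case: ifP => _; last by rewrite mul0r.
by congr (expR _ * _); ring.
Qed.
End TimeLimit.

Lemma measurable_select d (T : measurableType d) (R : realType) (k : T -> nat) (g : nat -> T -> R) :
  (forall m, measurable_fun setT (fun x => k x == m)) -> (forall m, measurable_fun setT (g m)) ->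
  measurable_fun setT (fun x => g (k x) x).
Proof.
move=> mk mg _ Y mY; rewrite setTI.
rewrite (_ : _ @^-1` Y = \bigcup_m ([set x | k x == m] `&` (g m @^-1` Y))).
  apply: bigcupT_measurable => m; apply: measurableI.
    by have := mk m measurableT [set true] I; rewrite setTI; congr measurable; apply/seteqP; split => x /=.
  by rewrite -[X in measurable X]setTI; exact: mg.
apply/seteqP; split => x /=; first by move=> H; exists (k x) => //; split=> //=.
by move=> [m _ [/eqP <-]].
Qed.

Lemma ae_countable d (T : measurableType d) (R : realType) (m : {measure set T -> \bar R})
  (J : countType) (Q : J -> T -> Prop) :
  (forall j, {ae m, forall x, Q j x}) -> {ae m, forall x, forall j, Q j x}.
Proof.
move=> H; have H' n : {ae m, forall x, forall j, unpickle n = Some j -> Q j x}.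
  case: (unpickle n) => [j|]; last by apply: aeW.
  by apply: (ae_mono (H j)) => x Qx j' [<-].
apply: (ae_mono (ae_foralln H')) => x Qx j; apply: (Qx (pickle j)); exact: pickleK.
Qed.

Lemma ae_and d (T : measurableType d) (R : realType) (m : {measure set T -> \bar R}) (A B : T -> Prop) :
  {ae m, forall x, A x} -> {ae m, forall x, B x} -> {ae m, forall x, A x /\ B x}.
Proof. by move=> HA HB; apply: filterS2 HA HB => x. Qed.

(** * Comparison of the Gevrey weight with powers and with an exponential *)

Section GevreyWeight.
Context (R : realType).

(* With [y = r^(1/sigma)] and [m >= sigma], [1 + r <= 2 (1 + y)^m], a power that
   the exponential dominates. *)
Lemma weight_le_gevrey (a sigma : R) : 0 < a -> 1 < sigma -> exists2 K : R, 0 <= K &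
  forall r : R, 0 <= r -> (1 + r) ^+ 2 <= K * expR (a * powR r sigma^-1).
Proof.
move=> a0 s1; pose m := (Num.truncn sigma).+1; have sm : sigma <= m%:R by exact/ltW/truncnS_gt.
have s0 : 0 < sigma by apply: lt_trans s1.
have m0 : 0 < m%:R :> R by rewrite ltr0n.
(* The [m]-th power of [exp(c y)] is [exp(a y / 2)], whose square is the Gevrey weight. *)
pose c := a / (2 * m%:R); have cp : 0 < c by rewrite divr_gt0// mulr_gt0.
pose k := 1 + c^-1; have k1 : 1 <= k by rewrite lerDl invr_ge0 ltW.
have k0 : 0 <= k := le_trans ler01 k1.
exists ((2 * k ^+ m) ^+ 2) => [|r r0]; first exact: sqr_ge0.
pose y := powR r sigma^-1; rewrite -/y; have y0 : 0 <= y by exact: powR_ge0.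
have ry : r = powR y sigma by rewrite /y -powRrM mulVf ?gt_eqF// powRr1.
have y1 : 1 + y <= k * expR (c * y).
  apply: (@le_trans _ _ (k * (1 + c * y))); last by apply: ler_wpM2l => //; exact: expR_ge1Dx.
  have E : c^-1 * c = 1 by rewrite mulVf// gt_eqF.
  have -> : k * (1 + c * y) = 1 + y + c^-1 + c * y + (c^-1 * c - 1) * y by rewrite /k; ring.
  have : 0 <= c^-1 by rewrite invr_ge0 ltW.
  have : 0 <= c * y by rewrite mulr_ge0// ltW.
  by rewrite E; lra.
have rle : r <= (1 + y) ^+ m.
  rewrite ry -powR_mulrn ?addr_ge0//; apply: (@le_trans _ _ (powR (1 + y) sigma)).
    by apply: ge0_ler_powR; rewrite ?nnegrE ?addr_ge0 ?(ltW s0)// lerDr.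
  by apply: ler_powR => //; rewrite lerDl.
have one : 1 <= (1 + y) ^+ m by rewrite exprn_ege1// lerDl.
have E : (1 + y) ^+ m <= k ^+ m * expR (a * y / 2).
  rewrite (_ : expR _ = expR (c * y) ^+ m).
    by rewrite -exprMn; apply: lerXn2r; rewrite ?nnegrE ?addr_ge0 ?mulr_ge0 ?expR_ge0.
  by rewrite -expRM_natl; congr expR; rewrite /c; field; rewrite gt_eqF.
apply: (@le_trans _ _ ((2 * (k ^+ m * expR (a * y / 2))) ^+ 2)).
  by apply: lerXn2r; rewrite ?nnegrE ?addr_ge0 ?mulr_ge0 ?exprn_ge0 ?expR_ge0//; lra.
rewrite mulrA exprMn le_eqVlt; apply/orP; left; apply/eqP; congr (_ * _).
by rewrite -expRM_natl; congr expR; field.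
Qed.

(** Since [1/sigma <= 1], [r^(1/sigma) <= (1 + r)^(1/sigma) <= 1 + r]. *)
Lemma gevrey_le_exp (a sigma r : R) : 0 <= a -> 1 < sigma -> 0 <= r ->
  expR (a * powR r sigma^-1) <= expR a * expR (a * r).
Proof.
move=> a0 s1 r0; rewrite -expRD ler_expR -{2}[a]mulr1 -mulrDr; apply: ler_wpM2l => //.
have s0 : 0 < sigma by apply: lt_trans s1.
apply: (@le_trans _ _ (powR (1 + r) sigma^-1)).
  by apply: ge0_ler_powR; rewrite ?nnegrE ?invr_ge0 ?(ltW s0) ?addr_ge0// lerDr.
apply: (@le_trans _ _ (powR (1 + r) 1)); last by rewrite powRr1// addr_ge0.
by apply: ler_powR; [rewrite lerDl|rewrite invf_le1// ltW].
Qed.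
End GevreyWeight.

(** * A jointly measurable version of the solution *)

Section Solution.
Context (R : realType) (a sigma nu : R) (Uh : R -> fvec R).
Local Notation X := (X3 R).
Local Notation I := ('I_3 * bool)%type.
Local Notation vec := (I -> R).
Local Notation mu := (mu3 R).
Local Notation lam := (lam R).
Hypotheses (a0 : 0 < a) (s1 : 1 < sigma) (nu0 : 0 < nu) (hU : NSE_global_solution a sigma nu Uh).

Lemma heat_coef_ge0 (x : X) : 0 <= nu * norm3 x ^+ 2.
Proof. by rewrite mulr_ge0 ?sqr_ge0// ltW. Qed.

Lemma measurable_datum t c : 0 <= t -> measurable_fun setT (fun x : X => enc (Uh t x) c).
Proof.
move=> t0; have [/(_ t t0)[/(_ c.1)[m1 m2] _] _] := hU; rewrite /enc.
by case: c.2.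
Qed.

Definition rtime (q : nat * nat) : R := q.1%:R / q.2.+1%:R.

Lemma rtime_ge0 q : 0 <= rtime q. Proof. by rewrite divr_ge0. Qed.

Definition nlin (x : X) (c : I) (s : R) : R := if 0 <= s then enc (NLterm (Uh s) x) c else 0.

Definition duhamel (t : R) (x : X) (c : I) : R :=
  ek (nu * norm3 x ^+ 2) t 0 * enc (Uh 0 x) c - RI lam (fun s => ek (nu * norm3 x ^+ 2) t s * nlin x c s).

Lemma nlin_lt0 x c s : s < 0 -> nlin x c s = 0.
Proof. by rewrite /nlin leNgt => ->. Qed.

Lemma duhamel_at t : 0 <= t -> {ae mu, forall x, forall c,
  L1 lam (fun s => if within t s then nlin x c s else 0) /\ enc (Uh t x) c = duhamel t x c}.
Proof.
move=> t0; have [_ [_ [_ [_ [_ [_ /(_ t t0) H]]]]]] := hU.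
apply: (ae_mono H) => x Hx c; have [i1 [i2 E]] := Hx c.1; cbn zeta in i1, i2, E.
have nlinE b s : s \in `[0, t] -> (if b then (NLterm (Uh s) x c.1).2 else (NLterm (Uh s) x c.1).1) = nlin x (c.1, b) s.
  by rewrite in_itv/= => /andP[s0 _]; rewrite /nlin s0 /enc; case: b.
have kE : ek (nu * norm3 x ^+ 2) t 0 = expR (- nu * t * norm3 x ^+ 2).
  by rewrite /ek t0; congr expR; ring.
have intE b : lam.-integrable `[0, t] (fun s => (expR (- nu * (t - s) * norm3 x ^+ 2) *
      (if b then (NLterm (Uh s) x c.1).2 else (NLterm (Uh s) x c.1).1))%:E).
  by case: b; [exact: i2|exact: i1].
have rE b : Rintegral lam `[0, t] (fun s => expR (- nu * (t - s) * norm3 x ^+ 2) *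
      (if b then (NLterm (Uh s) x c.1).2 else (NLterm (Uh s) x c.1).1)) =
    RI lam (fun s => ek (nu * norm3 x ^+ 2) t s * nlin x (c.1, b) s).
  rewrite -heat_RI; last by move=> s; exact: nlin_lt0.
  by apply: eq_Rintegral => s; rewrite inE /= => st; rewrite nlinE.
have cE : c = (c.1, c.2) by case: (c).
split.
  apply: (@heat_L1 _ nu (norm3 x ^+ 2)) => //; [exact: ltW|exact: sqr_ge0|].
  apply: eq_integrable (intE c.2) => // s; rewrite inE /= => st.
  by rewrite nlinE// -cE.
have rE2 := rE c.2; rewrite -cE in rE2.
rewrite /duhamel kE -rE2 /enc E /csub /Defs.cscale /=.
by case: (c.2).
Qed.

(** Everything is required at nonnegative rational times only. These are countable, so almost every
    frequency is good for all of them at once. *)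
Definition freq_good (x : X) : Prop := forall q : nat * nat,
  [/\ forall j, Uh (rtime q) (opp3 x) j = cconj (Uh (rtime q) x j),
    forall b, \sum_k coord3 x k * enc (Uh (rtime q) x) (k, b) = 0 &
    forall c, L1 lam (fun s => if within (rtime q) s then nlin x c s else 0) /\
      enc (Uh (rtime q) x) c = duhamel (rtime q) x c].

Lemma freq_good_ae : {ae mu, forall x, freq_good x}.
Proof.
apply: ae_countable => q; have q0 := rtime_ge0 q.
have [_ [_ [_ [_ [/(_ _ q0) H1 [/(_ _ q0) H2 _]]]]]] := hU.
have {}H1 : {ae mu, forall x, forall j, Uh (rtime q) (opp3 x) j = cconj (Uh (rtime q) x j)} := H1.
have {}H2 : {ae mu, forall x, \sum_(k < 3) coord3 x k * (Uh (rtime q) x k).1 = 0 /\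
       \sum_(k < 3) coord3 x k * (Uh (rtime q) x k).2 = 0} := H2.
apply: (ae_mono (ae_and (ae_and H1 H2) (duhamel_at q0))) => x [[h1 [h2 h3]] h4].
by split=> // -[].
Qed.

(** The good set is made measurable and symmetric under [opp3]; with the symmetry, conjugation can
    later hold at every frequency. *)
Lemma good_frequencies : exists g : X -> bool, [/\ measurable_fun setT g, {ae mu, forall x, g x},
  forall x, g (opp3 x) = g x & forall x, g x -> norm3 x != 0 /\ freq_good x].
Proof.
have [N [mN N0 sN]] := freq_good_ae.
have mopp : measurable_fun setT (@opp3 R : X -> X).
  rewrite (_ : @opp3 R = fun x : X => sub3 (0, 0, 0) x); last by apply/funext => x; rewrite sub3_0.
  pose z : X := (0, 0, 0); have msb := @measurable_sub3 R.
  by apply: (measurableT_comp msb (g := fun x : X => (z, x))); ms.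
have aN : {ae mu, forall x, x \notin N}.
  by exists N; split=> // x /= /negP; rewrite negbK inE.
have aN' : {ae mu, forall x, opp3 x \notin N}.
  have := ae_reflect (@measurable_sub3 R) (@mu3_reflect R) (0, 0, 0) aN.
  by move=> /ae_mono; apply => x; rewrite sub3_0.
have opp3K x : opp3 (opp3 x) = x by case: x => [[? ?] ?]; rewrite /opp3 /= !opprK.
have normN x : norm3 (opp3 x) = norm3 x by rewrite !norm3E /opp3 /= !sqrrN.
pose f (x : X) := x \notin N.
have mf : measurable_fun setT f.
  apply: (@measurable_fun_bool _ _ _ _ false); rewrite setTI.
  rewrite (_ : _ @^-1` _ = N)//; apply/seteqP; split => x /=; rewrite /f; first by move/negbFE; rewrite inE.
  by move=> Nx; apply/negbTE; rewrite negbK inE.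
exists (fun x => [&& f x, f (opp3 x) & 0 < norm3 x]); split.
- apply: measurable_and => //; apply: measurable_and; first exact: measurableT_comp mf mopp.
  by apply: measurable_fun_ltr; [by ms|exact: measurable_norm3].
- apply: (ae_mono (ae_and aN (ae_and aN' (@norm3_neq0 R)))) => x [h1 [h2 h3]].
  by apply/and3P; split=> //; rewrite lt_def h3 norm3_ge0.
- by move=> x; rewrite opp3K normN andbCA.
- move=> x /and3P[h1 _ h3]; split; first by rewrite gt_eqF.
  by apply: contrapT => H; move: h1; rewrite /f notin_setE; apply; exact: sN.
Qed.

(** The largest multiple of [1 / (n + 1)] below [t]: a rational approximation from the left, taking
    countably many values. *)
Definition floor_time (n : nat) (t : R) : R := rtime (Num.truncn (Num.max 0 t * n.+1%:R), n).

Lemma floor_timeP n t : 0 <= t -> 0 <= floor_time n t <= t.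
Proof.
move=> t0; rewrite rtime_ge0 /floor_time /rtime /= max_r// ler_pdivrMr//.
by have /andP[] := truncn_itv (mulr_ge0 t0 (ler0n R n.+1)).
Qed.

Lemma floor_time_cvg t : 0 <= t -> floor_time n t @[n --> \oo] --> t.
Proof.
move=> t0; apply: (@squeeze_cvgr _ _ _ _ (fun n => t - harmonic n) (cst t)).
- apply: nearW => n; have /andP[_ ->] := floor_timeP n t0; rewrite andbT.
  rewrite /floor_time /rtime /= max_r// /harmonic /=.
  rewrite ler_pdivlMr// mulrBl mulVf// lerBlDr natr1; exact/ltW/truncnS_gt.
- by rewrite -[X in _ --> X]subr0; apply: cvgB; [exact: cvg_cst|exact: cvg_harmonic].
- exact: cvg_cst.
Qed.

Lemma nlin_L1 x c t : freq_good x -> 0 <= t -> L1 lam (fun s => if within t s then nlin x c s else 0).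
Proof.
move=> gx t0; pose T := rtime ((Num.truncn t).+1, 0%N).
have tT : t <= T by rewrite /T /rtime /= divr1; apply/ltW/truncnS_gt.
have [_ _ /(_ c)[iN _]] := gx ((Num.truncn t).+1, 0%N); rewrite -/T in iN.
have mN := L1_meas iN; apply: (L1_dom iN).
  rewrite (_ : (fun s => _) = fun s => if within t s then if within T s then nlin x c s else 0 else 0).
    by apply: measurable_fun_ifT; [exact: mwithin|exact: mN|by ms].
  apply/funext => s; rewrite /within; case: ifP => // /andP[-> st].
  by rewrite (le_trans st tT).
move=> s; rewrite /within; have [s0|] := boolP (0 <= s) => /=; last by [].
have [st|] := boolP (s <= t); last by rewrite normr0.
by rewrite (le_trans st tT).
Qed.

Lemma duhamel_cvg x c t : freq_good x -> 0 <= t ->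
  enc (Uh (floor_time n t) x) c @[n --> \oo] --> duhamel t x c.
Proof.
move=> gx t0; have -> : (fun n => enc (Uh (floor_time n t) x) c) = (fun n => duhamel (floor_time n t) x c).
  by apply/funext => n; have [_ _ /(_ c)[_]] := gx (Num.truncn (Num.max 0 t * n.+1%:R), n).
have tc := floor_time_cvg t0; have tb n := floor_timeP n t0.
apply: cvgB; first by apply: cvgMl; exact: ek0_cvg.
apply: ek_int_cvg => //; [exact: heat_coef_ge0|by move=> s; exact: nlin_lt0|exact: nlin_L1].
Qed.

Lemma cvg_eq0 (f : nat -> R) l : (forall n, f n = 0) -> f n @[n --> \oo] --> l -> l = 0.
Proof.
move=> f0 fl; apply: (cvg_unique _ fl); first exact: Rhausdorff.
by rewrite (_ : f = fun=> 0); [exact: cvg_cst|apply/funext].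
Qed.

(* [V] is a jointly measurable version of [Uh]: on good frequencies it is the
   right-hand side of Duhamel's formula, which is continuous in time. *)
Lemma joint_version : exists g : X -> bool, exists V : TT R * X -> vec,
  [/\ measurable_fun setT g, {ae mu, forall x, g x}, forall x, g x -> norm3 x != 0 /\ freq_good x,
    forall p c, V p c = if (0 <= p.1) && g p.2 then duhamel p.1 p.2 c else 0 &
  [/\ mfield V, forall t, 0 <= t -> {ae mu, forall x, forall c, V (t, x) c = enc (Uh t x) c},
    forall p, divfree (@divf R) p.2 (V p) &
    forall t x j, V (t, opp3 x) (j, false) = V (t, x) (j, false) /\
      V (t, opp3 x) (j, true) = - V (t, x) (j, true)]].
Proof.
have [g [mg gae gopp gP]] := good_frequencies.
pose V (p : TT R * X) (c : I) : R := if (0 <= p.1) && g p.2 then duhamel p.1 p.2 c else 0.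
pose b (p : TT R * X) := (0 <= p.1) && g p.2.
have mb : measurable_fun setT b.
  apply: measurable_and; first by apply: measurable_fun_ler; ms.
  by apply: (measurableT_comp mg (g := snd)); ms.
(* For fixed [n] only countably many time slices of [Uh] occur, each measurable in frequency, so
   [Vn n] is jointly measurable although [Uh] need not be. *)
pose Vn n (p : TT R * X) (c : I) : R := if b p then enc (Uh (floor_time n p.1) p.2) c else 0.
have Vcvg p c : Vn n p c @[n --> \oo] --> V p c.
  rewrite /Vn /V -/(b p); have [bp|_] := boolP (b p); last exact: cvg_cst.
  by have /andP[p0 gp] := bp; apply: duhamel_cvg => //; exact: (gP _ gp).2.
have Vopp0 p c : ~~ b p -> V p c = 0 by rewrite /V -/(b p) => /negbTE ->.
have bopp t x : b (t, opp3 x) = b (t, x) by rewrite /b /= gopp.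
have good n (p : TT R * X) : b p -> _ := fun bp => (gP p.2 (andP bp).2).2 (Num.truncn (Num.max 0 p.1 * n.+1%:R), n).
exists g, V; split; [exact: mg|exact: gae|exact: gP|by []|split].
- move=> c; apply: (measurable_fun_cvg (h := fun n p => Vn n p c)); last by move=> p _; exact: Vcvg.
  move=> n; rewrite /Vn; apply: measurable_fun_ifT => //.
  apply: (measurable_select (k := fun p : TT R * X => Num.truncn (Num.max 0 p.1 * n.+1%:R))
     (g := fun m p => enc (Uh (rtime (m, n)) p.2) c)) => m; last first.
    by apply: (measurableT_comp (measurable_datum c (rtime_ge0 (m, n))) (g := snd)); ms.
  rewrite (_ : (fun p => _) = fun p : TT R * X => (m%:R <= Num.max 0 p.1 * n.+1%:R) && (Num.max 0 p.1 * n.+1%:R < m.+1%:R)).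
    have mq : measurable_fun setT (fun p : TT R * X => Num.max 0 p.1 * n.+1%:R : R).
      by apply: measurable_funM => //; apply: measurable_maxr; ms.
    apply: measurable_and; first by apply: measurable_fun_ler; [ms|exact: mq].
    by apply: measurable_fun_ltr; [exact: mq|ms].
  by apply/funext => p; rewrite truncn_eq// mulr_ge0// le_max lexx.
- move=> t t0; apply: (ae_mono (ae_and gae (duhamel_at t0))) => x [gx Dx] c.
  by rewrite /V /= t0 gx; have [_ ->] := Dx c.
(* Vanishing divergence, and below it conjugate symmetry, hold for every [Vn n] and pass to the
   pointwise limit. *)
- move=> p j; rewrite divf_sum.
  apply: (@cvg_eq0 (fun n => \sum_k coord3 p.2 k * Vn n p (k, j))).
    move=> n; have [bp|bp] := boolP (b p); last by apply: big1 => k _; rewrite /Vn (negbTE bp) mulr0.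
    have [_ /(_ j) H _] := good n p bp; rewrite -[RHS]H; apply: eq_bigr => k _; by rewrite /Vn bp.
  under eq_cvg do rewrite big_ord_recl big_ord_recl big_ord_recl big_ord0.
  rewrite big_ord_recl big_ord_recl big_ord_recl big_ord0.
  by do 3 (apply: cvgD; first by apply: cvgMr; exact: Vcvg); exact: cvg_cst.
- move=> t x j; split.
    apply: (cvg_unique _ (Vcvg (t, opp3 x) (j, false))); first exact: Rhausdorff.
    have -> : (fun n => Vn n (t, opp3 x) (j, false)) = (fun n => Vn n (t, x) (j, false)).
      apply/funext => n; rewrite /Vn bopp; have [bp|//] := boolP (b (t, x)).
      by have [/(_ j) H _ _] := good n (t, x) bp; rewrite /enc /= H.
    exact: Vcvg.
  apply: (cvg_unique _ (Vcvg (t, opp3 x) (j, true))); first exact: Rhausdorff.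
  have -> : (fun n => Vn n (t, opp3 x) (j, true)) = (fun n => - Vn n (t, x) (j, true)).
    apply/funext => n; rewrite /Vn bopp; have [bp|_] := boolP (b (t, x)); last by rewrite oppr0.
    by have [/(_ j) H _ _] := good n (t, x) bp; rewrite /enc /= H.
  by apply: cvgN; exact: Vcvg.
Qed.

(** * Local boundedness in time of the [Z^-1] norm *)

Definition zw (x : X) : R := (norm3 x)^-1 * expR (a * powR (norm3 x) sigma^-1).

Lemma zw_ge0 x : 0 <= zw x.
Proof. by rewrite mulr_ge0 ?invr_ge0 ?norm3_ge0 ?expR_ge0. Qed.

Lemma measurable_zw : measurable_fun setT zw.
Proof.
apply: measurable_funM; first by apply: minvr; exact: measurable_norm3.
apply: mexpR; apply: measurable_funM => //.
by apply: (measurableT_comp (measurable_powR _)); exact: measurable_norm3.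
Qed.

Lemma powR_N1 (x : X) : powR (norm3 x) (-1) = (norm3 x)^-1.
Proof. by rewrite powR_inv1// norm3_ge0. Qed.

Lemma cnorm3_n1 (v : 'I_3 -> cplx R) : cnorm3 v <= n1 (enc v) <= 6 * cnorm3 v.
Proof.
have S : \sum_(j < 3) ((v j).1 ^+ 2 + (v j).2 ^+ 2) = \sum_c enc v c ^+ 2 by rewrite sumI.
have S0 : 0 <= \sum_c enc v c ^+ 2 by apply: sumr_ge0 => c _; exact: sqr_ge0.
rewrite /cnorm3 S -/(sq (enc v)); have n0 := n1_ge0 (enc v); apply/andP; split.
  rewrite -[leRHS]ger0_norm// -sqrtr_sqr ler_wsqrtr// expr2; exact: sq_n1.
rewrite -(ler_pXn2r (n := 2))// ?nnegrE ?mulr_ge0 ?sqrtr_ge0// exprMn sqr_sqrtr//.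
rewrite expr2; apply: (le_trans (n1_sq _)).
rewrite card_prod card_ord card_bool -/(sq (enc v)); apply: ler_wpM2r => //.
by rewrite -natrX ler_nat.
Qed.

(* The l^1 norm of the components replaces the Euclidean norm of [Znorm]: its
   triangle inequality is immediate. *)
Definition zn (t : R) : \bar R := (\int[mu]_x (zw x * n1 (enc (Uh t x)))%:E)%E.

Lemma n1_encB (v w : 'I_3 -> cplx R) : n1 (enc v) <= n1 (enc w) + n1 (enc (fun j => csub (v j) (w j))).
Proof.
rewrite (_ : enc (fun j => csub (v j) (w j)) = fun c => enc v c - enc w c); first exact: n1_le_sub.
by apply/funext => -[j []].
Qed.

Lemma n1_encC (v w : 'I_3 -> cplx R) : n1 (enc (fun j => csub (v j) (w j))) = n1 (enc (fun j => csub (w j) (v j))).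
Proof. by apply: eq_bigr => -[j b] _; rewrite /enc /csub; case: b; rewrite /= distrC. Qed.

Lemma measurable_n1_enc t : 0 <= t -> measurable_fun setT (fun x : X => n1 (enc (Uh t x))).
Proof. by move=> t0; apply: mn1 => c; exact: measurable_datum. Qed.

Lemma Znorm_zw (f : fvec R) : Znorm a sigma (-1) f = (\int[mu]_x (zw x * cnorm3 (f x))%:E)%E.
Proof. by apply: eq_integral => x _; rewrite powR_N1. Qed.

Lemma le_Znorm (f : fvec R) : (forall c, measurable_fun setT (fun x : X => enc (f x) c)) ->
  (\int[mu]_x (zw x * n1 (enc (f x)))%:E <= 6%:E * Znorm a sigma (-1) f)%E.
Proof.
move=> mf; have mz := measurable_zw.
have mc : measurable_fun setT (fun x : X => cnorm3 (f x)).
  rewrite /cnorm3; apply: (measurableT_comp (f := @Num.sqrt R)); first exact: continuous_measurable_fun (@sqrt_continuous R).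
  apply: measurable_sum => j; have m1 := mf (j, false); have m2 := mf (j, true).
  by apply: measurable_funD; apply: measurable_funX.
rewrite Znorm_zw -ge0_integralZlT.
- apply: ge0_le_integralT => x; first by rewrite lee_fin mulr_ge0 ?zw_ge0 ?n1_ge0.
  rewrite -EFinM lee_fin mulrCA; apply: ler_wpM2l; first exact: zw_ge0.
  by case/andP: (cnorm3_n1 (f x)).
- by apply: mEFin; apply: measurable_funM.
- by move=> x; rewrite lee_fin mulr_ge0 ?zw_ge0 ?sqrtr_ge0.
- by [].
Qed.

Lemma zn_fin t : 0 <= t -> zn t \is a fin_num.
Proof.
move=> t0; rewrite ge0_fin_numE; last first.
  by apply: integral_ge0 => x _; rewrite lee_fin mulr_ge0 ?zw_ge0 ?n1_ge0.
apply: le_lt_trans (le_Znorm _) _; first by move=> c; exact: measurable_datum.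
have [/(_ t t0)[_ H] _] := hU.
by apply: lte_mul_pinfty.
Qed.

Lemma zn_near t : 0 <= t -> forall e : R, 0 < e -> exists2 del : R, 0 < del &
  forall s, 0 <= s -> `|s - t| < del -> `|fine (zn s) - fine (zn t)| < e.
Proof.
move=> t0 e e0; have [_ [/(_ t t0) H _]] := hU.
have [del del0 Hd] := H (e / 6) (divr_gt0 e0 (ltr0n R 6)).
exists del => // s s0 st; have {}Hd := Hd s s0 st.
pose D x := n1 (enc (fun j => csub (Uh s x j) (Uh t x j))).
have mD c : measurable_fun setT (fun x : X => enc (fun j => csub (Uh s x j) (Uh t x j)) c).
  have m1 := measurable_datum c s0; have m2 := measurable_datum c t0.
  have := measurable_funB m1 m2; congr measurable_fun; apply/funext => x.
  by rewrite /enc /csub /=; case: (c.2).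
have mnD : measurable_fun setT D by apply: mn1.
have mz := measurable_zw.
pose ID := (\int[mu]_x (zw x * D x)%:E)%E.
have ID0 : (0 <= ID)%E by apply: integral_ge0 => x _; rewrite lee_fin mulr_ge0 ?zw_ge0 ?n1_ge0.
have IDe : (ID < e%:E)%E.
  apply: le_lt_trans (le_Znorm (f := fun x j => csub (Uh s x j) (Uh t x j)) mD) _.
  rewrite (_ : e = 6 * (e / 6)); last by field.
  by rewrite EFinM lte_pmul2l.
have tri p q : 0 <= p -> 0 <= q -> (forall x, n1 (enc (Uh p x)) <= n1 (enc (Uh q x)) + D x) -> (zn p <= zn q + ID)%E.
  move=> p0 q0 H2; have m1 := measurable_n1_enc p0; have m2 := measurable_n1_enc q0.
  rewrite /zn /ID -ge0_integralD//.
  - apply: ge0_le_integralT => x; first by rewrite lee_fin mulr_ge0 ?zw_ge0 ?n1_ge0.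
    by rewrite -EFinD lee_fin -mulrDr; apply: ler_wpM2l; [exact: zw_ge0|exact: H2].
  - by move=> x _; rewrite lee_fin mulr_ge0 ?zw_ge0 ?n1_ge0.
  - by apply: mEFin; apply: measurable_funM.
  - by move=> x _; rewrite lee_fin mulr_ge0 ?zw_ge0 ?n1_ge0.
  - by apply: mEFin; apply: measurable_funM.
have h1 := tri s t s0 t0 (fun x => n1_encB _ _).
have h2 : (zn t <= zn s + ID)%E by apply: tri => // x; rewrite /D n1_encC; exact: n1_encB.
rewrite -(fineK (zn_fin s0)) -(fineK (zn_fin t0)) in h1 h2.
clear tri; clearbody ID; move: (fine _) (fine _) h1 h2 => u v.
case: ID ID0 IDe => [w| |]//= w0 we; rewrite -!EFinD !lee_fin => h1 h2.
by rewrite lee_fin in w0; rewrite lte_fin in we; rewrite ltr_norml; lra.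
Qed.

Lemma max0_lipschitz (x y : R) : `|Num.max 0 x - Num.max 0 y| <= `|x - y|.
Proof.
have h1 := ler_norm (x - y); have h2 := ler_norm (- (x - y)); rewrite normrN in h2.
rewrite ler_norml; apply/andP; rewrite /Num.max.
by have [h3|h3] := ltP 0 x; have [h4|h4] := ltP 0 y; split; lra.
Qed.

(** The norm is continuous in time by the triangle inequality, and precomposition with [max 0]
    extends it continuously to the line, where the extreme value theorem applies on [[0, T]]. *)
Lemma zn_bounded (T : R) : exists2 A : R, 0 <= A & forall t, within T t -> (zn t <= A%:E)%E.
Proof.
have [T0|T0] := leP 0 T; last first.
  by exists 0 => // t /andP[/le_trans h /h]; rewrite leNgt T0.
pose f t := fine (zn (Num.max 0 t)).
have cf : continuous f.
  move=> t; apply/cvgrPdist_lt => e e0.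
  have mt0 : 0 <= Num.max 0 t by rewrite le_max lexx.
  have [del del0 H] := zn_near mt0 e0; near=> s.
  rewrite distrC /f; apply: H; first by rewrite le_max lexx.
  apply: (@le_lt_trans _ _ `|s - t|); last by rewrite distrC; near: s; apply/nbhs_ballP; exists del.
  exact: max0_lipschitz.
have [c _ Hc] := EVT_max T0 (continuous_subspaceT cf).
exists (Num.max 0 (f c)) => [|t Tt]; first by rewrite le_max lexx.
have t0 : 0 <= t by case/andP: Tt.
rewrite -(fineK (zn_fin t0)) lee_fin le_max; apply/orP; right.
have := Hc t; rewrite in_itv /= => /(_ Tt); by rewrite /f max_r.
Unshelve. all: by end_near. Qed.
(** Two facts are added to the jointly measurable version. The local bound in the norm with weight
    [om] follows from that of the [Z^-1] norm, since the Gevrey weight dominates [om]. Duhamel's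
    formula holds with [NL] in place of [NLterm] at frequencies where the convolution converges at
    almost every time. *)
Lemma mild_representation : exists V : TT R * X -> vec, exists bV : TT R * X -> bool,
  [/\ mild_field mu (@sub3 R) (@norm3 R) (@bilin R) nu (fun x => V (0, x)) V bV, all_good mu bV,
    forall p, divfree (@divf R) p.2 (V p),
    forall t x j, V (t, opp3 x) (j, false) = V (t, x) (j, false) /\
      V (t, opp3 x) (j, true) = - V (t, x) (j, true) &
    forall t, 0 <= t -> {ae mu, forall x, forall c, V (t, x) c = enc (Uh t x) c}].
Proof.
have [g [V [mg gae gP VE [mV VU dV hV]]]] := joint_version.
have msb := @measurable_sub3 R; have mnr := @measurable_norm3 R; have r0 := @norm3_ge0 R.
have nV := nnm_en1 mV; have [mV1 V10] := nV.
have [K K0 HK] := weight_le_gevrey a0 s1.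
have Vz p c : norm3 p.2 = 0 \/ p.1 < 0 -> V p c = 0.
  rewrite VE; case: ifP => // /andP[p0 /gP[rn _]] [rE|]; first by rewrite rE eqxx in rn.
  by rewrite ltNge p0.
have bd T : exists2 A : R, 0 <= A & forall t : TT R, within T t ->
    (\int[mu]_x ((norm3 x)^-1%:E * ((om (@norm3 R) x)%:E * en1 V (t, x))) <= A%:E)%E.
  have [A A0 HA] := zn_bounded T; exists (K * A) => [|t Tt]; first by rewrite mulr_ge0.
  have t0 : 0 <= t by case/andP: Tt.
  have mU := measurable_n1_enc t0; have mz := measurable_zw.
  have mom' := mom mnr; have om0 x : 0 <= om (@norm3 R) x by exact: sqr_ge0.
  have mVt : measurable_fun setT (fun x : X => en1 V (t, x)) by ms.
  apply: (@le_trans _ _ (K%:E * zn t)%E); last first.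
    by rewrite EFinM; apply: lee_pmul => //; [apply: integral_ge0 => x _; rewrite lee_fin mulr_ge0 ?zw_ge0 ?n1_ge0|exact: HA].
  rewrite /zn -ge0_integralZlT; last 3 first.
  - by apply: mEFin; apply: measurable_funM.
  - by move=> x; rewrite lee_fin mulr_ge0 ?zw_ge0 ?n1_ge0.
  - by rewrite lee_fin.
  apply: ae_ge0_le_integral => //.
  - by move=> x _; apply: mule_ge0; [rewrite lee_fin invr_ge0|apply: mule_ge0; [rewrite lee_fin|exact: V10]].
  - by apply: emeasurable_funM; [apply: mEFin; apply: minvr|apply: emeasurable_funM => //; exact: mEFin].
  - by move=> x _; apply: mule_ge0; rewrite lee_fin// mulr_ge0 ?zw_ge0 ?n1_ge0.
  - by apply: emeasurable_funM => //; apply: mEFin; apply: measurable_funM.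
  apply: (ae_mono (VU t t0)) => x Vx _.
  rewrite /en1 (_ : V (t, x) = enc (Uh t x)); last by apply/funext.
  rewrite -!EFinM lee_fin /zw.
  rewrite (_ : K * _ = (norm3 x)^-1 * (K * expR (a * norm3 x `^ sigma^-1) * n1 (enc (Uh t x)))); last by ring.
  by apply: ler_wpM2l; [rewrite invr_ge0|apply: ler_wpM2r; [exact: n1_ge0|exact: HK]].
have [mcv cv0] := nnm_cv mu msb nV nV.
pose fb (p : TT R * X) := (cv mu (@sub3 R) (en1 V) (en1 V) p < +oo)%E.
have mfb : measurable_fun setT fb by apply: measurable_fun_lte; [exact: mcv|ms].
have fae (s : TT R) : {ae mu, forall x, fb (s, x)}.
  apply: nnm_finite_ae; first by split; [ms|move=> x; exact: cv0].
  rewrite -[X in (X < _)%E]/(mass mu (cv mu (@sub3 R) (en1 V) (en1 V)) s).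
  rewrite (mass_cv msb (@mu3_translate R))//.
  have [s0|s0] := leP (0 : R) (s : R); last first.
    rewrite /mass (_ : (fun x => _) = fun=> 0%E) ?integral0 ?mul0e//.
    by apply/funext => x; rewrite /en1 n1_0// => i; apply: Vz; right.
  have [A A0 HA] := bd s.
  have mA : (mass mu (en1 V) s <= A%:E)%E.
    apply: le_trans (HA s _); last by rewrite /within s0 lexx.
    apply: mass_le_weight; [exact: r0|exact: rom| |].
    - by move=> x; exact: V10.
    - by move=> x rx; rewrite /en1 n1_0// => i; apply: Vz; left.
  have m0 : (0 <= mass mu (en1 V) s)%E by apply: integral_ge0 => x _; exact: V10.
  by apply: (@le_lt_trans _ _ (A%:E * A%:E)%E); [exact: lee_pmul|rewrite -EFinM ltry].
(* The mass of the convolution is finite at every time; exchanging quantifiers gives almost every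
   frequency, then almost every time, as the time integral needs. *)
have [N [mN N0 sN]] := ae_swap mfb (aeW _ fae).
pose h (x : X) := x \notin N.
have mh : measurable_fun setT h.
  apply: (@measurable_fun_bool _ _ _ _ false); rewrite setTI.
  rewrite (_ : _ @^-1` _ = N)//; apply/seteqP; split => x /=; rewrite /h; first by move/negbFE; rewrite inE.
  by move=> Nx; apply/negbTE; rewrite negbK inE.
have hae : {ae mu, forall x, h x}.
  by exists N; split=> // x /= /negP; rewrite negbK inE.
have hP x : h x -> {ae lam, forall s, fb (s, x)}.
  by move=> hx; apply: contrapT => H; move: hx; rewrite /h notin_setE; apply; exact: sN.
(* Apart from the sign of the time, the condition depends on the frequency alone, which gives full
   measure at every nonnegative time. *)
pose bV (p : TT R * X) := [&& 0 <= p.1, g p.2 & h p.2].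
have good : all_good mu bV.
  by move=> t t0; apply: (ae_mono (ae_and gae hae)) => x [gx hx]; apply/and3P.
exists V, bV; split; [|exact: good|exact: dV|exact: hV|exact: VU]; split.
- move=> c; have mVc := mV c; by apply: (measurableT_comp mVc (g := fun x : X => ((0 : TT R), x))); ms.
- exact: mV.
- apply: measurable_and; first by apply: measurable_fun_ler; ms.
  by apply: measurable_and; [apply: (measurableT_comp mg (g := snd)); ms|apply: (measurableT_comp mh (g := snd)); ms].
- exact: Vz.
- move=> [t x] c /and3P[/= t0 gx hx]; have [rx gd] := gP x gx.
  have V0 : V (0, x) c = enc (Uh 0 x) c.
    rewrite VE /= lexx gx; have [_ _ /(_ c)[_ H]] := gd (0%N, 0%N).
    by rewrite /rtime /= mul0r in H.
  rewrite VE /= t0 gx /duh /= V0 /duhamel /duh_int; congr (_ - _).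
  have iN := nlin_L1 c gd t0; have mM := L1_meas iN.
  have -> : (fun s => ek (nu * norm3 x ^+ 2) t s * nlin x c s) =
     (fun s => ek (nu * norm3 x ^+ 2) t s * (if within t s then nlin x c s else 0)).
    apply/funext => s; rewrite /ek; case: ifP => st; last by rewrite !mul0r.
    by rewrite /within st andbT; case: leP => // /nlin_lt0 ->.
  have mker' := mker mnr nu (mconst (T := TT R) (t : TT R)) (@mid _ (TT R)) (mconst (T := TT R) x).
  apply: RI_ae.
  + by apply: measurable_funM; [exact: mker'|exact: mM].
  + exact: (mker_N mnr nu (t, x) c (mfield_NL mu msb (@measurable_bilin R) mV mV)).
  apply: (ae_mono (hP x hx)) => s fs; rewrite /ker /= /ek; case: ifP => st; last by rewrite !mul0r.
  congr (_ * _); rewrite /within st andbT; have [s0|s0] := leP (0 : R) (s : R).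
    rewrite /nlin s0; apply: (NLterm_NL (s := s)) => //; last exact: VU.
    by have [/(_ s s0)[m _] _] := hU.
  rewrite (NL_0 _ _ (@bilin_bound R))// => y i; apply: Vz; by right.
- by apply: aeW => t t0; exact: good.
- exact: bd.
Qed.

Lemma Znorm_le_exp (V : TT R * X -> vec) t : mfield V -> 0 <= t -> {ae mu, forall x, forall c, V (t, x) c = enc (Uh t x) c} ->
  (Znorm a sigma (-1) (Uh t) <=
   (expR a)%:E * \int[mu]_x ((norm3 x)^-1%:E * ((expR (a * norm3 x))%:E * en1 V (t, x))))%E.
Proof.
move=> mV t0 VU; have nV := nnm_en1 mV; have [mV1 V10] := nV; have mnr := @measurable_norm3 R.
have mU := measurable_n1_enc t0; have mz := measurable_zw; have r0 := @norm3_ge0 R.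
have mVt : measurable_fun setT (fun x : X => en1 V (t, x)) by ms.
have mw : measurable_fun setT (fun x : X => ((norm3 x)^-1%:E * ((expR (a * norm3 x))%:E * en1 V (t, x)))%E).
  apply: emeasurable_funM; first by apply: mEFin; apply: minvr.
  by apply: emeasurable_funM => //; apply: mEFin; apply: mexpR; apply: measurable_funM.
have w0 x : (0 <= (norm3 x)^-1%:E * ((expR (a * norm3 x))%:E * en1 V (t, x)))%E.
  by apply: mule_ge0; [rewrite lee_fin invr_ge0|apply: mule_ge0; [rewrite lee_fin expR_ge0|exact: V10]].
rewrite Znorm_zw -ge0_integralZlT; [|exact: mw|exact: w0|by rewrite lee_fin expR_ge0].
apply: (@le_trans _ _ (zn t)).
  apply: ge0_le_integralT => x; first by rewrite lee_fin mulr_ge0 ?zw_ge0 ?sqrtr_ge0.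
  by rewrite lee_fin; apply: ler_wpM2l; [exact: zw_ge0|case/andP: (cnorm3_n1 (Uh t x))].
apply: ae_ge0_le_integral => //.
- by move=> x _; rewrite lee_fin mulr_ge0 ?zw_ge0 ?n1_ge0.
- by apply: mEFin; apply: measurable_funM.
- by move=> x _; apply: mule_ge0; [rewrite lee_fin expR_ge0|exact: w0].
- exact: emeasurable_funM (measurable_cst _) mw.
apply: (ae_mono VU) => x Vx _.
rewrite /en1 (_ : V (t, x) = enc (Uh t x)); last by apply/funext.
rewrite -!EFinM lee_fin /zw.
rewrite (_ : expR a * _ = (norm3 x)^-1 * (expR a * expR (a * norm3 x) * n1 (enc (Uh t x)))); last by ring.
rewrite -[leLHS]mulrA; apply: ler_wpM2l; first by rewrite invr_ge0.
by apply: ler_wpM2r; [exact: n1_ge0|apply: gevrey_le_exp => //; exact: ltW].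
Qed.

Lemma Znorm_decay (eta : R) : 0 < eta -> exists2 t1 : R, 0 <= t1 &
  forall t, t1 <= t -> (Znorm a sigma (-1) (Uh t) <= eta%:E)%E.
Proof.
move=> eta0; have [V [bV [mild good dV hV VU]]] := mild_representation.
(* [C1] is the constant of [bilin_bound]; adding 1 after counting components makes [C] positive. *)
pose C1 := 12 * c0 R; pose C := #|{: I}|%:R * C1 + 1.
have C10 : 0 <= C1 by rewrite mulr_ge0// c0_ge0.
have C0 : 0 < C by rewrite ltr_wpDl// mulr_ge0.
have CC1 : #|{: I}|%:R * C1 <= C by rewrite lerDl.
have [A A0 HA] := mild_bd mild 0.
(* Compensates the factor [exp(a)] lost when the Gevrey weight is replaced by [exp(a |xi|)]. *)
have e0 : 0 < eta / expR a by rewrite divr_gt0// expR_gt0.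
have [t1 t10 Ht] := gevrey_decay (@measurable_sub3 R) (@measurable_norm3 R) (@norm3_ge0 R) (@sub3K R)
  (@mu3_reflect R) (@mu3_translate R) C10 (@bilin_bound R) (@bilinl R) (@bilinr R) (@measurable_bilin R)
  C0 CC1 (@norm3_triangle R) (@norm3_neq0 R) (@dissipation_weight_fin R) (@divf_bilin R)
  nu0 a0 mild good (fun x => dV (0, x)) (fun x c rx => mild_z mild (p := (0, x)) c (or_introl rx))
  (le_lt_trans (HA 0 (introT andP (conj (lexx 0) (lexx 0)))) (ltry A)) dV
  (cancels_bilin (mild_meas mild) hV dV) e0.
exists t1 => // t tt; have t0 := le_trans t10 tt.
apply: (le_trans (Znorm_le_exp (mild_meas mild) t0 (VU t t0))).
apply: (@le_trans _ _ ((expR a)%:E * (eta / expR a)%:E)%E).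
  apply: lee_pmul; [by rewrite lee_fin expR_ge0| |by []|exact: Ht].
  apply: integral_ge0 => x _; apply: mule_ge0; first by rewrite lee_fin invr_ge0 norm3_ge0.
  by apply: mule_ge0; [rewrite lee_fin expR_ge0|exact: (nnm_en1 (mild_meas mild)).2].
by rewrite -EFinM mulrCA divff ?mulr1// gt_eqF// expR_gt0.
Qed.
End Solution.

Theorem theorem1p5 (R : realType) (a sigma nu : R) (Uh : R -> fvec R) :
  0 < a -> 1 < sigma -> 0 < nu ->
  NSE_global_solution a sigma nu Uh ->
  limf_esup (fun t : R => Znorm a sigma (-1) (Uh t)) (pinfty_nbhs R) = 0%E.
Proof.
move=> a0 s1 nu0 hU; apply/eqP; rewrite eq_le; apply/andP; split.
  apply/lee_addgt0Pr => e e0; rewrite add0e.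
  have [t1 _ Ht] := Znorm_decay a0 s1 nu0 hU e0.
  apply: (@le_trans _ _ (ereal_sup [set Znorm a sigma (-1) (Uh t) | t in [set t | t1 <= t]])).
    apply: ereal_inf_lbound; exists [set t | t1 <= t] => //.
    by exists t1; split; [exact: num_real|move=> t /ltW].
  by apply: ge_ereal_sup => _ [t /= tt <-]; exact: Ht.
apply: limf_esup_ge0 => [|t]; first exact: filter_not_empty.
apply: integral_ge0 => x _.
by rewrite lee_fin mulr_ge0 ?sqrtr_ge0// mulr_ge0 ?expR_ge0 ?powR_ge0.
Qed.
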